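(* Let $\Psi$ be an Orlicz function satisfying condition $\Delta^2$. Then there exists an analytic self-map $\phi\colon\mathbb{D}\to\mathbb{D}$ such that $C_\phi\colon H^2\to H^2$ belongs to the Schatten class $S_p$ for every $p>0$, but such that $C_\phi\colon H^\Psi\to H^\Psi$ is not compact.
   Context: $\mathbb{D}$ is the open unit disk of $\mathbb{C}$, $\mathbb{T}=\partial\mathbb{D}$, and $m$ is normalized Lebesgue measure on $\mathbb{T}$. $H^p$ denotes the classical Hardy space on $\mathbb{D}$. For an analytic self-map $\phi\colon\mathbb{D}\to\mathbb{D}$, $C_\phi$ is the composition operator $f\mapsto f\circ\phi$. $S_p$ ($p>0$) is the Schatten class of compact operators on the Hilbert space $H^2$ whose singular numbers are in $\ell_p$. An Orlicz function is a non-decreasing convex function $\Psi\colon[0,\infty]\to[0,\infty]$ with $\Psi(0)=0$, $\Psi(\infty)=\infty$, which is moreover assumed to be continuous at $0$, strictly convex on $[0,\infty)$ (hence finite and increasing there), and such that $\Psi(x)/x\to\infty$ as $x\to\infty$. $L^\Psi(\mathbb{T})$ is the space of (classes of) measurable $f\colon\mathbb{T}\to\mathbb{C}$ for which there is $C>0$ with $\int_{\mathbb{T}}\Psi(|f|/C)\,dm<+\infty$; the Luxemburg norm $\|f\|_\Psi$ is the infimum of the constants $C>0$ such that this integral is $\le 1$. The Hardy-Orlicz space $H^\Psi$ is the space of all $f\in H^1$ whose boundary function $f^*$ lies in $L^\Psi(\mathbb{T})$, normed by $\|f^*\|_\Psi$. Every composition operator is bounded on every $H^p$ and on every $H^\Psi$.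 $\Psi$ satisfies condition $\Delta^2$ if, for some $A>1$, one has $[\Psi(x)]^2\le\Psi(Ax)$ for all $x$ large enough. *)

(* Defs.v *)
From HB Require Import structures.
From mathcomp Require Import all_boot all_order all_algebra.
From mathcomp Require Import all_classical all_reals all_analysis.
From mathcomp Require Import complex.

Set Implicit Arguments.
Unset Strict Implicit.
Unset Printing Implicit Defensive.

Import Order.TTheory GRing.Theory Num.Theory numFieldNormedType.Exports.
Import Normc.

Local Open Scope classical_set_scope.
Local Open Scope complex_scope.
Local Open Scope ring_scope.

Record orlicz_function (R : realType) (Psi : \bar R -> \bar R) : Prop := {
  orlicz_ge0 : forall x : \bar R, (0 <= x)%E -> (0 <= Psi x)%E ;
  orlicz_nondecreasing : forall x y : \bar R,
    (0 <= x)%E -> (x <= y)%E -> (Psi x <= Psi y)%E ;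
  orlicz_convex : forall (x y : \bar R) (t : R),
    (0 <= x)%E -> (0 <= y)%E -> 0 <= t -> t <= 1 ->
    (Psi (t%:E * x + (1 - t)%:E * y) <= t%:E * Psi x + (1 - t)%:E * Psi y)%E ;
  orlicz_0 : Psi 0%E = 0%E ;
  orlicz_pinfty : Psi +oo%E = +oo%E ;
  orlicz_cont0 : Psi x%:E @[x --> 0^'+] --> 0%E ;
  (* The strict inequality makes [Psi] finite on [0, +oo[: if [Psi] were
     infinite at some real, it would fail to the right of that real. *)
  orlicz_strictly_convex : forall x y t : R,
    0 <= x -> 0 <= y -> x != y -> 0 < t -> t < 1 ->
    (Psi (t * x + (1 - t) * y)%:E
       < t%:E * Psi x%:E + (1 - t)%:E * Psi y%:E)%E ;
  orlicz_superlinear : (Psi x%:E * (x^-1)%:E)%E @[x --> +oo%R] --> +oo%E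
}.

Definition Delta2_condition (R : realType) (Psi : \bar R -> \bar R) : Prop :=
  exists2 A : R, 1 < A &
    \forall x \near +oo%R, (Psi x%:E * Psi x%:E <= Psi (A * x)%:E)%E.

(* Functions on the disk are represented by functions on all of [R[i]] whose
   values off the disk are irrelevant: none of the definitions below depends
   on them. *)

Definition disk (R : realType) : set R[i] := [set z | normc z < 1].

(* [R[i]^o] is [R[i]] as a normed space over itself, so [derivable] is complex
   differentiability. *)
Definition analytic_on_disk (R : realType) (f : R[i] -> R[i]) : Prop :=
  forall z, disk z -> derivable (f : R[i]^o -> R[i]^o) z 1.

Definition self_map_of_disk (R : realType) (phi : R[i] -> R[i]) : Prop :=
  analytic_on_disk phi /\ forall z, disk z -> disk (phi z).

Definition composition_operator (R : realType) (phi f : R[i] -> R[i]) :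
  R[i] -> R[i] := f \o phi.

Definition cis (R : realType) (t : R) : R[i] := cos t +i* sin t.

(* Integrals against normalized Lebesgue measure on the unit circle, i.e. the
   image under [cis] of the measure dt / (2 pi) on [0, 2 pi]. *)
Definition circle_integral (R : realType) (h : R[i] -> \bar R) : \bar R :=
  (((2 * pi)^-1)%R%:E *
    \int[lebesgue_measure]_(t in `[0%R, (2 * pi)%R]) h (cis t))%E.

Definition circle_integralC (R : realType) (h : R[i] -> R[i]) : R[i] :=
  fine (circle_integral (fun xi => (complex.Re (h xi))%:E)) +i*
  fine (circle_integral (fun xi => (complex.Im (h xi))%:E)).

Definition integral_mean (R : realType) (p : R) (f : R[i] -> R[i]) (r : R) :
  \bar R := circle_integral (fun xi => (normc (f (r%:C * xi)) `^ p)%:E).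

Definition hardy_sup (R : realType) (p : R) (f : R[i] -> R[i]) : \bar R :=
  ereal_sup [set integral_mean p f r | r in `[0%R, 1%R[].

Definition hardy (R : realType) (p : R) : set (R[i] -> R[i]) :=
  [set f | analytic_on_disk f /\ (hardy_sup p f < +oo)%E].

Definition hardy_norm (R : realType) (p : R) (f : R[i] -> R[i]) : \bar R :=
  poweR (hardy_sup p f) p^-1.

(* The inner product of H^2. Since the means of |f|^2 increase with the radius,
   [hardy_inner f f] is the square of [hardy_norm 2 f]. *)
Definition hardy_inner (R : realType) (f g : R[i] -> R[i]) : R[i] :=
  lim ((circle_integralC (fun xi => f (r%:C * xi) * conjc (g (r%:C * xi)))
         : R[i]^o) @[r --> (1 : R)^'-]).

(* Radial limits; they exist almost everywhere on the circle for f in H^1. *)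
Definition boundary (R : realType) (f : R[i] -> R[i]) (xi : R[i]) : R[i] :=
  lim ((f (r%:C * xi) : R[i]^o) @[r --> (1 : R)^'-]).

Definition orlicz_modular (R : realType) (Psi : \bar R -> \bar R)
    (h : R[i] -> R[i]) (c : R) : \bar R :=
  circle_integral (fun xi => Psi (normc (h xi) / c)%:E).

Definition orlicz_space (R : realType) (Psi : \bar R -> \bar R) :
  set (R[i] -> R[i]) :=
  [set h | [/\ measurable_fun `[0%R, 2 * pi] (fun t : R => complex.Re (h (cis t))),
               measurable_fun `[0%R, 2 * pi] (fun t : R => complex.Im (h (cis t)))
             & exists2 c : R, 0 < c & (orlicz_modular Psi h c < +oo)%E]].

Definition luxemburg_norm (R : realType) (Psi : \bar R -> \bar R)
    (h : R[i] -> R[i]) : \bar R :=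
  ereal_inf [set c%:E | c in [set c : R |
    0 < c /\ (orlicz_modular Psi h c <= 1)%E]].

Definition hardy_orlicz (R : realType) (Psi : \bar R -> \bar R) :
  set (R[i] -> R[i]) :=
  [set f | hardy 1 f /\ orlicz_space Psi (boundary f)].

Definition hardy_orlicz_norm (R : realType) (Psi : \bar R -> \bar R)
    (f : R[i] -> R[i]) : \bar R := luxemburg_norm Psi (boundary f).

(* Compactness of an operator [T] on the space [X] normed by [N]: the image of
   the closed unit ball is relatively compact in [X]. *)
Definition compact_operator (R : realType) (X : set (R[i] -> R[i]))
    (N : (R[i] -> R[i]) -> \bar R) (T : (R[i] -> R[i]) -> (R[i] -> R[i])) :
  Prop :=
  forall u : nat -> (R[i] -> R[i]),
    (forall n, X (u n) /\ (N (u n) <= 1)%E) ->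
    exists g : R[i] -> R[i], X g /\
      exists k : nat -> nat, (forall n, (k n < k n.+1)%N) /\
        N (T (u (k n)) \- g) @[n --> \oo] --> 0%E.

Definition linear_on_H2 (R : realType)
    (T : (R[i] -> R[i]) -> (R[i] -> R[i])) : Prop :=
  (forall f, hardy 2 f -> hardy 2 (T f)) /\
  (forall (a : R[i]) f g, hardy 2 f -> hardy 2 g ->
     forall z, disk z -> T (fun w => a * f w + g w) z = a * T f z + T g z).

(* T^*T f = mu f, tested against all g in H^2. *)
Definition gram_eigenvector (R : realType)
    (T : (R[i] -> R[i]) -> (R[i] -> R[i])) (mu : R) (f : R[i] -> R[i]) : Prop :=
  hardy 2 f /\
  forall g, hardy 2 g -> hardy_inner (T f) (T g) = mu%:C * hardy_inner f g.

(* [s] lists the nonzero eigenvalues of (T^*T)^{1/2} in decreasing order, each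
   repeated according to its multiplicity, and is completed by zeros if there
   are finitely many: the [e n] with [s n = t > 0] form an orthonormal basis of
   the eigenspace of T^*T for t^2. *)
Definition singular_numbers (R : realType)
    (T : (R[i] -> R[i]) -> (R[i] -> R[i])) (s : nat -> R) : Prop :=
  [/\ forall n, 0 <= s n,
      forall n, s n.+1 <= s n
    & exists e : nat -> (R[i] -> R[i]),
        [/\ forall n, 0 < s n -> gram_eigenvector T (s n ^+ 2) (e n),
            forall m n, 0 < s m -> 0 < s n ->
              hardy_inner (e m) (e n) = (m == n)%:R
          & forall (t : R) f, 0 < t -> gram_eigenvector T (t ^+ 2) f ->
              exists (d : nat) (c : nat -> R[i]), forall z, disk z ->
                f z = \sum_(n < d | s n == t) c n * e n z]].

Definition schatten (R : realType) (p : R)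
    (T : (R[i] -> R[i]) -> (R[i] -> R[i])) : Prop :=
  [/\ linear_on_H2 T,
      compact_operator (@hardy R 2) (@hardy_norm R 2) T
    & exists2 s : nat -> R, singular_numbers T s &
        (\sum_(0 <= n <oo) (s n `^ p)%:E < +oo)%E].

(* Main.v *)
(* The map is a lens map.  For 0 < a < 1 let lens_a be the conjugate, under the Cayley
   transform cay z = (1 + z) / (1 - z), of the power w |-> w^a of the right half-plane; take
   phi = lens_(1/2).

   Schatten classes.  1 / (1 - |lens_a|^2) is at most the real part of a multiple of
   w^a + w^-a, where w = cay z, hence has bounded circle means: C_(lens_a) is compact and
   Hilbert-Schmidt, so its n-th singular number is O(n^(-1/2)).  Since
   phi = lens_a o ... o lens_a (k factors) for a^k = 1/2, the min-max principle bounds the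
   (k n)-th singular number of C_phi by the k-th power of the n-th one of C_(lens_a), that
   is, by O(n^(-k/2)), for every k.

   Failure of compactness.  With h = 1 / Psi(x) the function
   u_x(z) = x (h / (1 - (1 - h) z))^2 has Luxemburg norm at most 1 by convexity of Psi, and
   |u_x o phi| >= x / 4 on an arc of length comparable to h^2 = Psi(x)^-2.  By the
   condition Delta^2, Psi(c x) >= Psi(x)^4 for some c, which is much larger than the
   inverse of the length of the arc.  Hence u_x o phi, even after subtraction of any fixed
   function of H^1 and of any u_y o phi with y much smaller than x, cannot be small in
   norm.  Since the limit of a subsequence is an arbitrary function of H^1, its boundary
   values are controlled by Fatou's theorem: a function f of H^1 is q / p with bounded
   p = 1 / (1 + G) and q = f / (1 + G), where Re G >= |f|. *)
Require Import Defs.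
From HB Require Import structures.
From mathcomp Require Import all_boot all_order all_algebra.
From mathcomp Require Import all_classical all_reals all_analysis.
From mathcomp Require Import complex.
From mathcomp Require Import measurable_realfun ring lra.
Set Implicit Arguments.
Unset Strict Implicit.
Unset Printing Implicit Defensive.
Import Order.TTheory GRing.Theory Num.Theory numFieldNormedType.Exports.
Import Normc.
Local Open Scope classical_set_scope.
Local Open Scope complex_scope.
Local Open Scope ring_scope.

(** * The norm and differentiability on R[i] *)

Section Basic.
Variable R : realType.
Implicit Types (z w : R[i]) (f g : R[i] -> R[i]).

(** [boundary] is built on [lim], so its value is arbitrary wherever the radial limit fails to
    exist, and the boundary function of a difference splits only where both limits exist. This is
    why the failure of compactness rests on almost everywhere existence of radial limits, both for
    the bounded functions [u n \o phi] and for the unknown limit [g], and hence on Poisson integrals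
    and Lebesgue points. The lens of exponent 1/2 has a right angle at 1: points at distance h^2
    from 1 go within a constant times h of 1, where the test function of width h is large. On the
    Schatten side one quantity governs everything: [1 / (1 - |phi z|^2)] is the squared norm of the
    reproducing kernel of H^2 at [phi z], and a bound on its circle means gives boundedness,
    compactness and the Hilbert-Schmidt inequality together. No adjoint is formed: singular vectors
    are found by maximizing [|T f|^2] on successive orthogonal complements. The function theory is
    phrased with circle means; Goursat's theorem enters once, through their independence of the
    radius. *)

Lemma cnD z w : normc (z + w) <= normc z + normc w.
Proof. exact: (@le_normcD R z w). Qed.

Lemma cnN z : normc (- z) = normc z.
Proof. exact: (@normcN R z). Qed.

Lemma cnBC z w : normc (z - w) = normc (w - z).
Proof. by rewrite -(cnN (z - w)) opprB. Qed.

Lemma cnB z w : normc (z - w) <= normc z + normc w.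
Proof. by rewrite -(cnN w) cnD. Qed.

Lemma cn_ge0 z : 0 <= normc z.
Proof. by case: z => a b; rewrite /= sqrtr_ge0. Qed.

Lemma cn_sqr z : normc z ^+ 2 = complex.Re z ^+ 2 + complex.Im z ^+ 2.
Proof. by case: z => a b; rewrite /= sqr_sqrtr // addr_ge0 // sqr_ge0. Qed.

Lemma cnM z w : normc (z * w) = normc z * normc w.
Proof. exact: (@normcM R z w). Qed.

Lemma cn0 : normc (0 : R[i]) = 0.
Proof. exact: (@normc0 R). Qed.

Lemma cn1 : normc (1 : R[i]) = 1.
Proof. exact: (@normc1 R). Qed.

Lemma cnV z : normc z^-1 = (normc z)^-1.
Proof. exact: (@normcV R z). Qed.

Lemma cnX z n : normc (z ^+ n) = normc z ^+ n.
Proof. by elim: n => [|n IH]; rewrite ?expr0 ?cn1 // !exprS cnM IH. Qed.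

Lemma cn_eq0 z : (normc z == 0) = (z == 0).
Proof. by apply/eqP/eqP => [/eq0_normc//|->]; rewrite cn0. Qed.

Lemma cn_gt0 z : (0 < normc z) = (z != 0).
Proof. by rewrite lt_def cn_ge0 andbT cn_eq0. Qed.

Lemma cnR (r : R) : normc r%:C = `|r|.
Proof. by rewrite /= expr0n addr0 sqrtr_sqr. Qed.

Lemma cnn (n : nat) : normc (n%:R : R[i]) = n%:R.
Proof. by rewrite -(rmorph_nat (real_complex R)) cnR ger0_norm. Qed.

Lemma cnJ z : normc (conjc z) = normc z.
Proof. by case: z => a b; rewrite /= sqrrN. Qed.

Lemma Re_le_cn z : `|complex.Re z| <= normc z.
Proof.
rewrite -(@ler_pXn2r _ 2) ?nnegrE ?cn_ge0 // cn_sqr real_normK ?num_real //.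
by rewrite lerDl sqr_ge0.
Qed.

Lemma Im_le_cn z : `|complex.Im z| <= normc z.
Proof.
rewrite -(@ler_pXn2r _ 2) ?nnegrE ?cn_ge0 // cn_sqr real_normK ?num_real //.
by rewrite lerDr sqr_ge0.
Qed.

Lemma ReD z w : complex.Re (z + w) = complex.Re z + complex.Re w.
Proof. by case: z w => [a b] [c d]. Qed.
Lemma ImD z w : complex.Im (z + w) = complex.Im z + complex.Im w.
Proof. by case: z w => [a b] [c d]. Qed.
Lemma ReN z : complex.Re (- z) = - complex.Re z.
Proof. by case: z => [a b]. Qed.
Lemma ImN z : complex.Im (- z) = - complex.Im z.
Proof. by case: z => [a b]. Qed.
Lemma ReM z w : complex.Re (z * w) =
  complex.Re z * complex.Re w - complex.Im z * complex.Im w.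
Proof. by case: z w => [a b] [c d]. Qed.
Lemma ImM z w : complex.Im (z * w) =
  complex.Re z * complex.Im w + complex.Im z * complex.Re w.
Proof. by case: z w => [a b] [c d]. Qed.
Lemma ReJ z : complex.Re (conjc z) = complex.Re z.
Proof. by case: z. Qed.
Lemma ImJ z : complex.Im (conjc z) = - complex.Im z.
Proof. by case: z. Qed.

Lemma cplx_ext z w : complex.Re z = complex.Re w ->
  complex.Im z = complex.Im w -> z = w.
Proof. by case: z w => [a b] [c d] /= -> ->. Qed.

Lemma cn_le_ReIm z : normc z <= `|complex.Re z| + `|complex.Im z|.
Proof.
have -> : z = (complex.Re z)%:C + 'i * (complex.Im z)%:C by exact: complexE.
apply: le_trans (cnD _ _) _; rewrite cnM !cnR.
case: z => a b /=; rewrite ?mul0r ?mul1r ?mulr0 ?subr0 ?addr0 ?add0r ?subrr.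
by rewrite expr0n add0r expr1n sqrtr1 mul1r.
Qed.

Lemma cn_sum (I : Type) (r : seq I) (P : pred I) (F : I -> R[i]) :
  normc (\sum_(i <- r | P i) F i) <= \sum_(i <- r | P i) normc (F i).
Proof.
elim/big_rec2: _ => [|i y x _ H]; first by rewrite cn0.
by apply: le_trans (cnD _ _) _; rewrite lerD2l.
Qed.

Lemma cnB_ge z w : normc z - normc w <= normc (z - w).
Proof. by rewrite lerBlDr -{1}(subrK w z) cnD. Qed.

Lemma mulcJ z : z * conjc z = (normc z ^+ 2)%:C.
Proof. by rewrite cn_sqr; apply: cplx_ext; case: z => a b /=; ring. Qed.

Lemma cisD (s t : R) : cis (s + t) = cis s * cis t.
Proof. by rewrite /cis cosD sinD; apply: cplx_ext => /=; ring. Qed.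

Lemma cis0 : cis (0 : R) = 1.
Proof. by rewrite /cis cos0 sin0. Qed.

Lemma cn_cis (t : R) : normc (cis t) = 1.
Proof. by rewrite /cis /= cos2Dsin2 sqrtr1. Qed.

Lemma cis_neq0 (t : R) : cis t != 0.
Proof. by rewrite -cn_gt0 cn_cis. Qed.

Lemma cisN (t : R) : cis (- t) = conjc (cis t).
Proof. by rewrite /cis cosN sinN. Qed.

Lemma cis_period (t : R) : cis (t + 2 * pi) = cis t.
Proof. by rewrite /cis -[2 * pi]/(2%:R * pi) mulr_natl cosD2pi sinD2pi. Qed.

Lemma normc_complex z : `|z| = (normc z)%:C.
Proof. by rewrite normc_def; case: z. Qed.

Lemma gt0_complexP (e : R[i]) : 0 < e -> 0 < complex.Re e /\ e = (complex.Re e)%:C.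
Proof. by rewrite ltcE; case: e => a b /= /andP[/eqP -> ?]. Qed.

(** The little-o form with real [e] and [d] makes sense at [w = z] and keeps all estimates in the
    ordered field [R], away from the partial order of [R[i]]. *)
Definition cdiff f z l := forall e : R, 0 < e -> exists2 d : R, 0 < d &
  forall w, normc (w - z) < d -> normc (f w - f z - l * (w - z)) <= e * normc (w - z).

Lemma derivable_cdiff f z : derivable (f : R[i]^o -> R[i]^o) z 1 ->
  exists l, cdiff f z l.
Proof.
case/cvg_ex => /= l /cvgrPdist_le H; exists l => e e0.
have e0' : 0 < e%:C :> R[i] by rewrite ltcE /= eqxx.
have := H _ e0'; rewrite near_withinE => /nbhs_ballP[d /= d0 Hd].
have [d1 dE] := gt0_complexP d0.
exists (complex.Re d) => // w hw.
have [->|wz] := eqVneq w z; first by rewrite !subrr mulr0 subrr cn0 mulr0.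
have wz0 : w - z != 0 by rewrite subr_eq0.
have := Hd (w - z).
rewrite /ball /= sub0r normrN normc_complex dE ltcR => /(_ hw wz0).
rewrite /GRing.scale /= mulr1 subrK normc_complex lecR => Hn.
have -> : f w - f z - l * (w - z) = - ((l - (w - z)^-1 * (f w - f z)) * (w - z)).
  by field.
by rewrite cnN cnM ler_wpM2r // cn_ge0.
Qed.

Lemma cdiff_derivable f z l : cdiff f z l -> derivable (f : R[i]^o -> R[i]^o) z 1.
Proof.
move=> H; apply/cvg_ex; exists l; apply/cvgrPdist_le => e /gt0_complexP[e0 ->].
have [d d0 Hd] := H _ e0.
rewrite near_withinE; apply/nbhs_ballP; exists d%:C; first by rewrite /= ltcE /= eqxx.
move=> h; rewrite /ball /= sub0r normrN normc_complex ltcR => hd h0.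
have := Hd (h + z); rewrite addrK => /(_ hd) Hh.
rewrite /GRing.scale /= mulr1 normc_complex lecR.
have -> : l - h^-1 * (f (h + z) - f z) = - ((f (h + z) - f z - l * h) / h) by field.
by rewrite cnN cnM cnV ler_pdivrMr ?cn_gt0.
Qed.

(** Nothing bounds [r] from below, so [d] is shrunk by [Num.min 1 d] wherever radii must be
    nonnegative. *)
Definition lim1 (u : R -> R[i]) l := forall e : R, 0 < e -> exists2 d : R, 0 < d &
  forall r, 1 - d < r -> r < 1 -> normc (u r - l) < e.

Lemma lim1_lim (u : R -> R[i]) l : lim1 u l ->
  lim ((u r : R[i]^o) @[r --> (1 : R)^'-]) = l.
Proof.
move=> H; apply/cvg_lim => //; apply/cvgrPdist_lt => e /gt0_complexP[e0 ->].
have [d d0 Hd] := H _ e0.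
rewrite near_withinE; apply/nbhs_ballP; exists d => // r.
rewrite /ball /= => hr r1.
rewrite normc_complex ltcR cnBC; apply: Hd => //.
by move: hr; rewrite ltr_norml => /andP[_]; lra.
Qed.
End Basic.

(** * Complex differentiability and the exponential *)

Section Cdiff.
Variable R : realType.
Local Notation C := (R[i]^o).
Implicit Types (z w : R[i]) (f g : R[i] -> R[i]).

Lemma cvgcP (T : Type) (F : set_system T) (FF : Filter F) (f : T -> C) (l : C) :
  f @ F --> l <-> forall e : R, 0 < e -> \forall x \near F, normc (f x - l) < e.
Proof.
split=> [/cvgrPdist_lt H e e0|H].
  have e0' : 0 < e%:C :> R[i] by rewrite ltcE /= eqxx.
  apply: filterS (H _ e0') => x.
  by rewrite normc_complex ltcR cnBC.
apply/cvgrPdist_lt => e /gt0_complexP[e0 ->].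
by apply: filterS (H _ e0) => x; rewrite normc_complex ltcR cnBC.
Qed.

Lemma nbhscP z (P : R[i] -> Prop) : (\forall w \near (z : C), P w) <->
  exists2 d : R, 0 < d & forall w, normc (w - z) < d -> P w.
Proof.
split=> [/nbhs_ballP[d /= /gt0_complexP[d0 dE] H]|[d d0 H]].
  by exists (complex.Re d) => // w hw; apply: H; rewrite /ball /= dE normc_complex ltcR cnBC.
apply/nbhs_ballP; exists d%:C; first by rewrite /= ltcE /= eqxx.
by move=> w; rewrite /ball /= normc_complex ltcR cnBC; apply: H.
Qed.

Lemma cvgc_nbhsP f z l : (f : C -> C) w @[w --> (z : C)] --> (l : C) <->
  forall e : R, 0 < e -> exists2 d : R, 0 < d &
    forall w, normc (w - z) < d -> normc (f w - l) < e.
Proof.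
split=> [/(@cvgcP _ (nbhs (z : C)) _ (f : C -> C) (l : C)) H e /H /nbhscP//|H].
by apply/(@cvgcP _ (nbhs (z : C)) _ (f : C -> C) (l : C)) => e /H ?; apply/nbhscP.
Qed.

Definition ccont f z := forall e : R, 0 < e -> exists2 d : R, 0 < d &
    forall w, normc (w - z) < d -> normc (f w - f z) < e.

Lemma ccont_cst (a : R[i]) z : ccont (fun=> a) z.
Proof. by move=> e e0; exists 1 => // w _; rewrite subrr cn0. Qed.

Lemma ccont_id z : ccont id z.
Proof. by move=> e e0; exists e. Qed.

Lemma ccontD f g z : ccont f z -> ccont g z -> ccont (fun w => f w + g w) z.
Proof.
move=> F G e e0; have e2 : 0 < e / 2 by rewrite divr_gt0.
have [d1 d10 H1] := F _ e2; have [d2 d20 H2] := G _ e2.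
exists (Num.min d1 d2); first by rewrite lt_min d10.
move=> w; rewrite lt_min => /andP[/H1 h1 /H2 h2].
have -> : f w + g w - (f z + g z) = (f w - f z) + (g w - g z) by ring.
by apply: le_lt_trans (cnD _ _) _; lra.
Qed.

Lemma ccontM f g z : ccont f z -> ccont g z -> ccont (fun w => f w * g w) z.
Proof.
move=> F G e e0; set A := normc (f z) + 1; set B := normc (g z) + 1.
have A0 : 0 < A by rewrite ltr_wpDl ?cn_ge0.
have B0 : 0 < B by rewrite ltr_wpDl ?cn_ge0.
have e1 : 0 < e / (2 * B) by rewrite divr_gt0 ?mulr_gt0.
have e2 : 0 < Num.min 1 (e / (2 * A)) by rewrite lt_min ltr01 divr_gt0 ?mulr_gt0.
have [d1 d10 H1] := F _ e1; have [d2 d20 H2] := G _ e2.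
exists (Num.min d1 d2); first by rewrite lt_min d10.
move=> w; rewrite lt_min => /andP[/H1 h1 /H2]; rewrite lt_min => /andP[h2 h3].
have -> : f w * g w - f z * g z = (f w - f z) * g w + f z * (g w - g z) by ring.
apply: le_lt_trans (cnD _ _) _; rewrite !cnM.
have hB : normc (g w) <= B by have := cnB_ge (g w) (g z); rewrite /B; lra.
have : normc (f w - f z) * normc (g w) <= e / (2 * B) * B.
  by apply: ler_pM; rewrite ?cn_ge0 // ltW.
have : normc (f z) * normc (g w - g z) < A * (e / (2 * A)).
  apply: (@le_lt_trans _ _ (normc (f z) * (e / (2 * A)))).
    by rewrite ler_wpM2l ?cn_ge0 // ltW.
  by rewrite ltr_pM2r ?divr_gt0 ?mulr_gt0 // ltrDl.
have -> : A * (e / (2 * A)) = e / 2 by field; rewrite gt_eqF.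
have -> : e / (2 * B) * B = e / 2 by field; rewrite gt_eqF.
lra.
Qed.

Lemma ccontN f z : ccont f z -> ccont (fun w => - f w) z.
Proof.
by move=> /(ccontM (ccont_cst (-1) z)); under eq_fun do rewrite mulN1r.
Qed.

Lemma ccont_comp f g z : ccont f z -> ccont g (f z) -> ccont (fun w => g (f w)) z.
Proof.
move=> F G e /G[d /F[d' d'0 H] H']; exists d' => // w /H; exact: H'.
Qed.

Lemma cvg_Re (T : Type) (F : set_system T) (FF : Filter F) (f : T -> C) (l : C) :
  f @ F --> l -> (complex.Re (f x) @[x --> F] --> complex.Re l).
Proof.
move=> /cvgcP H; apply/cvgrPdist_lt => e /H; apply: filterS => x.
by apply: le_lt_trans; rewrite distrC -ReN -ReD Re_le_cn.
Qed.

Lemma cvg_Im (T : Type) (F : set_system T) (FF : Filter F) (f : T -> C) (l : C) :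
  f @ F --> l -> (complex.Im (f x) @[x --> F] --> complex.Im l).
Proof.
move=> /cvgcP H; apply/cvgrPdist_lt => e /H; apply: filterS => x.
by apply: le_lt_trans; rewrite distrC -ImN -ImD Im_le_cn.
Qed.

Lemma cvg_normc (T : Type) (F : set_system T) (FF : Filter F) (f : T -> C) (l : C) :
  f @ F --> l -> (normc (f x) @[x --> F] --> normc l).
Proof.
move=> /cvgcP H; apply/cvgrPdist_lt => e /H; apply: filterS => x.
apply: le_lt_trans; rewrite ler_norml cnBC.
rewrite (cnB_ge l (f x)) andbT lerNl opprB cnBC; exact: cnB_ge.
Qed.

Lemma cvg_ReIm (T : Type) (F : set_system T) (FF : Filter F) (u v : T -> R) (a b : R) :
  u @ F --> a -> v @ F --> b -> ((u x +i* v x : C) @[x --> F] --> (a +i* b : C)).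
Proof.
move=> /cvgrPdist_lt H1 /cvgrPdist_lt H2; apply/cvgcP => e e0.
have e2 : 0 < e / 2 by rewrite divr_gt0.
apply: filterS2 (H1 _ e2) (H2 _ e2) => x h1 h2.
apply: le_lt_trans (cn_le_ReIm _) _.
by rewrite ReD ImD ReN ImN /= distrC (distrC (v x)); lra.
Qed.

(* Caratheodory's form of differentiability, from which the calculus rules are immediate. *)
Lemma cdiffP f z l : cdiff f z l <-> exists q : R[i] -> R[i],
  [/\ q z = l, forall w, f w - f z = q w * (w - z)
    & ccont q z].
Proof.
split=> [H|[q [qz qE qc]] e e0].
  exists (fun w => if w == z then l else (f w - f z) / (w - z)).
  split; rewrite ?eqxx //.
    by move=> w; case: eqVneq => [->|wz]; rewrite ?subrr ?mulr0 // divfK // subr_eq0.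
  move=> e e0.
  have e2 : 0 < e / 2 by rewrite divr_gt0.
  have [d d0 Hd] := H _ e2; exists d => // w hw.
  case: eqVneq => [_|wz]; first by rewrite eqxx subrr cn0.
  rewrite eqxx; have wz0 : w - z != 0 by rewrite subr_eq0.
  have -> : (f w - f z) / (w - z) - l = (f w - f z - l * (w - z)) / (w - z) by field.
  rewrite cnM cnV ltr_pdivrMr ?cn_gt0 //; apply: le_lt_trans (Hd _ hw) _.
  by rewrite ltr_pM2r ?cn_gt0 //; lra.
have [d d0 Hd] := qc _ e0; exists d => // w /Hd hw.
by rewrite qE -qz -mulrBl cnM ler_wpM2r ?cn_ge0 // ltW.
Qed.

Lemma cdiff_ccont f z l : cdiff f z l -> ccont f z.
Proof.
case/cdiffP => q [_ qE qc].
have fE : f = (fun w => f z + q w * (w - z)) by apply/funext => w; rewrite -qE addrC subrK.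
rewrite fE; apply: ccontD; first exact: ccont_cst.
by apply: ccontM => //; apply: ccontD; [exact: ccont_id|exact: ccont_cst].
Qed.

Lemma cdiff_cst (a : R[i]) z : cdiff (fun=> a) z 0.
Proof. by move=> e e0; exists 1 => // w _; rewrite subrr mul0r subrr cn0 mulr_ge0 ?cn_ge0 ?ltW. Qed.

Lemma cdiff_id z : cdiff id z 1.
Proof. by move=> e e0; exists 1 => // w _; rewrite mul1r subrr cn0 mulr_ge0 ?cn_ge0 ?ltW. Qed.

Lemma cdiffD f g z a b : cdiff f z a -> cdiff g z b ->
  cdiff (fun w => f w + g w) z (a + b).
Proof.
move=> /cdiffP[p [pz pE pc]] /cdiffP[q [qz qE qc]]; apply/cdiffP.
exists (fun w => p w + q w); split; rewrite ?pz ?qz //.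
  by move=> w; rewrite mulrDl -pE -qE; ring.
exact: ccontD.
Qed.

Lemma cdiffM f g z a b : cdiff f z a -> cdiff g z b ->
  cdiff (fun w => f w * g w) z (a * g z + f z * b).
Proof.
move=> df /[dup] dg /cdiffP[q [qz qE qc]]; case/cdiffP: df => p [pz pE pc]; apply/cdiffP.
exists (fun w => p w * g w + f z * q w); split; rewrite ?pz ?qz //.
  by move=> w; rewrite mulrDl mulrAC -pE -mulrA -qE; ring.
apply: ccontD; first by apply: ccontM => //; exact: cdiff_ccont dg.
by apply: ccontM => //; exact: ccont_cst.
Qed.

Lemma cdiff_comp f g z a b : cdiff f z a -> cdiff g (f z) b ->
  cdiff (fun w => g (f w)) z (b * a).
Proof.
move=> /[dup] df /cdiffP[p [pz pE pc]] /cdiffP[q [qz qE qc]]; apply/cdiffP.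
exists (fun w => q (f w) * p w); split; rewrite ?pz ?qz //.
  by move=> w; rewrite qE pE mulrA.
apply: ccontM => //; exact: (ccont_comp (cdiff_ccont df)).
Qed.

Lemma cdiffV z : z != 0 -> cdiff (fun w => w^-1) z (- (z ^- 2)).
Proof.
move=> z0 e e0; have nz : 0 < normc z by rewrite cn_gt0.
(* The first bound keeps [|w| >= |z| / 2]. The error is exactly (w - z)^2 / (w z^2), so the second
   makes it at most [e |w - z|]. *)
exists (Num.min (normc z / 2) (e * normc z ^+ 3 / 2)).
  by rewrite lt_min !divr_gt0 ?mulr_gt0 ?exprn_gt0.
move=> w; rewrite lt_min => /andP[h1 h2].
have hw : normc z / 2 <= normc w by have := cnB_ge z w; rewrite cnBC; lra.
have w0 : w != 0 by rewrite -cn_gt0; lra.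
have -> : w^-1 - z^-1 - - z ^- 2 * (w - z) = (w - z) / (w * z ^+ 2) * (w - z).
  by field; rewrite z0 w0.
rewrite cnM ler_wpM2r ?cn_ge0 // cnM cnV cnM cnX ler_pdivrMr ?mulr_gt0 ?exprn_gt0 ?cn_gt0 //.
apply: le_trans (ltW h2) _.
have -> : e * normc z ^+ 3 / 2 = e * (normc z / 2 * normc z ^+ 2) by field.
by rewrite ler_wpM2l ?(ltW e0) // ler_wpM2r // exprn_ge0 // cn_ge0.
Qed.

Lemma ccontV f z : f z != 0 -> ccont f z -> ccont (fun w => (f w)^-1) z.
Proof. by move=> f0 /ccont_comp; apply; exact: cdiff_ccont (cdiffV f0). Qed.

Lemma cdiff_eq_near f g z a : (\forall w \near (z : C), f w = g w) ->
  cdiff f z a -> cdiff g z a.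
Proof.
move=> /nbhscP[r r0 H] df e e0; have [d d0 Hd] := df _ e0.
exists (Num.min d r); first by rewrite lt_min d0.
move=> w; rewrite lt_min => /andP[h1 h2].
by rewrite -!H ?subrr ?cn0 //; exact: Hd.
Qed.

Definition holo f z := exists l, cdiff f z l.

Lemma holo_ccont f z : holo f z -> ccont f z.
Proof. by case=> l /cdiff_ccont. Qed.
Lemma holo_cst a z : holo (fun=> a) z. Proof. by exists 0; exact: cdiff_cst. Qed.
Lemma holo_id z : holo id z. Proof. by exists 1; exact: cdiff_id. Qed.
Lemma holoD f g z : holo f z -> holo g z -> holo (fun w => f w + g w) z.
Proof. by move=> [a ?] [b ?]; exists (a + b); exact: cdiffD. Qed.
Lemma holoM f g z : holo f z -> holo g z -> holo (fun w => f w * g w) z.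
Proof. by move=> [a ?] [b ?]; eexists; apply: cdiffM; eassumption. Qed.
Lemma holo_comp f g z : holo f z -> holo g (f z) -> holo (fun w => g (f w)) z.
Proof. by move=> [a ?] [b ?]; exists (b * a); exact: cdiff_comp. Qed.
Lemma holoN f z : holo f z -> holo (fun w => - f w) z.
Proof.
by move=> /(holoM (holo_cst (-1) z)); under eq_fun do rewrite mulN1r.
Qed.
Lemma holoB f g z : holo f z -> holo g z -> holo (fun w => f w - g w) z.
Proof. by move=> ? /holoN; exact: holoD. Qed.
Lemma holoV f z : f z != 0 -> holo f z -> holo (fun w => (f w)^-1) z.
Proof. by move=> f0 h; apply: (holo_comp h); eexists; exact: cdiffV. Qed.
Lemma holo_div f g z : g z != 0 -> holo f z -> holo g z -> holo (fun w => f w / g w) z.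
Proof. by move=> g0 hf hg; apply: holoM => //; exact: holoV. Qed.
Lemma holoX f z n : holo f z -> holo (fun w => f w ^+ n) z.
Proof.
move=> h; elim: n => [|n IH]; first by under eq_fun do rewrite expr0; exact: holo_cst.
by under eq_fun do rewrite exprS; exact: holoM.
Qed.
Lemma holo_sum (F : nat -> R[i] -> R[i]) n z : (forall k, holo (F k) z) ->
  holo (fun w => \sum_(k < n) F k w) z.
Proof.
move=> h; elim: n => [|n IH].
  by under eq_fun do rewrite big_ord0; exact: holo_cst.
by under eq_fun do rewrite big_ord_recr; exact: holoD.
Qed.

Lemma analyticP f : analytic_on_disk f <-> forall z, normc z < 1 -> holo f z.
Proof.
split=> H z hz; first exact: derivable_cdiff (H z hz).
by have [l /cdiff_derivable] := H z hz.
Qed.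

Definition cexp z : R[i] := (expR (complex.Re z))%:C * cis (complex.Im z).

Lemma cexpD z w : cexp (z + w) = cexp z * cexp w.
Proof. by rewrite /cexp ReD ImD expRD cisD rmorphM; ring. Qed.

Lemma cexp0 : cexp 0 = 1.
Proof. by rewrite /cexp expR0 cis0 mulr1. Qed.

Lemma cn_cexp z : normc (cexp z) = expR (complex.Re z).
Proof. by rewrite /cexp cnM cn_cis mulr1 cnR ger0_norm ?expR_ge0. Qed.

Lemma cexp_neq0 z : cexp z != 0.
Proof. by rewrite -cn_gt0 cn_cexp expR_gt0. Qed.

Lemma cdiff_cexp0 : cdiff cexp 0 1.
Proof.
have E : cexp = (fun w => (expR (complex.Re w))%:C * cis (complex.Im w)) by [].
have dR (u : R -> R) (a l : R) : is_derive a (1 : R) u l -> forall e, 0 < e ->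
    exists2 d : R, 0 < d & forall h, `|h| < d -> `|u (a + h) - u a - l * h| <= e * `|h|.
  move=> [du dv] e e0.
  move: du => /cvg_ex[l' Hl'].
  have l'E : l' = l by rewrite -dv; apply/esym/cvg_lim.
  move/cvgrPdist_le: Hl' => /(_ e e0); rewrite l'E near_withinE => /nbhs_ballP[d /= d0 Hd].
  exists d => // h hd; have [->|h0] := eqVneq h 0.
    by rewrite addr0 mulr0 subrr subr0 normr0 mulr0.
  have := Hd h; rewrite /ball /= sub0r normrN => /(_ hd h0).
  rewrite /GRing.scale /= mulr1 [h + a]addrC => H.
  have -> : u (a + h) - u a - l * h = - ((l - h^-1 * (u (a + h) - u a)) * h) by field.
  by rewrite normrN normrM ler_wpM2r.
move=> e e0.
(* The linearization errors of [expR], [cos] and [sin], multiplied out below, add up to at most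
   [9 e' |w|]. *)
pose e' := Num.min 1 (e / 16).
have e'0 : 0 < e' by rewrite lt_min ltr01 divr_gt0.
have e'1 : e' <= 1 by rewrite ge_min lexx.
have e'e : e' <= e / 16 by rewrite ge_min lexx orbT.
clearbody e'.
have [d1 d10 H1] := dR _ _ _ (is_derive_expR 0) _ e'0.
have [d2 d20 H2] := dR _ _ _ (is_derive_cos 0) _ e'0.
have [d3 d30 H3] := dR _ _ _ (is_derive_sin 0) _ e'0.
exists (Num.min e' (Num.min d1 (Num.min d2 d3))); first by rewrite !lt_min e'0 d10 d20 d30.
move=> w; rewrite subr0 !lt_min => /and4P[hw w1 w2 w3].
have hx := Re_le_cn w; have hy := Im_le_cn w.
have := H1 _ (le_lt_trans hx w1); have := H2 _ (le_lt_trans hy w2); have := H3 _ (le_lt_trans hy w3).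
rewrite !add0r expR0 cos0 sin0 oppr0 mul0r !subr0 !mul1r.
rewrite cexp0 /cexp /cis; move: (expR _) (cos _) (sin _) => E1 c1 s1 h3 h2 h1.
set x := complex.Re w in hx h1 *; set y := complex.Im w in hy h2 h3 *.
have n0 := cn_ge0 w; set n := normc w in hx hy hw n0 *.
have A1 : `|E1 - 1 - x| <= e' * n by apply: le_trans h1 _; rewrite ler_wpM2l // ltW.
have A2 : `|c1 - 1| <= e' * n by apply: le_trans h2 _; rewrite ler_wpM2l // ltW.
rewrite addr0 in h3; have A3 : `|s1 - y| <= e' * n by apply: le_trans h3 _; rewrite ler_wpM2l // ltW.
have en : e' * n <= n by rewrite ler_piMl.
have B1 : `|E1| <= 1 + n + n.
  have -> : E1 = (E1 - 1 - x) + x + 1 by ring.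
  by apply: le_trans (ler_normD _ _) _; rewrite normr1; have := ler_normD (E1 - 1 - x) x; lra.
have Hn : n <= e' by rewrite ltW.
have B3 : `|E1| <= 3 by lra.
have B2 : `|E1 - 1| <= 2 * n.
  have -> : E1 - 1 = (E1 - 1 - x) + x by ring.
  by apply: le_trans (ler_normD _ _) _; lra.
apply: le_trans (cn_le_ReIm _) _.
rewrite !(ReD, ImD, ReN, ImN, ReM, ImM) /= -/x -/y.
rewrite !mul0r !subr0 addr0.
have -> : E1 * c1 - 1 - x = E1 * (c1 - 1) + (E1 - 1 - x) by ring.
have -> : E1 * s1 - y = E1 * (s1 - y) + (E1 - 1) * y by ring.
have C1 : `|E1 * (c1 - 1)| <= 3 * (e' * n) by rewrite normrM ler_pM.
have C2 : `|E1 * (s1 - y)| <= 3 * (e' * n) by rewrite normrM ler_pM.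
have C3 : `|(E1 - 1) * y| <= e' * n + e' * n.
  rewrite normrM; apply: (@le_trans _ _ (2 * n * n)); first by rewrite ler_pM.
  have : n * n <= e' * n by rewrite ler_wpM2r.
  lra.
have D1 := ler_normD (E1 * (c1 - 1)) (E1 - 1 - x).
have D2 := ler_normD (E1 * (s1 - y)) ((E1 - 1) * y).
have : e' * n <= e / 16 * n by rewrite ler_wpM2r.
have : 0 <= e * n by rewrite mulr_ge0 // ltW.
lra.
Qed.

Lemma cdiff_cexp z : cdiff cexp z (cexp z).
Proof.
have E : cexp = (fun w => cexp z * cexp (w - z)).
  by apply/funext => w; rewrite -cexpD addrC subrK.
have D : cdiff (fun w => w - z) z (1 + 0) by apply: cdiffD; [exact: cdiff_id|exact: cdiff_cst].
have := cdiff_comp (b := 1) D; rewrite subrr => /(_ cexp cdiff_cexp0) D2.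
have := cdiffM (cdiff_cst (cexp z) z) D2.
by rewrite subrr cexp0 mul0r add0r mul1r addr0 mulr1 -E.
Qed.

Lemma holo_cexp z : holo cexp z. Proof. by exists (cexp z); exact: cdiff_cexp. Qed.
End Cdiff.

(** * Integrals of complex functions of a real variable *)

Section Cint.
Variable R : realType.
Local Notation mu := (@lebesgue_measure R).
Implicit Types (f g : R -> R[i]) (u v : R -> R) (a b c : R).

Definition rcont f (x : R) := forall e : R, 0 < e -> exists2 d : R, 0 < d &
  forall y, `|y - x| < d -> normc (f y - f x) < e.

Definition rcts a b f := forall x, a <= x -> x <= b -> rcont f x.

Lemma rcont_comp f (g : R[i] -> R[i]) x :
  rcont f x -> ccont g (f x) -> rcont (fun t => g (f t)) x.
Proof. by move=> F G e /G[d /F[d' d'0 H] H']; exists d' => // w /H; exact: H'. Qed.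

Lemma rcont_ReIm u v x : {for x, continuous u} -> {for x, continuous v} ->
  rcont (fun t => u t +i* v t) x.
Proof.
move=> /cvgrPdist_lt H1 /cvgrPdist_lt H2 e e0.
have e2 : 0 < e / 2 by rewrite divr_gt0.
have /nbhs_ballP[d1 /= d10 K1] := H1 _ e2.
have /nbhs_ballP[d2 /= d20 K2] := H2 _ e2.
exists (Num.min d1 d2); first by rewrite lt_min d10.
move=> y; rewrite distrC lt_min => /andP[/K1 h1 /K2 h2].
apply: le_lt_trans (cn_le_ReIm ((u y +i* v y) - (u x +i* v x))) _.
by rewrite ReD ImD ReN ImN /= distrC (distrC (v y)); lra.
Qed.

Lemma rcont_RtoC u x : {for x, continuous u} -> rcont (fun t => (u t)%:C) x.
Proof. by move=> h; apply: rcont_ReIm => //; exact: cvg_cst. Qed.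

Lemma rcont_cst k x : rcont (fun=> k) x.
Proof. by move=> e e0; exists 1 => // w _; rewrite subrr cn0. Qed.

Lemma rcont_cis x : rcont (@cis R) x.
Proof. by apply: rcont_ReIm; [exact: continuous_cos|exact: continuous_sin]. Qed.

Lemma rcontD f g x : rcont f x -> rcont g x -> rcont (fun w => f w + g w) x.
Proof.
move=> F G e e0; have e2 : 0 < e / 2 by rewrite divr_gt0.
have [d1 d10 H1] := F _ e2; have [d2 d20 H2] := G _ e2.
exists (Num.min d1 d2); first by rewrite lt_min d10.
move=> w; rewrite lt_min => /andP[/H1 h1 /H2 h2].
have -> : f w + g w - (f x + g x) = (f w - f x) + (g w - g x) by ring.
by apply: le_lt_trans (cnD _ _) _; lra.
Qed.

Lemma rcont_Re f x : rcont f x -> {for x, continuous (fun t => complex.Re (f t))}.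
Proof.
move=> F; apply/cvgrPdist_lt => e /F[d d0 H]; apply/nbhs_ballP; exists d => // y.
rewrite /ball /= distrC => /H; apply: le_lt_trans.
by rewrite distrC -ReN -ReD Re_le_cn.
Qed.

Lemma rcont_Im f x : rcont f x -> {for x, continuous (fun t => complex.Im (f t))}.
Proof.
move=> F; apply/cvgrPdist_lt => e /F[d d0 H]; apply/nbhs_ballP; exists d => // y.
rewrite /ball /= distrC => /H; apply: le_lt_trans.
by rewrite distrC -ImN -ImD Im_le_cn.
Qed.

Lemma rcontM f g x : rcont f x -> rcont g x -> rcont (fun w => f w * g w) x.
Proof.
move=> F G.
have E : (fun w => f w * g w) = (fun w =>
  (complex.Re (f w) * complex.Re (g w) - complex.Im (f w) * complex.Im (g w)) +i*
  (complex.Re (f w) * complex.Im (g w) + complex.Im (f w) * complex.Re (g w))).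
  by apply/funext => w; apply: cplx_ext; rewrite (ReM, ImM).
have Fr := rcont_Re F; have Fi := rcont_Im F.
have Gr := rcont_Re G; have Gi := rcont_Im G.
rewrite E; apply: rcont_ReIm; [apply: cvgB|apply: cvgD]; exact: cvgM.
Qed.

Lemma rcontB f g x : rcont f x -> rcont g x -> rcont (fun w => f w - g w) x.
Proof.
move=> F G; under eq_fun do rewrite -mulN1r.
by apply: rcontD => //; apply: rcontM => //; exact: rcont_cst.
Qed.

Lemma rcontJ f x : rcont f x -> rcont (fun w => conjc (f w)) x.
Proof.
move=> F e /F[d d0 H]; exists d => // y /H; congr (_ < _).
by rewrite -cnJ; congr normc; apply: cplx_ext; rewrite !(ReJ, ImJ, ReD, ImD, ReN, ImN) ?ReJ ?ImJ; ring.
Qed.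

Lemma rcont_normc f x : rcont f x -> {for x, continuous (fun t => normc (f t))}.
Proof.
move=> F; apply/cvgrPdist_lt => e /F[d d0 H]; apply/nbhs_ballP; exists d => // y.
rewrite /ball /= distrC => /H; apply: le_lt_trans; rewrite ler_norml cnBC.
rewrite (cnB_ge (f x) (f y)) andbT lerNl opprB cnBC; exact: cnB_ge.
Qed.

Lemma cts_integrable u a b : (forall x, a <= x -> x <= b -> {for x, continuous u}) ->
  mu.-integrable `[a, b] (EFin \o u).
Proof.
move=> H; apply: continuous_compact_integrable; first exact: segment_compact.
apply: continuous_in_subspaceT => x; rewrite inE /= in_itv /= => /andP[]; exact: H.
Qed.

Definition rint a b u : R := \int[mu]_(x in `[a, b]) u x.
Definition cint a b f : R[i] :=
  rint a b (fun x => complex.Re (f x)) +i* rint a b (fun x => complex.Im (f x)).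

Lemma rint_eq a b u v : (forall x, a <= x -> x <= b -> u x = v x) -> rint a b u = rint a b v.
Proof. by move=> H; apply: eq_Rintegral => x; rewrite inE /= in_itv /= => /andP[]; exact: H. Qed.

Lemma cint_eq a b f g : (forall x, a <= x -> x <= b -> f x = g x) -> cint a b f = cint a b g.
Proof. by move=> H; congr Complex; apply: rint_eq => x ? ?; rewrite H. Qed.

Definition cts a b u := forall x, a <= x -> x <= b -> {for x, continuous u}.

Lemma rintD a b u v : cts a b u -> cts a b v ->
  rint a b (fun x => u x + v x) = rint a b u + rint a b v.
Proof. by move=> hu hv; apply: RintegralD => //; exact: cts_integrable. Qed.

Lemma rintB a b u v : cts a b u -> cts a b v ->
  rint a b (fun x => u x - v x) = rint a b u - rint a b v.
Proof. by move=> hu hv; apply: RintegralB => //; exact: cts_integrable. Qed.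

Lemma rintZ a b k u : cts a b u -> rint a b (fun x => k * u x) = k * rint a b u.
Proof. by move=> hu; apply: RintegralZl => //; exact: cts_integrable. Qed.

Lemma rint_le a b u v : cts a b u -> cts a b v ->
  (forall x, a <= x -> x <= b -> u x <= v x) -> rint a b u <= rint a b v.
Proof.
move=> hu hv H; apply: le_Rintegral => //; try exact: cts_integrable.
by move=> x; rewrite /= in_itv /= => /andP[]; exact: H.
Qed.

Lemma rint_cst a b k : a <= b -> rint a b (fun=> k) = k * (b - a).
Proof.
move=> ab; rewrite /rint Rintegral_cst //=.
have -> : mu `[a, b]%classic = (b - a)%:E; last by [].
rewrite lebesgue_measure_itv /= lte_fin; case: ltP => [_|ba] //=.
by have -> : b = a by [apply/eqP; rewrite eq_le ba ab]; rewrite subrr.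
Qed.

Lemma rint_split a c b u : a <= c -> c <= b -> cts a b u ->
  rint a b u = rint a c u + rint c b u.
Proof.
move=> ac cb hu.
have iab := cts_integrable hu.
have := Rintegral_itvB iab (x := c); rewrite !bnd_simp => /(_ ac cb) E.
rewrite [X in X = _](_ : _ = rint a c u + \int[mu]_(x in `]c, b]) u x); last first.
  by rewrite -E /rint; ring.
congr (_ + _); rewrite /rint Rintegral_itv_obnd_cbnd //.
apply: (integrableS _ _ _ iab) => //.
by move=> x /=; rewrite !in_itv /= => /andP[cx ->]; rewrite andbT (le_trans ac (ltW cx)).
Qed.

Lemma rcts_Re a b f : rcts a b f -> cts a b (fun x => complex.Re (f x)).
Proof. by move=> H x ? ?; apply: rcont_Re; exact: H. Qed.
Lemma rcts_Im a b f : rcts a b f -> cts a b (fun x => complex.Im (f x)).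
Proof. by move=> H x ? ?; apply: rcont_Im; exact: H. Qed.
Hint Resolve rcts_Re rcts_Im : core.

Lemma cintD a b f g : rcts a b f -> rcts a b g ->
  cint a b (fun x => f x + g x) = cint a b f + cint a b g.
Proof.
move=> hf hg; apply: cplx_ext; rewrite (ReD, ImD) /=.
  by rewrite -rintD; auto; apply: rint_eq => *; rewrite ReD.
by rewrite -rintD; auto; apply: rint_eq => *; rewrite ImD.
Qed.

Lemma rctsZ a b k f : rcts a b f -> rcts a b (fun x => k * f x).
Proof. by move=> hf x ? ?; apply: rcontM; [exact: rcont_cst|exact: hf]. Qed.

Lemma cintZ a b k f : rcts a b f -> cint a b (fun x => k * f x) = k * cint a b f.
Proof.
move=> hf; have [h1 h2] := (rcts_Re hf, rcts_Im hf).
have ctsZ l u : cts a b u -> cts a b (fun x => l * u x).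
  by move=> H x ? ?; apply: cvgM; [exact: cvg_cst|exact: H].
apply: cplx_ext; rewrite (ReM, ImM) /=.
  rewrite -!rintZ // -rintB; try exact: ctsZ.
  by apply: rint_eq => *; rewrite ReM.
rewrite -!rintZ // -rintD; try exact: ctsZ.
by apply: rint_eq => *; rewrite ImM.
Qed.

Lemma cintB a b f g : rcts a b f -> rcts a b g ->
  cint a b (fun x => f x - g x) = cint a b f - cint a b g.
Proof.
move=> hf hg; rewrite -mulN1r -cintZ // -cintD //; last exact: rctsZ.
by apply: cint_eq => *; rewrite mulN1r.
Qed.

Lemma cint_cst a b k : a <= b -> cint a b (fun=> k) = k * (b - a)%:C.
Proof.
by move=> ab; apply: cplx_ext; rewrite (ReM, ImM) /= rint_cst //; ring.
Qed.

Lemma cint_split a c b f : a <= c -> c <= b -> rcts a b f ->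
  cint a b f = cint a c f + cint c b f.
Proof.
by move=> ac cb hf; apply: cplx_ext; rewrite (ReD, ImD) /= (rint_split ac cb); auto.
Qed.

(** Multiplying by the unimodular [u] makes the integral real and nonnegative, so it suffices to
    integrate [Re (u f) <= |f|]. *)
Lemma cn_cint a b f : rcts a b f -> normc (cint a b f) <= rint a b (fun x => normc (f x)).
Proof.
move=> hf; set w := cint a b f.
have cn : cts a b (fun x => normc (f x)) by move=> x ? ?; apply: rcont_normc; exact: hf.
have [w0|w0] := eqVneq w 0.
  by rewrite w0 cn0; apply: Rintegral_ge0 => x _; exact: cn_ge0.
pose u := conjc w / (normc w)%:C.
have nw : 0 < normc w by rewrite cn_gt0.
have nw0 : (normc w)%:C != 0 :> R[i] by rewrite -cn_eq0 cnR ger0_norm ?cn_ge0 // gt_eqF.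
have nu : normc u = 1.
  by rewrite cnM cnV cnJ cnR ger0_norm ?cn_ge0 // divff // gt_eqF.
have uw : u * w = (normc w)%:C.
  have -> : u * w = (w * conjc w) / (normc w)%:C by rewrite /u; ring.
  by rewrite mulcJ rmorphXn /= expr2 mulfK.
have : complex.Re (u * w) = normc w by rewrite uw.
rewrite -cintZ //= => <-; apply: rint_le => //; first by apply: rcts_Re; exact: rctsZ.
move=> x _ _; apply: le_trans (ler_norm _) _; apply: le_trans (Re_le_cn _) _.
by rewrite cnM nu mul1r.
Qed.

Lemma cn_cint_bound a b f M : a <= b -> rcts a b f ->
  (forall x, a <= x -> x <= b -> normc (f x) <= M) -> normc (cint a b f) <= M * (b - a).
Proof.
move=> ab hf H; apply: le_trans (cn_cint hf) _; rewrite -rint_cst //.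
apply: rint_le => // [x ? ?|x ? ?]; last exact: cvg_cst.
by apply: rcont_normc; exact: hf.
Qed.
End Cint.

Arguments normc : simpl never.

(** * Goursat's theorem *)

Arguments normc : simpl never.

Section Goursat.
Variable R : realType.
Implicit Types (a b c d s t : R).

(** Goursat's argument for an arbitrary function of rectangles: a positive value would be inherited,
    relative to the squared size, by nested rectangles shrinking to a point, against the local bound
    at that point. *)
Lemma bisection (I : R -> R -> R -> R -> R) a b c d : a <= b -> c <= d ->
  (forall a' b' c' d', a <= a' -> a' <= b' -> b' <= b -> c <= c' -> c' <= d' -> d' <= d ->
    let m := (a' + b') / 2 in let n := (c' + d') / 2 in
    I a' b' c' d' <= I a' m c' n + I m b' c' n + I a' m n d' + I m b' n d') ->
  (forall s t, a <= s -> s <= b -> c <= t -> t <= d -> forall e, 0 < e ->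
    exists2 h, 0 < h & forall a' b' c' d', a <= a' -> a' <= s -> s <= b' -> b' <= b ->
      c <= c' -> c' <= t -> t <= d' -> d' <= d -> b' - a' < h -> d' - c' < h ->
      I a' b' c' d' <= e * ((b' - a') + (d' - c')) ^+ 2) ->
  I a b c d <= 0.
Proof.
move=> ab cd Hsub Hloc; rewrite leNgt; apply/negP => I0.
pose sz (q : (R * R) * (R * R)) := (q.1.2 - q.1.1) + (q.2.2 - q.2.1).
pose II (q : (R * R) * (R * R)) := I q.1.1 q.1.2 q.2.1 q.2.2.
pose q0 := ((a, b), (c, d)).
(* The term 1 makes the initial rectangle strictly [bad] and avoids a division by zero when it is
   degenerate. *)
pose e := I a b c d / (sz q0 ^+ 2 + 1).
have sz1 : 0 < sz q0 ^+ 2 + 1 by rewrite ltr_wpDl // sqr_ge0.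
have e0 : 0 < e by rewrite divr_gt0.
pose bad q := e * sz q ^+ 2 < II q.
have bad0 : bad q0.
  rewrite /bad /e mulrAC ltr_pdivrMr // ltr_pM2l // ltrDl //.
(* The last quarter is taken untested: by the subdivision inequality it is [bad] when the other
   three are not. *)
pose step (q : (R * R) * (R * R)) :=
  let: ((a, b), (c, d)) := q in let m := (a + b) / 2 in let n := (c + d) / 2 in
  if bad ((a, m), (c, n)) then ((a, m), (c, n)) else
  if bad ((m, b), (c, n)) then ((m, b), (c, n)) else
  if bad ((a, m), (n, d)) then ((a, m), (n, d)) else ((m, b), (n, d)).
pose Q n := iter n step q0.
pose good (q : (R * R) * (R * R)) := [/\ a <= q.1.1, q.1.1 <= q.1.2, q.1.2 <= b &
  [/\ c <= q.2.1, q.2.1 <= q.2.2, q.2.2 <= d & bad q]].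
have stepP q : good q -> [/\ good (step q),
    [/\ q.1.1 <= (step q).1.1, (step q).1.2 <= q.1.2, q.2.1 <= (step q).2.1 &
    (step q).2.2 <= q.2.2],
    (step q).1.2 - (step q).1.1 = (q.1.2 - q.1.1) / 2 &
    (step q).2.2 - (step q).2.1 = (q.2.2 - q.2.1) / 2].
  case: q => -[a' b'] [c' d'] [] /= aa ab' bb [cc cd' dd] bq.
  have := Hsub _ _ _ _ aa ab' bb cc cd' dd.
  set m := (a' + b') / 2; set n := (c' + d') / 2; move=> /= Hs.
  have am : a' <= m by rewrite /m; lra.
  have mb : m <= b' by rewrite /m; lra.
  have cn : c' <= n by rewrite /n; lra.
  have nd : n <= d' by rewrite /n; lra.
  have E1 : m - a' = (b' - a') / 2 by rewrite /m; field.
  have E2 : b' - m = (b' - a') / 2 by rewrite /m; field.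
  have E3 : n - c' = (d' - c') / 2 by rewrite /n; field.
  have E4 : d' - n = (d' - c') / 2 by rewrite /n; field.
  have am' : a <= m by exact: le_trans am.
  have mb' : m <= b by exact: le_trans bb.
  have cn' : c <= n by exact: le_trans cn.
  have nd' : n <= d by exact: le_trans dd.
  clearbody m n.
  case: ifPn => [b1|b1] /=; first by do 3?[split => //].
  case: ifPn => [b2|b2] /=; first by do 3?[split => //].
  case: ifPn => [b3|b3] /=; first by do 3?[split => //].
  do 3![split => //].
  move: bq b1 b2 b3; rewrite /bad -!leNgt /II /sz /= E1 E2 E3 E4.
  have -> : (b' - a') / 2 + (d' - c') / 2 = (b' - a' + (d' - c')) / 2 by field.
  set X := b' - a' + (d' - c').
  have -> : e * (X / 2) ^+ 2 = e * X ^+ 2 / 4 by field.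
  by move: Hs; set J1 := I a' m c' n; set J2 := I m b' c' n; set J3 := I a' m n d'; lra.
have good0 : good q0 by split.
have gQ n : good (Q n) by elim: n => //= n /stepP[].
have mon n m : (n <= m)%N -> [/\ (Q n).1.1 <= (Q m).1.1, (Q m).1.2 <= (Q n).1.2,
    (Q n).2.1 <= (Q m).2.1 & (Q m).2.2 <= (Q n).2.2].
  move=> /subnKC <-; elim: (m - n)%N => [|k [h1 h2 h3 h4]]; first by rewrite addn0.
  rewrite addnS; have [_ [k1 k2 k3 k4] _ _] := stepP _ (gQ (n + k)%N).
  by split; [exact: le_trans k1|exact: le_trans h2|exact: le_trans k3|exact: le_trans h4].
have szE n : (Q n).1.2 - (Q n).1.1 = (b - a) / 2 ^+ n /\ (Q n).2.2 - (Q n).2.1 = (d - c) / 2 ^+ n.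
  elim: n => [|n [h1 h2]]; first by rewrite expr0 !divr1.
  have [_ _ -> ->] := stepP _ (gQ n); rewrite h1 h2 exprS invfM; split; ring.
pose A := [set (Q n).1.1 | n in setT]; pose C := [set (Q n).2.1 | n in setT].
have A12 n m : (Q n).1.1 <= (Q m).1.2.
  have [h1 _ _ _] := mon _ _ (leq_maxl n m); have [_ h2 _ _] := mon _ _ (leq_maxr n m).
  have [_ h _ _] := gQ (maxn n m); lra.
have C12 n m : (Q n).2.1 <= (Q m).2.2.
  have [_ _ h1 _] := mon _ _ (leq_maxl n m); have [_ _ _ h2] := mon _ _ (leq_maxr n m).
  have [_ _ _ [_ h _ _]] := gQ (maxn n m); lra.
have As m : ubound A (Q m).1.2 by move=> _ [n _ <-].
have Cs m : ubound C (Q m).2.2 by move=> _ [n _ <-].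
have A0 : A !=set0 by exists a; exists 0%N.
have C0 : C !=set0 by exists c; exists 0%N.
have s1 n : (Q n).1.1 <= sup A.
  by apply: (@ub_le_sup _ A); [exists b; exact: (As 0%N)|exists n].
have t1 n : (Q n).2.1 <= sup C.
  by apply: (@ub_le_sup _ C); [exists d; exact: (Cs 0%N)|exists n].
have s2 n : sup A <= (Q n).1.2 by apply: ge_sup.
have t2 n : sup C <= (Q n).2.2 by apply: ge_sup.
have [h h0 Hh] := Hloc _ _ (s1 0%N) (s2 0%N) (t1 0%N) (t2 0%N) _ e0.
have [n hn] : exists n, (b - a) / 2 ^+ n < h /\ (d - c) / 2 ^+ n < h.
  pose K := Num.max (b - a) (d - c).
  have [n] : exists n, K / 2 ^+ n < h.
    exists (Num.bound (K / h)); rewrite ltr_pdivrMr ?exprn_gt0 // mulrC -ltr_pdivrMr //.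
    have K0 : 0 <= K by rewrite le_max subr_ge0 ab.
    apply: lt_trans (archi_boundP (divr_ge0 K0 (ltW h0))) _.
    by rewrite -natrX ltr_nat ltn_expl.
  move=> hn; exists n; split; apply: le_lt_trans hn; rewrite ler_wpM2r ?invr_ge0 ?exprn_ge0 //.
    by rewrite le_max lexx.
  by rewrite le_max lexx orbT.
have [g1 g2 g3 [g4 g5 g6 g7]] := gQ n.
have [z1 z2] := szE n.
have := Hh (Q n).1.1 (Q n).1.2 (Q n).2.1 (Q n).2.2.
rewrite z1 z2 => /(_ g1 (s1 n) (s2 n) g3 g4 (t1 n) (t2 n) g6 hn.1 hn.2).
by move: g7; rewrite /bad /II /sz z1 z2; lra.
Qed.

Implicit Types (G f : R[i] -> R[i]).

Definition hline G a b c := cint a b (fun s => G (s +i* c)).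
Definition vline G b c d := cint c d (fun t => G (b +i* t)).
(** The integral of [G z dz] along the counterclockwise boundary of the rectangle. *)
Definition contour G a b c d : R[i] :=
  (hline G a b c - hline G a b d) + 'i * (vline G b c d - vline G a c d).

Lemma rcont_hline G s c : ccont G (s +i* c) -> rcont (fun s => G (s +i* c)) s.
Proof.
move=> h; apply: (@rcont_comp _ (fun s => s +i* c)) => //.
by apply: rcont_ReIm; [exact: cvg_id|exact: cvg_cst].
Qed.

Lemma rcont_vline G b t : ccont G (b +i* t) -> rcont (fun t => G (b +i* t)) t.
Proof.
move=> h; apply: (@rcont_comp _ (fun t => b +i* t)) => //.
by apply: rcont_ReIm; [exact: cvg_cst|exact: cvg_id].
Qed.

Lemma goursat G a b c d : a <= b -> c <= d ->
  (forall s t, a <= s -> s <= b -> c <= t -> t <= d -> holo G (s +i* t)) ->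
  contour G a b c d = 0.
Proof.
move=> ab cd hG.
have cG s t : a <= s -> s <= b -> c <= t -> t <= d -> ccont G (s +i* t).
  by move=> *; apply: holo_ccont; exact: hG.
have ctsh a' b' t : a <= a' -> b' <= b -> c <= t -> t <= d -> rcts a' b' (fun s => G (s +i* t)).
  move=> h1 h2 h3 h4 s s1 s2; apply: rcont_hline; apply: cG => //.
    exact: le_trans s1.
  exact: le_trans h2.
have ctsv s c' d' : a <= s -> s <= b -> c <= c' -> d' <= d -> rcts c' d' (fun t => G (s +i* t)).
  move=> h1 h2 h3 h4 t t1 t2; apply: rcont_vline; apply: cG => //.
    exact: le_trans t1.
  exact: le_trans h4.
suff : normc (contour G a b c d) <= 0.
  by move=> h; apply/eqP; rewrite -cn_eq0 eq_le h cn_ge0.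
apply: (@bisection (fun a b c d => normc (contour G a b c d))) => //.
  move=> a' b' c' d' aa ab' bb cc cd' dd /=.
  set m := (a' + b') / 2; set n := (c' + d') / 2.
  have am : a' <= m by rewrite /m; lra.
  have mb : m <= b' by rewrite /m; lra.
  have cn : c' <= n by rewrite /n; lra.
  have nd : n <= d' by rewrite /n; lra.
  have -> : contour G a' b' c' d' = contour G a' m c' n + contour G m b' c' n
      + contour G a' m n d' + contour G m b' n d'.
    rewrite /contour.
    have hs t : c <= t -> t <= d -> hline G a' b' t = hline G a' m t + hline G m b' t.
      by move=> ? ?; apply: cint_split => //; apply: ctsh => //.
    have vs s : a <= s -> s <= b -> vline G s c' d' = vline G s c' n + vline G s n d'.
      by move=> ? ?; apply: cint_split => //; apply: ctsv => //.
    have [? ?] : a' <= b /\ a <= b' by split; lra.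
    have [? ?] : c' <= d /\ c <= d' by split; lra.
    by rewrite (hs c') // (hs d') // (vs a') // (vs b') //; ring.
  apply: le_trans (cnD _ _) _; rewrite lerD2r.
  apply: le_trans (cnD _ _) _; rewrite lerD2r.
  exact: cnD.
move=> s t sa sb tc td e e0; have [l dl] := hG s t sa sb tc td.
have e4 : 0 < e / 4 by rewrite divr_gt0.
have [h h0 Hh] := dl _ e4.
exists (h / 2); first by rewrite divr_gt0.
move=> a' b' c' d' aa as' sb' bb cc ct td' dd hab hcd.
set X := (b' - a') + (d' - c').
pose E w := G w - G (s +i* t) - l * (w - (s +i* t)).
have EP x y : a' <= x -> x <= b' -> c' <= y -> y <= d' -> normc (E (x +i* y)) <= e / 4 * X.
  move=> xa xb yc yd.
  have hX : normc ((x +i* y) - (s +i* t)) <= X.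
    apply: le_trans (cn_le_ReIm _) _; rewrite !(ReD, ImD, ReN, ImN) /= /X lerD //.
      by rewrite ler_norml; apply/andP; split; lra.
    by rewrite ler_norml; apply/andP; split; lra.
  apply: le_trans (Hh _ _) _; last by rewrite ler_wpM2l // ltW.
  by apply: le_lt_trans hX _; rewrite /X; lra.
have GE w : G w = G (s +i* t) + l * (w - (s +i* t)) + E w by rewrite /E; ring.
have ab' : a' <= b' by lra.
have cd' : c' <= d' by lra.
have X0 : 0 <= X by rewrite /X; lra.
have H1 : normc (hline G a' b' c' - hline G a' b' d' - l * ('i * (c' - d')%:C) * (b' - a')%:C)
    <= (e / 2 * X) * (b' - a').
  have k1 : rcts a' b' (fun x => G (x +i* c')) by apply: ctsh => //; lra.
  have k2 : rcts a' b' (fun x => G (x +i* d')) by apply: ctsh => //; lra.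
  rewrite /hline -(cintB k1 k2) -(cint_cst _ ab').
  have cc2 : rcts a' b' (fun x => G (x +i* c') - G (x +i* d')).
    by move=> x ? ?; apply: rcontB; [exact: k1|exact: k2].
  rewrite -cintB //; last by move=> x ? ?; exact: rcont_cst.
  apply: cn_cint_bound => //.
    move=> x ? ?; apply: rcontB; first exact: cc2.
    exact: rcont_cst.
  move=> x xa xb.
  have -> : G (x +i* c') - G (x +i* d') - l * ('i * (c' - d')%:C) = E (x +i* c') - E (x +i* d').
    rewrite /E; set u := x +i* c'; set v := x +i* d'.
    have -> : 'i * (c' - d')%:C = u - v by apply: cplx_ext; rewrite !(ReD,ImD,ReN,ImN,ReM,ImM) /=; ring.
    ring.
  apply: le_trans (cnB _ _) _.
  have := EP x c' xa xb (lexx _) cd'; have := EP x d' xa xb cd' (lexx _); lra.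
have H2 : normc (vline G b' c' d' - vline G a' c' d' - l * (b' - a')%:C * (d' - c')%:C)
    <= (e / 2 * X) * (d' - c').
  have k1 : rcts c' d' (fun x => G (b' +i* x)) by apply: ctsv => //; lra.
  have k2 : rcts c' d' (fun x => G (a' +i* x)) by apply: ctsv => //; lra.
  rewrite /vline -(cintB k1 k2) -(cint_cst _ cd').
  have cc2 : rcts c' d' (fun x => G (b' +i* x) - G (a' +i* x)).
    by move=> x ? ?; apply: rcontB; [exact: k1|exact: k2].
  rewrite -cintB //; last by move=> x ? ?; exact: rcont_cst.
  apply: cn_cint_bound => //.
    move=> x ? ?; apply: rcontB; first exact: cc2.
    exact: rcont_cst.
  move=> y ya yb.
  have -> : G (b' +i* y) - G (a' +i* y) - l * (b' - a')%:C = E (b' +i* y) - E (a' +i* y).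
    rewrite /E; set u := b' +i* y; set v := a' +i* y.
    have -> : (b' - a')%:C = u - v by apply: cplx_ext; rewrite !(ReD,ImD,ReN,ImN,ReM,ImM) /=; ring.
    ring.
  apply: le_trans (cnB _ _) _.
  have := EP b' y ab' (lexx _) ya yb; have := EP a' y (lexx _) ab' ya yb; lra.
(* The subtracted terms, which come from the affine part of [G] at the point, cancel: horizontal and
   vertical sides contribute opposite multiples of [l]. Only the remainder [E] is left to
   estimate. *)
have -> : contour G a' b' c' d' =
  (hline G a' b' c' - hline G a' b' d' - l * ('i * (c' - d')%:C) * (b' - a')%:C) +
  'i * (vline G b' c' d' - vline G a' c' d' - l * (b' - a')%:C * (d' - c')%:C).
  by rewrite /contour !rmorphB /=; ring.
apply: le_trans (cnD _ _) _; rewrite cnM.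
have -> : normc ('i : R[i]) = 1 by rewrite /normc /= expr0n add0r expr1n sqrtr1.
have -> : e * X ^+ 2 = e / 2 * X * (b' - a') + e / 2 * X * (d' - c') + e / 2 * X ^+ 2.
  by rewrite -mulrDr -/X; field.
have : 0 <= e / 2 * X ^+ 2 by rewrite mulr_ge0 ?sqr_ge0 // divr_ge0 // ltW.
lra.
Qed.
End Goursat.

(** * Circle means and the Cauchy formula *)

Section Cauchy.
Variable R : realType.
Implicit Types (f g : R[i] -> R[i]) (z w : R[i]) (r t e : R).

Lemma eq_of_dist z w : (forall e, 0 < e -> normc (z - w) <= e) -> z = w.
Proof.
move=> H; apply/eqP; rewrite -subr_eq0 -cn_eq0 eq_le cn_ge0 andbT leNgt.
apply/negP => h; have := H _ (divr_gt0 h (ltr0n R 2)); lra.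
Qed.

Lemma pi2_gt0 : 0 < 2 * pi :> R.
Proof. by rewrite mulr_gt0 // pi_gt0. Qed.

Definition cmean f r : R[i] :=
  ((2 * pi)^-1)%:C * cint 0 (2 * pi) (fun t => f (r%:C * cis t)).

(** Continuity in the plane at the points of the circle, not merely along it: this is what allows
    the radius to vary. *)
Definition circ f r := forall t, ccont f (r%:C * cis t).

Lemma cn_circle r t : 0 <= r -> normc (r%:C * cis t) = r.
Proof. by move=> r0; rewrite cnM cn_cis mulr1 cnR ger0_norm. Qed.

Lemma circ_rcts f r a b : circ f r -> rcts a b (fun t => f (r%:C * cis t)).
Proof.
move=> h t _ _; apply: (@rcont_comp _ (fun t => r%:C * cis t)) => //.
by apply: rcontM; [exact: rcont_cst|exact: rcont_cis].
Qed.

Lemma circD f g r : circ f r -> circ g r -> circ (fun z => f z + g z) r.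
Proof. by move=> F G t; apply: ccontD; [exact: F|exact: G]. Qed.

Lemma circM f g r : circ f r -> circ g r -> circ (fun z => f z * g z) r.
Proof. by move=> F G t; apply: ccontM; [exact: F|exact: G]. Qed.

Lemma circ_cst k r : circ (fun=> k) r.
Proof. by move=> t; exact: ccont_cst. Qed.

Lemma circN f r : circ f r -> circ (fun z => - f z) r.
Proof. by move=> F t; apply: ccontN; exact: F. Qed.

Lemma circ_holo f r : 0 <= r -> (forall z, normc z = r -> holo f z) -> circ f r.
Proof. by move=> r0 H t; apply: holo_ccont; apply: H; rewrite cn_circle. Qed.

Lemma cmean_eq f g r : (forall t, f (r%:C * cis t) = g (r%:C * cis t)) ->
  cmean f r = cmean g r.
Proof. by move=> H; congr (_ * _); apply: cint_eq. Qed.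

Lemma cmean_eqr f g r : 0 <= r -> (forall z, normc z = r -> f z = g z) ->
  cmean f r = cmean g r.
Proof. by move=> r0 H; apply: cmean_eq => t; rewrite H // cn_circle. Qed.

Lemma cmeanD f g r : circ f r -> circ g r ->
  cmean (fun z => f z + g z) r = cmean f r + cmean g r.
Proof. by move=> F G; rewrite /cmean cintD ?mulrDr //; exact: circ_rcts. Qed.

Lemma cmeanB f g r : circ f r -> circ g r ->
  cmean (fun z => f z - g z) r = cmean f r - cmean g r.
Proof. by move=> F G; rewrite /cmean cintB ?mulrBr //; exact: circ_rcts. Qed.

Lemma cmeanZ k f r : circ f r -> cmean (fun z => k * f z) r = k * cmean f r.
Proof. by move=> F; rewrite /cmean cintZ; [rewrite mulrCA|exact: circ_rcts]. Qed.

Lemma cmean_cst k r : cmean (fun=> k) r = k.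
Proof.
rewrite /cmean cint_cst ?subr0; last by rewrite ltW // pi2_gt0.
by rewrite mulrCA -rmorphM /= mulVf ?mulr1 // gt_eqF // pi2_gt0.
Qed.

Lemma cn_cmean_le f r M : circ f r ->
  (forall t, 0 <= t -> t <= 2 * pi -> normc (f (r%:C * cis t)) <= M) ->
  normc (cmean f r) <= M.
Proof.
move=> F H; rewrite /cmean cnM cnR ger0_norm ?invr_ge0 ?(ltW pi2_gt0) //.
rewrite mulrC ler_pdivrMr ?pi2_gt0 //.
have := @cn_cint_bound _ 0 (2 * pi) _ M (ltW pi2_gt0) (circ_rcts F) H.
by rewrite subr0.
Qed.

Lemma cn_cmean_ler f r M : 0 <= r -> circ f r ->
  (forall z, normc z = r -> normc (f z) <= M) -> normc (cmean f r) <= M.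
Proof. by move=> r0 F H; apply: cn_cmean_le => // t _ _; apply: H; rewrite cn_circle. Qed.

(** Compactness of the segment of angles makes the continuity uniform in [t]; the circle means then
    depend continuously on the radius. *)
Lemma circle_tube f r0 : circ f r0 -> forall e, 0 < e -> exists2 d, 0 < d &
  forall r t, `|r - r0| < d -> 0 <= t -> t <= 2 * pi ->
    normc (f (r%:C * cis t) - f (r0%:C * cis t)) < e.
Proof.
move=> F e e0.
have /compact_near_coveringP K := @segment_compact R 0 (2 * pi).
have := K _ (nbhs r0)
  (fun r t => normc (f (r%:C * cis t) - f (r0%:C * cis t)) < e) _.
move=> /(_ _)[].
  move=> t _.
  have e2 : 0 < e / 2 by rewrite divr_gt0.
  have [d d0 Hd] := F t _ e2.
  have d2 : 0 < d / 2 by rewrite divr_gt0.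
  have k : rcont (fun s => r0%:C * cis s) t.
    by apply: rcontM; [exact: rcont_cst|exact: rcont_cis].
  have [d' d'0 Hd'] := k _ d2.
  exists (ball t d', ball r0 (d / 2)).
    by split => /=; apply: nbhsx_ballx.
  case=> s r /= []; rewrite /ball /= distrC => hs hr.
  have h1 := Hd' _ hs.
  have h2 : normc (r%:C * cis s - r0%:C * cis s) < d / 2.
    by rewrite -mulrBl -rmorphB cnM cn_cis mulr1 cnR distrC.
  have h3 : normc (r%:C * cis s - r0%:C * cis t) < d.
    have -> : r%:C * cis s - r0%:C * cis t =
      (r%:C * cis s - r0%:C * cis s) + (r0%:C * cis s - r0%:C * cis t) by ring.
    by apply: le_lt_trans (cnD _ _) _; lra.
  have h4 : normc (r0%:C * cis s - r0%:C * cis t) < d by lra.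
  have := Hd _ h3; have := Hd _ h4; rewrite cnBC => k1 k2.
  have -> : f (r%:C * cis s) - f (r0%:C * cis s) = (f (r%:C * cis s) - f (r0%:C * cis t))
    + (f (r0%:C * cis t) - f (r0%:C * cis s)) by ring.
  by apply: le_lt_trans (cnD _ _) _; lra.
move=> d /= d0 H; exists d => // r t hr t0 t1; apply: (H r).
  by rewrite /ball_ /= distrC.
by rewrite /= in_itv /= t0.
Qed.

Lemma circle_bounded f r : circ f r -> exists M, [/\ 0 <= M &
  forall t, 0 <= t -> t <= 2 * pi -> normc (f (r%:C * cis t)) <= M].
Proof.
move=> F; have [|c _ Hc] := @EVT_max R (fun t => normc (f (r%:C * cis t))) 0 (2 * pi) (ltW pi2_gt0).
  apply: continuous_in_subspaceT => x _; apply: rcont_normc.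
  by apply: (circ_rcts (a := x) (b := x)).
exists (normc (f (r%:C * cis c))); split; first exact: cn_ge0.
by move=> t t0 t1; apply: Hc; rewrite in_itv /= t0.
Qed.

Lemma cmean_cts f r0 : 0 <= r0 -> (forall r, 0 <= r -> r < 1 -> circ f r) -> r0 < 1 ->
  forall e, 0 < e -> exists2 d, 0 < d & forall r, 0 <= r -> r < 1 -> `|r - r0| < d ->
    normc (cmean f r - cmean f r0) <= e.
Proof.
move=> r00 F r01 e e0; have [d d0 H] := circle_tube (F _ r00 r01) e0.
exists d => // r rr0 r1 hr.
rewrite /cmean -mulrBr -cintB; try by apply: circ_rcts; apply: F.
rewrite cnM cnR ger0_norm ?invr_ge0 ?(ltW pi2_gt0) // mulrC ler_pdivrMr ?pi2_gt0 //.
have := @cn_cint_bound _ 0 (2 * pi) (fun x => f (r%:C * cis x) - f (r0%:C * cis x)) e (ltW pi2_gt0).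
rewrite subr0; apply.
  by move=> x ? ?; apply: rcontB; [apply: (circ_rcts (F _ rr0 r1))|apply: (circ_rcts (F _ r00 r01))]; eassumption.
by move=> x x0 x1; apply/ltW/H.
Qed.

(* In logarithmic coordinates the annulus is a rectangle whose horizontal sides cancel. *)
Lemma cmean_const f r1 r2 : 0 < r1 -> r1 <= r2 ->
  (forall z, r1 <= normc z -> normc z <= r2 -> holo f z) -> cmean f r1 = cmean f r2.
Proof.
move=> r10 r12 hf; have r20 : 0 < r2 by exact: lt_le_trans r12.
have cE s t : cexp (s +i* t) = (expR s)%:C * cis t by [].
have l12 : ln r1 <= ln r2 by rewrite ler_ln ?posrE.
have : contour (fun z => f (cexp z)) (ln r1) (ln r2) 0 (2 * pi) = 0.
  apply: goursat => //; first exact: ltW pi2_gt0.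
  move=> s t h1 h2 _ _; apply: (@holo_comp R (@cexp R) f); first exact: holo_cexp.
  apply: hf; rewrite cn_cexp /=; first by rewrite -(lnK r10) ler_expR.
  by rewrite -(lnK r20) ler_expR.
have hh : hline (fun z => f (cexp z)) (ln r1) (ln r2) (2 * pi) =
  hline (fun z => f (cexp z)) (ln r1) (ln r2) 0.
  by apply: cint_eq => x _ _; rewrite !cE -(cis_period 0) add0r.
rewrite /contour hh subrr add0r => /eqP; rewrite mulf_eq0 => /orP[/eqP/(congr1 (@complex.Im R))/eqP|].
  by rewrite /= oner_eq0.
rewrite subr_eq0 /vline => /eqP E; congr (_ * _).
have fE r : 0 < r -> (fun t => f (cexp (ln r +i* t))) = (fun t => f (r%:C * cis t)).
  by move=> r0; apply/funext => t; rewrite cE lnK ?posrE.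
by move: E; rewrite !fE.
Qed.

(** Carries a value of the mean over to a limiting radius. In Cauchy's formula these are the radii 0
    and [|w|], which [cmean_const] does not reach. *)
Lemma cmean_continuity0 f : (forall r, 0 <= r -> r < 1 -> circ f r) -> forall r1,
  0 <= r1 -> r1 < 1 -> forall v, (forall d, 0 < d -> exists r, [/\ 0 <= r, r < 1, `|r - r1| < d & cmean f r = v])
  -> cmean f r1 = v.
Proof.
move=> F r1 r10 r11 v H; apply: eq_of_dist => e e0.
have [d d0 Hd] := cmean_cts r10 F r11 e0.
have [r [h1 h2 h3 <-]] := H _ d0.
by rewrite cnBC; apply: Hd.
Qed.

(** The kernel is 1 + w / (z - w), and the mean of the second term does not depend on the radius
    while it tends to 0 at infinity. *)
Lemma mean_kernel r w : normc w < r -> cmean (fun z => z / (z - w)) r = 1.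
Proof.
move=> wr; have r0 : 0 < r by apply: le_lt_trans wr; exact: cn_ge0.
have zw z : r <= normc z -> z - w != 0.
  by rewrite subr_eq0 => h; apply: contraTneq h => ->; rewrite -ltNge.
have hh z : r <= normc z -> holo (fun z => w / (z - w)) z.
  move=> h; apply: holo_div; first exact: zw; first exact: holo_cst.
  by apply: holoB; [exact: holo_id|exact: holo_cst].
have cc s : r <= s -> circ (fun z => w / (z - w)) s.
  move=> rs; apply: circ_holo; first by rewrite (le_trans (ltW r0)).
  by move=> z zs; apply: hh; rewrite zs.
rewrite (cmean_eqr (g := fun z => 1 + w / (z - w)) (ltW r0)); last first.
  by move=> z zr; have := zw z; rewrite zr lexx => /(_ isT) ?; field.
rewrite cmeanD; [|exact: circ_cst|exact: cc].
rewrite cmean_cst -[RHS]addr0; congr (_ + _).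
apply: eq_of_dist => e e0; rewrite subr0.
pose s := r + normc w / e.
have rs : r <= s by rewrite lerDl divr_ge0 ?cn_ge0 // ltW.
rewrite (cmean_const r0 rs); last by move=> z rz _; exact: hh.
apply: cn_cmean_ler; [by rewrite (le_trans (ltW r0))|exact: cc|].
move=> z zs; rewrite cnM cnV ler_pdivrMr; last by rewrite cn_gt0 zw // zs.
have h : normc w / e <= normc (z - w).
  by apply: le_trans (cnB_ge _ _); rewrite zs /s; lra.
by rewrite mulrC -ler_pdivrMr.
Qed.

(** Let [q] be the difference quotient of [f] at [w], continuous there, and F(z) = q(z) z. The mean
    of F is constant for radii on either side of [|w|], continuous across [|w|], and 0 at radius 0,
    hence 0 throughout. Since f(z) = f(w) + q(z) (z - w), the mean of f(z) z / (z - w) is f(w) times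
    that of the kernel. *)
Lemma cauchy f r w : (forall z, normc z < 1 -> holo f z) -> normc w < r -> r < 1 ->
  f w = cmean (fun z => f z * (z / (z - w))) r.
Proof.
move=> hf wr r1; have r0 : 0 < r by apply: le_lt_trans wr; exact: cn_ge0.
have w1 : normc w < 1 by exact: lt_trans r1.
have [l /cdiffP[q [qw qE qc]]] := hf _ w1.
pose F z := q z * z.
have Fh z : z != w -> normc z < 1 -> holo F z.
  move=> zw z1; apply: holoM; last exact: holo_id.
  have [l' H] : holo (fun z => (f z - f w) / (z - w)) z.
    apply: holo_div; first by rewrite subr_eq0.
      by apply: holoB; [exact: hf|exact: holo_cst].
    by apply: holoB; [exact: holo_id|exact: holo_cst].
  exists l'; apply: cdiff_eq_near H; apply/nbhscP; exists (normc (z - w)).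
    by rewrite cn_gt0 subr_eq0.
  move=> x hx; rewrite qE mulfK // subr_eq0; apply: contraTneq hx => ->.
  by rewrite cnBC ltxx.
have Fc z : normc z < 1 -> ccont F z.
  move=> z1; case: (eqVneq z w) => [->|zw]; last exact/holo_ccont/Fh.
  by apply: ccontM => //; exact: ccont_id.
have Fcirc s : 0 <= s -> s < 1 -> circ F s.
  by move=> s0 s1 t; apply: Fc; rewrite cn_circle.
have Fout s : normc w < s -> s < 1 -> cmean F s = cmean F r.
  move=> ws s1; have s0 : 0 < s by apply: le_lt_trans ws; exact: cn_ge0.
  have nw x y z : normc w < x -> y < 1 -> x <= normc z -> normc z <= y -> holo F z.
    move=> h1 h2 h3 h4; apply: Fh; last exact: le_lt_trans h2.
    by apply: contraTneq h3 => ->; rewrite -ltNge.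
  by case: (leP s r) => [sr|/ltW sr]; [|apply/esym]; apply: cmean_const => // z; exact: nw.
have F0 : cmean F 0 = 0.
  rewrite -[RHS](cmean_cst 0 0); apply: cmean_eq => t.
  by rewrite /F mul0r mulr0.
have Fin s : 0 < s -> s < normc w -> cmean F s = 0.
  move=> s0 sw; rewrite -F0; apply/esym.
  apply: (cmean_continuity0 Fcirc) => // d d0.
  exists (Num.min s (d / 2)).
  have m0 : 0 < Num.min s (d / 2) by rewrite lt_min s0 divr_gt0.
  have ms : Num.min s (d / 2) <= s by rewrite ge_min lexx.
  have md : Num.min s (d / 2) <= d / 2 by rewrite ge_min lexx orbT.
  split; [exact: ltW|lra|by rewrite subr0 gtr0_norm; lra|].
  apply: cmean_const => // z _ h2; apply: Fh; last lra.
  by apply: contraTneq h2 => ->; rewrite -ltNge.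
have Fw : cmean F (normc w) = 0.
  have [w0|w0] := eqVneq (normc w) 0; first by rewrite w0.
  have w0' : 0 < normc w by rewrite lt_def w0 cn_ge0.
  apply: (cmean_continuity0 Fcirc) => // [|d d0]; first exact: cn_ge0.
  exists (Num.max (normc w / 2) (normc w - d / 2)).
  have m1 : normc w / 2 <= Num.max (normc w / 2) (normc w - d / 2) by rewrite le_max lexx.
  have m2 : normc w - d / 2 <= Num.max (normc w / 2) (normc w - d / 2) by rewrite le_max lexx orbT.
  have m3 : Num.max (normc w / 2) (normc w - d / 2) < normc w by rewrite gt_max; apply/andP; split; lra.
  by split; [lra|lra|rewrite ltr0_norm; lra|apply: Fin; lra].
have Fr : cmean F r = 0.
  rewrite -Fw; apply/esym; apply: (cmean_continuity0 Fcirc) => // [|d d0]; first exact: cn_ge0.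
  exists (Num.min r (normc w + d / 2)).
  have m1 : Num.min r (normc w + d / 2) <= r by rewrite ge_min lexx.
  have m2 : Num.min r (normc w + d / 2) <= normc w + d / 2 by rewrite ge_min lexx orbT.
  have m3 : normc w < Num.min r (normc w + d / 2) by rewrite lt_min wr; lra.
  have w0 := cn_ge0 w.
  by split; [lra|lra|rewrite gtr0_norm; lra|apply: Fout; lra].
have zw z : normc z = r -> z - w != 0.
  by rewrite subr_eq0 => h; apply: contraTneq wr => <-; rewrite h ltxx.
rewrite (cmean_eqr (g := fun z => F z + f w * (z / (z - w))) (ltW r0)); last first.
  move=> z zr; rewrite /F; have fE : f z = q z * (z - w) + f w by rewrite -qE subrK.
  by rewrite fE; have := zw _ zr => ?; field.
have ck : circ (fun z => z / (z - w)) r.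
  apply: circ_holo; first exact: ltW.
  move=> z zr; apply: holo_div; [exact: zw|exact: holo_id|].
  by apply: holoB; [exact: holo_id|exact: holo_cst].
rewrite cmeanD; [|exact: Fcirc (ltW r0) r1|by apply: circM => //; exact: circ_cst].
by rewrite Fr add0r cmeanZ // mean_kernel // mulr1.
Qed.

Lemma mean_value f r : (forall z, normc z < 1 -> holo f z) -> 0 < r -> r < 1 ->
  cmean f r = f 0.
Proof.
move=> hf r0 r1; rewrite [RHS](cauchy (r := r) hf) ?cn0 //.
apply: cmean_eqr; first exact: ltW.
move=> z zr; have z0 : z != 0 by rewrite -cn_eq0 zr gt_eqF.
by rewrite subr0 divff // mulr1.
Qed.

(** Cauchy's formula is differentiated under the integral by hand; its use is to pass holomorphy to
    locally uniform limits. *)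
Lemma cauchy_holo f r w0 : circ f r -> normc w0 < r ->
  (forall w, normc w < r -> f w = cmean (fun z => f z * (z / (z - w))) r) -> holo f w0.
Proof.
move=> fc wr H; have r0 : 0 < r by apply: le_lt_trans wr; exact: cn_ge0.
have [M [M0 HM]] := circle_bounded fc.
have zw w z : normc w < r -> normc z = r -> z - w != 0.
  by move=> h1 h2; rewrite subr_eq0; apply: contraTneq h1 => <-; rewrite h2 ltxx.
have ci w : normc w < r -> circ (fun z => (z - w)^-1) r.
  move=> h; apply: circ_holo; first exact: ltW.
  move=> z zr; apply: holoV; first exact: zw.
  by apply: holoB; [exact: holo_id|exact: holo_cst].
have cid : circ id r by move=> t; exact: ccont_id.
pose d := (r - normc w0) / 2; have d0 : 0 < d by rewrite divr_gt0 // subr_gt0.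
exists (cmean (fun z => f z * (z * ((z - w0)^-1 * (z - w0)^-1))) r) => e e0.
(* The remainder is (w - w0)^2 times the mean of f(z) z / ((z - w) (z - w0)^2), where every
   denominator is at least [d] in modulus; the 1 makes [B] positive. *)
pose B := M * r / d ^+ 3 + 1.
have dge0 := ltW d0; have rge0 := ltW r0.
have B0 : 0 < B.
  by apply: ltr_wpDl => //; apply: divr_ge0; [exact: mulr_ge0|exact: exprn_ge0].
exists (Num.min d (e / B)); first by rewrite lt_min d0 divr_gt0.
move=> w; rewrite lt_min => /andP[hd he].
have wr' : normc w < r.
  have -> : w = w0 + (w - w0) by ring.
  by apply: le_lt_trans (cnD _ _) _; rewrite /d in hd; lra.
have c1 x : normc x < r -> circ (fun z => f z * (z / (z - x))) r.
  by move=> h; apply: circM => //; apply: circM => //; exact: ci.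
have c2 : circ (fun z => f z * (z * ((z - w0)^-1 * (z - w0)^-1))) r.
  by apply: circM => //; apply: circM => //; apply: circM; exact: ci.
rewrite (H w) // (H w0) // mulrC -cmeanZ // -cmeanB; try exact: c1.
rewrite -cmeanB; [|by apply: circD; [exact: c1|apply: circN; exact: c1]|
  by apply: circM => //; exact: circ_cst].
rewrite (cmean_eqr (g := fun z => (w - w0) ^+ 2 *
   (f z * (z * ((z - w)^-1 * ((z - w0)^-1 * (z - w0)^-1))))) (ltW r0)); last first.
  by move=> z zr; have := zw _ _ wr' zr; have := zw _ _ wr zr => ? ?; field; apply/andP.
rewrite cmeanZ; last first.
  by apply: circM => //; apply: circM => //; apply: circM; [exact: ci|apply: circM; exact: ci].
rewrite cnM cnX expr2 -mulrA mulrC; apply: ler_wpM2r; first exact: cn_ge0.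
set K := cmean _ _.
have hK : normc K <= B.
  apply: (@le_trans _ _ (M * r / d ^+ 3)); last by rewrite lerDl.
  apply: cn_cmean_le.
    by apply: circM => //; apply: circM => //; apply: circM; [exact: ci|apply: circM; exact: ci].
  move=> t t0 t1; set z := r%:C * cis t; have zr : normc z = r by rewrite cn_circle // ltW.
  have hMz : normc (f z) <= M by exact: HM.
  clearbody z.
  have di x : normc x < r -> normc (x - w0) < d -> (normc (z - x))^-1 <= d^-1.
    move=> hx hxd; have ? : d <= normc (z - x).
      apply: le_trans (cnB_ge _ _); rewrite zr.
      have : normc x <= normc w0 + normc (x - w0) by rewrite -{1}(subrK w0 x) addrC cnD.
      by rewrite /d in hxd *; lra.
    by rewrite lef_pV2 ?posrE //; exact: lt_le_trans d0 _.
  rewrite !cnM !cnV zr.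
  have i1 := di _ wr' hd; have i2 := di w0 wr; rewrite subrr cn0 in i2; have {}i2 := i2 d0.
  have p1 : 0 <= (normc (z - w))^-1 by rewrite invr_ge0 cn_ge0.
  have p2 : 0 <= (normc (z - w0))^-1 by rewrite invr_ge0 cn_ge0.
  have -> : M * r / d ^+ 3 = M * (r * (d^-1 * (d^-1 * d^-1))) by field; rewrite gt_eqF.
  apply: ler_pM; rewrite ?cn_ge0 // ?mulr_ge0 ?(ltW r0) //; 
  by apply: ler_pM; rewrite ?mulr_ge0 ?(ltW r0) //; apply: ler_pM; rewrite ?mulr_ge0 //; apply: ler_pM.
apply: (@le_trans _ _ (e / B * B)); last by rewrite divfK // gt_eqF.
by apply: ler_pM; rewrite ?cn_ge0 //; exact: ltW.
Qed.
End Cauchy.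

(** * Power series *)

Section PowerSeries.
Variable R : realType.
Implicit Types (f g : R[i] -> R[i]) (z w : R[i]) (r t e : R) (a b : nat -> R[i]).

Lemma circ_disk f r : (forall z, normc z < 1 -> ccont f z) -> 0 <= r -> r < 1 -> circ f r.
Proof. by move=> F r0 r1 t; apply: F; rewrite cn_circle. Qed.

Lemma geo_cvg (q e M : R) : 0 <= q -> q < 1 -> 0 < e -> exists N, forall n, (N <= n)%N -> M * q ^+ n < e.
Proof.
move=> q0 q1 e0.
have [M0|M0] := leP M 0.
  by exists 0%N => n _; apply: le_lt_trans e0; rewrite mulr_le0_ge0 // exprn_ge0.
have /cvgrPdist_lt H : q ^+ n @[n --> \oo] --> (0 : R).
  by apply: cvg_expr; rewrite ger0_norm.
have [N _ HN] := H _ (divr_gt0 e0 M0); exists N => n /HN /=.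
by rewrite sub0r normrN ger0_norm ?exprn_ge0 // ltr_pdivlMr // mulrC.
Qed.

Definition pol a n w : R[i] := \sum_(k < n) a k * w ^+ k.

(** A geometric rate, uniform on each smaller closed disk, in place of pointwise convergence of the
    series: sums and circle means are exchanged by means of this bound alone. *)
Definition ps a f := forall p : R, 0 < p -> p < 1 -> exists M q : R,
  [/\ 0 <= M, 0 <= q, q < 1 &
   forall n w, normc w <= p -> normc (f w - pol a n w) <= M * q ^+ n].

Lemma pol_holo a n z : holo (pol a n) z.
Proof.
apply: (@holo_sum _ (fun k w => a k * w ^+ k)) => k.
by apply: holoM; [exact: holo_cst|apply: holoX; exact: holo_id].
Qed.

Lemma ps_ccont a f z : ps a f -> normc z < 1 -> ccont f z.
Proof.
move=> H z1 e e0.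
pose p := (1 + normc z) / 2; have z0 := cn_ge0 z.
have [p0 p1 zp] : [/\ 0 < p, p < 1 & normc z < p] by rewrite /p; split; lra.
have [M [q [M0 q0 q1 Hq]]] := H _ p0 p1.
have e3 : 0 < e / 3 by rewrite divr_gt0.
have [n /(_ n (leqnn n)) Hn] := geo_cvg M q0 q1 e3.
have [d d0 Hd] := holo_ccont (pol_holo a n z) e3.
exists (Num.min d (p - normc z)); first by rewrite lt_min d0 subr_gt0.
move=> w; rewrite lt_min => /andP[/Hd h1 h2].
have wp : normc w <= p.
  by rewrite -(subrK z w); apply: le_trans (cnD _ _) _; lra.
have k1 := Hq n _ wp; have k2 := Hq n _ (ltW zp).
have -> : f w - f z = (f w - pol a n w) + (pol a n w - pol a n z) - (f z - pol a n z) by ring.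
apply: le_lt_trans (cnB _ _) _; have := cnD (f w - pol a n w) (pol a n w - pol a n z); lra.
Qed.

Lemma ps_circ a f r : ps a f -> 0 <= r -> r < 1 -> circ f r.
Proof. by move=> H; apply: circ_disk => z; exact: ps_ccont H. Qed.

Lemma circ_pow r (k : nat) : circ (fun z : R[i] => z ^+ k) r.
Proof. by move=> t; apply: holo_ccont; apply: holoX; exact: holo_id. Qed.

Lemma circ_Vpow r (k : nat) : 0 < r -> circ (fun z : R[i] => z ^- k) r.
Proof.
move=> r0; apply: circ_holo; first exact: ltW.
move=> z zr; apply: holoV; first by rewrite expf_neq0 // -cn_eq0 zr gt_eqF.
by apply: holoX; exact: holo_id.
Qed.

(** Weierstrass' argument: Cauchy's formula for the partial sums passes to the uniform limit on a
    circle, and a continuous function satisfying it is holomorphic. *)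
Lemma ps_holo a f z : ps a f -> normc z < 1 -> holo f z.
Proof.
move=> H z1; pose r := (1 + normc z) / 2; have z0 := cn_ge0 z.
have [r0 r1 zr] : [/\ 0 < r, r < 1 & normc z < r] by rewrite /r; split; lra.
have fc := ps_circ H (ltW r0) r1.
apply: (cauchy_holo fc zr) => w wr.
have [M [q [M0 q0 q1 Hq]]] := H _ r0 r1.
have ck : circ (fun z => z / (z - w)) r.
  apply: circ_holo; first exact: ltW.
  move=> x xr; apply: holo_div; [|exact: holo_id|by apply: holoB; [exact: holo_id|exact: holo_cst]].
  by rewrite subr_eq0; apply: contraTneq wr => <-; rewrite xr ltxx.
have [K [K0 HK]] := circle_bounded ck.
apply: eq_of_dist => e e0.
have [n /(_ n (leqnn n)) Hn] := geo_cvg (M * (1 + K)) q0 q1 e0.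
have pc : circ (pol a n) r by move=> t; apply: holo_ccont; exact: pol_holo.
rewrite -(subrKA (pol a n w)) (cauchy (r := r) (f := pol a n)) //; last by move=> x _; exact: pol_holo.
rewrite -cmeanB; try by apply: circM.
apply: le_trans (cnD _ _) _; apply: le_trans (ltW Hn).
have -> : M * (1 + K) * q ^+ n = M * q ^+ n + M * q ^+ n * K by ring.
rewrite -(cauchy (r := r) (f := pol a n)) //; last by move=> x _; exact: pol_holo.
apply: lerD; first exact/Hq/ltW.
apply: cn_cmean_le.
  by apply: circD; [exact: circM|apply: circN; exact: circM].
move=> t t0 t1; rewrite -mulrBl cnM; apply: ler_pM; rewrite ?cn_ge0 //; last exact: HK.
by rewrite cnBC; apply: Hq; rewrite cn_circle // ltW.
Qed.

Lemma mean_pow r (j k : nat) : 0 < r -> r < 1 ->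
  cmean (fun z => z ^+ j * z ^- k) r = (j == k)%:R.
Proof.
move=> r0 r1; have nz z : normc z = r -> z != 0 by move=> zr; rewrite -cn_eq0 zr gt_eqF.
case: (ltngtP j k) => [jk|kj|->]; last first.
- rewrite -[RHS](cmean_cst _ r); apply: cmean_eqr; first exact: ltW.
  by move=> z /nz z0; rewrite divff // expf_neq0.
- rewrite (cmean_eqr (g := fun z => z ^+ (j - k)) (ltW r0)).
    have -> := @mean_value _ (fun z : R[i] => z ^+ (j - k)) r _ r0 r1.
      by rewrite expr0n subn_eq0 leqNgt kj.
    by move=> z _; apply: holoX; exact: holo_id.
  by move=> z /nz z0; rewrite -{1}(subnK (ltnW kj)) exprD mulfK // expf_neq0.
pose m := (k - j.+1)%N.
have mE : k = (m.+1 + j)%N by rewrite /m addSnnS subnK.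
rewrite (cmean_eqr (g := fun z => z ^- m.+1) (ltW r0)); last first.
  by move=> z /nz z0; rewrite mE exprD invfM mulrCA divff ?mulr1 // expf_neq0.
apply: eq_of_dist => e e0; rewrite subr0.
(* The mean of a negative power does not depend on the radius, and at radius [s] it is at most
   [s^-1 <= e]. *)
pose s := 1 + e^-1.
have s1 : 1 <= s by rewrite lerDl invr_ge0 ltW.
rewrite (@cmean_const _ _ r s) //; last first.
- move=> z rz _; apply: holoV; last by apply: holoX; exact: holo_id.
  by rewrite expf_neq0 // -cn_gt0 (lt_le_trans r0).
- by apply: le_trans s1; exact: ltW.
have s0 : 0 < s by exact: lt_le_trans s1.
apply: cn_cmean_ler; [exact: ltW|exact: circ_Vpow|].
move=> z zs; rewrite cnV cnX zs.
have h : s <= s ^+ m.+1 by rewrite exprS ler_pMr // exprn_ege1.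
apply: (@le_trans _ _ s^-1); first by rewrite lef_pV2 ?posrE // exprn_gt0.
by rewrite -[leRHS]invrK lef_pV2 ?posrE ?invr_gt0 // lerDr.
Qed.

Lemma cmean_sum r (F : nat -> R[i] -> R[i]) n : (forall k, circ (F k) r) ->
  cmean (fun z => \sum_(k < n) F k z) r = \sum_(k < n) cmean (F k) r.
Proof.
move=> H; have cs m : circ (fun z => \sum_(k < m) F k z) r.
  elim: m => [|m IH]; first by under eq_fun do rewrite big_ord0; exact: circ_cst.
  by under eq_fun do rewrite big_ord_recr /=; exact: circD.
elim: n => [|n IH]; first by under eq_fun do rewrite big_ord0; rewrite cmean_cst big_ord0.
rewrite big_ord_recr /= -IH -(cmeanD (cs n) (H n)).
by apply: cmean_eq => t; rewrite big_ord_recr.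
Qed.

Lemma pol_coef a n k r : 0 < r -> r < 1 -> (k < n)%N ->
  cmean (fun z => pol a n z * z ^- k) r = a k.
Proof.
move=> r0 r1 kn.
transitivity (cmean (fun z => \sum_(j < n) (a j * (z ^+ j * z ^- k))) r).
  by apply: cmean_eq => t; rewrite mulr_suml; apply: eq_bigr => j _; rewrite mulrA.
have cj j : circ (fun z => z ^+ j * z ^- k) r.
  by apply: circM; [exact: circ_pow|exact: circ_Vpow].
rewrite (@cmean_sum _ (fun j z => a j * (z ^+ j * z ^- k))).
  rewrite (bigD1 (Ordinal kn)) //= cmeanZ // mean_pow // eqxx mulr1 big1 ?addr0 // => j jk.
  rewrite cmeanZ // mean_pow // (_ : (j == k :> nat) = false) ?mulr0 //.
  by apply: contraNF jk => /eqP jk; apply/eqP/val_inj.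
by move=> j; apply: circM => //; exact: circ_cst.
Qed.

Lemma ps_coef a f k r : ps a f -> 0 < r -> r < 1 -> cmean (fun z => f z * z ^- k) r = a k.
Proof.
move=> H r0 r1; have [M [q [M0 q0 q1 Hq]]] := H _ r0 r1.
have fc := ps_circ H (ltW r0) r1.
apply: eq_of_dist => e e0.
have [N HN] := geo_cvg (M * r ^- k) q0 q1 e0.
pose n := maxn N k.+1.
have pc : circ (pol a n) r by move=> t; apply: holo_ccont; exact: pol_holo.
have vc := circ_Vpow k r0.
rewrite -(@pol_coef a n k r) // ?leq_max ?leqnn ?orbT // -cmeanB; try exact: circM.
apply: le_trans (ltW (HN n _)); last by rewrite leq_maxl.
apply: cn_cmean_ler; [exact: ltW|by apply: circD; [exact: circM|apply: circN; exact: circM]|].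
move=> z zr; rewrite -mulrBl cnM cnV cnX zr mulrAC ler_wpM2r ?invr_ge0 ?exprn_ge0 ?(ltW r0) //.
by apply: Hq; rewrite zr.
Qed.

Lemma taylor f : (forall z, normc z < 1 -> holo f z) -> exists a, ps a f.
Proof.
move=> hf; pose c k r := cmean (fun z => f z * z ^- k) r.
have cE k r s : 0 < r -> r < 1 -> 0 < s -> s < 1 -> c k r = c k s.
  have H x y : 0 < x -> x <= y -> y < 1 -> c k x = c k y.
    move=> x0 xy y1; apply: cmean_const => // z xz zy.
    apply: holoM; first by apply: hf; exact: le_lt_trans y1.
    apply: holoV; last by apply: holoX; exact: holo_id.
    by rewrite expf_neq0 // -cn_gt0 (lt_le_trans x0).
  by move=> r0 r1 s0 s1; case: (leP r s) => [/H ->//|/ltW/H ->].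
(* The radius 1/2 is arbitrary, since [c k r] does not depend on [r]. *)
exists (fun k => c k (1 / 2)) => p p0 p1.
pose r := (1 + p) / 2.
have [r0 r1 pr] : [/\ 0 < r, r < 1 & p < r] by rewrite /r; split; lra.
clearbody r.
have fc : circ f r.
  by apply: circ_disk => [z /hf/holo_ccont||] //; exact: ltW.
have [M [M0 HM]] := circle_bounded fc.
have dpr : 0 < r - p by rewrite subr_gt0.
exists (M * (r / (r - p))), (p / r); split.
- by rewrite mulr_ge0 // divr_ge0 ?ltW.
- by rewrite divr_ge0 ?ltW.
- by rewrite ltr_pdivrMr // mul1r.
move=> n w wp; have wr : normc w < r by exact: le_lt_trans pr.
have zw z : normc z = r -> z - w != 0.
  by move=> zr; rewrite subr_eq0; apply: contraTneq wr => <-; rewrite zr ltxx.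
have nz z : normc z = r -> z != 0 by move=> zr; rewrite -cn_eq0 zr gt_eqF.
have ck : circ (fun z => z / (z - w)) r.
  apply: circ_holo; first exact: ltW.
  move=> x xr; apply: holo_div; [exact: zw|exact: holo_id|by apply: holoB; [exact: holo_id|exact: holo_cst]].
have cp m : circ (fun z => (w / z) ^+ m) r.
  apply: circ_holo; first exact: ltW.
  move=> x xr; apply: holoX; apply: holo_div; [exact: nz|exact: holo_cst|exact: holo_id].
(* Finite geometric expansion of the Cauchy kernel: z / (z - w) is the sum of (w/z)^k over k < m
   plus (w/z)^m z / (z - w). *)
have E m : f w = pol (fun k => c k (1 / 2)) m w +
    cmean (fun z => f z * ((w / z) ^+ m * (z / (z - w)))) r.
  elim: m => [|m IH].
    rewrite /pol big_ord0 add0r (cauchy hf wr r1).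
    by apply: cmean_eq => t; rewrite expr0 mul1r.
  rewrite {}IH /pol big_ord_recr /= -addrA; congr (_ + _).
  rewrite (cE m (1 / 2) r) //; [|by lra..].
  rewrite mulrC -cmeanZ; last by apply: circM => //; exact: circ_Vpow.
  rewrite -cmeanD; first last.
  - by apply: circM => //; apply: circM.
  - by apply: circM; [exact: circ_cst|apply: circM => //; exact: circ_Vpow].
  apply: cmean_eqr; first exact: ltW.
  move=> z zr; have := nz _ zr; have := zw _ zr => ? ?.
  rewrite exprS expr_div_n; field.
  by rewrite !expf_neq0 //; apply/and3P.
rewrite {1}(E n) addrC addKr.
apply: cn_cmean_le; first by apply: circM => //; exact: circM.
move=> t t0 t1; have := HM t t0 t1; have := cn_circle t (ltW r0).
set z := r%:C * cis t; clearbody z => zr hM.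
have h2 : (normc (z - w))^-1 <= (r - p)^-1.
  have h : r - p <= normc (z - w) by apply: le_trans (cnB_ge _ _); rewrite zr; lra.
  by rewrite lef_pV2 ?posrE //; exact: lt_le_trans h.
rewrite cnM cnM cnX cnM cnM !cnV zr.
have -> : M * (r / (r - p)) * (p / r) ^+ n = M * ((p / r) ^+ n * (r / (r - p))) by ring.
apply: ler_pM => //; rewrite ?cn_ge0 ?mulr_ge0 ?exprn_ge0 ?mulr_ge0 ?invr_ge0 ?cn_ge0 ?(ltW r0) //.
apply: ler_pM => //; rewrite ?exprn_ge0 ?mulr_ge0 ?invr_ge0 ?cn_ge0 ?(ltW r0) //.
  apply: lerXn2r; rewrite ?nnegrE ?mulr_ge0 ?invr_ge0 ?cn_ge0 ?(ltW r0) ?(ltW p0) //.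
  by rewrite ler_wpM2r // invr_ge0 ltW.
by rewrite ler_wpM2l // ltW.
Qed.
End PowerSeries.

(** * The Hilbert space H^2 *)

Section HardyTwo.
Variable R : realType.
Implicit Types (f g h : R[i] -> R[i]) (z w : R[i]) (r s t e : R) (a b : nat -> R[i]).

Lemma CS_sum (x y : nat -> R) n : (\sum_(k < n) x k * y k) ^+ 2 <=
  (\sum_(k < n) x k ^+ 2) * (\sum_(k < n) y k ^+ 2).
Proof.
set S := \sum_(k < n) _; set X := \sum_(k < n) x k ^+ 2; set Y := \sum_(k < n) y k ^+ 2.
have Y0 : 0 <= Y by apply: sumr_ge0 => i _; exact: sqr_ge0.
have H : 0 <= \sum_(k < n) (x k * Y - y k * S) ^+ 2 by apply: sumr_ge0 => i _; exact: sqr_ge0.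
have E : \sum_(k < n) (x k * Y - y k * S) ^+ 2 = Y * (X * Y - S ^+ 2).
  transitivity (\sum_(k < n) (x k ^+ 2 * Y ^+ 2 + (x k * y k) * (- 2 * Y * S) + y k ^+ 2 * S ^+ 2)).
    by apply: eq_bigr => i _; ring.
  by rewrite !big_split /= -!mulr_suml -/X -/S -/Y; ring.
rewrite E in H; have [Y1|] := boolP (0 < Y).
  by rewrite -subr_ge0 -(pmulr_rge0 _ Y1).
rewrite lt_def Y0 andbT negbK => /eqP Y1.
have y0 (k : 'I_n) : y k = 0.
  have /eqP := Y1; rewrite psumr_eq0; last by move=> i _; exact: sqr_ge0.
  by move/allP => /(_ k); rewrite mem_index_enum sqrf_eq0 => /(_ isT)/eqP.
by rewrite Y1 mulr0 /S big1 ?expr0n // => k _; rewrite y0 mulr0.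
Qed.

Lemma circJ f r : circ f r -> circ (fun z => conjc (f z)) r.
Proof.
move=> F t e e0; have [d d0 H] := F t e e0; exists d => // w /H; congr (_ < _).
rewrite -cnJ; congr normc; by apply: cplx_ext; rewrite !(ReD, ImD, ReN, ImN, ReJ, ImJ); ring.
Qed.

Lemma circ_id r : circ (@id R[i]) r.
Proof. by move=> t; exact: ccont_id. Qed.

Lemma conj_sum n (F : 'I_n -> R[i]) : conjc (\sum_k F k) = \sum_k conjc (F k).
Proof. exact: rmorph_sum. Qed.

Lemma conjM z w : conjc (z * w) = conjc z * conjc w. Proof. exact: rmorphM. Qed.
Lemma conjD z w : conjc (z + w) = conjc z + conjc w. Proof. exact: rmorphD. Qed.
Lemma conjX z n : conjc (z ^+ n) = conjc z ^+ n. Proof. exact: rmorphXn. Qed.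
Lemma conjR r : conjc r%:C = r%:C :> R[i]. Proof. by apply: cplx_ext; rewrite /= ?oppr0. Qed.

(** Only [g] is replaced by its Taylor polynomial. On the circle the conjugate of z is r^2 / z,
    which turns the mean of [f] against a conjugate power into a Taylor coefficient of [f]. *)
Lemma parseval a b f g r : ps a f -> ps b g -> 0 < r -> r < 1 ->
  forall e, 0 < e -> exists N, forall n, (N <= n)%N ->
  normc (cmean (fun z => f z * conjc (g z)) r -
    \sum_(k < n) a k * conjc (b k) * (r ^+ (k * 2))%:C) <= e.
Proof.
move=> F G r0 r1 e e0.
have fc := ps_circ F (ltW r0) r1; have gc := ps_circ G (ltW r0) r1.
have [K [K0 HK]] := circle_bounded fc.
have [M [q [M0 q0 q1 Hq]]] := G _ r0 r1.
have [N HN] := geo_cvg (K * M) q0 q1 e0; exists N => n Nn.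
have pc : circ (pol b n) r by move=> t; apply: holo_ccont; exact: pol_holo.
have -> : \sum_(k < n) a k * conjc (b k) * (r ^+ (k * 2))%:C =
    cmean (fun z => f z * conjc (pol b n z)) r.
  have cc k : circ (fun z => f z * z ^- k) r by apply: circM => //; exact: circ_Vpow.
  have cc2 k : circ (fun z => conjc (b k) * (r ^+ (k * 2))%:C * (f z * z ^- k)) r.
    by apply: circM => //; exact: circ_cst.
  transitivity (cmean (fun z => \sum_(k < n) conjc (b k) * (r ^+ (k * 2))%:C * (f z * z ^- k)) r).
    rewrite (cmean_sum n cc2); apply: eq_bigr => k _.
    by rewrite cmeanZ // (ps_coef k F r0 r1); ring.
  apply: cmean_eqr; first exact: ltW.
  move=> z zr; rewrite /pol conj_sum mulr_sumr; apply: eq_bigr => k _.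
  have z0 : z != 0 by rewrite -cn_eq0 zr gt_eqF.
  have -> : conjc (b k * z ^+ k) = conjc (b k) * (conjc z) ^+ k by rewrite conjM conjX.
  have -> : conjc z = (r ^+ 2)%:C * z^-1 by rewrite -zr -mulcJ; field.
  by rewrite exprMn -rmorphXn -exprM mulnC exprVn /=; ring.
rewrite -cmeanB; [|by apply: circM => //; exact: circJ..].
apply: le_trans (ltW (HN n Nn)).
apply: cn_cmean_le; first by apply: circD; [|apply: circN]; apply: circM => //; exact: circJ.
move=> t t0 t1; set z := r%:C * cis t.
have -> : f z * conjc (g z) - f z * conjc (pol b n z) = f z * conjc (g z - pol b n z).
  by rewrite -mulrBr; congr (_ * _); apply: cplx_ext; rewrite !(ReD, ImD, ReN, ImN, ReJ, ImJ); ring.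
rewrite cnM cnJ -mulrA; apply: ler_pM; rewrite ?cn_ge0 //; first exact: HK.
by apply: Hq; rewrite cn_circle // ltW.
Qed.

Definition cprod f g r := cmean (fun z => f z * conjc (g z)) r.
Definition msq f r : R := complex.Re (cprod f f r).
(** Partial sums of Parseval's series for [msq]; at [r = 1], of the squared norm in H^2. *)
Definition asq a n r : R := \sum_(k < n) normc (a k) ^+ 2 * r ^+ (k * 2).

Lemma cprod_self f r : cprod f f r = (msq f r)%:C.
Proof.
apply: cplx_ext; first by [].
rewrite /cprod /cmean (@cint_eq _ _ _ _ (fun t => (normc (f (r%:C * cis t)) ^+ 2)%:C)).
  by rewrite ImM /= mul0r addr0 rint_cst ?(ltW (pi2_gt0 R)) // mul0r mulr0.
by move=> x _ _; rewrite mulcJ.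
Qed.

Lemma msq_rint f r : msq f r = (2 * pi)^-1 * rint 0 (2 * pi) (fun t => normc (f (r%:C * cis t)) ^+ 2).
Proof.
rewrite /msq /cprod /cmean (@cint_eq _ _ _ _ (fun t => (normc (f (r%:C * cis t)) ^+ 2)%:C)).
  by rewrite ReM /= mul0r subr0.
by move=> x _ _; rewrite mulcJ.
Qed.

Lemma msq_ge0 f r : 0 <= msq f r.
Proof.
rewrite msq_rint mulr_ge0 ?invr_ge0 ?(ltW (pi2_gt0 R)) //.
by apply: Rintegral_ge0 => x _; exact: sqr_ge0.
Qed.

Lemma asq_lim a f r : ps a f -> 0 < r -> r < 1 -> forall e, 0 < e ->
  exists N, forall n, (N <= n)%N -> `|msq f r - asq a n r| <= e.
Proof.
move=> F r0 r1 e e0; have [N HN] := parseval F F r0 r1 e0; exists N => n /HN.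
rewrite -/(cprod f f r) cprod_self => H; apply: le_trans H; rewrite -cnR.
rewrite le_eqVlt; apply/orP; left; apply/eqP; congr normc.
rewrite rmorphB rmorph_sum /=; congr (_ - _); apply: eq_bigr => k _.
by rewrite mulcJ rmorphM.
Qed.

Lemma asq_mono a n m r : 0 <= r -> (n <= m)%N -> asq a n r <= asq a m r.
Proof.
move=> r0 /subnKC <-; elim: (m - n)%N => [|k IH]; first by rewrite addn0.
by rewrite addnS /asq big_ord_recr /=; apply: le_trans IH _; rewrite lerDl mulr_ge0 ?sqr_ge0 ?exprn_ge0.
Qed.

Lemma asq_le_msq a f r n : ps a f -> 0 < r -> r < 1 -> asq a n r <= msq f r.
Proof.
move=> F r0 r1; apply/ler_addgt0Pr => e e0.
have [N HN] := asq_lim F r0 r1 e0.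
have := HN (maxn N n) (leq_maxl _ _); rewrite ler_norml => /andP[h _].
have := asq_mono a (ltW r0) (leq_maxr N n); lra.
Qed.

Lemma msq_le a f r B : ps a f -> 0 < r -> r < 1 -> (forall n, asq a n r <= B) -> msq f r <= B.
Proof.
move=> F r0 r1 H; apply/ler_addgt0Pr => e e0.
have [N /(_ N (leqnn N))] := asq_lim F r0 r1 e0.
rewrite ler_norml => /andP[_ h]; have := H N; lra.
Qed.

Lemma msq0 f : msq f 0 = normc (f 0) ^+ 2.
Proof.
rewrite msq_rint; under [X in _ * X]rint_eq do rewrite mul0r.
by rewrite rint_cst ?(ltW (pi2_gt0 R)) // subr0 mulrCA mulVf ?mulr1 // gt_eqF // pi2_gt0.
Qed.

Lemma asq1 a n r : r <= 1 -> 0 <= r -> asq a n r <= asq a n 1.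
Proof.
move=> r1 r0; apply: ler_sum => k _; rewrite ler_wpM2l ?sqr_ge0 // expr1n.
exact: exprn_ile1.
Qed.

Lemma ps0 a f : ps a f -> f 0 = a 0%N.
Proof.
move=> F; have h : 0 < 1 / 2 :> R by [].
have h1 : 1 / 2 < 1 :> R by lra.
rewrite -(ps_coef 0 F h h1) -(mean_value (r := 1 / 2)) //; last by move=> z; exact: ps_holo F.
by apply: cmean_eq => t; rewrite expr0 divr1.
Qed.

Lemma msq_mono a f r s : ps a f -> 0 <= r -> r <= s -> s < 1 -> msq f r <= msq f s.
Proof.
move=> F r0 rs s1; have [->//|nrs] := eqVneq r s.
have s0 : 0 < s by apply: le_lt_trans r0 _; rewrite lt_def rs eq_sym nrs.
have [->|r00] := eqVneq r 0.
  rewrite msq0 (ps0 F); apply: le_trans (asq_le_msq 1 F s0 s1).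
  by rewrite /asq big_ord1 mul0n expr0 mulr1.
have {}r0 : 0 < r by rewrite lt_def r00.
apply: (msq_le F) => // [|n]; first exact: le_lt_trans s1.
apply: le_trans (asq_le_msq n F s0 s1); apply: ler_sum => k _.
by rewrite ler_wpM2l ?sqr_ge0 //; apply: lerXn2r; rewrite ?nnegrE ?(ltW r0) ?(ltW s0).
Qed.

Lemma bernoulli_ineq (d : R) m : 0 <= d -> d <= 1 -> 1 - m%:R * d <= (1 - d) ^+ m.
Proof.
move=> d0 d1; elim: m => [|k IH]; first by rewrite mul0r subr0 expr0.
rewrite exprS; apply: (@le_trans _ _ ((1 - d) * (1 - k%:R * d))).
  have -> : (1 - d) * (1 - k%:R * d) = 1 - k.+1%:R * d + k%:R * d ^+ 2 by rewrite -natr1; ring.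
  by rewrite lerDl mulr_ge0 // sqr_ge0.
by rewrite ler_wpM2l // subr_ge0.
Qed.

Lemma pow_limit (S N : R) m : 0 <= S -> (forall r, 0 < r -> r < 1 -> S * r ^+ m <= N) -> S <= N.
Proof.
move=> S0 H; rewrite leNgt; apply/negP => NS.
have N0 : 0 <= N.
  by apply: le_trans (H (1 / 2) _ _); rewrite ?mulr_ge0 ?exprn_ge0 //; lra.
have S1 : 0 < S by exact: le_lt_trans NS.
(* With [r = 1 - d], Bernoulli's inequality gives S r^m >= S - (S - N) m / (m + 2) > N. *)
pose d := (S - N) / S / (m.+2)%:R.
have d0 : 0 < d by rewrite !divr_gt0 ?subr_gt0.
have d1 : d < 1.
  rewrite ltr_pdivrMr // mul1r ltr_pdivrMr //.
  apply: (@le_lt_trans _ _ S); first by rewrite lerBlDr lerDl.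
  by rewrite ltr_pMl // ltr1n.
have h1 : 0 < 1 - d by rewrite subr_gt0.
have h2 : 1 - d < 1 by rewrite ltrBlDr ltrDl.
have H1 := H _ h1 h2.
have H2 : S * (1 - m%:R * d) <= N.
  apply: le_trans H1; rewrite ler_wpM2l // bernoulli_ineq //; exact: ltW.
have E : S * (1 - m%:R * d) = S - (S - N) * (m%:R / m.+2%:R).
  have K0 : m.+2%:R != 0 :> R by rewrite pnatr_eq0.
  have S0' : S != 0 by rewrite gt_eqF.
  rewrite /d; move: (m.+2%:R) K0 => K K0; field; by rewrite ?K0 ?S0'.
have H3 : (S - N) * (m%:R / m.+2%:R) < S - N.
  by rewrite gtr_pMr ?subr_gt0 // ltr_pdivrMr // mul1r ltr_nat.
by rewrite E in H2; move: H2 H3; move: (_ * _) => X; lra.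
Qed.

(** Real-valued counterpart of [hardy 2]; with [nsq], the square of [hardy_norm 2], it keeps the
    extended reals out of the Hilbert space arguments. See [hardy2P] and [hardy_norm_nsq]. *)
Definition H2 f := (forall z, normc z < 1 -> holo f z) /\
  exists B : R, forall r, 0 <= r -> r < 1 -> msq f r <= B.

Definition nsq f : R := sup [set msq f r | r in `[0, 1[].

Lemma msq_le_nsq f r : H2 f -> 0 <= r -> r < 1 -> msq f r <= nsq f.
Proof.
move=> [_ [B HB]] r0 r1; apply: (@ub_le_sup _ [set msq f r | r in `[0, 1[]).
  by exists B => _ [s /= + <-]; rewrite in_itv /= => /andP[s0 s1]; exact: HB.
by exists r => //=; rewrite in_itv /= r0.
Qed.

Lemma nsq_le f B : (forall r, 0 <= r -> r < 1 -> msq f r <= B) -> nsq f <= B.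
Proof.
move=> H; apply: ge_sup; first by exists (msq f 0); exists 0 => //=; rewrite in_itv /= lexx ltr01.
by move=> _ [s /= + <-]; rewrite in_itv /= => /andP[s0 s1]; exact: H.
Qed.

Lemma nsq_ge0 f : H2 f -> 0 <= nsq f.
Proof. by move=> h; apply: le_trans (msq_ge0 f 0) _; apply: msq_le_nsq. Qed.

Lemma H2_ps f : H2 f -> exists a, ps a f.
Proof. by case=> /taylor. Qed.

Lemma H2_circ f r : H2 f -> 0 <= r -> r < 1 -> circ f r.
Proof. by move=> /H2_ps[a]; exact: ps_circ. Qed.

Lemma asq_le_nsq a f n : ps a f -> H2 f -> asq a n 1 <= nsq f.
Proof.
move=> F h; apply: (@pow_limit _ _ (n * 2)).
  by apply: sumr_ge0 => k _; rewrite mulr_ge0 ?sqr_ge0 // expr1n.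
move=> r r0 r1; apply: le_trans (msq_le_nsq h (ltW r0) r1).
apply: le_trans (asq_le_msq n F r0 r1).
rewrite /asq mulr_suml; apply: ler_sum => k _; rewrite expr1n mulr1 ler_wpM2l ?sqr_ge0 //.
by apply: ler_wiXn2l; rewrite ?ltW // leq_mul2r /= ltnW.
Qed.

Lemma H2_asq a f B : ps a f -> (forall n, asq a n 1 <= B) -> H2 f /\ nsq f <= B.
Proof.
move=> F H.
have K r : 0 <= r -> r < 1 -> msq f r <= B.
  move=> r0 r1; have h : 0 < (r + 1) / 2 by lra.
  have h1 : (r + 1) / 2 < 1 by lra.
  apply: le_trans (msq_mono F r0 _ h1) _; first by lra.
  apply: (msq_le F) => // n; apply: le_trans (H n); apply: asq1; exact: ltW.
split; last exact: nsq_le.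
by split; [move=> z; exact: ps_holo F|exists B].
Qed.

Lemma msq_lim f : H2 f -> forall e, 0 < e -> exists2 d, 0 < d & forall r, 1 - d < r -> r < 1 -> 0 <= r ->
  nsq f - e < msq f r.
Proof.
move=> h e e0; have [a F] := H2_ps h.
have S : has_sup [set msq f r | r in `[0, 1[].
  split; first by exists (msq f 0); exists 0 => //=; rewrite in_itv /= lexx ltr01.
  by exists (nsq f) => _ [s /= + <-]; rewrite in_itv /= => /andP[s0 s1]; exact: msq_le_nsq.
have [x [s hs01 sE] hs] := sup_adherent e0 S.
move: hs01; rewrite /= in_itv /= => /andP[s0 s1].
exists (1 - s); first by rewrite subr_gt0.
move=> r hr r1 r0; apply: lt_le_trans hs _; rewrite -sE.
by apply: (msq_mono F) => //; lra.
Qed.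

Lemma cts_sq f r : circ f r -> cts 0 (2 * pi) (fun t => normc (f (r%:C * cis t)) ^+ 2).
Proof.
move=> F x x0 x1.
have k : {for x, continuous (fun t => normc (f (r%:C * cis t)))}.
  by apply: rcont_normc; apply: (circ_rcts F); eassumption.
exact: (cvgM k k).
Qed.

Lemma msq_D f g r : circ f r -> circ g r -> msq (fun z => f z + g z) r <= 2 * msq f r + 2 * msq g r.
Proof.
move=> F G; rewrite !msq_rint mulrCA (mulrCA 2) -mulrDr ler_pM2l ?invr_gt0 ?pi2_gt0 //.
have c2 h : circ h r -> cts 0 (2 * pi) (fun t => 2 * normc (h (r%:C * cis t)) ^+ 2).
  by move=> K x ? ?; apply: cvgM; [exact: cvg_cst|exact: cts_sq].
rewrite -!rintZ; try exact: cts_sq.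
rewrite -rintD; try exact: c2.
apply: rint_le; first exact: (cts_sq (circD F G)).
  by move=> x ? ?; apply: cvgD; apply: c2.
move=> x x0 x1.
set u := f _; set v := g _.
have h := cnD u v; have h0 := cn_ge0 (u + v); have := sqr_ge0 (normc u - normc v).
have : normc (u + v) ^+ 2 <= (normc u + normc v) ^+ 2 by rewrite lerXn2r // nnegrE addr_ge0 ?cn_ge0.
nra.
Qed.

Lemma msq_Z k f r : circ f r -> msq (fun z => k * f z) r = normc k ^+ 2 * msq f r.
Proof.
move=> F; rewrite !msq_rint mulrCA -(rintZ (normc k ^+ 2) (cts_sq F)).
by congr (_ * _); apply: rint_eq => x _ _; rewrite cnM exprMn.
Qed.

Lemma H2D f g : H2 f -> H2 g -> H2 (fun z => f z + g z).
Proof.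
move=> hf hg; split; first by move=> z z1; apply: holoD; [exact: hf.1|exact: hg.1].
exists (2 * nsq f + 2 * nsq g) => r r0 r1.
apply: le_trans (msq_D (H2_circ hf r0 r1) (H2_circ hg r0 r1)) _.
by rewrite lerD // ler_wpM2l // msq_le_nsq.
Qed.

Lemma H2Z k f : H2 f -> H2 (fun z => k * f z).
Proof.
move=> hf; split; first by move=> z z1; apply: holoM; [exact: holo_cst|exact: hf.1].
exists (normc k ^+ 2 * nsq f) => r r0 r1.
by rewrite (msq_Z _ (H2_circ hf r0 r1)) ler_wpM2l ?sqr_ge0 // msq_le_nsq.
Qed.

Lemma H2B f g : H2 f -> H2 g -> H2 (fun z => f z - g z).
Proof. by move=> hf /(H2Z (-1)) hg; under eq_fun do rewrite -mulN1r; exact: H2D. Qed.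

Lemma H2_0 : H2 (fun=> 0).
Proof.
split; first by move=> z _; exact: holo_cst.
exists 0 => r _ _; rewrite msq_rint (@rint_eq _ _ _ _ (fun=> 0)).
  by rewrite rint_cst ?(ltW (pi2_gt0 R)) // mul0r mulr0.
by move=> x _ _; rewrite cn0 expr0n.
Qed.

Lemma H2_sum n (c : nat -> R[i]) (F : nat -> R[i] -> R[i]) : (forall i, H2 (F i)) ->
  H2 (fun z => \sum_(i < n) c i * F i z).
Proof.
move=> h; elim: n => [|n IH].
  by have := H2_0; congr H2; apply/funext => z; rewrite big_ord0.
under eq_fun do rewrite big_ord_recr /=.
by apply: H2D => //; exact: H2Z.
Qed.

(* The polarization identity reduces the existence of the limit defining the
   inner product to the monotonicity of the quadratic means. *)
Lemma cprod_polar f g r : circ f r -> circ g r ->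
  cprod f g r = ((msq (fun z => f z + g z) r - msq f r - msq g r) / 2) +i*
    ((msq (fun z => f z + 'i * g z) r - msq f r - msq g r) / 2).
Proof.
move=> F G.
have JF := circJ F; have JG := circJ G.
have key k : normc k = 1 -> complex.Re (conjc k * cprod f g r) =
    (msq (fun z => f z + k * g z) r - msq f r - msq g r) / 2.
  move=> k1; rewrite /msq.
  have -> : cprod (fun z => f z + k * g z) (fun z => f z + k * g z) r =
    cprod f f r + conjc k * cprod f g r + k * cprod g f r + cprod g g r.
    have [c1 c2] := (circM F JF, circM G JG).
    have c3 : circ (fun z => conjc k * (f z * conjc (g z))) r.
      by apply: circM; [exact: circ_cst|exact: circM].
    have c4 : circ (fun z => k * (g z * conjc (f z))) r.
      by apply: circM; [exact: circ_cst|exact: circM].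
    rewrite /cprod -(cmeanZ _ (circM F JG)) -(cmeanZ _ (circM G JF)).
    rewrite -(cmeanD c1 c3) -(cmeanD (circD c1 c3) c4) -(cmeanD (circD (circD c1 c3) c4) c2).
    apply: cmean_eq => t; rewrite conjD conjM.
    have kk : k * conjc k = 1 by rewrite mulcJ k1 expr1n.
    set u := f _; set v := g _.
    transitivity (u * conjc u + conjc k * (u * conjc v) + k * (v * conjc u) + (k * conjc k) * (v * conjc v)).
      by ring.
    by rewrite kk mul1r.
  have cJ : cprod g f r = conjc (cprod f g r).
    rewrite /cprod /cmean conjM conjR; congr (_ * _).
    apply: cplx_ext; rewrite (ReJ, ImJ) /=.
      by apply: rint_eq => x _ _; rewrite !ReM !ReJ !ImJ; ring.
    rewrite -mulN1r -rintZ; last first.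
      exact: (rcts_Im (circ_rcts (circM F JG))).
    by apply: rint_eq => x _ _; rewrite !ImM !ReJ !ImJ; ring.
  by rewrite cJ !(ReD, ReM, ReJ, ImJ); field.
apply: cplx_ext; rewrite [RHS]/=.
  have := key 1; rewrite cn1 => /(_ erefl).
  rewrite (_ : conjc 1 = 1 :> R[i]) ?mul1r; last by apply: cplx_ext; rewrite /= ?oppr0.
  by move=> ->; under [X in msq X]eq_fun do rewrite mul1r.
have i1 : normc ('i : R[i]) = 1 by rewrite /normc /= expr0n add0r expr1n sqrtr1.
rewrite -(key _ i1) ReM ReJ ImJ [complex.Re 'i]/= [complex.Im 'i]/=; ring.
Qed.

Lemma polar_close (A B C A' B' C' e : R) : A - e / 8 < A' -> A' <= A -> B - e / 8 < B' ->
  B' <= B -> C - e / 8 < C' -> C' <= C ->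
  `|(A' - B' - C') / 2 - (A - B - C) / 2| < e / 2.
Proof. by move=> *; rewrite ltr_norml; apply/andP; split; lra. Qed.

Definition ip f g : R[i] := hardy_inner f g.

Lemma circle_integralC_cmean f r : circ f r ->
  circle_integralC (fun xi => f (r%:C * xi)) = cmean f r.
Proof.
move=> F; rewrite /cmean; apply: cplx_ext; rewrite (ReM, ImM) /= mul0r ?subr0 ?addr0.
  rewrite /circle_integral fineM //.
  by apply: integrable_fin_num => //; apply: cts_integrable; apply: rcts_Re; exact: circ_rcts.
rewrite /circle_integral fineM //.
by apply: integrable_fin_num => //; apply: cts_integrable; apply: rcts_Im; exact: circ_rcts.
Qed.

Lemma ip_lim f g : H2 f -> H2 g -> lim1 (cprod f g) (ip f g).
Proof.
move=> hf hg.
pose l : R[i] := ((nsq (fun z => f z + g z) - nsq f - nsq g) / 2) +i*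
    ((nsq (fun z => f z + 'i * g z) - nsq f - nsq g) / 2).
have L : lim1 (cprod f g) l.
  move=> e e0; have e8 : 0 < e / 8 by rewrite divr_gt0.
  have h1 := H2D hf hg; have h2 := H2D hf (H2Z 'i hg).
  have [d1 d10 H1] := msq_lim hf e8; have [d2 d20 H2'] := msq_lim hg e8.
  have [d3 d30 H3] := msq_lim h1 e8; have [d4 d40 H4] := msq_lim h2 e8.
  pose d := Num.min 1 (Num.min (Num.min d1 d2) (Num.min d3 d4)).
  exists d; first by rewrite !lt_min ltr01 d10 d20 d30 d40.
  move=> r; rewrite ltrBlDr -ltrBlDl !lt_min => /and3P[k0 /andP[k1 k2] /andP[k3 k4]] r1.
  have r0 : 0 <= r by lra.
  rewrite cprod_polar; [|exact: H2_circ..].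
  have I1 : nsq f - e / 8 < msq f r by apply: H1 => //; lra.
  have I2 : nsq g - e / 8 < msq g r by apply: H2' => //; lra.
  have I3 : nsq (fun z => f z + g z) - e / 8 < msq (fun z => f z + g z) r by apply: H3 => //; lra.
  have I4 : nsq (fun z => f z + 'i * g z) - e / 8 < msq (fun z => f z + 'i * g z) r by apply: H4 => //; lra.
  have [J1 J2] := (msq_le_nsq hf r0 r1, msq_le_nsq hg r0 r1).
  have [J3 J4] := (msq_le_nsq h1 r0 r1, msq_le_nsq h2 r0 r1).
  apply: le_lt_trans (cn_le_ReIm _) _; rewrite !(ReD, ImD, ReN, ImN) /=.
  rewrite [ltRHS]splitr; apply: ltrD.
    exact: (polar_close I3 J3 I1 J1 I2 J2).
  exact: (polar_close I4 J4 I1 J1 I2 J2).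
suff -> : ip f g = l by exact: L.
apply: lim1_lim => e e0; have [d d0 Hd] := L _ e0.
exists (Num.min d 1); first by rewrite lt_min d0 ltr01.
move=> r; rewrite ltrBlDr -ltrBlDl lt_min => /andP[k1 k2] r1.
have r0 : 0 <= r by lra.
rewrite (circle_integralC_cmean (f := fun z => f z * conjc (g z))).
  by apply: Hd => //; lra.
by apply: circM; [|apply: circJ]; exact: H2_circ.
Qed.
End HardyTwo.

(** * The inner product of H^2 and point evaluations *)

Section InnerProduct.
Variable R : realType.
Implicit Types (f g h : R[i] -> R[i]) (z w k : R[i]) (r s t e : R) (a b : nat -> R[i]).

Lemma lim1_uniq (u : R -> R[i]) l l' : lim1 u l -> lim1 u l' -> l = l'.
Proof. by move=> /lim1_lim <- /lim1_lim <-. Qed.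

Lemma lim1_eq (u v : R -> R[i]) l : (forall r, 0 <= r -> r < 1 -> u r = v r) -> lim1 u l -> lim1 v l.
Proof.
move=> E H e e0; have [d d0 Hd] := H _ e0; exists (Num.min d 1); first by rewrite lt_min d0 ltr01.
move=> r; rewrite ltrBlDr -ltrBlDl lt_min => /andP[k1 k2] r1.
by rewrite -E //; [apply: Hd => //|]; lra.
Qed.

Lemma lim1D (u v : R -> R[i]) l l' : lim1 u l -> lim1 v l' -> lim1 (fun r => u r + v r) (l + l').
Proof.
move=> H H' e e0; have e2 : 0 < e / 2 by rewrite divr_gt0.
have [d d0 Hd] := H _ e2; have [d' d'0 Hd'] := H' _ e2.
exists (Num.min d d'); first by rewrite lt_min d0.
move=> r; rewrite ltrBlDr -ltrBlDl lt_min => /andP[k1 k2] r1.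
have h1 := Hd r; have h2 := Hd' r.
have -> : u r + v r - (l + l') = (u r - l) + (v r - l') by ring.
apply: le_lt_trans (cnD _ _) _; rewrite [ltRHS]splitr ltrD //.
  by apply: h1 => //; lra.
by apply: h2 => //; lra.
Qed.

Lemma lim1Z k (u : R -> R[i]) l : lim1 u l -> lim1 (fun r => k * u r) (k * l).
Proof.
move=> H e e0; have k1 : 0 < normc k + 1 by rewrite ltr_wpDl ?cn_ge0.
have [d d0 Hd] := H _ (divr_gt0 e0 k1); exists d => // r h1 h2.
rewrite -mulrBr cnM; have := Hd _ h1 h2; rewrite ltr_pdivlMr // mulrDr mulr1.
by have := cn_ge0 (u r - l); rewrite mulrC; lra.
Qed.

Lemma lim1J (u : R -> R[i]) l : lim1 u l -> lim1 (fun r => conjc (u r)) (conjc l).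
Proof.
move=> H e e0; have [d d0 Hd] := H _ e0; exists d => // r h1 h2.
have := Hd _ h1 h2; rewrite -cnJ; congr (normc _ < _).
by apply: cplx_ext; rewrite !(ReD, ImD, ReN, ImN, ReJ, ImJ); ring.
Qed.

Lemma cprodD f g h r : circ f r -> circ g r -> circ h r ->
  cprod (fun z => f z + g z) h r = cprod f h r + cprod g h r.
Proof.
move=> F G H; rewrite /cprod -cmeanD; [|by apply: circM => //; exact: circJ..].
by apply: cmean_eq => t; rewrite mulrDl.
Qed.

Lemma cprodZ k f h r : circ f r -> circ h r ->
  cprod (fun z => k * f z) h r = k * cprod f h r.
Proof.
move=> F H; rewrite /cprod -cmeanZ; last by apply: circM => //; exact: circJ.
by apply: cmean_eq => t; rewrite mulrA.
Qed.

Lemma cprodC f g r : circ f r -> circ g r -> cprod g f r = conjc (cprod f g r).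
Proof.
move=> F G; rewrite /cprod /cmean conjM conjR; congr (_ * _).
have JG := circJ G.
apply: cplx_ext; rewrite (ReJ, ImJ) [LHS]/= [RHS]/=.
  by apply: rint_eq => x _ _; rewrite !ReM !ReJ !ImJ; ring.
rewrite -mulN1r -(rintZ _ (rcts_Im (circ_rcts (circM F JG)))).
by apply: rint_eq => x _ _; rewrite !ImM !ReJ !ImJ; ring.
Qed.

Lemma ipD f g h : H2 f -> H2 g -> H2 h -> ip (fun z => f z + g z) h = ip f h + ip g h.
Proof.
move=> F G H; apply: (lim1_uniq (ip_lim (H2D F G) H)).
apply: lim1_eq (lim1D (ip_lim F H) (ip_lim G H)) => r r0 r1.
by rewrite cprodD //; exact: H2_circ.
Qed.

Lemma ipZ k f h : H2 f -> H2 h -> ip (fun z => k * f z) h = k * ip f h.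
Proof.
move=> F H; apply: (lim1_uniq (ip_lim (H2Z k F) H)).
apply: lim1_eq (lim1Z k (ip_lim F H)) => r r0 r1.
by rewrite cprodZ //; exact: H2_circ.
Qed.

Lemma ipC f g : H2 f -> H2 g -> ip g f = conjc (ip f g).
Proof.
move=> F G; apply: (lim1_uniq (ip_lim G F)).
apply: lim1_eq (lim1J (ip_lim F G)) => r r0 r1.
by rewrite [RHS]cprodC //; exact: H2_circ.
Qed.

Lemma ip_self f : H2 f -> ip f f = (nsq f)%:C.
Proof.
move=> F; apply: (lim1_uniq (ip_lim F F)) => e e0.
have [d d0 Hd] := msq_lim F e0; exists (Num.min d 1); first by rewrite lt_min d0 ltr01.
move=> r; rewrite ltrBlDr -ltrBlDl lt_min => /andP[k1 k2] r1.
have r0 : 0 <= r by lra.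
have h : nsq f - e < msq f r by apply: Hd => //; lra.
have h' := msq_le_nsq F r0 r1.
by rewrite cprod_self -rmorphB cnR ltr_norml; apply/andP; split; lra.
Qed.

Lemma ipDr f g h : H2 f -> H2 g -> H2 h -> ip h (fun z => f z + g z) = ip h f + ip h g.
Proof.
move=> F G H; rewrite (ipC (H2D F G) H) ipD // conjD -!ipC //.
Qed.

Lemma ipZr k f h : H2 f -> H2 h -> ip h (fun z => k * f z) = conjc k * ip h f.
Proof. by move=> F H; rewrite (ipC (H2Z k F) H) ipZ // conjM -ipC. Qed.

Lemma ip_sum n (c : nat -> R[i]) (F : nat -> R[i] -> R[i]) h : (forall i, H2 (F i)) -> H2 h ->
  ip (fun z => \sum_(i < n) c i * F i z) h = \sum_(i < n) c i * ip (F i) h.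
Proof.
move=> hF H; elim: n => [|n IH].
  rewrite big_ord0; have E : (fun z : R[i] => \sum_(i < 0) c i * F i z) = (fun z => 0 * h z).
    by apply/funext => z; rewrite big_ord0 mul0r.
  by rewrite E ipZ // mul0r.
have E : (fun z : R[i] => \sum_(i < n.+1) c i * F i z) =
    (fun z => (\sum_(i < n) c i * F i z) + c n * F n z).
  by apply/funext => z; rewrite big_ord_recr.
by rewrite E (ipD (H2_sum n c hF) (H2Z (c n) (hF n)) H) (ipZ _ (hF n) H) IH big_ord_recr.
Qed.

Lemma nsqZ k f : H2 f -> nsq (fun z => k * f z) = normc k ^+ 2 * nsq f.
Proof.
move=> F; have := ip_self (H2Z k F); rewrite ipZ ?ipZr //; last exact: H2Z.
by rewrite ip_self // mulrA mulcJ -rmorphM /= => /complexI.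
Qed.

Lemma nsqD_le f g : H2 f -> H2 g -> nsq (fun z => f z + g z) <= 2 * nsq f + 2 * nsq g.
Proof.
move=> F G; apply: nsq_le => r r0 r1.
apply: le_trans (msq_D (H2_circ F r0 r1) (H2_circ G r0 r1)) _.
by rewrite lerD // ler_wpM2l // msq_le_nsq.
Qed.

Lemma nsqD f g : H2 f -> H2 g ->
  nsq (fun z => f z + g z) = nsq f + nsq g + 2 * complex.Re (ip f g).
Proof.
move=> F G; apply: (@complexI R); rewrite -ip_self; last exact: H2D.
rewrite ipD ?ipDr //; try exact: H2D.
rewrite !ip_self // (ipC F G).
have -> : (nsq f)%:C + ip f g + (conjc (ip f g) + (nsq g)%:C) =
  (nsq f)%:C + (nsq g)%:C + (ip f g + conjc (ip f g)) by ring.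
by rewrite addcJ !rmorphD rmorphM rmorph_nat.
Qed.

Lemma conjN z : conjc (- z) = - conjc z.
Proof. by case: z => u v; rewrite /conjc /=; apply: cplx_ext. Qed.

Lemma cauchy_schwarz f g : H2 f -> H2 g -> normc (ip f g) ^+ 2 <= nsq f * nsq g.
Proof.
move=> F G; pose k x : R[i] := - (x%:C * ip f g).
have H x : 0 <= nsq f + x ^+ 2 * normc (ip f g) ^+ 2 * nsq g - 2 * x * normc (ip f g) ^+ 2.
  have := nsq_ge0 (H2D F (H2Z (k x) G)).
  rewrite nsqD //; last exact: H2Z.
  rewrite nsqZ // ipZr // /k cnN cnM cnR exprMn real_normK ?num_real //.
  have -> : conjc (- (x%:C * ip f g)) * ip f g = - (x * normc (ip f g) ^+ 2)%:C.
    rewrite conjN conjM conjR mulNr -mulrA (mulrC (conjc _)) mulcJ. by rewrite -rmorphM.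
  by rewrite ReN /=; lra.
have g0 := nsq_ge0 G; have f0 := nsq_ge0 F.
set y := normc (ip f g) ^+ 2 in H *; have y0 : 0 <= y by exact: sqr_ge0.
have [g1|] := boolP (0 < nsq g).
  have := H (nsq g)^-1.
  have -> : nsq f + (nsq g)^-1 ^+ 2 * y * nsq g - 2 * (nsq g)^-1 * y = nsq f - y / nsq g.
    by field; rewrite gt_eqF.
  by rewrite subr_ge0 ler_pdivrMr.
rewrite lt_def g0 andbT negbK => /eqP g1; rewrite g1 mulr0 in H *.
rewrite leNgt; apply/negP => y1.
(* If [nsq g = 0], this choice turns the nonnegative expression into [- nsq f - 2]. *)
have := H ((nsq f + 1) / y).
by rewrite mulr0 addr0 -mulrA divfK ?gt_eqF //; lra.
Qed.

Lemma sum_geo_le (x : R) n : 0 <= x -> x < 1 -> \sum_(k < n) x ^+ k <= (1 - x)^-1.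
Proof.
move=> x0 x1; have h : 0 < 1 - x by rewrite subr_gt0.
rewrite -[leRHS]mul1r ler_pdivlMr // mulrC.
have -> : (1 - x) * (\sum_(k < n) x ^+ k) = 1 - x ^+ n.
  by rewrite -opprB mulNr -subrX1 opprB.
by rewrite lerBlDr lerDl exprn_ge0.
Qed.

Lemma pol_bound a n z : normc (pol a n z) ^+ 2 <= asq a n 1 * \sum_(k < n) (normc z ^+ 2) ^+ k.
Proof.
apply: (@le_trans _ _ ((\sum_(k < n) normc (a k) * normc z ^+ k) ^+ 2)).
  apply: lerXn2r; rewrite ?nnegrE ?cn_ge0 //.
    by apply: sumr_ge0 => i _; rewrite mulr_ge0 ?exprn_ge0 ?cn_ge0.
  apply: le_trans (cn_sum _ _ _) _; apply: ler_sum => k _; by rewrite cnM cnX.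
have H := CS_sum (fun i => normc (a i)) (fun i => normc z ^+ i) n.
apply: (le_trans H).
rewrite /asq; under [X in _ <= X * _]eq_bigr do rewrite expr1n mulr1.
by under [X in _ * X <= _]eq_bigr do rewrite -exprM mulnC exprM.
Qed.

(** Cauchy-Schwarz on the Taylor polynomials: the sum of |z|^(2k) is 1 / (1 - |z|^2), the squared
    norm of the reproducing kernel at [z]. *)
Lemma pt_bound f z : H2 f -> normc z < 1 -> normc (f z) ^+ 2 <= nsq f / (1 - normc z ^+ 2).
Proof.
move=> F z1; have [a A] := H2_ps F.
have z0 := cn_ge0 z; have zz : normc z ^+ 2 < 1 by rewrite expr_lt1.
have hz : 0 < 1 - normc z ^+ 2 by rewrite subr_gt0.
set B := nsq f / _; have B0 : 0 <= B by rewrite divr_ge0 ?nsq_ge0 // ltW.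
have pB n : normc (pol a n z) <= Num.sqrt B.
  rewrite -[leLHS]ger0_norm ?cn_ge0 // -sqrtr_sqr ler_wsqrtr //.
  apply: le_trans (pol_bound a n z) _; apply: ler_pM.
  - by apply: sumr_ge0 => k _; rewrite mulr_ge0 ?sqr_ge0 ?exprn_ge0.
  - by apply: sumr_ge0 => k _; rewrite !exprn_ge0.
  - exact: asq_le_nsq.
  - by apply: sum_geo_le => //; exact: sqr_ge0.
suff : normc (f z) <= Num.sqrt B.
  by move=> h; rewrite -[leRHS]sqr_sqrtr //; apply: lerXn2r; rewrite ?nnegrE ?cn_ge0 ?sqrtr_ge0.
apply/ler_addgt0Pr => e e0.
pose p := (1 + normc z) / 2.
have [p0 p1 zp] : [/\ 0 < p, p < 1 & normc z <= p] by rewrite /p; split; lra.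
have [M [q [M0 q0 q1 Hq]]] := A _ p0 p1.
have [n /(_ n (leqnn n)) Hn] := geo_cvg M q0 q1 e0.
have := Hq n z zp; have := pB n; have := cnB_ge (f z) (pol a n z); lra.
Qed.

Lemma nsq_eq0 f : H2 f -> nsq f = 0 -> forall z, normc z < 1 -> f z = 0.
Proof.
move=> F f0 z z1; have := pt_bound F z1; rewrite f0 mul0r => h.
by apply/eqP; rewrite -cn_eq0 -sqrf_eq0 eq_le h sqr_ge0.
Qed.

Lemma integral_mean_msq f r : circ f r -> integral_mean 2 f r = (msq f r)%:E.
Proof.
move=> F; rewrite /integral_mean /circle_integral msq_rint EFinM; congr (_ * _)%E.
have E : (fun t : R => (normc (f (r%:C * cis t)) `^ 2)%:E) = EFin \o (fun t => normc (f (r%:C * cis t)) ^+ 2).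
  by apply/funext => t /=; rewrite -powR_mulrn ?cn_ge0.
by rewrite E /rint /Rintegral fineK // integrable_fin_num //; exact: (cts_integrable (cts_sq F)).
Qed.

Lemma hardy_sup_nsq f : H2 f -> hardy_sup 2 f = (nsq f)%:E.
Proof.
move=> F; apply/eqP; rewrite eq_le; apply/andP; split.
  apply: ge_ereal_sup => _ [r /= + <-]; rewrite in_itv /= => /andP[r0 r1].
  by rewrite integral_mean_msq ?lee_fin ?msq_le_nsq //; exact: H2_circ.
have [f0|f0] := eqVneq (hardy_sup 2 f) +oo%E; first by rewrite f0 leey.
have : (-oo < hardy_sup 2 f)%E.
  apply: lt_le_trans (ltNyr (msq f 0)) _; apply: ereal_sup_ubound; exists 0.
    by rewrite /= in_itv /= lexx ltr01.
  by rewrite integral_mean_msq //; apply: H2_circ.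
case E : (hardy_sup 2 f) f0 => [x| |] // _ _.
rewrite lee_fin; apply: nsq_le => r r0 r1; rewrite -lee_fin -E -integral_mean_msq; last exact: H2_circ.
by apply: ereal_sup_ubound; exists r => //; rewrite /= in_itv /= r0.
Qed.

Lemma hardy2P f : hardy 2 f <-> H2 f.
Proof.
split=> [[/analyticP hf]|F]; last first.
  by split; [exact/analyticP/F.1|rewrite hardy_sup_nsq // ltry].
have cf r : 0 <= r -> r < 1 -> circ f r.
  by apply: circ_disk => z z1; apply: holo_ccont; exact: hf.
move=> fo; split=> //.
case E : (hardy_sup 2 f) fo => [x| |] // _.
  exists x => r r0 r1; rewrite -lee_fin -E -integral_mean_msq; last exact: cf.
  by apply: ereal_sup_ubound; exists r => //; rewrite /= in_itv /= r0.
exists 0 => r r0 r1; have : (integral_mean 2 f r <= hardy_sup 2 f)%E.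
  by apply: ereal_sup_ubound; exists r => //; rewrite /= in_itv /= r0.
by rewrite E integral_mean_msq; [rewrite leeNy_eq|exact: cf].
Qed.

Lemma hardy_norm_nsq f : H2 f -> hardy_norm 2 f = (Num.sqrt (nsq f))%:E.
Proof. by move=> F; rewrite /hardy_norm hardy_sup_nsq // poweR_EFin powR12_sqrt // nsq_ge0. Qed.
End InnerProduct.

(** * Weak compactness in H^2 *)

Section Compactness.
Variable R : realType.
Implicit Types (f g h : R[i] -> R[i]) (z w : R[i]) (r s t e : R) (a b : nat -> R[i]).

(** With K (1 - q) = M, the sequence v n - K q^n increases and v n + K q^n decreases; the supremum
    of the former lies between them. *)
Lemma geo_limit (v : nat -> R) (M q : R) : 0 <= M -> 0 <= q -> q < 1 ->
  (forall n, `|v n.+1 - v n| <= M * q ^+ n) ->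
  exists l, forall n, `|v n - l| <= M / (1 - q) * q ^+ n.
Proof.
move=> M0 q0 q1 H; set K := M / (1 - q).
have d0 : 0 < 1 - q by rewrite subr_gt0.
have KE : K * (1 - q) = M by rewrite /K divfK // gt_eqF.
have K0 : 0 <= K by rewrite divr_ge0 // ltW.
pose lo n := v n - K * q ^+ n; pose hi n := v n + K * q ^+ n.
have lo1 n : lo n <= lo n.+1.
  rewrite /lo exprS; have := H n; rewrite -KE ler_norml => /andP[h _].
  have -> : K * (q * q ^+ n) = K * q ^+ n - K * (1 - q) * q ^+ n by ring.
  by move: h; set X := K * (1 - q) * _; lra.
have hi1 n : hi n.+1 <= hi n.
  rewrite /hi exprS; have := H n; rewrite -KE ler_norml => /andP[_ h].
  have -> : K * (q * q ^+ n) = K * q ^+ n - K * (1 - q) * q ^+ n by ring.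
  by move: h; set X := K * (1 - q) * _; lra.
have lom n m : (n <= m)%N -> lo n <= lo m.
  by move=> /subnKC <-; elim: (m - n)%N => [|k IH]; rewrite ?addn0 // addnS (le_trans IH).
have him n m : (n <= m)%N -> hi m <= hi n.
  by move=> /subnKC <-; elim: (m - n)%N => [|k IH]; rewrite ?addn0 // addnS (le_trans _ IH).
have lohi n m : lo n <= hi m.
  apply: (@le_trans _ _ (lo (maxn n m))); first by rewrite lom // leq_maxl.
  apply: (@le_trans _ _ (hi (maxn n m))); last by rewrite him // leq_maxr.
  have : 0 <= K * q ^+ maxn n m by rewrite mulr_ge0 // exprn_ge0.
  by rewrite /lo /hi; lra.
exists (sup [set lo n | n in setT]) => n.
have h1 : lo n <= sup [set lo n | n in setT].
  apply: (@ub_le_sup _ [set lo n | n in setT]); last by exists n.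
  by exists (hi 0%N) => _ [m _ <-].
have h2 : sup [set lo n | n in setT] <= hi n.
  by apply: ge_sup; [exists (lo 0%N); exists 0%N|move=> _ [m _ <-]].
by move: h1 h2; rewrite /lo /hi ler_norml => ? ?; apply/andP; split; lra.
Qed.

(** The hypothesis at a radius [r] between [p] and 1 bounds the terms on the disk of radius [p] by a
    multiple of (p/r)^n. *)
Lemma ps_exists a : (forall p : R, 0 < p -> p < 1 -> exists M, forall k, normc (a k) * p ^+ k <= M) ->
  exists f, ps a f.
Proof.
move=> H.
have key p : 0 < p -> p < 1 -> exists M q : R, [/\ 0 <= M, 0 <= q, q < 1 &
    forall w, normc w <= p -> exists l, forall n, normc (l - pol a n w) <= M * q ^+ n].
  move=> p0 p1; pose r := (1 + p) / 2.
  have [r0 r1 pr] : [/\ 0 < r, r < 1 & p < r] by rewrite /r; split; lra.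
  clearbody r; have [M HM] := H _ r0 r1.
  have M0 : 0 <= M by apply: le_trans (HM 0%N); rewrite mulr_ge0 ?cn_ge0 ?exprn_ge0 // ltW.
  pose q := p / r.
  have q0 : 0 <= q by rewrite divr_ge0 // ltW.
  have q1 : q < 1 by rewrite ltr_pdivrMr // mul1r.
  exists (M / (1 - q) * 2), q; split=> //.
    by rewrite mulr_ge0 // divr_ge0 // subr_ge0 ltW.
  move=> w wp.
  have step n : normc (pol a n.+1 w - pol a n w) <= M * q ^+ n.
    rewrite /pol big_ord_recr /= addrAC subrr add0r cnM cnX.
    apply: (@le_trans _ _ (normc (a n) * p ^+ n)).
      by rewrite ler_wpM2l ?cn_ge0 //; apply: lerXn2r; rewrite ?nnegrE ?cn_ge0 // ltW.
    rewrite /q expr_div_n mulrA ler_pdivlMr ?exprn_gt0 //.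
    rewrite mulrAC; apply: ler_wpM2r; first by rewrite exprn_ge0 // ltW.
    exact: HM.
  have [|x hx] := @geo_limit (fun n => complex.Re (pol a n w)) M q M0 q0 q1.
    by move=> n; rewrite -ReN -ReD; apply: le_trans (Re_le_cn _) _.
  have [|y hy] := @geo_limit (fun n => complex.Im (pol a n w)) M q M0 q0 q1.
    by move=> n; rewrite -ImN -ImD; apply: le_trans (Im_le_cn _) _.
  exists (x +i* y) => n; rewrite cnBC; apply: le_trans (cn_le_ReIm _) _.
  rewrite !(ReD, ImD, ReN, ImN) /=; have := hx n; have := hy n; set X := M / (1 - q) * q ^+ n.
  have -> : M / (1 - q) * 2 * q ^+ n = X + X by rewrite /X; ring.
  by move=> h1 h2; exact: lerD.
pose P w l := forall e, 0 < e -> exists N, forall n, (N <= n)%N -> normc (l - pol a n w) <= e.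
have PM w l M q : 0 <= q -> q < 1 -> (forall n, normc (l - pol a n w) <= M * q ^+ n) -> P w l.
  move=> q0 q1 h e e0; have [N HN] := geo_cvg M q0 q1 e0; exists N => n /HN hn.
  exact: le_trans (h n) (ltW hn).
have Pu w l l' : P w l -> P w l' -> l = l'.
  move=> h h'; apply: eq_of_dist => e e0; have e2 : 0 < e / 2 by rewrite divr_gt0.
  have [N HN] := h _ e2; have [N' HN'] := h' _ e2.
  have h1 := HN (maxn N N') (leq_maxl _ _); have h2 := HN' (maxn N N') (leq_maxr _ _).
  have -> : l - l' = (l - pol a (maxn N N') w) - (l' - pol a (maxn N N') w) by ring.
  by apply: le_trans (cnB _ _) _; lra.
have [f Hf] : exists f : R[i] -> R[i], forall w, normc w < 1 -> P w (f w).
  have : forall w, exists l, normc w < 1 -> P w l.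
    move=> w; have [w1|w1] := boolP (normc w < 1); last by exists 0.
    have w0 := cn_ge0 w; pose p := (1 + normc w) / 2.
    have [p0 p1 wp] : [/\ 0 < p, p < 1 & normc w <= p] by rewrite /p; split; lra.
    have [M [q [M0 q0 q1 Hq]]] := key _ p0 p1.
    by have [l hl] := Hq w wp; exists l => _; exact: PM hl.
  by move=> /choice[f Hf]; exists f.
exists f => p p0 p1; have [M [q [M0 q0 q1 Hq]]] := key _ p0 p1.
exists M, q; split=> // n w wp; have [l hl] := Hq w wp.
have <- // : l = f w.
by apply: (Pu w); [exact: PM hl|apply: Hf; exact: le_lt_trans p1].
Qed.

Lemma ps_exists_bounded a (B : R) : (forall k, normc (a k) <= B) -> exists f, ps a f.
Proof.
move=> H; apply: ps_exists => p p0 p1; exists B => k.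
have p0' := ltW p0; have p1' := ltW p1.
have B0 : 0 <= B by apply: le_trans (H 0%N); exact: cn_ge0.
by rewrite -[leRHS]mulr1 ler_pM ?cn_ge0 ?exprn_ge0 // exprn_ile1.
Qed.

Lemma psB a b f g : ps a f -> ps b g -> ps (fun k => a k - b k) (fun z => f z - g z).
Proof.
move=> F G p p0 p1; have [M [q [M0 q0 q1 Hq]]] := F _ p0 p1.
have [M' [q' [M'0 q'0 q'1 Hq']]] := G _ p0 p1.
pose m := Num.max q q'.
have [m1 m2] : q <= m /\ q' <= m by rewrite /m !le_max !lexx orbT.
exists (M + M'), m; split; [exact: addr_ge0|exact: le_trans m1|by rewrite /m gt_max q1|].
move=> n w wp; have -> : f w - g w - pol (fun k => a k - b k) n w = (f w - pol a n w) - (g w - pol b n w).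
  rewrite /pol; have -> : \sum_(k < n) (a k - b k) * w ^+ k =
      \sum_(k < n) a k * w ^+ k - \sum_(k < n) b k * w ^+ k.
    by rewrite -sumrB; apply: eq_bigr => k _; rewrite mulrBl.
  ring.
apply: le_trans (cnB _ _) _; rewrite mulrDl; apply: lerD.
  by apply: le_trans (Hq n _ wp) _; rewrite ler_wpM2l //; apply: lerXn2r; rewrite ?nnegrE // (le_trans q0).
by apply: le_trans (Hq' n _ wp) _; rewrite ler_wpM2l //; apply: lerXn2r; rewrite ?nnegrE // (le_trans q'0).
Qed.

Definition ccvg (u : nat -> R[i]) (l : R[i]) := forall e, 0 < e -> exists N : nat,
  forall n, (N <= n)%N -> normc (u n - l) < e.

(** Tychonoff's theorem supplies a cluster point of the sequence in the product of the intervals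
    [-B, B] indexed by coordinates and real or imaginary part; the subsequence picks indices close
    to it in more and more coordinates. *)
Lemma diagonal (x : nat -> nat -> R[i]) (B : R) : (forall j n, normc (x j n) <= B) ->
  exists k : nat -> nat, (forall j, (k j < k j.+1)%N) /\
    exists a, forall n, ccvg (fun j => x (k j) n) (a n).
Proof.
move=> HB; pose I := (nat * bool)%type.
pose X (j : nat) : I -> R := fun i => if i.2 then complex.Re (x j i.1) else complex.Im (x j i.1).
have cpt : compact [set f : prod_topology (fun _ : I => R : topologicalType) | forall i, `[- B, B]%classic (f i)].
  exact: (@tychonoff I (fun _ => R : topologicalType) (fun _ => `[- B, B]%classic)
    (fun _ => @segment_compact R _ _)).
pose F : set_system (prod_topology (fun _ : I => R : topologicalType)) := X @ \oo.
have FF : ProperFilter F by exact: fmap_proper_filter.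
have [|p [_ clp]] := cpt F FF.
  exists 0%N => // j _ i /=; rewrite in_itv /= -ler_norml /X.
  by case: ifP => _; [apply: le_trans (Re_le_cn _) _|apply: le_trans (Im_le_cn _) _].
pose U (m : nat) := [set f : prod_topology (fun _ : I => R : topologicalType) |
  forall n, (n < m)%N -> `|f (n, true) - p (n, true)| < m.+1%:R^-1 /\ `|f (n, false) - p (n, false)| < m.+1%:R^-1].
have Up m : nbhs p (U m).
  have h (e : R) i : 0 < e -> nbhs p [set f : prod_topology (fun _ : I => R : topologicalType) | `|f i - p i| < e].
    move=> e0; have := @proj_continuous I (fun _ => R : topologicalType) i p.
    move=> /(_ [set y : R | `|y - p i| < e]); apply.
    by apply/nbhs_ballP; exists e => // y; rewrite /ball /= distrC.
  have m0 : (0 : R) < m.+1%:R^-1 by rewrite invr_gt0.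
  have {}h l : nbhs p [set f : prod_topology (fun _ : I => R : topologicalType) |
    forall n, (n < l)%N -> `|f (n, true) - p (n, true)| < m.+1%:R^-1 /\ `|f (n, false) - p (n, false)| < m.+1%:R^-1].
    elim: l => [|l IH]; first by apply: filterS filterT => f _ n.
    apply: filterS (filterI IH (filterI (h _ (l, true) m0) (h _ (l, false) m0))).
    move=> f /= [k1 [k2 k3]] n; rewrite ltnS leq_eqVlt => /orP[/eqP->//|]; exact: k1.
  exact: h.
have step m N : exists j, (N <= j)%N /\ U m (X j).
  have FX : F (X @` [set j | (N <= j)%N]) by exists N => // j Nj; exists j.
  by have [f [[j Nj <-] Uf]] := clp _ _ FX (Up m); exists j.
have /choice[c Hc] : forall mN : nat * nat, exists j, (mN.2 <= j)%N /\ U mN.1 (X j).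
  by move=> [m N]; exact: step.
(* Asking for an index at least [(k j').+1] makes [k] strictly increasing. *)
pose k := fix k (j : nat) := if j is j'.+1 then c (j, (k j').+1) else c (0%N, 0%N).
exists k; split; first by move=> j /=; have [] := Hc (j.+1, (k j).+1).
exists (fun n => p (n, true) +i* p (n, false)) => n e e0.
pose N := Num.bound (2 / e).
have hN m : (N <= m)%N -> 2 / m.+1%:R < e.
  move=> Nm; rewrite ltr_pdivrMr // mulrC -ltr_pdivrMr //.
  apply: lt_le_trans (archi_boundP _) _; first by rewrite divr_ge0 // ltW.
  by rewrite ler_nat (leq_trans Nm).
exists (maxn N n.+1) => m; rewrite geq_max => /andP[Nm nm].
have Uk : U m (X (k m)) by case: m {Nm nm} => [|m] /=; [have [] := Hc (0%N, 0%N)|have [] := Hc (m.+1, (k m).+1)].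
have [h1 h2] := Uk n nm; rewrite /X /= in h1 h2.
apply: le_lt_trans (cn_le_ReIm _) _; rewrite !(ReD, ImD, ReN, ImN) /=.
apply: lt_trans (hN m Nm); have -> : 2 / m.+1%:R = m.+1%:R^-1 + m.+1%:R^-1 :> R by ring.
exact: ltrD.
Qed.

(** Taylor coefficients on the unit ball are at most 1 in modulus, so a subsequence converges
    coefficientwise; each finite sum of squares passes to the limit, which keeps the limit in the
    ball. *)
Lemma weak_compact (u : nat -> R[i] -> R[i]) : (forall j, H2 (u j) /\ nsq (u j) <= 1) ->
  exists (k : nat -> nat) (v : R[i] -> R[i]) (A : nat -> nat -> R[i]) a,
  [/\ forall j, (k j < k j.+1)%N, H2 v /\ nsq v <= 1, ps a v,
    forall j, ps (A j) (u (k j)) & forall n, ccvg (fun j => A j n) (a n)].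
Proof.
move=> hu; have /choice[A0 HA0] : forall j, exists a, ps a (u j).
  by move=> j; apply: H2_ps; exact: (hu j).1.
have bA j n : normc (A0 j n) <= 1.
  rewrite -(@ler_pXn2r _ 2) ?nnegrE ?cn_ge0 // expr1n.
  apply: le_trans (hu j).2; apply: le_trans (asq_le_nsq n.+1 (HA0 j) (hu j).1).
  rewrite /asq big_ord_recr /= expr1n mulr1 lerDr; apply: sumr_ge0 => i _.
  by rewrite expr1n mulr1 sqr_ge0.
have [k [kinc [a Ha]]] := diagonal bA.
have ba n : normc (a n) <= 1.
  apply/ler_addgt0Pr => e e0; have [N /(_ N (leqnn N)) H] := Ha n e e0.
  by have := cnB_ge (a n) (A0 (k N) n); rewrite cnBC; have := bA (k N) n; lra.
have [v Hv] := ps_exists_bounded ba.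
have Sa n : asq a n 1 <= 1.
  (* Two numbers at distance at most [d <= 1], one of modulus at most 1, have squared moduli
     differing by at most [3 d]; there are [n] coefficients. *)
  apply/ler_addgt0Pr => e e0; pose d := Num.min 1 (e / (3 * n.+1%:R)).
  have d0 : 0 < d by rewrite lt_min ltr01 divr_gt0 // mulr_gt0.
  have [d1 d2] : d <= 1 /\ d <= e / (3 * n.+1%:R) by rewrite /d !ge_min !lexx orbT.
  have /choice[N HN] : forall i, exists N : nat, forall j, (N <= j)%N -> normc (A0 (k j) i - a i) < d.
    by move=> i; exact: Ha.
  pose J := (\max_(i < n) N i)%N.
  have h (i : 'I_n) : normc (a i) ^+ 2 <= normc (A0 (k J) i) ^+ 2 + 3 * d.
    have hi := HN i J (leq_bigmax i); have := cnB_ge (a i) (A0 (k J) i); rewrite cnBC => h1.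
    have := bA (k J) i; have := cn_ge0 (A0 (k J) i); have := cn_ge0 (a i).
    move: hi h1; set x := normc _; set y := normc _; set y' := normc _; nra.
  apply: (@le_trans _ _ (\sum_(i < n) (normc (A0 (k J) i) ^+ 2 + 3 * d))).
    by apply: ler_sum => i _; rewrite expr1n mulr1.
  rewrite big_split /= sumr_const card_ord; apply: lerD.
    apply: le_trans (hu (k J)).2; apply: le_trans (asq_le_nsq n (HA0 (k J)) (hu (k J)).1).
    by apply: ler_sum => i _; rewrite expr1n mulr1.
  apply: (@le_trans _ _ (3 * d * n.+1%:R)).
    by rewrite -[leLHS]mulr_natr ler_wpM2l ?ler_nat // mulr_ge0 // ltW.
  apply: (@le_trans _ _ (3 * (e / (3 * n.+1%:R)) * n.+1%:R)).
    by rewrite ler_wpM2r // ler_wpM2l.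
  rewrite le_eqVlt; apply/orP; left; apply/eqP.
  have n0 : n.+1%:R != 0 :> R by rewrite pnatr_eq0.
  by move: (n.+1%:R) n0 => x x0; field.
exists k, v, (fun j => A0 (k j)), a; split=> //.
exact: (H2_asq Hv Sa).
Qed.
End Compactness.

(** * Compact composition operators on H^2 *)

Section HilbertSchmidt.
Variable R : realType.
Implicit Types (f g h : R[i] -> R[i]) (z w : R[i]) (r s t e : R) (a b : nat -> R[i]).

Lemma cmean_at0 f : cmean f 0 = f 0.
Proof. by rewrite -[RHS](cmean_cst _ 0); apply: cmean_eq => t; rewrite mul0r. Qed.

(** Finitely many suprema over the radius are nearly attained at one common radius, because the
    means increase. *)
Lemma sum_nsq_le n (F : nat -> R[i] -> R[i]) (B : R) : (forall i, H2 (F i)) ->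
  (forall r, 0 <= r -> r < 1 -> \sum_(i < n) msq (F i) r <= B) -> \sum_(i < n) nsq (F i) <= B.
Proof.
move=> hF H; apply/ler_addgt0Pr => e e0.
pose d := e / n.+1%:R; have d0 : 0 < d by rewrite divr_gt0.
have key m : exists r0, [/\ 0 <= r0, r0 < 1 & forall r, r0 < r -> r < 1 ->
    forall i, (i < m)%N -> nsq (F i) - d < msq (F i) r].
  elim: m => [|m [r0 [h0 h1 IH]]]; first by exists 0; split.
  have [c c0 Hc] := msq_lim (hF m) d0.
  have [m1 m2] : r0 <= Num.max r0 (1 - c) /\ 1 - c <= Num.max r0 (1 - c).
    by rewrite !le_max !lexx orbT.
  exists (Num.max r0 (1 - c)); split; first exact: le_trans m1.
    by rewrite gt_max h1 /=; lra.
  move=> r hr r1 i; rewrite ltnS leq_eqVlt => /orP[/eqP->|im].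
    by apply: Hc => //; lra.
  by apply: IH => //; lra.
have [r0 [h0 h1 hr]] := key n.
pose r := (1 + r0) / 2; have [r1 [r2 r3]] : 0 <= r /\ r0 < r /\ r < 1 by rewrite /r; lra.
apply: (@le_trans _ _ (\sum_(i < n) (msq (F i) r + d))).
  by apply: ler_sum => i _; have := hr r r2 r3 i (ltn_ord i); lra.
rewrite big_split /= sumr_const card_ord; apply: lerD; first exact: H.
rewrite -[leLHS]mulr_natr /d -mulrA ler_piMr ?(ltW e0) //.
by rewrite mulrC ler_pdivrMr // mul1r ler_nat.
Qed.

Lemma msq_approx f r (B : R) : circ f r -> 0 <= B ->
  (forall e, 0 < e -> exists g, [/\ circ g r, (forall t, 0 <= t -> t <= 2 * pi ->
     normc (f (r%:C * cis t) - g (r%:C * cis t)) <= e) & msq g r <= B]) -> msq f r <= B.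
Proof.
move=> F B0 H; apply/ler_addgt0Pr => e e0.
pose d := Num.min 1 (e / (B + 2)).
have B2 : 0 < B + 2 by lra.
have d0 : 0 < d by rewrite lt_min ltr01 divr_gt0.
have [d1 d2] : d <= 1 /\ d <= e / (B + 2) by rewrite /d !ge_min !lexx orbT.
have d3 : d * (B + 2) <= e by rewrite -ler_pdivlMr.
have [g [G Hg gB]] := H _ d0.
clearbody d.
(* From [2 d y <= d y^2 + d] and [d^2 <= d] follows [(y + d)^2 <= (1 + d) y^2 + 2 d]; the total
   excess over [B] is [d (B + 2) <= e]. *)
have : msq f r <= (1 + d) * msq g r + 2 * d.
  have pi0 := pi2_gt0 R.
  rewrite !msq_rint mulrCA; have -> : 2 * d = (2 * pi)^-1 * rint 0 (2 * pi) (fun=> 2 * d).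
    by rewrite rint_cst ?(ltW pi0) // subr0 mulrCA mulVf ?mulr1 // gt_eqF.
  rewrite -mulrDr ler_pM2l ?invr_gt0 //.
  rewrite -(rintZ (1 + d) (cts_sq G)).
  have c1 : cts 0 (2 * pi) (fun t => (1 + d) * normc (g (r%:C * cis t)) ^+ 2).
    by move=> x ? ?; apply: cvgM; [exact: cvg_cst|exact: (cts_sq G)].
  have c2 : cts 0 (2 * pi) (fun _ : R => 2 * d) by move=> x ? ?; exact: cvg_cst.
  rewrite -(rintD c1 c2); apply: rint_le; first exact: (cts_sq F).
    by move=> x ? ?; apply: cvgD; [exact: c1|exact: c2].
  move=> t t0 t1; have := Hg t t0 t1; have := cnB_ge (f (r%:C * cis t)) (g (r%:C * cis t)).
  have := cn_ge0 (f (r%:C * cis t)); have := cn_ge0 (g (r%:C * cis t)).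
  set x := normc (f _); set y := normc (g _) => y0 x0 h1 h2.
  have h3 : x <= y + d by lra.
  have h4 : x ^+ 2 <= (y + d) ^+ 2 by apply: lerXn2r; rewrite ?nnegrE ?addr_ge0 // ltW.
  have h5 : 0 <= d * (y - 1) ^+ 2 by rewrite mulr_ge0 ?sqr_ge0 // ltW.
  have h6 : d ^+ 2 <= d by rewrite expr2 ler_piMr // ltW.
  by nra.
have : (1 + d) * msq g r <= (1 + d) * B by rewrite ler_wpM2l //; lra.
lra.
Qed.

Lemma ps_pol a n : ps (fun k => if (k < n)%N then a k else 0) (pol a n).
Proof.
have F := pol_holo a n; have [b B] := taylor (fun z (_ : normc z < 1) => F z).
suff bE : b = (fun k => if (k < n)%N then a k else 0) by rewrite -bE.
apply/funext => k; have h0 : 0 < 1 / 2 :> R by lra.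
have h1 : 1 / 2 < 1 :> R by lra.
rewrite -(ps_coef k B h0 h1); case: ltnP => kn; first by rewrite pol_coef.
have h : pol a n = pol (fun k => if (k < n)%N then a k else 0) k.+1.
  apply/funext => z; rewrite /pol -(subnKC kn) -addnS big_split_ord /=.
  rewrite [X in _ + X]big1 ?addr0; last by move=> i _; rewrite ltnNge leq_addr /= mul0r.
  by apply: eq_bigr => i _; rewrite ltn_ord.
by rewrite h pol_coef // ltnNge kn.
Qed.

Lemma ip_pow a f k : ps a f -> H2 f -> ip f (fun z => z ^+ k) = a k.
Proof.
move=> F hf.
have Z : ps (fun j => (j == k)%:R) (fun z : R[i] => z ^+ k).
  have := @ps_pol (fun j => (j == k)%:R) k.+1; congr ps.
    apply/funext => j; rewrite ltnS; case: leqP => // kj.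
    by rewrite gtn_eqF.
  apply/funext => z; rewrite /pol big_ord_recr /= eqxx mul1r big1 ?add0r // => i _.
  by rewrite ltn_eqF // mul0r.
have hz : H2 (fun z : R[i] => z ^+ k).
  apply: (H2_asq (B := 1) Z _).1 => n.
  rewrite /asq; apply: (@le_trans _ _ (\sum_(i < n) (if i == k :> nat then 1 else 0))).
    by apply: ler_sum => i _; rewrite expr1n mulr1 cnn; case: eqP => _; rewrite ?expr1n ?expr0n.
  rewrite -big_mkcond /=; have [kn|kn] := ltnP k n.
    by rewrite (big_pred1 (Ordinal kn)).
  by rewrite big_pred0 // => i; apply: ltn_eqF; exact: leq_trans kn.
apply: (lim1_uniq (ip_lim hf hz)) => e e0.
have na := cn_ge0 (a k); pose B := normc (a k) * (k * 2)%:R + 1.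
have B0 : 0 < B by rewrite ltr_wpDl // mulr_ge0.
exists (Num.min 1 (e / B)); first by rewrite lt_min ltr01 divr_gt0.
move=> r; rewrite ltrBlDr -ltrBlDl lt_min => /andP[k1 k2] r1.
have r0 : 0 < r by lra.
have -> : cprod f (fun z => z ^+ k) r = (r ^+ (k * 2))%:C * a k.
  have cc : circ (fun z => f z * z ^- k) r.
    by apply: circM; [exact: ps_circ F (ltW r0) r1|exact: circ_Vpow].
  rewrite -(ps_coef k F r0 r1) -(cmeanZ _ cc); apply: cmean_eqr; first exact: ltW.
  move=> z zr; have z0 : z != 0 by rewrite -cn_eq0 zr gt_eqF.
  have -> : conjc (z ^+ k) = (conjc z) ^+ k by exact: conjX.
  have -> : conjc z = (r ^+ 2)%:C * z^-1 by rewrite -zr -mulcJ; field.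
  by rewrite exprMn -rmorphXn -exprM mulnC exprVn /=; ring.
have -> : (r ^+ (k * 2))%:C * a k - a k = - ((1 - r ^+ (k * 2))%:C * a k).
  by rewrite rmorphB rmorph1; ring.
rewrite cnN cnM cnR ger0_norm; last by rewrite subr_ge0 exprn_ile1 // ltW.
have bi := bernoulli_ineq (k * 2) (d := 1 - r) ltac:(by lra) ltac:(by lra).
rewrite (_ : 1 - (1 - r) = r) in bi; last by ring.
apply: (@le_lt_trans _ _ ((1 - r) * B)); last by rewrite -ltr_pdivlMr.
apply: (@le_trans _ _ ((k * 2)%:R * (1 - r) * normc (a k))).
  by rewrite ler_wpM2r //; lra.
have -> : (k * 2)%:R * (1 - r) * normc (a k) = (1 - r) * (B - 1) by rewrite /B; ring.
by rewrite ler_wpM2l //; lra.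
Qed.

Lemma sum_msq_rint (F : nat -> R[i] -> R[i]) r n : (forall i, circ (F i) r) ->
  \sum_(i < n) msq (F i) r =
    (2 * pi)^-1 * rint 0 (2 * pi) (fun t => \sum_(i < n) normc (F i (r%:C * cis t)) ^+ 2) /\
  cts 0 (2 * pi) (fun t => \sum_(i < n) normc (F i (r%:C * cis t)) ^+ 2).
Proof.
move=> cF; elim: n => [|m [IH1 IH2]].
  have E0 : (fun t : R => \sum_(i < 0) normc (F i (r%:C * cis t)) ^+ 2) = (fun=> 0).
    by apply/funext => t; rewrite big_ord0.
  rewrite E0 big_ord0 rint_cst ?(ltW (pi2_gt0 R)) // mul0r mulr0; split => // x ? ?; exact: cvg_cst.
have E1 : (fun t : R => \sum_(i < m.+1) normc (F i (r%:C * cis t)) ^+ 2) =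
   (fun t => (\sum_(i < m) normc (F i (r%:C * cis t)) ^+ 2) + normc (F m (r%:C * cis t)) ^+ 2).
  by apply/funext => t; rewrite big_ord_recr.
split.
  by rewrite E1 big_ord_recr /= IH1 (rintD IH2 (cts_sq (cF m))) msq_rint (mulrDr (2 * pi)^-1).
by rewrite E1 => x x0 x1; apply: cvgD; [exact: IH2|exact: (cts_sq (cF m))].
Qed.

(** [Re Hm] is a harmonic majorant of the squared kernel norm at [phi z]. By the mean value property
    its circle means equal [C], which thereby bounds both the squared operator norm and the squared
    Hilbert-Schmidt norm of composition with [phi]. *)
Variables (phi Hm : R[i] -> R[i]).
Hypothesis phi_holo : forall z, normc z < 1 -> holo phi z.
Hypothesis phi_disk : forall z, normc z < 1 -> normc (phi z) < 1.
Hypothesis Hm_holo : forall z, normc z < 1 -> holo Hm z.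
Hypothesis Hm_dom : forall z, normc z < 1 -> (1 - normc (phi z) ^+ 2)^-1 <= complex.Re (Hm z).
Let C := complex.Re (Hm 0).

Lemma mean_dom (g : R -> R) r : 0 <= r -> r < 1 -> cts 0 (2 * pi) g ->
  (forall t, g t <= complex.Re (Hm (r%:C * cis t))) -> (2 * pi)^-1 * rint 0 (2 * pi) g <= C.
Proof.
move=> r0 r1 cg H.
have ch : circ Hm r by apply: circ_disk => // z /Hm_holo/holo_ccont.
have -> : C = complex.Re (cmean Hm r).
  have [->|rn] := eqVneq r 0; first by rewrite cmean_at0.
  by rewrite mean_value // lt_def rn.
rewrite /cmean ReM [complex.Re (_%:C)]/= [complex.Im (_%:C)]/= mul0r subr0.
rewrite ler_pM2l ?invr_gt0 ?pi2_gt0 //; apply: rint_le => //.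
exact: (rcts_Re (circ_rcts ch)).
Qed.

Lemma C_ge0 : 0 <= C.
Proof.
apply: le_trans (Hm_dom _); last by rewrite cn0.
rewrite invr_ge0 subr_ge0 exprn_ile1 ?cn_ge0 // ltW // phi_disk //; by rewrite cn0.
Qed.

Lemma comp_holo f z : (forall z, normc z < 1 -> holo f z) -> normc z < 1 -> holo (fun z => f (phi z)) z.
Proof. by move=> hf z1; apply: holo_comp; [exact: phi_holo|apply: hf; exact: phi_disk]. Qed.

Lemma comp_circ f r : (forall z, normc z < 1 -> holo f z) -> 0 <= r -> r < 1 -> circ (fun z => f (phi z)) r.
Proof. by move=> hf; apply: circ_disk => z z1; apply/holo_ccont/comp_holo. Qed.

(** [pt_bound] at [phi z], divided by [nsq f], is below the majorant and can be averaged over the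
    circle. *)
Lemma msq_comp f r : H2 f -> 0 <= r -> r < 1 -> msq (fun z => f (phi z)) r <= C * nsq f.
Proof.
move=> F r0 r1; have cf := comp_circ F.1 r0 r1.
have [f0|f0] := eqVneq (nsq f) 0.
  rewrite f0 mulr0 msq_rint (@rint_eq _ _ _ _ (fun=> 0)).
    by rewrite rint_cst ?(ltW (pi2_gt0 R)) // mul0r mulr0.
  move=> t _ _; rewrite (nsq_eq0 F f0) ?cn0 ?expr0n //.
  by apply: phi_disk; rewrite cn_circle.
have f1 : 0 < nsq f by rewrite lt_def f0 nsq_ge0.
rewrite -ler_pdivrMr // msq_rint -mulrA (mulrC (rint _ _ _)) -(rintZ _ (cts_sq cf)).
apply: (mean_dom r0 r1).
  by move=> x ? ?; apply: cvgM; [exact: cvg_cst|exact: (cts_sq cf)].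
move=> t; have z1 : normc (r%:C * cis t) < 1 by rewrite cn_circle.
apply: le_trans (Hm_dom z1); rewrite [leLHS]mulrC ler_pdivrMr // [leRHS]mulrC.
by apply: pt_bound => //; exact: phi_disk.
Qed.

Lemma comp_H2 f : H2 f -> H2 (fun z => f (phi z)) /\ nsq (fun z => f (phi z)) <= C * nsq f.
Proof.
move=> F; split; last by apply: nsq_le => r; exact: msq_comp.
by split; [move=> z; exact: comp_holo F.1|exists (C * nsq f) => r; exact: msq_comp].
Qed.

Lemma sum_msq_le n (F : nat -> R[i] -> R[i]) r : (forall i, H2 (F i)) -> 0 <= r -> r < 1 ->
  (forall w, normc w < 1 -> \sum_(i < n) normc (F i w) ^+ 2 <= (1 - normc w ^+ 2)^-1) ->
  \sum_(i < n) msq (fun z => F i (phi z)) r <= C.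
Proof.
move=> hF r0 r1 H.
have [-> cS] := @sum_msq_rint (fun i z => F i (phi z)) r n (fun i => comp_circ (hF i).1 r0 r1).
apply: (mean_dom r0 r1); first exact: cS.
move=> t; have z1 : normc (r%:C * cis t) < 1 by rewrite cn_circle.
by apply: le_trans (Hm_dom z1); apply: H; exact: phi_disk.
Qed.

Lemma H2_pow k : H2 (fun z : R[i] => z ^+ k).
Proof.
split; first by move=> z _; apply: holoX; exact: holo_id.
exists 1 => r r0 r1; rewrite msq_rint mulrC ler_pdivrMr ?pi2_gt0 // -[X in _ <= 1 * X]subr0.
rewrite -rint_cst ?(ltW (pi2_gt0 R)) //; apply: rint_le.
- exact: (cts_sq (circ_pow r k)).
- by move=> x ? ?; exact: cvg_cst.
move=> t _ _; rewrite cnX cn_circle // -exprM exprn_ile1 //; exact: ltW.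
Qed.

(** The squared norms of the images of the orthonormal basis z^k form a series bounded by [C], so
    its tails are small. *)
Lemma pow_tail e : 0 < e -> exists n : nat, forall m r, 0 <= r -> r < 1 ->
  \sum_(k < m) msq (fun z => phi z ^+ (n + k)) r <= e.
Proof.
move=> e0; pose T k := nsq (fun z => phi z ^+ k).
have hT k : H2 (fun z => phi z ^+ k) by exact: (comp_H2 (H2_pow k)).1.
have SC n : \sum_(k < n) T k <= C.
  have W w : normc w < 1 -> \sum_(i < n) normc (w ^+ i) ^+ 2 <= (1 - normc w ^+ 2)^-1.
    move=> w1; under eq_bigr do rewrite cnX -exprM mulnC exprM.
    apply: sum_geo_le; first exact: sqr_ge0.
    by rewrite expr_lt1 ?cn_ge0.
  apply: (@sum_nsq_le n (fun k z => phi z ^+ k) C hT) => r r0 r1.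
  exact: (@sum_msq_le n (fun k z => z ^+ k) r H2_pow r0 r1 W).
pose A := [set \sum_(k < n) T k | n in setT].
have hA : has_sup A by split; [exists 0; exists 0%N => //; rewrite big_ord0|exists C => _ [n _ <-]].
have [x [n _ nE] hn] := sup_adherent e0 hA.
exists n => m r r0 r1; apply: (@le_trans _ _ (\sum_(k < m) T (n + k)%N)).
  by apply: ler_sum => k _; apply: msq_le_nsq.
have : \sum_(k < n + m) T k <= sup A.
  by apply: (@ub_le_sup _ A); [exists C => _ [j _ <-]|exists (n + m)%N].
rewrite big_split_ord /= nE; move: hn; lra.
Qed.

(** Cauchy-Schwarz pairs the coefficients of [Q] with the powers of [phi] of exponent at least [n],
    whose mean squares sum to at most [e]. The Taylor polynomial approximates [Q] uniformly on the
    image of one circle, which lies in a smaller disk. *)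
Lemma comp_tail a Q n (e : R) : ps a Q -> H2 Q -> (forall k, (k < n)%N -> a k = 0) -> 0 <= e ->
  (forall m r, 0 <= r -> r < 1 -> \sum_(k < m) msq (fun z => phi z ^+ (n + k)) r <= e) ->
  nsq (fun z => Q (phi z)) <= e * nsq Q.
Proof.
move=> A hQ a0 e0 He; apply: nsq_le => r r0 r1.
have cQ := comp_circ hQ.1 r0 r1; have q0 := nsq_ge0 hQ.
apply: (msq_approx cQ); first exact: mulr_ge0.
move=> d d0.
have ch : circ Hm r by apply: circ_disk => // z /Hm_holo/holo_ccont.
have [B [B0 HB]] := circle_bounded ch.
(* On the circle the majorant is at most [B], so [1 / (1 - |phi|^2) <= B + 1], that is,
   [|phi| <= p < 1]. *)
pose p := Num.sqrt (1 - (B + 1)^-1).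
have B1 : 0 < B + 1 by lra.
have B2 : (B + 1)^-1 <= 1 by rewrite invf_le1 //; lra.
have B3 : 0 < (B + 1)^-1 by rewrite invr_gt0.
have pE : p ^+ 2 = 1 - (B + 1)^-1 by rewrite sqr_sqrtr // subr_ge0.
have p1 : p < 1 by rewrite -(@expr_lt1 _ 2) ?sqrtr_ge0 // pE; lra.
have hp t : 0 <= t -> t <= 2 * pi -> normc (phi (r%:C * cis t)) <= p.
  move=> t0 t1; have z1 : normc (r%:C * cis t) < 1 by rewrite cn_circle.
  rewrite -(@ler_pXn2r _ 2) ?nnegrE ?cn_ge0 ?sqrtr_ge0 // pE.
  have := Hm_dom z1; have := HB t t0 t1; have := Re_le_cn (Hm (r%:C * cis t)).
  have := ler_norm (complex.Re (Hm (r%:C * cis t))).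
  move=> k1 k2 k3 k4.
  have : (1 - normc (phi (r%:C * cis t)) ^+ 2)^-1 <= B + 1 by lra.
  have y0 : 0 < 1 - normc (phi (r%:C * cis t)) ^+ 2.
    by rewrite subr_gt0 expr_lt1 ?cn_ge0 // phi_disk.
  move=> h; have : (B + 1)^-1 <= 1 - normc (phi (r%:C * cis t)) ^+ 2.
    by rewrite -[leRHS]invrK lef_pV2 ?posrE ?invr_gt0.
  lra.
pose p' := (1 + p) / 2.
have [p'0 p'1 pp'] : [/\ 0 < p', p' < 1 & p <= p'] by rewrite /p'; have := sqrtr_ge0 (1 - (B + 1)^-1); rewrite -/p; split; lra.
have [M [q [M0 qq0 q1 Hq]]] := A _ p'0 p'1.
have [N HN] := geo_cvg M qq0 q1 d0.
pose m := (n + N)%N.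
exists (fun z => pol a m (phi z)); split.
- by apply: comp_circ => // z _; exact: pol_holo.
- move=> t t0 t1; apply: le_trans (Hq m _ _) _; first by apply: le_trans (hp t t0 t1) pp'.
  by apply/ltW/HN; rewrite leq_addl.
have pw w : normc (pol a m w) ^+ 2 <= nsq Q * \sum_(k < N) normc (w ^+ (n + k)) ^+ 2.
  have -> : pol a m w = \sum_(k < N) a (n + k)%N * w ^+ (n + k).
    rewrite /pol big_split_ord /= big1 ?add0r // => k _; by rewrite a0 ?mul0r.
  apply: (@le_trans _ _ ((\sum_(k < N) normc (a (n + k)%N) * normc (w ^+ (n + k))) ^+ 2)).
    apply: lerXn2r; rewrite ?nnegrE ?cn_ge0 //.
      by apply: sumr_ge0 => i _; rewrite mulr_ge0 ?cn_ge0.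
    by apply: le_trans (cn_sum _ _ _) _; apply: ler_sum => k _; rewrite cnM.
  apply: le_trans (CS_sum (fun k => normc (a (n + k)%N)) (fun k => normc (w ^+ (n + k))) N) _.
  apply: ler_wpM2r; first by apply: sumr_ge0 => k _; exact: sqr_ge0.
  apply: le_trans (asq_le_nsq m A hQ); rewrite /asq big_split_ord /= [X in _ <= X + _]big1 ?add0r.
    by apply: ler_sum => k _; rewrite expr1n mulr1.
  by move=> k _; rewrite a0 // cn0 expr0n mul0r.
have cp : circ (fun z => pol a m (phi z)) r by apply: comp_circ => // z _; exact: pol_holo.
have [ES cS] := @sum_msq_rint (fun k z => phi z ^+ (n + k)) r N
  (fun k => comp_circ (H2_pow (n + k)).1 r0 r1).
apply: (@le_trans _ _ (nsq Q * \sum_(k < N) msq (fun z => phi z ^+ (n + k)) r)); last first.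
  by rewrite mulrC ler_wpM2r // He.
rewrite msq_rint ES mulrCA ler_pM2l ?invr_gt0 ?pi2_gt0 // -(rintZ _ cS).
apply: rint_le; first exact: (cts_sq cp).
  by move=> x ? ?; apply: cvgM; [exact: cvg_cst|exact: cS].
by move=> t _ _; exact: pw.
Qed.
End HilbertSchmidt.

(** * From weak to norm convergence under composition *)

Section CompositionCompact.
Variable R : realType.
Implicit Types (f g h : R[i] -> R[i]) (z w : R[i]) (r s t e : R) (a b : nat -> R[i]).

Lemma two_quarters (x y e : R) : x <= e / 4 -> y <= e / 4 -> 2 * x + 2 * y <= e.
Proof. lra. Qed.

Lemma asq_close a f e : ps a f -> H2 f -> 0 < e -> exists n, nsq f - e <= asq a n 1.
Proof.
move=> A F e0; apply: contrapT => /forallNP H.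
have K n : asq a n 1 <= nsq f - e by rewrite ltW // ltNge; apply/negP; exact: H.
by have [_ h] := H2_asq A K; lra.
Qed.

(** Split [g] into a Taylor polynomial, which sees finitely many coefficients of [d j], and a
    remainder of small norm, which is paired with a bounded sequence. *)
Lemma weak_ip (d : nat -> R[i] -> R[i]) (D : nat -> nat -> R[i]) (B : R) g :
  (forall j, H2 (d j) /\ nsq (d j) <= B) -> (forall j, ps (D j) (d j)) ->
  (forall n, ccvg (fun j => D j n) 0) -> H2 g -> ccvg (fun j => ip (d j) g) 0.
Proof.
move=> hd hD D0 hg e e0; have [b hb] := H2_ps hg.
have B0 : 0 <= B by apply: le_trans (hd 0%N).2; apply: nsq_ge0; exact: (hd 0%N).1.
(* Makes [(B + 1) * eta] the square of [e / 2], as Cauchy-Schwarz requires for the remainder. *)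
pose eta := e ^+ 2 / (4 * (B + 1)).
have B1 : 0 < B + 1 by lra.
have eta0 : 0 < eta by rewrite divr_gt0 ?exprn_gt0 // mulr_gt0.
have [n hn] := asq_close hb hg eta0.
have hp := ps_pol b n; pose G z := g z - pol b n z.
have hP : H2 (pol b n) by exact: (@H2_sum R n b (fun k z => z ^+ k) (@H2_pow R)).
have hG : H2 G by exact: H2B.
have nG : nsq G <= eta.
  apply: (H2_asq (psB hb hp) _).2 => m.
  have := asq_le_nsq (n + m) hb hg; rewrite /asq big_split_ord /= => h1.
  apply: (@le_trans _ _ (\sum_(i < m) normc (b (n + i)%N) ^+ 2 * 1 ^+ ((n + i) * 2))).
    have -> : \sum_(k < m) normc (b k - (if (k < n)%N then b k else 0)) ^+ 2 * 1 ^+ (k * 2) =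
        \sum_(k < m) (if (k < n)%N then 0 else normc (b k) ^+ 2 * 1 ^+ (k * 2)).
      by apply: eq_bigr => k _; case: ifP => _; rewrite ?subrr ?cn0 ?expr0n ?mul0r ?subr0.
    have pos k : 0 <= (if (k < n)%N then 0 else normc (b k) ^+ 2 * 1 ^+ (k * 2)).
      by case: ifP => // _; rewrite mulr_ge0 ?sqr_ge0 // expr1n.
    apply: (@le_trans _ _ (\sum_(k < n + m) (if (k < n)%N then 0 else normc (b k) ^+ 2 * 1 ^+ (k * 2)))).
      rewrite addnC big_split_ord /= lerDl; apply: sumr_ge0 => k _; exact: pos.
    rewrite big_split_ord /= big1 ?add0r; last by move=> k _; rewrite ltn_ord.
    by apply: ler_sum => k _; rewrite ltnNge leq_addr.
  by move: hn h1; rewrite /asq; lra.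
have /choice[N HN] : forall k, exists N : nat, forall j, (N <= j)%N ->
    normc (D j k - 0) < e / 2 / (n.+1%:R * (normc (b k) + 1)).
  move=> k; apply: D0; have b0 := cn_ge0 (b k).
  by rewrite !divr_gt0 // mulr_gt0 //; lra.
exists (\max_(k < n) N k)%N => j hj; rewrite subr0.
have [hdj ndj] := hd j.
have E : ip (d j) g = ip (d j) (pol b n) + ip (d j) G.
  rewrite -(ipDr hP hG hdj); congr (ip _ _).
  by apply/funext => z; rewrite /G addrC subrK.
have E2 : ip (d j) (pol b n) = \sum_(k < n) conjc (b k) * D j k.
  rewrite (ipC hP hdj) (@ip_sum R n b (fun k z => z ^+ k) (d j) (@H2_pow R) hdj).
  rewrite conj_sum; apply: eq_bigr => k _.
  by rewrite conjM -(ipC (@H2_pow R k) hdj) (ip_pow _ (hD j) hdj).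
rewrite E E2; apply: le_lt_trans (cnD _ _) _.
have h1 : normc (\sum_(k < n) conjc (b k) * D j k) < e / 2.
  apply: (@le_lt_trans _ _ (\sum_(k < n) (e / 2 / n.+1%:R))).
    apply: le_trans (cn_sum _ _ _) _; apply: ler_sum => k _.
    have jk : (N k <= j)%N by apply: leq_trans hj; exact: leq_bigmax.
    have := HN k j jk; rewrite subr0 cnM cnJ => h; have b0 := cn_ge0 (b k).
    apply: (@le_trans _ _ ((normc (b k) + 1) * (e / 2 / (n.+1%:R * (normc (b k) + 1))))).
      by apply: ler_pM; rewrite ?cn_ge0 // ?(ltW h) // lerDl.
    have n0 : n.+1%:R != 0 :> R by rewrite pnatr_eq0.
    have b1 : normc (b k) + 1 != 0 by rewrite gt_eqF //; lra.
    by move: (normc (b k) + 1) (n.+1%:R) b1 n0 => x y x0 y0; rewrite le_eqVlt; apply/orP; left; apply/eqP; field; rewrite x0 y0.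
  rewrite sumr_const card_ord -[ltLHS]mulr_natr -mulrA gtr_pMr ?divr_gt0 //.
  by rewrite mulrC ltr_pdivrMr // mul1r ltr_nat.
have h2 : normc (ip (d j) G) <= e / 2.
  rewrite -(@ler_pXn2r _ 2) ?nnegrE ?cn_ge0 ?divr_ge0 ?(ltW e0) //.
  apply: le_trans (cauchy_schwarz hdj hG) _.
  apply: (@le_trans _ _ ((B + 1) * eta)).
    apply: ler_pM => //; [exact: nsq_ge0|exact: nsq_ge0|lra].
  by rewrite /eta le_eqVlt; apply/orP; left; apply/eqP; field; rewrite gt_eqF.
lra.
Qed.

Variables (phi Hm : R[i] -> R[i]).
Hypothesis phi_holo : forall z, normc z < 1 -> holo phi z.
Hypothesis phi_disk : forall z, normc z < 1 -> normc (phi z) < 1.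
Hypothesis Hm_holo : forall z, normc z < 1 -> holo Hm z.
Hypothesis Hm_dom : forall z, normc z < 1 -> (1 - normc (phi z) ^+ 2)^-1 <= complex.Re (Hm z).
Let C := complex.Re (Hm 0).
Let CH2 f (F : H2 f) := comp_H2 phi_holo phi_disk Hm_holo Hm_dom F.

(** Split [d j] at degree [n]: the polynomial part tends to 0 with its coefficients, and the rest is
    small after composition, uniformly in [j], by [comp_tail]. *)
Lemma strong_cvg (d : nat -> R[i] -> R[i]) (D : nat -> nat -> R[i]) (B : R) :
  (forall j, H2 (d j) /\ nsq (d j) <= B) -> (forall j, ps (D j) (d j)) ->
  (forall n, ccvg (fun j => D j n) 0) ->
  forall e, 0 < e -> exists N : nat, forall j, (N <= j)%N -> nsq (fun z => d j (phi z)) <= e.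
Proof.
move=> hd hD D0 e e0.
have B0 : 0 <= B by apply: le_trans (hd 0%N).2; apply: nsq_ge0; exact: (hd 0%N).1.
have B1 : 0 < B + 1 by lra.
have C0 : 0 <= C by exact: (C_ge0 phi_disk Hm_dom).
have e1 : 0 < e / (4 * (B + 1)) by rewrite divr_gt0 // mulr_gt0.
have [n Hn] := pow_tail phi_holo phi_disk Hm_holo Hm_dom e1.
pose x := Num.min 1 (e / (4 * (C + 1) * n.+1%:R)).
have C1 : 0 < C + 1 by lra.
have x0 : 0 < x by rewrite lt_min ltr01 divr_gt0 // mulr_gt0 // mulr_gt0.
have [x1 x2] : x <= 1 /\ x <= e / (4 * (C + 1) * n.+1%:R) by rewrite /x !ge_min !lexx orbT.
have /choice[N HN] : forall k, exists N : nat, forall j, (N <= j)%N -> normc (D j k - 0) < x.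
  by move=> k; exact: D0.
exists (\max_(k < n) N k)%N => j hj; have [hdj ndj] := hd j.
have hP : H2 (pol (D j) n) by exact: (@H2_sum R n (D j) (fun k z => z ^+ k) (@H2_pow R)).
have hp := ps_pol (D j) n; pose Q z := d j z - pol (D j) n z.
have hQ : H2 Q by exact: H2B.
have nQ : nsq Q <= B.
  apply: (H2_asq (psB (hD j) hp) _).2 => m; apply: le_trans ndj; apply: le_trans (asq_le_nsq m (hD j) hdj).
  apply: ler_sum => k _; rewrite expr1n !mulr1; case: ifP => _; rewrite ?subr0 // subrr cn0 expr0n.
  exact: sqr_ge0.
have q0 k : (k < n)%N -> D j k - (if (k < n)%N then D j k else 0) = 0 by move=> ->; rewrite subrr.
have hq := comp_tail phi_holo phi_disk Hm_holo Hm_dom (psB (hD j) hp) hQ q0 (ltW e1) Hn.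
have nP : nsq (pol (D j) n) <= x * n%:R.
  apply: (H2_asq hp _).2 => m.
  have pos k : 0 <= normc (if (k < n)%N then D j k else 0) ^+ 2 * 1 ^+ (k * 2).
    by rewrite expr1n mulr1 sqr_ge0.
  apply: (@le_trans _ _ (asq (fun k => if (k < n)%N then D j k else 0) (n + m) 1)).
    by rewrite /asq addnC big_split_ord /= lerDl; apply: sumr_ge0 => k _; exact: pos.
  rewrite /asq big_split_ord /= [X in _ + X <= _]big1 ?addr0; last first.
    by move=> k _; rewrite ltnNge leq_addr /= cn0 expr0n mul0r.
  apply: (@le_trans _ _ (\sum_(k < n) x)); last by rewrite sumr_const card_ord -[leLHS]mulr_natr.
  apply: ler_sum => k _; rewrite ltn_ord expr1n mulr1.
  have jk : (N k <= j)%N by apply: leq_trans hj; exact: leq_bigmax.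
  have := HN k j jk; rewrite subr0 => h; have := cn_ge0 (D j k).
  move=> y0; rewrite -[leRHS]mulr1 expr2.
  by apply: ler_pM => //; [exact: ltW|exact: le_trans (ltW h) x1].
have E : (fun z => d j (phi z)) = (fun z => pol (D j) n (phi z) + Q (phi z)).
  by apply/funext => z; rewrite /Q addrC subrK.
rewrite E; apply: le_trans (nsqD_le (CH2 hP).1 (CH2 hQ).1) _.
have h1 : nsq (fun z => pol (D j) n (phi z)) <= C * (x * n%:R).
  by apply: le_trans (CH2 hP).2 _; rewrite ler_wpM2l.
have h2 : nsq (fun z => Q (phi z)) <= e / 4.
  apply: le_trans hq _; apply: (@le_trans _ _ (e / (4 * (B + 1)) * (B + 1))).
    by apply: (ler_wpM2l (ltW e1)); apply: (le_trans nQ); rewrite lerDl.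
  by rewrite le_eqVlt; apply/orP; left; apply/eqP; field; rewrite gt_eqF.
have h3 : C * (x * n%:R) <= e / 4.
  apply: (@le_trans _ _ ((C + 1) * (e / (4 * (C + 1) * n.+1%:R) * n.+1%:R))).
    apply: ler_pM => //; [by rewrite mulr_ge0 // ltW|by rewrite lerDl|].
    by apply: ler_pM => //; [exact: ltW|rewrite ler_nat].
  have n0 : n.+1%:R != 0 :> R by rewrite pnatr_eq0.
  have c0 : C + 1 != 0 by rewrite gt_eqF.
  by move: (C + 1) (n.+1%:R) c0 n0 => u v u0 v0; rewrite le_eqVlt; apply/orP; left; apply/eqP; field; rewrite u0 v0.
exact: two_quarters (le_trans h1 h3) h2.
Qed.

Lemma comp_compact (u : nat -> R[i] -> R[i]) : (forall j, H2 (u j) /\ nsq (u j) <= 1) ->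
  exists (k : nat -> nat) v, [/\ forall j, (k j < k j.+1)%N, H2 v /\ nsq v <= 1,
    forall e, 0 < e -> exists N : nat, forall j, (N <= j)%N ->
      nsq (fun z => u (k j) (phi z) - v (phi z)) <= e &
    forall g, H2 g -> ccvg (fun j => ip (u (k j)) g) (ip v g)].
Proof.
move=> hu; have [k [v [A [a [kinc [hv nv] av Au Aa]]]]] := weak_compact hu.
have hd j : H2 (fun z => u (k j) z - v z) /\ nsq (fun z => u (k j) z - v z) <= 4.
  split; first by apply: H2B => //; exact: (hu (k j)).1.
  have -> : (fun z => u (k j) z - v z) = (fun z => u (k j) z + -1 * v z).
    by apply/funext => z; rewrite mulN1r.
  apply: le_trans (nsqD_le (hu (k j)).1 (H2Z (-1) hv)) _.
  by rewrite nsqZ // cnN cn1 expr1n mul1r; have := (hu (k j)).2; lra.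
have hD j := psB (Au j) av.
have D0 n : ccvg (fun j => A j n - a n) 0.
  by move=> e /(Aa n)[N HN]; exists N => j /HN; rewrite subr0.
exists k, v; split=> //; first exact: (strong_cvg hd hD D0).
move=> g hg e e0; have [N HN] := weak_ip hd hD D0 hg e0; exists N => j /HN.
have -> : (fun z => u (k j) z - v z) = (fun z => u (k j) z + -1 * v z).
  by apply/funext => z; rewrite mulN1r.
by rewrite (ipD (hu (k j)).1 (H2Z (-1) hv) hg) (ipZ _ hv hg) mulN1r subr0.
Qed.

(** For fixed [w], the combination [f] of the [E i] with coefficients the conjugates of [E i w]
    satisfies [f w = nsq f = S]. Then [pt_bound] reads S^2 <= S / (1 - |w|^2): Bessel's inequality
    for the kernel at [w]. *)
Lemma bessel_hs n (E : nat -> R[i] -> R[i]) : (forall i, H2 (E i)) ->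
  (forall i j, (i < n)%N -> (j < n)%N -> ip (E i) (E j) = (i == j)%:R) ->
  \sum_(i < n) nsq (fun z => E i (phi z)) <= C.
Proof.
move=> hE on; apply: (@sum_nsq_le R n (fun i z => E i (phi z))).
  by move=> i; exact: (CH2 (hE i)).1.
move=> r r0 r1; apply: (@sum_msq_le R phi Hm phi_holo phi_disk Hm_holo Hm_dom n E r hE r0 r1).
move=> w w1; pose c i := conjc (E i w); pose f z := \sum_(i < n) c i * E i z.
have hf : H2 f by exact: H2_sum.
set S := \sum_(i < n) _; have S0 : 0 <= S by apply: sumr_ge0 => i _; exact: sqr_ge0.
have fw : f w = S%:C.
  by rewrite /f /S rmorph_sum; apply: eq_bigr => i _; rewrite /c mulrC mulcJ.
have nf : nsq f = S.
  apply: (@complexI R); rewrite -(ip_self hf) -fw /f.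
  rewrite (ip_sum n c hE hf); apply: eq_bigr => i _; congr (_ * _).
  rewrite (ipC hf (hE i)) (ip_sum n c hE (hE i)) (bigD1 i) //= on // eqxx mulr1 big1 ?addr0.
    by rewrite /c; apply: cplx_ext; rewrite ?ReJ ?ImJ ?opprK.
  move=> k ki; rewrite on // (_ : (k == i :> nat) = false) ?mulr0 //.
  by apply: contraNF ki => /eqP ki; apply/eqP/val_inj.
have h := pt_bound hf w1; rewrite fw nf cnR ger0_norm // expr2 in h.
have [->|Sn] := eqVneq S 0.
  by rewrite invr_ge0 subr_ge0 exprn_ile1 ?cn_ge0 // ltW.
by move: h; rewrite ler_pM2l // lt_def Sn.
Qed.
End CompositionCompact.

(** * Singular systems and the min-max principle *)

Opaque ip nsq.
Section Spectral.
Variable R : realType.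
Implicit Types (f g h u v : R[i] -> R[i]) (z w c : R[i]) (r t : R).

(** The weight [x] keeps the factor of [nsq f] close to 1, which the factor 2 of [nsqD_le] would
    not. *)
Lemma nsqB_le f g (x : R) : H2 f -> H2 g -> 0 < x ->
  nsq (fun z => f z + g z) <= (1 + x) * nsq f + (1 + x^-1) * nsq g.
Proof.
move=> F G x0; have := nsq_ge0 (H2D F (H2Z (- x^-1%:C) G)).
rewrite !nsqD ?nsqZ ?ipZr //; try exact: H2Z.
rewrite cnN cnR ger0_norm ?invr_ge0 ?(ltW x0) // conjN conjR.
rewrite -rmorphN ReM [complex.Re (_%:C)]/= [complex.Im (_%:C)]/= mul0r subr0.
set X := nsq f; set Y := nsq g; set Z := complex.Re _ => h.
have : 0 <= x * (X + x^-1 ^+ 2 * Y + 2 * (- x^-1 * Z)) by rewrite mulr_ge0 // ltW.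
have -> : x * (X + x^-1 ^+ 2 * Y + 2 * (- x^-1 * Z)) = x * X + x^-1 * Y - 2 * Z.
  by field; rewrite gt_eqF.
lra.
Qed.

Lemma Re_comb (M : R) c (x y : R[i]) : complex.Re (conjc c * (M%:C * x - y)) =
  M * complex.Re (conjc c * x) - complex.Re (conjc c * y).
Proof. by case: c x y => [c1 c2] [x1 x2] [y1 y2] /=; ring. Qed.

Lemma quad_id (M a b d n x y : R) : M * (a + n * b + 2 * x) - (M * a + n * d + 2 * y) =
  2 * (M * x - y) + n * (M * b - d).
Proof. ring. Qed.

Lemma nsq_0 : nsq (fun _ : R[i] => 0) = 0 :> R.
Proof.
have E : (fun _ : R[i] => 0) = (fun z => 0 * (fun _ : R[i] => 0 : R[i]) z).
  by apply/funext => z; rewrite mul0r.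
by rewrite E (nsqZ 0 (@H2_0 R)) cn0 expr0n mul0r.
Qed.

Lemma ip_0l g : H2 g -> ip (fun=> 0) g = 0.
Proof.
move=> G; have E : (fun _ : R[i] => 0) = (fun z => 0 * (fun _ : R[i] => 0 : R[i]) z).
  by apply/funext => z; rewrite mul0r.
by rewrite E (ipZ 0 (@H2_0 R) G) mul0r.
Qed.

Lemma ip_0r g : H2 g -> ip g (fun=> 0) = 0.
Proof. by move=> G; rewrite (ipC (@H2_0 R) G) ip_0l //; apply: cplx_ext; rewrite /= ?oppr0. Qed.

Variables (phi : R[i] -> R[i]) (C : R).
Hypothesis phi_H2 : forall f, H2 f -> H2 (fun z => f (phi z)) /\ nsq (fun z => f (phi z)) <= C * nsq f.
Hypothesis phi_compact : forall u : nat -> R[i] -> R[i], (forall j, H2 (u j) /\ nsq (u j) <= 1) ->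
  exists (k : nat -> nat) v, [/\ forall j, (k j < k j.+1)%N, H2 v /\ nsq v <= 1,
    forall e : R, 0 < e -> exists N : nat, forall j, (N <= j)%N ->
      nsq (fun z => u (k j) (phi z) - v (phi z)) <= e &
    forall g, H2 g -> ccvg (fun j => ip (u (k j)) g) (ip v g)].

(** Being a composition, [T] is linear by conversion: sums and multiples pass through it without
    rewriting. *)
Let T f : R[i] -> R[i] := fun z => f (phi z).
Let TH f (F : H2 f) : H2 (T f) := (phi_H2 F).1.
Let TN f (F : H2 f) : nsq (T f) <= C * nsq f := (phi_H2 F).2.

Definition orth_to n (E : nat -> R[i] -> R[i]) f := forall i, (i < n)%N -> ip f (E i) = 0.

Lemma incr_ge (k : nat -> nat) : (forall j, (k j < k j.+1)%N) -> forall j, (j <= k j)%N.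
Proof. by move=> h; elim=> // j IH; exact: leq_ltn_trans IH (h j). Qed.

(** Along a subsequence of a maximizing sequence, [u] converges weakly and [T u] in norm:
    orthogonality to [E] survives the first limit and the maximal value the second. *)
Lemma maximizer n E : (forall i, (i < n)%N -> H2 (E i)) -> exists (M : R) v,
  [/\ 0 <= M, H2 v /\ nsq v <= 1, orth_to n E v, nsq (T v) = M &
      forall f, H2 f -> orth_to n E f -> nsq (T f) <= M * nsq f].
Proof.
move=> hE.
pose A := [set nsq (T f) | f in [set f | [/\ H2 f, orth_to n E f & nsq f <= 1]]].
have [C1 C2] : 0 <= Num.max C 0 /\ C <= Num.max C 0 by rewrite !le_max !lexx orbT.
have ubA : ubound A (Num.max C 0).
  move=> _ [f [F _ f1] <-]; apply: le_trans (TN F) _.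
  apply: (@le_trans _ _ (Num.max C 0 * nsq f)); first by rewrite ler_wpM2r // nsq_ge0.
  by rewrite ler_piMr.
have n0 := nsq_0; have ip0 := ip_0l.
have A0 : A 0.
  exists (fun=> 0); last exact: n0.
  by split; [exact: H2_0|move=> i /hE; exact: ip0|rewrite n0].
have hA : has_sup A by split; [exists 0|exists (Num.max C 0)].
pose M := sup A.
have M0 : 0 <= M by apply: (@ub_le_sup _ A) => //; exact: hA.2.
have hM f : H2 f -> orth_to n E f -> nsq (T f) <= M * nsq f.
  move=> F oF; have [f0|f0] := eqVneq (nsq f) 0.
    by rewrite f0 mulr0; apply: le_trans (TN F) _; rewrite f0 mulr0.
  have f1 : 0 < nsq f by rewrite lt_def f0 nsq_ge0.
  pose c : R[i] := ((Num.sqrt (nsq f))^-1)%:C.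
  have c2 : normc c ^+ 2 = (nsq f)^-1.
    by rewrite cnR ger0_norm ?invr_ge0 ?sqrtr_ge0 // exprVn sqr_sqrtr // ltW.
  have : A (nsq (T (fun z => c * f z))).
    exists (fun z => c * f z) => //; split; first exact: H2Z.
      by move=> i hi; rewrite ipZ ?oF ?mulr0 //; exact: hE.
    by rewrite nsqZ // c2 mulVf.
  have -> : nsq (T (fun z => c * f z)) = (nsq f)^-1 * nsq (T f).
    by rewrite -c2 -nsqZ //; exact: TH.
  move=> /(ub_le_sup hA.2); rewrite -/M mulrC ler_pdivrMr //.
have /choice[u hu] : forall j : nat, exists f, [/\ H2 f, orth_to n E f, nsq f <= 1 & M - j.+1%:R^-1 < nsq (T f)].
  move=> j; have j0 : (0 : R) < j.+1%:R^-1 by rewrite invr_gt0.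
  by have [_ [f [F oF f1] <-] h] := sup_adherent j0 hA; exists f.
have [|k [v [kinc [V v1] Tuv wuv]]] := phi_compact (u := u).
  by move=> j; have [] := hu j.
have ov : orth_to n E v.
  move=> i hi; apply/eqP; rewrite -cn_eq0; apply/eqP/le_anti; rewrite cn_ge0 andbT.
  apply/ler_addgt0Pr => e e0; rewrite add0r; have [N /(_ N (leqnn N))] := wuv _ (hE i hi) e e0.
  by have [_ o _ _] := hu (k N); rewrite o // sub0r cnN => /ltW.
exists M, v; split=> //.
apply/le_anti/andP; split; first by apply: (ub_le_sup hA.2); exists v.
have TV := TH V.
apply/ler_addgt0Pr => e e0; have K0 := nsq_ge0 TV; set K := nsq (T v) in K0 *.
(* Three errors of at most [e / 4] each: [x K], the weighted distance from [T (u (k j))] to [T v],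
   and the defect of the maximizing sequence. *)
pose x := e / 4 / (K + 1); have K1 : 0 < K + 1 by lra.
have x0 : 0 < x by rewrite !divr_gt0.
have xi0 : 0 < 1 + x^-1 by rewrite addr_gt0 ?invr_gt0.
have d0 : 0 < e / 4 / (1 + x^-1) by rewrite !divr_gt0.
have [N HN] := Tuv _ d0.
pose N' := Num.bound (4 / e); pose j := maxn N N'.
have [U oU u1 hj] := hu (k j).
have hk : (k j).+1%:R^-1 < e / 4.
  rewrite invf_plt ?posrE ?divr_gt0 // invf_div.
  apply: lt_le_trans (archi_boundP _) _; first by rewrite divr_ge0 // ltW.
  rewrite ler_nat -/N'; apply: leq_trans (leqnSn _); apply: leq_trans (incr_ge kinc j).
  by rewrite leq_maxr.
have hd := HN j (leq_maxl _ _).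
have D : H2 (fun z => u (k j) (phi z) - v (phi z)) by apply: H2B; exact: TH.
have E1 : T (u (k j)) = (fun z => T v z + (u (k j) (phi z) - v (phi z))).
  by apply/funext => z; rewrite /T addrC subrK.
have h1 : nsq (T (u (k j))) <= (1 + x) * K + (1 + x^-1) * nsq (fun z => u (k j) (phi z) - v (phi z)).
  by rewrite E1; exact: nsqB_le.
have h2 : (1 + x^-1) * nsq (fun z => u (k j) (phi z) - v (phi z)) <= e / 4.
  by rewrite mulrC -ler_pdivlMr.
have h3 : x * K <= e / 4.
  apply: (@le_trans _ _ (x * (K + 1))); first by rewrite ler_wpM2l ?(ltW x0) // lerDl.
  by rewrite /x divfK // gt_eqF.
move: h1 h2 h3 hj hk; rewrite mulrDl mul1r.
set X := nsq _; set Y := x * K; set Z := _ * nsq _; set W := (k j).+1%:R^-1; clearbody X Y Z W K.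
by move=> *; lra.
Qed.

(** First variation: [M |f|^2 - |T f|^2] is nonnegative on the complement and vanishes at [v], so
    its linear part [B] at [v] in the direction [g] is 0. *)
Lemma maximizer_eigen n E (M : R) v : (forall i, (i < n)%N -> H2 (E i)) -> H2 v -> orth_to n E v ->
  nsq (T v) = M * nsq v -> (forall f, H2 f -> orth_to n E f -> nsq (T f) <= M * nsq f) ->
  forall g, H2 g -> orth_to n E g -> ip (T v) (T g) = M%:C * ip v g.
Proof.
move=> hE V ov Mv HM g G og.
pose B := M%:C * ip v g - ip (T v) (T g).
suff : B = 0 by move/eqP; rewrite subr_eq0 => /eqP.
pose Q := M * nsq g - nsq (T g).
have Q0 : 0 <= Q by rewrite subr_ge0 HM.
have [TV TG] := (TH V, TH G).
have key c : 0 <= 2 * complex.Re (conjc c * B) + normc c ^+ 2 * Q.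
  have W : H2 (fun z => v z + c * g z) by apply: H2D => //; exact: H2Z.
  have oW : orth_to n E (fun z => v z + c * g z).
    by move=> i hi; have Ei := hE i hi; rewrite (ipD V (H2Z c G) Ei) (ipZ _ G Ei) ov // og // mulr0 addr0.
  have := HM _ W oW.
  have -> : nsq (T (fun z => v z + c * g z)) =
    nsq (T v) + normc c ^+ 2 * nsq (T g) + 2 * complex.Re (conjc c * ip (T v) (T g)).
    by rewrite -(nsqZ c TG) -(ipZr c TG TV); exact: (nsqD TV (H2Z c TG)).
  rewrite (nsqD V (H2Z c G)) (nsqZ c G) (ipZr c G V) Mv.
  rewrite (Re_comb M c (ip v g) (ip (T v) (T g)) : complex.Re (conjc c * B) = _).
  by rewrite -subr_ge0 quad_id.
have Q1 : 0 < Q + 1 by lra.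
(* This multiple of [g] gives the value [- |B|^2 (Q + 2) / (Q + 1)^2], nonnegative only if
   [B = 0]. *)
have := key (- ((Q + 1)^-1%:C * B)).
rewrite conjN conjM conjR cnN cnM cnR ger0_norm ?invr_ge0 ?(ltW Q1) //.
rewrite mulNr -mulrA (mulrC (conjc B)) mulcJ -rmorphM -rmorphN [complex.Re _]/= exprMn.
set b := normc B ^+ 2; have b0 : 0 <= b by exact: sqr_ge0.
have -> : 2 * - ((Q + 1)^-1 * b) + (Q + 1)^-1 ^+ 2 * b * Q = - (b * ((Q + 2) / (Q + 1) ^+ 2)).
  by field; rewrite gt_eqF.
rewrite oppr_ge0 => h; have d0 : 0 < (Q + 2) / (Q + 1) ^+ 2 by rewrite divr_gt0 ?exprn_gt0 //; lra.
have : b <= 0 by rewrite -(pmulr_lle0 _ d0).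
move=> b1; apply/eqP; rewrite -cn_eq0 -sqrf_eq0; apply/eqP/le_anti/andP; by split.
Qed.

Definition next_vec n (E : nat -> R[i] -> R[i]) (x : R * (R[i] -> R[i])) :=
  [/\ 0 <= x.1 /\ H2 x.2, orth_to n E x.2, (0 < x.1 -> nsq x.2 = 1) /\ (x.1 = 0 -> x.2 = fun=> 0),
   forall f, H2 f -> orth_to n E f -> nsq (T f) <= x.1 ^+ 2 * nsq f &
   forall g, H2 g -> orth_to n E g -> ip (T x.2) (T g) = (x.1 ^+ 2)%:C * ip x.2 g].

Lemma next_vec_exists n E : (forall i, (i < n)%N -> H2 (E i)) -> exists x, next_vec n E x.
Proof.
move=> hE; have [M [v [M0 [V v1] ov Mv HM]]] := maximizer hE.
have ip0 := ip_0l.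
have [Mz|Mn] := eqVneq M 0.
  exists (0, fun=> 0); split=> //=.
  - by split; [|exact: H2_0].
  - by move=> i hi; apply: ip0; exact: hE.
  - by split=> //; rewrite ltxx.
  - by move=> f F oF; rewrite expr0n; have := HM f F oF; rewrite Mz !mul0r.
  - by move=> g G _; rewrite (ip0 g G) mulr0; apply: ip0; exact: TH.
have Mp : 0 < M by rewrite lt_def Mn.
have v1' : nsq v = 1.
  apply/le_anti; rewrite v1 /=; have := HM v V ov; rewrite Mv.
  by rewrite -{1}[M]mulr1 ler_pM2l.
have sM : Num.sqrt M ^+ 2 = M by rewrite sqr_sqrtr.
exists (Num.sqrt M, v); split; rewrite /= ?sM //.
- by split=> // s0; move: Mp; rewrite -sM s0 expr0n ltxx.
- by move=> g G og; apply: (maximizer_eigen hE V ov _ HM); rewrite // v1' mulr1.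
Qed.

(** Each new vector maximizes on the complement of the earlier ones. This gives the eigenvector
    relation only against [g] in that complement; it extends to all [g] because the earlier
    relations make [T (e n)] orthogonal to every [T (e i)] with [i < n]. *)
Theorem singular_system : exists (s : nat -> R) (e : nat -> R[i] -> R[i]),
  [/\ forall n, 0 <= s n, forall n, s n.+1 <= s n,
      (forall n, H2 (e n)) /\ (forall n, s n = 0 -> e n = fun=> 0),
      (forall n, forall g, H2 g -> ip (T (e n)) (T g) = (s n ^+ 2)%:C * ip (e n) g) /\
      (forall m n, 0 < s m -> 0 < s n -> ip (e m) (e n) = (m == n)%:R) &
      forall n f, H2 f -> orth_to n e f -> nsq (T f) <= s n ^+ 2 * nsq f].
Proof.
have /choice[F HF] : forall nE : nat * (nat -> R[i] -> R[i]), exists x,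
    (forall i, (i < nE.1)%N -> H2 (nE.2 i)) -> next_vec nE.1 nE.2 x.
  move=> [n E]; have [h|h] := pselect (forall i, (i < n)%N -> H2 (E i)).
    by have [x hx] := next_vec_exists h; exists x.
  by exists (0, fun=> 0).
(* The choice [F] depends on the whole earlier sequence, so the recursion builds initial segments:
   [st n] holds the first [n] vectors and is 0 beyond. *)
pose st := fix st (n : nat) : nat -> R[i] -> R[i] :=
  if n is m.+1 then (fun i => if i == m then (F (m, st m)).2 else st m i) else fun=> fun=> 0.
pose e n := (F (n, st n)).2; pose s n := (F (n, st n)).1.
have stE n i : (i < n)%N -> st n i = e i.
  elim: n => // n IH; rewrite ltnS leq_eqVlt => /orP[/eqP->|hi] /=; first by rewrite eqxx.
  by rewrite ltn_eqF // IH.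
have hst n : forall i, (i < n)%N -> H2 (st n i).
  elim: n => // n IH i; rewrite ltnS /= => hi; case: eqP => [_|/eqP ni].
    by have [[]] := HF (n, st n) IH.
  by apply: IH; rewrite ltn_neqAle ni.
have hn n : next_vec n (st n) (F (n, st n)) := HF (n, st n) (hst n).
have o2 n f : orth_to n (st n) f <-> orth_to n e f.
  by split=> h i hi; have := h i hi; rewrite stE.
have eH n : H2 (e n) by have [[]] := hn n.
have s0 n : 0 <= s n by have [[]] := hn n.
have e0 n : s n = 0 -> e n = fun=> 0 by have [_ _ []] := hn n.
have e1 n : 0 < s n -> nsq (e n) = 1 by have [_ _ []] := hn n.
have eo n : orth_to n e (e n) by have [_ h _ _ _] := hn n; exact: (o2 n (e n)).1 h.
have eB n f : H2 f -> orth_to n e f -> nsq (T f) <= s n ^+ 2 * nsq f.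
  by move=> hf /(o2 n f).2 of_; have [_ _ _ h _] := hn n; exact: h f hf of_.
have eE n g : H2 g -> orth_to n e g -> ip (T (e n)) (T g) = (s n ^+ 2)%:C * ip (e n) g.
  by move=> hg /(o2 n g).2 og; have [_ _ _ _ h] := hn n; exact: h g hg og.
have ort i j : i != j -> ip (e i) (e j) = 0.
  case: (ltngtP i j) => // [ij|ji] _; last exact: eo.
  by rewrite (ipC (eH j) (eH i)) (eo j i ij); apply: cplx_ext; rewrite /= ?oppr0.
have on i j : 0 < s i -> 0 < s j -> ip (e i) (e j) = (i == j)%:R.
  move=> si sj; case: (eqVneq i j) => [<-|ij]; last exact: ort.
  by rewrite ip_self // e1.
have Tself n : nsq (T (e n)) = s n ^+ 2 * nsq (e n).
  apply: (@complexI R); rewrite -(ip_self (TH (eH n))) (eE n _ (eH n) (eo n)) ip_self //.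
  by rewrite -rmorphM.
have sdec n : s n.+1 <= s n.
  have [z|nz] := eqVneq (s n.+1) 0; first by rewrite z.
  have p : 0 < s n.+1 by rewrite lt_def nz s0.
  rewrite -(@ler_pXn2r _ 2) ?nnegrE //.
  have := eB n (e n.+1) (eH _); rewrite Tself e1 // !mulr1; apply.
  by move=> i hi; apply: eo; exact: ltnW.
exists s, e; split=> //; split=> // n.
(* [g] is replaced by its component [g'] orthogonal to the first [n] vectors; the induction
   hypothesis disposes of the projection. *)
elim/ltn_ind: n => n IH g G.
pose c i := ip g (e i).
pose g' z := g z - \sum_(i < n) c i * e i z.
have S : H2 (fun z => \sum_(i < n) c i * e i z) by exact: H2_sum.
have G' : H2 g' by exact: H2B.
have og' : orth_to n e g'.
  move=> i hi.
  have -> : g' = (fun z => g z + -1 * (\sum_(i < n) c i * e i z)).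
    by apply/funext => z; rewrite mulN1r.
  rewrite (ipD G (H2Z _ S) (eH i)) (ipZ _ S (eH i)) (ip_sum n c eH (eH i)) (bigD1 (Ordinal hi)) //=.
  rewrite [X in -1 * (_ + X)]big1 ?addr0; last first.
    by move=> j ji; rewrite ort ?mulr0.
  have [z|nz] := eqVneq (s i) 0.
    have ez : ip g (e i) = 0 by rewrite (e0 _ z) ip_0r.
    by rewrite /c ez mul0r mulr0 addr0.
  by rewrite on ?eqxx ?mulr1 /c ?mulN1r ?subrr // lt_def nz s0.
have gE : g = (fun z => (\sum_(i < n) c i * e i z) + g' z).
  by apply/funext => z; rewrite /g' addrC subrK.
have TS : H2 (T (fun z => \sum_(i < n) c i * e i z)) by exact: TH.
have E1 : ip (T (e n)) (T (fun z => \sum_(i < n) c i * e i z)) = 0.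
  rewrite (ipC TS (TH (eH n))) [X in conjc X](@ip_sum R n c (fun i => T (e i)) (T (e n)) _ (TH (eH n))).
    rewrite big1; first by apply: cplx_ext; rewrite /= ?oppr0.
    move=> i _; rewrite (IH i (ltn_ord i) (e n) (eH n)) ort ?mulr0 //.
    by rewrite ltn_eqF.
  by move=> i; exact: TH.
have E2 : ip (e n) (fun z => \sum_(i < n) c i * e i z) = 0.
  rewrite (ipC S (eH n)) (ip_sum n c eH (eH n)) big1; first by apply: cplx_ext; rewrite /= ?oppr0.
  by move=> i _; rewrite ort ?mulr0 // ltn_eqF.
rewrite {2}gE (ipDr S G' (eH n)) E2 add0r -(eE n g' G' og').
have -> : T g = (fun z => T (fun z => \sum_(i < n) c i * e i z) z + T g' z).
  by rewrite {1}gE.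
by rewrite (ipDr TS (TH G') (TH (eH n))) E1 add0r.
Qed.

(** * Min-max principle, decay of singular numbers and eigenspaces *)

Section MinMax.
Variables (s : nat -> R) (e : nat -> R[i] -> R[i]).
Hypothesis s_ge0 : forall n, 0 <= s n.
Hypothesis s_dec : forall n, s n.+1 <= s n.
Hypothesis eH : forall n, H2 (e n).
Hypothesis e_eigen : forall n, forall g, H2 g -> ip (T (e n)) (T g) = (s n ^+ 2)%:C * ip (e n) g.
Hypothesis e_on : forall m n, 0 < s m -> 0 < s n -> ip (e m) (e n) = (m == n)%:R.

Lemma s_mono m n : (m <= n)%N -> s n <= s m.
Proof.
by move=> /subnKC <-; elim: (n - m)%N => [|k IH]; rewrite ?addn0 // addnS (le_trans (s_dec _)).
Qed.

(** On the span of [e 0, ..., e n] the [n] functionals have a common nonzero zero [f], found in the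
    kernel of an (n+1) by n matrix, and there [|T f|^2 >= s n ^+ 2 |f|^2]. Linearity of [L] is asked
    only on these combinations. *)
Lemma minmax n (L : nat -> (R[i] -> R[i]) -> R[i]) (x : R) : 0 <= x ->
  (forall i (c : nat -> R[i]), (i < n)%N -> L i (fun z => \sum_(j < n.+1) c j * e j z) = \sum_(j < n.+1) c j * L i (e j)) ->
  (forall f, H2 f -> (forall i, (i < n)%N -> L i f = 0) -> nsq (T f) <= x ^+ 2 * nsq f) ->
  s n <= x.
Proof.
move=> x0 Llin HL; have [->//|sn0] := eqVneq (s n) 0.
have sn : 0 < s n by rewrite lt_def sn0 s_ge0.
have sp j : (j <= n)%N -> 0 < s j by move=> jn; apply: lt_le_trans sn (s_mono jn).
pose A : 'M[R[i]]_(n.+1, n) := \matrix_(j, i) L i (e j).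
have kA : kermx A != 0.
  rewrite kermx_eq0 /row_free; apply/negP => /eqP h.
  by have := rank_leq_col A; rewrite h ltnn.
have /rowV0Pn[v /sub_kermxP vA v0] := kA.
pose c (j : nat) : R[i] := if insub j is Some k then v 0 k else 0.
have cE (j : 'I_n.+1) : c j = v 0 j by rewrite /c valK.
clearbody c; have sp' (j : 'I_n.+1) : 0 < s j by apply: sp; rewrite -ltnS.
pose f z := \sum_(j < n.+1) c j * e j z.
have F : H2 f by exact: H2_sum.
have Lf i : (i < n)%N -> L i f = 0.
  move=> hi; rewrite Llin //; have := congr1 (fun M : 'rV_n => M 0 (Ordinal hi)) vA.
  rewrite !mxE => {2}<-; apply: eq_bigr => j _; by rewrite cE !mxE.
have ipe (j : 'I_n.+1) : ip (e j) f = conjc (c j).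
  rewrite (ipC F (eH j)) (ip_sum n.+1 c eH (eH j)) (bigD1 j) //= (e_on (sp' j) (sp' j)) eqxx mulr1.
  rewrite big1 ?addr0 // => k kj; rewrite (e_on (sp' k) (sp' j)) (_ : (k == j :> nat) = false) ?mulr0 //.
  by apply: contraNF kj => /eqP kj; apply/eqP/val_inj.
have nf : nsq f = \sum_(j < n.+1) normc (c j) ^+ 2.
  apply: (@complexI R); rewrite -(ip_self F) {1}/f (ip_sum n.+1 c eH F) rmorph_sum.
  by apply: eq_bigr => j _; rewrite ipe mulcJ.
have nTf : nsq (T f) = \sum_(j < n.+1) s j ^+ 2 * normc (c j) ^+ 2.
  apply: (@complexI R); rewrite -(ip_self (TH F)).
  rewrite [X in ip X _](_ : _ = fun z => \sum_(j < n.+1) c j * T (e j) z) //.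
  rewrite (@ip_sum R n.+1 c (fun j => T (e j)) (T f) (fun j => TH (eH j)) (TH F)) rmorph_sum.
  apply: eq_bigr => j _; rewrite e_eigen // ipe mulrCA mulcJ -rmorphM //.
have f0 : 0 < nsq f.
  rewrite lt_def nsq_ge0 // andbT; apply: contra v0 => /eqP; rewrite nf => /eqP.
  rewrite psumr_eq0 => [/allP h|j _]; last exact: sqr_ge0.
  apply/eqP/rowP => j; rewrite mxE -cE.
  by have := h j; rewrite mem_index_enum sqrf_eq0 cn_eq0 => /(_ isT)/eqP.
have h1 := HL f F Lf.
have h2 : s n ^+ 2 * nsq f <= nsq (T f).
  rewrite nTf nf mulr_sumr; apply: ler_sum => j _; rewrite ler_wpM2r ?sqr_ge0 //.
  by apply: lerXn2r; rewrite ?nnegrE ?s_ge0 // s_mono // -ltnS.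
by have := le_trans h2 h1; rewrite (ler_pM2r f0) ler_pXn2r ?nnegrE ?s_ge0.
Qed.

(** The first n + 1 values dominate [s n], and the sum of their squares is the Hilbert-Schmidt sum
    over [e 0, ..., e n]. *)
Lemma hs_decay (D : R) n : (forall m (E : nat -> R[i] -> R[i]), (forall i, H2 (E i)) ->
    (forall i j, (i < m)%N -> (j < m)%N -> ip (E i) (E j) = (i == j)%:R) ->
    \sum_(i < m) nsq (T (E i)) <= D) -> 0 <= D -> s n ^+ 2 <= D / n.+1%:R.
Proof.
move=> H D0; have [->|sn0] := eqVneq (s n) 0; first by rewrite expr0n divr_ge0.
have sn : 0 < s n by rewrite lt_def sn0 s_ge0.
have sp j : (j < n.+1)%N -> 0 < s j by rewrite ltnS => jn; apply: lt_le_trans sn (s_mono jn).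
rewrite ler_pdivlMr // mulr_natr -[X in _ *+ X]card_ord -sumr_const.
apply: le_trans (H n.+1 e eH _); last by move=> i j hi hj; apply: e_on; exact: sp.
apply: ler_sum => j _.
have -> : nsq (T (e j)) = s j ^+ 2.
  apply: (@complexI R); rewrite -(ip_self (TH (eH j))) e_eigen // e_on ?sp // eqxx mulr1 //.
by apply: lerXn2r; rewrite ?nnegrE ?s_ge0 // s_mono // -ltnS.
Qed.

Hypothesis e_zero : forall n, s n = 0 -> e n = fun=> 0.
Hypothesis e_bound : forall n f, H2 f -> orth_to n e f -> nsq (T f) <= s n ^+ 2 * nsq f.

(** Subtracting from [f] its projection on the [e n] with [s n = t] leaves an eigenvector for [t^2]
    orthogonal to the first [N] vectors, where [|T f'|^2 <= s N ^+ 2 |f'|^2] with [s N < t]; so it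
    vanishes. *)
Lemma eigen_expansion (t : R) f N : 0 < t -> s N < t -> H2 f ->
  (forall g, H2 g -> ip (T f) (T g) = (t ^+ 2)%:C * ip f g) ->
  exists c : nat -> R[i], forall z, normc z < 1 -> f z = \sum_(n < N | s n == t) c n * e n z.
Proof.
move=> t0 sN F Ff.
pose c n := if s n == t then ip f (e n) else 0.
have ip0 := ip_0l.
pose S z := \sum_(n < N) c n * e n z; pose f' z := f z - S z.
have HS : H2 S by exact: H2_sum.
have F' : H2 f' by exact: H2B.
have fE : f' = (fun z => f z + -1 * S z) by apply/funext => z; rewrite mulN1r.
have TS : H2 (T S) by exact: TH.
have E' g : H2 g -> ip (T f') (T g) = (t ^+ 2)%:C * ip f' g.
  move=> G; have TG := TH G.
  have -> : T f' = (fun z => T f z + -1 * T S z) by rewrite /T fE.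
  rewrite (ipD (TH F) (H2Z _ TS) TG) (ipZ _ TS TG) fE (ipD F (H2Z _ HS) G) (ipZ _ HS G) (Ff g G).
  rewrite (ip_sum N c eH G) [X in -1 * X](@ip_sum R N c (fun n => T (e n)) (T g) (fun n => TH (eH n)) TG).
  rewrite mulrDr; congr (_ + _); rewrite [RHS]mulrCA; congr (_ * _); rewrite mulr_sumr.
  apply: eq_bigr => n _; rewrite e_eigen // /c; case: eqP => [->|_]; last by rewrite !mul0r mulr0.
  by rewrite mulrCA.
have o' : orth_to N e f'.
  move=> i hi; rewrite fE (ipD F (H2Z _ HS) (eH i)) (ipZ _ HS (eH i)) (ip_sum N c eH (eH i)).
  have [z|nz] := eqVneq (s i) 0.
    have ez g : H2 g -> ip g (e i) = 0 by move=> G; rewrite (e_zero z) ip_0r.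
    rewrite ez // big1 ?mulr0 ?addr0 // => j _; by rewrite ez ?mulr0.
  have si : 0 < s i by rewrite lt_def nz s_ge0.
  have cj j : c j * ip (e j) (e i) = c j * (j == i)%:R.
    rewrite /c; case: eqP => [sj|_]; last by rewrite !mul0r.
    by rewrite e_on // sj.
  rewrite (bigD1 (Ordinal hi)) //= big1 ?addr0; last first.
    move=> j ji; rewrite cj (_ : (j == i :> nat) = false) ?mulr0 //.
    by apply: contraNF ji => /eqP ji; apply/eqP/val_inj.
  rewrite cj eqxx mulr1 /c; case: eqP => [_|/eqP st]; first by rewrite mulN1r subrr.
  rewrite mulr0 addr0.
  (* For [s i != t]: evaluating the Gram form on [f] and [e i] in both orders gives
     [(s i ^+ 2 - t ^+ 2) * ip f (e i) = 0]. *)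
  have h1 := Ff (e i) (eH i); have h2 := e_eigen i F.
  rewrite (ipC (TH (eH i)) (TH F)) h2 conjM conjR -(ipC (eH i) F) in h1.
  have : ((s i ^+ 2)%:C - (t ^+ 2)%:C) * ip f (e i) = 0 by rewrite mulrBl h1 subrr.
  move/eqP; rewrite mulf_eq0 => /orP[|/eqP//].
  rewrite subr_eq0 => /eqP/(@complexI R)/eqP.
  by rewrite eqrXn2 ?(ltW t0) ?s_ge0 // (negbTE st).
have n0 : nsq f' = 0.
  have h1 : nsq (T f') = t ^+ 2 * nsq f'.
    apply: (@complexI R); rewrite -(ip_self (TH F')) (E' _ F') (ip_self F') -rmorphM //.
  have := e_bound F' o'; rewrite h1 => h2.
  apply/le_anti; rewrite nsq_ge0 // andbT leNgt; apply/negP => p.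
  move: h2; rewrite ler_pM2r // leNgt => /negP; apply.
  by rewrite ltr_pXn2r ?nnegrE ?s_ge0 // ltW.
exists c => z z1; have := nsq_eq0 F' n0 z1; rewrite /f' => /eqP; rewrite subr_eq0 => /eqP ->.
rewrite /S [RHS]big_mkcond; apply: eq_bigr => n _; rewrite /c; case: eqP => // _; by rewrite mul0r.
Qed.
End MinMax.
End Spectral.

(** * Lens maps *)

Section Clog.
Variable R : realType.
Implicit Types (z w : R[i]) (a b : R).

(** The principal logarithm on the right half-plane. As [atan] is total, the imaginary part lies
    strictly between -pi/2 and pi/2 for every [z]. *)
Definition clog z : R[i] := ln (normc z) +i* atan (complex.Im z / complex.Re z).

Lemma Re_gt0_neq0 z : 0 < complex.Re z -> z != 0.
Proof. by move=> h; apply/eqP => z0; move: h; rewrite z0 ltxx. Qed.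

Lemma Im_clog z : - (pi / 2) < complex.Im (clog z) < pi / 2.
Proof. by rewrite atan_gtNpi2 atan_ltpi2. Qed.

Lemma cexp_clog z : 0 < complex.Re z -> cexp (clog z) = z.
Proof.
move=> h; have z0 := Re_gt0_neq0 h.
have n0 : 0 < normc z by rewrite cn_gt0.
set x := complex.Re z in h *; set y := complex.Im z.
have sE : Num.sqrt (1 + (y / x) ^+ 2) = normc z / x.
  apply/eqP; rewrite -(@eqrXn2 _ 2) ?sqrtr_ge0 ?divr_ge0 ?(ltW n0) ?(ltW h) //.
  rewrite sqr_sqrtr ?addr_ge0 ?sqr_ge0 // !expr_div_n cn_sqr -/x -/y; apply/eqP; field.
  by rewrite gt_eqF.
have cE : cos (atan (y / x)) = x / normc z.
  by rewrite cos_atan sE invf_div.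
have sinE : sin (atan (y / x)) = y / normc z.
  have := atanK (y / x); rewrite /tan cE => /(canRL (divfK _)) ->.
    by field; rewrite !gt_eqF.
  by rewrite mulf_neq0 ?invr_eq0 ?gt_eqF.
rewrite /cexp /clog /= lnK ?posrE // /cis cE sinE.
by apply: cplx_ext; rewrite ?ReM ?ImM /= -?/x -?/y; field; rewrite gt_eqF.
Qed.

Lemma Re_cexp z : complex.Re (cexp z) = expR (complex.Re z) * cos (complex.Im z).
Proof. by rewrite /cexp ReM /= mul0r subr0. Qed.

Lemma clog_cexp z : - (pi / 2) < complex.Im z < pi / 2 -> clog (cexp z) = z.
Proof.
move=> h; apply: cplx_ext; rewrite /clog /=; first by rewrite cn_cexp expRK.
rewrite !mul0r addr0 subr0 -mulf_div divff ?gt_eqF ?expR_gt0 // mul1r.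
by rewrite -/(tan _) tanK // in_itv.
Qed.

Lemma clog_ccont z : 0 < complex.Re z -> ccont clog z.
Proof.
move=> h; apply/cvgc_nbhsP.
have idc : (id : R[i]^o -> R[i]^o) w @[w --> (z : R[i]^o)] --> (z : R[i]^o) by exact: cvg_id.
have n0 : 0 < normc z by rewrite cn_gt0 Re_gt0_neq0.
apply: (@cvg_ReIm _ _ (nbhs (z : R[i]^o)) _).
  apply: (@cvg_comp _ _ _ (fun w : R[i]^o => normc w) (@ln R)); last exact: continuous_ln.
  exact: (cvg_normc _ idc).
apply: (@cvg_comp _ _ _ (fun w : R[i]^o => complex.Im w / complex.Re w) (@atan R)); last exact: continuous_atan.
apply: cvgM; first exact: (cvg_Im _ idc).
by apply: cvgV; [rewrite gt_eqF|exact: (cvg_Re _ idc)].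
Qed.

(** Derivative of a continuous inverse: if [q] is the difference quotient of [cexp] at [clog z],
    then [clog w - clog z = (w - z) / q (clog w)], and [q] has no zero there because
    [cexp (clog w) = w]. *)
Lemma holo_clog z : 0 < complex.Re z -> holo clog z.
Proof.
move=> h; have z0 := Re_gt0_neq0 h; exists z^-1.
have := cdiff_cexp (clog z); rewrite cexp_clog // => /cdiffP[q [qz qE qc]].
have qlz : q (clog z) != 0 by rewrite qz.
have cq := ccontV (f := fun w => q (clog w)) qlz (ccont_comp (clog_ccont h) qc).
have hp w : 0 < complex.Re w -> q (clog w) != 0.
  move=> hw; apply/eqP => q0; have := qE (clog w); rewrite q0 mul0r !cexp_clog // => /eqP.
  by rewrite subr_eq0 => /eqP wz; move: qlz; rewrite -wz q0 eqxx.
move=> e e0; have [d d0 Hd] := cq _ e0.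
exists (Num.min d (complex.Re z)); first by rewrite lt_min d0.
move=> w; rewrite lt_min => /andP[hd hw].
have wp : 0 < complex.Re w.
  by have := Re_le_cn (w - z); rewrite ReD ReN ler_norml => /andP[]; lra.
have -> : clog w - clog z - z^-1 * (w - z) = ((q (clog w))^-1 - (q (clog z))^-1) * (w - z).
  rewrite qz mulrBl; congr (_ - _).
  by have := qE (clog w); rewrite !cexp_clog // => ->; rewrite mulKf // hp.
by rewrite cnM ler_wpM2r ?cn_ge0 // ltW // Hd.
Qed.

Definition cpow a z : R[i] := cexp (a%:C * clog z).

Lemma holo_cpow a z : 0 < complex.Re z -> holo (cpow a) z.
Proof.
move=> h; apply: (@holo_comp _ (fun z => a%:C * clog z)); last exact: holo_cexp.
by apply: holoM; [exact: holo_cst|exact: holo_clog].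
Qed.

Lemma cn_cpow a z : normc (cpow a z) = expR (a * ln (normc z)).
Proof. by rewrite cn_cexp ReM /= mul0r subr0. Qed.

Lemma Im_scale a z : complex.Im (a%:C * z) = a * complex.Im z.
Proof. by rewrite ImM /= mul0r addr0. Qed.

Lemma abs_Im_clog z : `|complex.Im (clog z)| < pi / 2.
Proof. by rewrite ltr_norml Im_clog. Qed.

(** The power [a] maps into the sector of half-angle a pi / 2 around the positive axis. *)
Lemma Re_cpow_ge a z : 0 < a -> a <= 1 ->
  cos (a * (pi / 2)) * normc (cpow a z) <= complex.Re (cpow a z).
Proof.
move=> a0 a1; rewrite Re_cexp cn_cexp mulrC ler_wpM2l ?expR_ge0 //.
have p2 : 0 < pi / 2 :> R by rewrite divr_gt0 ?pi_gt0.
have hl := abs_Im_clog z.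
rewrite Im_scale -(cos_norm (a * complex.Im _)) normrM (gtr0_norm a0).
have ha : a * `|complex.Im (clog z)| < a * (pi / 2) by rewrite ltr_pM2l.
have hb : a * (pi / 2) <= pi / 2 by rewrite ler_piMl // ltW.
have hc : 0 <= a * `|complex.Im (clog z)| by rewrite mulr_ge0 // ltW.
by rewrite ltW // ltr_cos // in_itv /=; lra.
Qed.

Lemma cos_cpow_gt0 a : 0 < a -> a < 1 -> 0 < cos (a * (pi / 2)).
Proof.
move=> a0 a1; apply: cos_gt0_pihalf.
have p2 : 0 < pi / 2 :> R by rewrite divr_gt0 ?pi_gt0.
have : a * (pi / 2) < pi / 2 by rewrite -[ltRHS]mul1r ltr_pM2r.
have : 0 < a * (pi / 2) by rewrite mulr_gt0.
lra.
Qed.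

Lemma Re_cpow_gt0 a z : 0 < a -> a < 1 -> 0 < complex.Re (cpow a z).
Proof.
move=> a0 a1; apply: lt_le_trans (Re_cpow_ge _ a0 (ltW a1)).
by rewrite mulr_gt0 ?cos_cpow_gt0 // cn_gt0 cexp_neq0.
Qed.

Lemma cpowM a b z : 0 < b -> b <= 1 -> cpow a (cpow b z) = cpow (a * b) z.
Proof.
move=> b0 b1; rewrite /cpow clog_cexp; first by rewrite rmorphM mulrA.
have p2 : 0 < pi / 2 :> R by rewrite divr_gt0 ?pi_gt0.
rewrite -ltr_norml Im_scale normrM (gtr0_norm b0).
apply: le_lt_trans (abs_Im_clog z); exact: ler_piMl.
Qed.
End Clog.

(** * The Cayley transform and lens maps *)

Section Lens.
Variable R : realType.
Implicit Types (z w : R[i]) (a b : R).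

Definition cay z : R[i] := (1 + z) / (1 - z).
Definition cayV w : R[i] := (w - 1) / (w + 1).

Lemma disk_1B_neq0 z : normc z < 1 -> 1 - z != 0.
Proof. by move=> h; apply/eqP => /eqP; rewrite subr_eq0 => /eqP z1; move: h; rewrite -z1 cn1 ltxx. Qed.

Lemma Re_addV1 z w : 0 < complex.Re w -> z = w + 1 -> z != 0.
Proof. by move=> h ->; apply: Re_gt0_neq0; rewrite ReD /= addr_gt0. Qed.

Lemma Re_ratio z w : w != 0 -> complex.Re (z / w) = complex.Re (z * conjc w) / normc w ^+ 2.
Proof.
move=> w0; have n0 : normc w != 0 by rewrite cn_eq0.
have -> : z / w = z * conjc w * ((normc w ^+ 2)^-1)%:C.
  have cw : conjc w != 0 by rewrite -cn_eq0 cnJ.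
  apply: (mulIf w0); rewrite divfK // -[RHS]mulrA [_%:C * w]mulrC mulrA -[z * _ * w]mulrA.
  rewrite [conjc w * w]mulrC mulcJ -mulrA -rmorphM divff ?expf_neq0 //.
  by rewrite rmorph1 mulr1.
by rewrite ReM /= mulr0 subr0.
Qed.

Lemma Re_cay_gt0 z : normc z < 1 -> 0 < complex.Re (cay z).
Proof.
move=> h; have z0 := disk_1B_neq0 h.
rewrite /cay Re_ratio // divr_gt0 ?exprn_gt0 ?cn_gt0 //.
have -> : complex.Re ((1 + z) * conjc (1 - z)) = 1 - normc z ^+ 2.
  by rewrite cn_sqr; case: z {h z0} => x y /=; ring.
by rewrite subr_gt0 expr_lt1 ?cn_ge0.
Qed.

Lemma cn_cayV w : 0 < complex.Re w ->
  1 - normc (cayV w) ^+ 2 = 4 * complex.Re w / normc (w + 1) ^+ 2.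
Proof.
move=> h; have w1 : w + 1 != 0 by exact: Re_addV1 h erefl.
have n0 : normc (w + 1) != 0 by rewrite cn_eq0.
have E : normc (w - 1) ^+ 2 = normc (w + 1) ^+ 2 - 4 * complex.Re w.
  by rewrite !cn_sqr; case: w {h w1 n0} => x y /=; ring.
by rewrite /cayV cnM cnV exprMn exprVn E; field.
Qed.

Lemma cayV_disk w : 0 < complex.Re w -> normc (cayV w) < 1.
Proof.
move=> h; have w1 : w + 1 != 0 by exact: Re_addV1 h erefl.
rewrite -(@expr_lt1 _ 2) ?cn_ge0 // -subr_gt0 cn_cayV //.
by rewrite divr_gt0 ?mulr_gt0 ?exprn_gt0 ?cn_gt0.
Qed.

Lemma cayVK w : 0 < complex.Re w -> cay (cayV w) = w.
Proof.
move=> h; have w1 : w + 1 != 0 by exact: Re_addV1 h erefl.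
rewrite /cay /cayV; field; rewrite w1 /=.
have -> : w + 1 - (w - 1) = 2%:R by ring.
by rewrite pnatr_eq0.
Qed.

Definition lens a z : R[i] := cayV (cpow a (cay z)).

Lemma cay_holo z : normc z < 1 -> holo cay z.
Proof.
move=> h; apply: holo_div; first exact: disk_1B_neq0.
  by apply: holoD; [exact: holo_cst|exact: holo_id].
by apply: holoB; [exact: holo_cst|exact: holo_id].
Qed.

Lemma cpow_cay_holo a z : normc z < 1 -> holo (fun z => cpow a (cay z)) z.
Proof. by move=> h; apply: holo_comp; [exact: cay_holo|exact/holo_cpow/Re_cay_gt0]. Qed.

Section Theta.
Variables (a : R) (a0 : 0 < a) (a1 : a < 1).

Lemma lens_holo z : normc z < 1 -> holo (lens a) z.
Proof.
move=> h; apply: (@holo_comp _ (fun z => cpow a (cay z)) cayV); first exact: cpow_cay_holo.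
apply: holo_div; first exact: (Re_addV1 (Re_cpow_gt0 _ a0 a1) erefl).
  by apply: holoB; [exact: holo_id|exact: holo_cst].
by apply: holoD; [exact: holo_id|exact: holo_cst].
Qed.

Lemma lens_disk z : normc (lens a z) < 1.
Proof. exact/cayV_disk/Re_cpow_gt0. Qed.

Lemma cay_lens z : cay (lens a z) = cpow a (cay z).
Proof. exact/cayVK/Re_cpow_gt0. Qed.

Let c : R := cos (a * (pi / 2)).

(** With W = [cpow a (cay z)], 1 / (1 - |lens|^2) = |W + 1|^2 / (4 Re W) <= (|W| + 1/|W|) / (2 c),
    since |W + 1|^2 <= 2 (|W|^2 + 1) and Re W >= c |W|. The sector bound for W and 1/W costs the
    second factor c. *)
Definition lens_maj z : R[i] := ((2 * c ^+ 2)^-1)%:C * (cpow a (cay z) + (cpow a (cay z))^-1).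

Lemma lens_maj_holo z : normc z < 1 -> holo lens_maj z.
Proof.
move=> h; apply: holoM; first exact: holo_cst.
apply: holoD; first exact: cpow_cay_holo.
by apply: holoV; [exact: cexp_neq0|exact: cpow_cay_holo].
Qed.

Lemma lens_maj_dom z : normc z < 1 -> (1 - normc (lens a z) ^+ 2)^-1 <= complex.Re (lens_maj z).
Proof.
move=> h; rewrite cn_cayV ?Re_cpow_gt0 // /lens_maj.
have hc : 0 < c by exact: cos_cpow_gt0.
have W0 : cpow a (cay z) != 0 by exact: cexp_neq0.
have := Re_cpow_ge (cay z) a0 (ltW a1); rewrite -/c.
move: (cpow a (cay z)) W0 => W W0 hW; set n := normc W in hW.
have n0 : 0 < n by rewrite cn_gt0.
have ReV : complex.Re W^-1 = complex.Re W / n ^+ 2.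
  by rewrite -[W^-1]mul1r Re_ratio // mul1r ReJ.
have -> : complex.Re (((2 * c ^+ 2)^-1)%:C * (W + W^-1)) = (2 * c ^+ 2)^-1 * (complex.Re W * (1 + n ^- 2)).
  by rewrite ReM /= mul0r subr0 ReD ReV; ring.
have nE := cn_sqr W; rewrite -/n in nE.
have E : normc (W + 1) ^+ 2 = n ^+ 2 + 1 + 2 * complex.Re W.
  by rewrite nE cn_sqr; case: (W) => x y /=; ring.
have x0 : 0 < complex.Re W by apply: lt_le_trans hW; rewrite mulr_gt0.
have xn : complex.Re W <= n by apply: le_trans (ler_norm _) (Re_le_cn _).
rewrite invf_div E; move: (complex.Re W) hW x0 xn => x hW x0 xn.
rewrite ler_pdivrMr ?mulr_gt0 //.
have -> : (2 * c ^+ 2)^-1 * (x * (1 + n ^- 2)) * (4 * x) = 2 * (x / (c * n)) ^+ 2 * (n ^+ 2 + 1).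
  by field; rewrite !gt_eqF.
have k1 : 1 <= (x / (c * n)) ^+ 2.
  by rewrite exprn_ege1 // ler_pdivlMr ?mulr_gt0 // mul1r.
have k2 : 2 * x <= n ^+ 2 + 1 by have := sqr_ge0 (n - 1); rewrite sqrrB1 -mulr_natr; lra.
have k3 : 1 * (n ^+ 2 + 1) <= (x / (c * n)) ^+ 2 * (n ^+ 2 + 1) by rewrite ler_wpM2r // addr_ge0 // sqr_ge0.
by rewrite -mulrA; lra.
Qed.
End Theta.

Lemma lensM a b z : 0 < b -> b < 1 -> lens a (lens b z) = lens (a * b) z.
Proof. by move=> b0 b1; rewrite /lens cay_lens // cpowM // ltW. Qed.

End Lens.

(** * Schatten classes *)

Section LensSchatten.
Variable R : realType.
Implicit Types (f g h : R[i] -> R[i]) (z w : R[i]).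

Lemma sum_inv_sqr n : \sum_(0 <= m < n) (m.+1%:R ^- 2) <= 2 - n%:R^-1 :> R.
Proof.
(* Since [0^-1 = 0] the bound is 2 for the empty sum; the telescoping step starts at the second
   term. *)
elim: n => [|n IH]; first by rewrite big_nil invr0 subr0.
rewrite big_nat_recr //=; case: n IH => [_|n IH].
  by rewrite big_nil add0r invr1 expr1n invr1; lra.
apply: le_trans (lerD IH (lexx _)) _.
have a0 : 0 < n.+1%:R :> R by rewrite ltr0n.
have b0 : 0 < n.+2%:R :> R by rewrite ltr0n.
have E : n.+2%:R = n.+1%:R + 1 :> R by rewrite -natr1.
rewrite E in b0 *; move: (n.+1%:R) a0 b0 => x x0 x1.
suff : (x + 1) ^- 2 <= x^-1 - (x + 1)^-1 by lra.
have -> : x^-1 - (x + 1)^-1 = (x * (x + 1))^-1 by field; rewrite !gt_eqF.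
rewrite lef_pV2 ?posrE ?mulr_gt0 ?exprn_gt0 // expr2 ler_pM2r //; lra.
Qed.

Section OneLens.
Variables (a : R) (a0 : 0 < a) (a1 : a < 1).

Let C := complex.Re (lens_maj a 0).

Lemma lens_H2 f : H2 f -> H2 (fun z => f (lens a z)) /\ nsq (fun z => f (lens a z)) <= C * nsq f.
Proof.
apply: (comp_H2 (Hm := lens_maj a)); [exact: lens_holo|by move=> z _; exact: lens_disk|exact: lens_maj_holo|exact: lens_maj_dom].
Qed.

Lemma lens_compact (u : nat -> R[i] -> R[i]) : (forall j, H2 (u j) /\ nsq (u j) <= 1) ->
  exists (k : nat -> nat) v, [/\ forall j, (k j < k j.+1)%N, H2 v /\ nsq v <= 1,
    forall e : R, 0 < e -> exists N : nat, forall j, (N <= j)%N ->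
      nsq (fun z => u (k j) (lens a z) - v (lens a z)) <= e &
    forall g, H2 g -> ccvg (fun j => ip (u (k j)) g) (ip v g)].
Proof.
apply: (comp_compact (Hm := lens_maj a)); [exact: lens_holo|by move=> z _; exact: lens_disk|exact: lens_maj_holo|exact: lens_maj_dom].
Qed.

Lemma lens_hs m (E : nat -> R[i] -> R[i]) : (forall i, H2 (E i)) ->
    (forall i j, (i < m)%N -> (j < m)%N -> ip (E i) (E j) = (i == j)%:R) ->
    \sum_(i < m) nsq (fun z => E i (lens a z)) <= C.
Proof.
apply: (bessel_hs (Hm := lens_maj a)); [exact: lens_holo|by move=> z _; exact: lens_disk|exact: lens_maj_holo|exact: lens_maj_dom].
Qed.

Lemma lens_C_ge0 : 0 <= C.
Proof.
apply: (@C_ge0 _ (lens a) (lens_maj a)) => z hz; first [exact: lens_holo|exact: lens_disk|exact: lens_maj_holo|exact: lens_maj_dom].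
Qed.

Lemma iter_lens k z : (0 < k)%N -> iter k (lens a) z = lens (a ^+ k) z.
Proof.
elim: k => [|[|k] IH] _ //.
rewrite iterS IH // lensM -?exprS //; first by rewrite exprn_gt0.
by rewrite exprn_ilt1 // ltW.
Qed.

Lemma iter_lens_H2 k f : H2 f -> H2 (fun z => f (iter k (lens a) z)).
Proof.
elim: k f => [|k IH] f F //.
by have := (lens_H2 (IH _ F)).1; under eq_fun do rewrite -iterSr.
Qed.
End OneLens.

(* The functionals are [f |-> <f o lens_a^j, e'_i>] for [j < k] and [i < n]. *)
Lemma sv_iter (a b : R) k n (s s' : nat -> R) (e e' : nat -> R[i] -> R[i]) :
  0 < a -> a < 1 -> 0 < b -> b < 1 -> (0 < k)%N -> a ^+ k = b ->
  (forall n, 0 <= s n) -> (forall n, s n.+1 <= s n) -> (forall n, H2 (e n)) ->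
  (forall n, forall g, H2 g ->
    ip (fun z => e n (lens b z)) (fun z => g (lens b z)) = (s n ^+ 2)%:C * ip (e n) g) ->
  (forall m n, 0 < s m -> 0 < s n -> ip (e m) (e n) = (m == n)%:R) ->
  (forall n, 0 <= s' n) -> (forall n, H2 (e' n)) ->
  (forall n f, H2 f -> orth_to n e' f -> nsq (fun z => f (lens a z)) <= s' n ^+ 2 * nsq f) ->
  s (k * n)%N <= s' n ^+ k.
Proof.
move=> a0 a1 b0 b1 k0 akb s0 sd eH eE eo s'0 e'H e'B.
apply: (minmax (lens_H2 b0 b1) s0 sd eH eE eo
  (L := fun m f => ip (fun z => f (iter (m %/ n) (lens a) z)) (e' (m %% n)%N))).
- exact: exprn_ge0.
- move=> i c _; apply: (@ip_sum _ _ c (fun j z => e j (iter (i %/ n) (lens a) z))) => // j.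
  exact: iter_lens_H2.
move=> f F HL.
have -> : (fun z => f (lens b z)) = (fun z => f (iter k (lens a) z)).
  by apply/funext => z; rewrite iter_lens // akb.
suff : forall j, (j <= k)%N -> nsq (fun z => f (iter j (lens a) z)) <= (s' n ^+ j) ^+ 2 * nsq f by exact.
elim=> [_|j IH jk]; first by rewrite expr0 expr1n mul1r.
have E : (fun z => f (iter j.+1 (lens a) z)) = (fun z => f (iter j (lens a) (lens a z))).
  by apply/funext => z; rewrite iterSr.
rewrite E [s' n ^+ j.+1]exprS exprMn -mulrA; apply: le_trans (ler_wpM2l (sqr_ge0 (s' n)) (IH (ltnW jk))).
apply: e'B; first exact: iter_lens_H2.
move=> i il; have n0 : (0 < n)%N by apply: leq_ltn_trans il.
(* The pair (j, i) is coded as [j * n + i], with [i < n] recovered as the remainder; each factor of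
   the lens then costs one [s' n]. *)
have := HL (j * n + i)%N; rewrite divnMDl // modnMDl divn_small // addn0 modn_small //; apply.
by apply: leq_trans (leq_mul jk (leqnn n)); rewrite mulSn addnC ltn_add2r.
Qed.

Lemma root_exists (b : R) k : 0 < b -> b < 1 -> (0 < k)%N -> exists a : R, [/\ 0 < a, a < 1 & a ^+ k = b].
Proof.
move=> b0 b1 k0; have kp : 0 < k%:R :> R by rewrite ltr0n.
exists (expR (ln b / k%:R)); split; first exact: expR_gt0.
  rewrite expR_lt1 pmulr_llt0 ?invr_gt0 // -expR_lt1 lnK //.
by rewrite -expRM_natl mulrC divfK ?gt_eqF // lnK.
Qed.

(** [x^p] is at most (y^2)^(k p / 2), and the exponent k p / 2 >= 2 turns the decay 1/(m+1) of y^2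
    into a summable one. *)
Lemma decay_summand (M x y p : R) (k m : nat) : 0 <= x -> 0 <= y -> x <= y ^+ k ->
  0 <= M -> y ^+ 2 <= M / m.+1%:R -> 4 <= k%:R * p ->
  x `^ p <= M `^ (k%:R * p / 2) * m.+1%:R ^- 2.
Proof.
move=> x0 y0 xy M0 yM kp.
have m0 : 0 < m.+1%:R :> R by rewrite ltr0n.
have k0 : 0 < k%:R :> R.
  by rewrite ltr0n lt0n; apply/eqP => k0; move: kp; rewrite k0 mul0r; lra.
have p0 : 0 <= p by rewrite -(pmulr_rge0 _ k0); lra.
have q0 : 0 <= k%:R * p / 2 by lra.
have -> : M `^ (k%:R * p / 2) * m.+1%:R ^- 2 = M `^ (k%:R * p / 2) * (m.+1%:R^-1) `^ 2.
  by rewrite powR_mulrn ?invr_ge0 ?(ltW m0) // exprVn.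
apply: (@le_trans _ _ ((y ^+ k) `^ p)).
  by apply: ge0_ler_powR; rewrite ?nnegrE ?exprn_ge0.
have -> : (y ^+ k) `^ p = (y ^+ 2) `^ (k%:R * p / 2).
  by rewrite -(powR_mulrn k y0) -(powR_mulrn 2 y0) -!powRrM [2%:R * _]mulrC divfK // pnatr_eq0.
apply: (@le_trans _ _ ((M / m.+1%:R) `^ (k%:R * p / 2))).
  apply: ge0_ler_powR yM; rewrite ?nnegrE ?sqr_ge0 //; exact: divr_ge0.
rewrite powRM ?invr_ge0 ?(ltW m0) // ler_wpM2l ?powR_ge0 //; apply: ger_powR.
  by rewrite invr_gt0 m0 invf_le1 // ler1n.
lra.
Qed.

Lemma nneseries_bounded (u : nat -> R) (B : R) : (forall n, 0 <= u n) ->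
  (forall n, \sum_(0 <= m < n) u m <= B) -> (\sum_(0 <= n <oo) (u n)%:E < +oo)%E.
Proof.
move=> u0 uB; apply: (@le_lt_trans _ _ B%:E); last exact: ltry.
apply: lime_le; first by apply: is_cvg_nneseries => n _ _; rewrite lee_fin.
by apply: nearW => n; rewrite sumEFin lee_fin.
Qed.

Theorem lens_schatten (b p : R) : 0 < b -> b < 1 -> 0 < p ->
  schatten p (composition_operator (lens b)).
Proof.
move=> b0 b1 p0.
have [s [e [s0 sd [eH ez] [eE eo] eB]]] := singular_system (lens_H2 b0 b1) (lens_compact b0 b1).
split.
- split; last by move=> c f g _ _ z _.
  move=> f /hardy2P F; apply/hardy2P.
  by have [] := lens_H2 b0 b1 F.
- move=> u Hu.
  have Hu' j : H2 (u j) /\ nsq (u j) <= 1.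
    have [/hardy2P F] := Hu j; rewrite hardy_norm_nsq // lee_fin => N; split=> //.
    have := ler_pM (sqrtr_ge0 _) (sqrtr_ge0 _) N N.
    by rewrite -expr2 sqr_sqrtr ?mul1r //; exact: nsq_ge0.
  have [k [v [kk [V _] kv _]]] := lens_compact b0 b1 Hu'.
  exists (fun z => v (lens b z)); split.
    by apply/hardy2P; exact: (lens_H2 b0 b1 V).1.
  exists k; split=> //.
  have E n : hardy_norm 2 (composition_operator (lens b) (u (k n)) \- (fun z => v (lens b z))) =
      (Num.sqrt (nsq (fun z => u (k n) (lens b z) - v (lens b z))))%:E.
    apply: hardy_norm_nsq; apply: (@H2B _ (fun z => u (k n) (lens b z)) (fun z => v (lens b z))).
      exact: (lens_H2 b0 b1 (Hu' (k n)).1).1.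
    exact: (lens_H2 b0 b1 V).1.
  under eq_fun do rewrite E.
  apply: cvg_EFin; first by apply: nearW.
  apply/cvgrPdist_le => x x0.
  have [N HN] := kv (x ^+ 2) (exprn_gt0 2 x0).
  exists N => // n /= /HN h; rewrite sub0r normrN ger0_norm ?sqrtr_ge0 //.
  by rewrite -(ger0_norm (ltW x0)) -sqrtr_sqr ler_wsqrtr.
exists s.
  split=> //; exists e; split=> //.
    move=> n _; split; first exact/hardy2P.
    by move=> g /hardy2P G; exact: eE.
  move=> t f t0 [/hardy2P F fE].
  pose D := complex.Re (lens_maj b 0).
  have [N sN] : exists N, s N < t.
    (* The Hilbert-Schmidt bound s_N^2 <= D / (N + 1) falls below t^2 at this index. *)
    exists (Num.truncn (D / t ^+ 2)).
    rewrite -(@ltr_pXn2r _ 2) ?nnegrE ?(ltW t0) //.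
    apply: le_lt_trans (hs_decay (lens_H2 b0 b1) s0 sd eH eE eo _ (lens_hs b0 b1) (lens_C_ge0 b0 b1)) _.
    rewrite ltr_pdivrMr ?ltr0n // mulrC -ltr_pdivrMr ?exprn_gt0 //; exact: truncnS_gt.
  have [c Hc] := eigen_expansion (lens_H2 b0 b1) s0 eH eE eo ez eB t0 sN F (fun g G => fE g ((hardy2P g).2 G)).
  by exists N, c.
(* The number of lens factors depends on [p]: it has to satisfy [k p >= 4]. *)
pose k := (Num.truncn (4 / p)).+1.
have kp : 4 <= k%:R * p by rewrite -ler_pdivrMr // ltW // truncnS_gt.
have [a [a0 a1 ak]] := root_exists b0 b1 (ltn0Sn (Num.truncn (4 / p))); rewrite -/k in ak.
have [s' [e' [s'0 s'd [e'H e'z] [e'E e'o] e'B]]] := singular_system (lens_H2 a0 a1) (lens_compact a0 a1).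
pose D := complex.Re (lens_maj a 0); have D0 : 0 <= D by exact: lens_C_ge0.
pose B := (D * k%:R) `^ (k%:R * p / 2).
have B0 : 0 <= B by exact: powR_ge0.
have k0 : 0 < k%:R :> R by rewrite ltr0n.
(* For a general index, s_n <= s_(k [n/k]) <= (s'_[n/k])^k. Since n + 1 <= k ([n/k] + 1), the bound
   D / ([n/k] + 1) becomes D k / (n + 1). *)
have H n : s n `^ p <= B * n.+1%:R ^- 2.
  apply: (@decay_summand _ _ (s' (n %/ k)%N)); rewrite ?mulr_ge0 ?(ltW k0) //.
    apply: le_trans (sv_iter (k := k) (n %/ k) a0 a1 b0 b1 _ ak s0 sd eH eE eo s'0 e'H e'B) => //.
    by apply: s_mono => //; rewrite mulnC leq_divM.
  apply: le_trans (hs_decay (lens_H2 a0 a1) s'0 s'd e'H e'E e'o (n %/ k) (lens_hs a0 a1) D0) _.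
  rewrite -[D * k%:R / _]mulrA ler_wpM2l // ler_pdivlMr ?ltr0n // mulrC ler_pdivrMr ?ltr0n //.
  by rewrite -natrM ler_nat mulnC; apply: ltn_ceil.
apply: (@nneseries_bounded _ (B * 2)) => n; first exact: powR_ge0.
apply: (@le_trans _ _ (\sum_(0 <= m < n) B * m.+1%:R ^- 2)); first by apply: ler_sum => m _.
rewrite -mulr_sumr ler_wpM2l //; apply: le_trans (sum_inv_sqr n) _.
by rewrite gerBl invr_ge0.
Qed.
End LensSchatten.

(** * Poisson integrals and radial limits of bounded functions *)

Section RadialSubsequence.
Variable R : realType.
Implicit Types (f g : R[i] -> R[i]) (z w : R[i]) (a : nat -> R[i]) (r s t : R).
Local Notation mu := (@lebesgue_measure R).

Lemma ps_dilate a f q : ps a f -> 0 <= q -> q <= 1 ->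
  ps (fun k => a k * (q ^+ k)%:C) (fun z => f (q%:C * z)).
Proof.
move=> F q0 q1 p p0 p1; have [M [s [M0 s0 s1 Hs]]] := F _ p0 p1.
exists M, s; split=> // n w wp.
have -> : pol (fun k => a k * (q ^+ k)%:C) n w = pol a n (q%:C * w).
  by apply: eq_bigr => k _; rewrite exprMn rmorphXn mulrA.
apply: Hs; rewrite cnM cnR ger0_norm //; apply: le_trans wp.
by rewrite ler_piMl // cn_ge0.
Qed.

Lemma sqr_1B_le (x : R) : 0 <= x -> x <= 1 -> (1 - x) ^+ 2 <= 1 - x ^+ 2.
Proof. by move=> x0 x1; rewrite !expr2; have := mulr_ge0 x0 (_ : 0 <= 1 - x); rewrite subr_ge0 => /(_ x1); lra. Qed.

(** Compared coefficient by coefficient, this is (1 - q^k)^2 <= 1 - q^(2k). *)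
Lemma msq_dilate a f q s : ps a f -> 0 < q -> q <= 1 -> 0 < s -> s < 1 ->
  msq (fun z => f z - f (q%:C * z)) s <= msq f s - msq f (q * s).
Proof.
move=> F q0 q1 s0 s1.
have r0 : 0 < q * s by rewrite mulr_gt0.
have r1 : q * s < 1 by apply: le_lt_trans s1; rewrite ler_piMl // ltW.
have G := psB F (ps_dilate F (ltW q0) q1).
apply: (msq_le G s0 s1) => n; apply/ler_addgt0Pr => e e0.
have [N HN] := asq_lim F r0 r1 e0.
apply: le_trans (asq_mono _ (ltW s0) (leq_maxl n N)) _.
have := HN _ (leq_maxr n N); rewrite ler_norml => /andP[_ h].
have h' := asq_le_msq (maxn n N) F s0 s1.
suff : asq (fun k => a k - a k * (q ^+ k)%:C) (maxn n N) s <= asq a (maxn n N) s - asq a (maxn n N) (q * s) by lra.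
rewrite /asq -sumrB; apply: ler_sum => k _.
have qk0 : 0 <= q ^+ k by rewrite exprn_ge0 // ltW.
have qk1 : q ^+ k <= 1 by rewrite exprn_ile1 // ltW.
have -> : a k - a k * (q ^+ k)%:C = a k * (1 - q ^+ k)%:C by rewrite rmorphB mulrBr rmorph1 mulr1.
rewrite cnM cnR ger0_norm ?subr_ge0 // exprMn -mulrBr -mulrA ler_wpM2l ?sqr_ge0 //.
rewrite exprMn -[X in _ <= X - _]mul1r -mulrBl ler_wpM2r ?exprn_ge0 ?(ltW s0) // [q ^+ (k * 2)]exprM.
exact: sqr_1B_le.
Qed.

(** The distances to 1 obtained by choice need not decrease with the index; their running minimum
    does. *)
Fixpoint runmin (d : nat -> R) j : R := if j is k.+1 then Num.min (runmin d k) (d j) else d 0%N.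

Lemma runmin_le d j : runmin d j <= d j.
Proof. by case: j => //= j; rewrite ge_min lexx orbT. Qed.

Lemma runmin_gt0 d : (forall j, 0 < d j) -> forall j, 0 < runmin d j.
Proof. by move=> d0; elim=> //= j IH; rewrite lt_min IH d0. Qed.

(** The defect 16^-j is the square of 4^-j, so that the increments between successive radii are at
    most 2 pi 4^-j in L^1. *)
Lemma radii f : H2 f -> exists r : nat -> R, [/\ forall j, 0 < r j, forall j, r j < 1,
  forall j, r j <= r j.+1, forall j, 1 - j.+1%:R^-1 <= r j &
  forall j, nsq f - (16 ^- j) <= msq f (r j)].
Proof.
move=> F.
have /choice[d Hd] : forall j : nat, exists d : R, [/\ 0 < d, d <= 1 / 2, d <= j.+1%:R^-1 &
    forall r, 1 - d <= r -> r < 1 -> nsq f - 16 ^- j <= msq f r].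
  move=> j; have e0 : 0 < (16 ^- j : R) by rewrite invr_gt0 exprn_gt0.
  have [d d0 H] := msq_lim F e0.
  exists (Num.min (d / 2) (Num.min (1 / 2) j.+1%:R^-1)); split.
  - by rewrite !lt_min !divr_gt0 ?ltr01 //= invr_gt0 ltr0n.
  - by rewrite !ge_min lexx !orbT.
  - by rewrite !ge_min lexx !orbT.
  set m := Num.min _ _; move=> r hr r1; apply/ltW/H => //.
    by have : m <= d / 2 by [rewrite ge_min lexx]; lra.
  by have : m <= 1 / 2 by [rewrite !ge_min lexx orbT]; lra.
have d0 j : 0 < d j by case: (Hd j).
exists (fun j => 1 - runmin d j); split=> j; have [h1 h2 h3 h4] := Hd j;
  have m0 := runmin_gt0 d0 j; have ml := runmin_le d j.
- lra.
- lra.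
- by rewrite lerB // /= ge_min lexx.
- by rewrite lerB // (le_trans ml).
- by apply: h4; lra.
Qed.

Definition osc f r s t : R := normc (f (s%:C * cis t) - f (r%:C * cis t)).

(** Takes the place of Cauchy-Schwarz in passing from L^2 to L^1: it is integrated with
    [k = e^-1]. *)
Lemma amgm_inv (x k : R) : 0 < k -> x <= (k * x ^+ 2 + k^-1) / 2.
Proof.
move=> k0; have : 0 <= (k * x - 1) ^+ 2 by exact: sqr_ge0.
rewrite sqrrB1 exprMn -mulr_natr => h.
suff : k * (2 * x) <= k * (k * x ^+ 2 + k^-1) by rewrite ler_pM2l //; lra.
rewrite [leRHS]mulrDr divff ?gt_eqF //; lra.
Qed.

Lemma osc_cts f r s : (forall z, normc z < 1 -> holo f z) -> 0 <= r -> r < 1 -> 0 <= s -> s < 1 ->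
  forall x, {for x, continuous (osc f r s)}.
Proof.
move=> hf r0 r1 s0 s1 x; apply: rcont_normc.
have cf q : 0 <= q -> q < 1 -> rcont (fun t => f (q%:C * cis t)) x.
  move=> q0 q1; have C : circ f q by apply: circ_disk => // z z1; exact/holo_ccont/hf.
  by apply: (circ_rcts (a := x) (b := x) C).
by apply: rcontB; exact: cf.
Qed.

(** Going from radius [s] to [r] is a dilation by [q = r / s], so the mean square of the increment
    is at most [msq f s - msq f r <= e^2]. *)
Lemma osc_rint f r s (e : R) : H2 f -> 0 < r -> r <= s -> s < 1 -> 0 < e ->
  nsq f - e ^+ 2 <= msq f r -> rint 0 (2 * pi) (osc f r s) <= 2 * pi * e.
Proof.
move=> F r0 rs s1 e0 H; have s0 : 0 < s by apply: lt_le_trans rs.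
have r1 : r < 1 by apply: le_lt_trans s1.
have [a A] := H2_ps F.
pose q := r / s.
have q0 : 0 < q by rewrite divr_gt0.
have q1 : q <= 1 by rewrite ler_pdivrMr // mul1r.
have qs : q * s = r by rewrite /q divfK // gt_eqF.
have := msq_dilate A q0 q1 s0 s1; rewrite qs => hm.
have hm2 : msq (fun z => f z - f (q%:C * z)) s <= e ^+ 2.
  by have := msq_le_nsq F (ltW s0) s1; lra.
have E t : osc f r s t = normc (f (s%:C * cis t) - f (q%:C * (s%:C * cis t))).
  by rewrite /osc mulrA -rmorphM qs.
have Cg : circ (fun z => f z - f (q%:C * z)) s.
  exact: ps_circ (psB A (ps_dilate A (ltW q0) q1)) (ltW s0) s1.
rewrite msq_rint mulrC ler_pdivrMr ?pi2_gt0 // in hm2.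
have c1 := cts_sq Cg.
have c2 : cts 0 (2 * pi) (osc f r s).
  by move=> x _ _; apply: osc_cts => //; [exact: F.1|exact: ltW|exact: ltW].
have c3 : cts 0 (2 * pi) (fun t : R => e / 2) by move=> x _ _; exact: cvg_cst.
have c4 : cts 0 (2 * pi) (fun t => (2 * e)^-1 * normc (f (s%:C * cis t) - f (q%:C * (s%:C * cis t))) ^+ 2).
  by move=> x h h'; apply: cvgM; [exact: cvg_cst|exact: c1].
have c5 : cts 0 (2 * pi) (fun t => (2 * e)^-1 * normc (f (s%:C * cis t) - f (q%:C * (s%:C * cis t))) ^+ 2 + e / 2).
  by move=> x h h'; apply: cvgD; [exact: c4|exact: c3].
apply: (@le_trans _ _ (rint 0 (2 * pi)
   (fun t => (2 * e)^-1 * normc (f (s%:C * cis t) - f (q%:C * (s%:C * cis t))) ^+ 2 + e / 2))).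
  apply: rint_le => // x _ _; rewrite E.
  have := amgm_inv (normc (f (s%:C * cis x) - f (q%:C * (s%:C * cis x)))) (_ : 0 < e^-1).
  by rewrite invr_gt0 e0 invrK invfM => /(_ isT); lra.
rewrite (rintD c4 c3) (rintZ _ c1) rint_cst ?(ltW (pi2_gt0 R)) // subr0.
have -> : 2 * pi * e = (2 * e)^-1 * (e ^+ 2 * (2 * pi)) + e / 2 * (2 * pi).
  by field; rewrite gt_eqF.
by rewrite lerD2r ler_wpM2l // invr_ge0 mulr_ge0 // ltW.
Qed.

Lemma continuous_measurable (u : R -> R) (D : set R) : measurable D ->
  (forall x, {for x, continuous u}) -> measurable_fun D u.
Proof.
move=> mD cu; apply: measurable_funTS; apply: open_continuous_measurable_fun; first exact: openT.
by move=> x _; exact: cu.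
Qed.

(* Along these radii the functions on the circle have summable increments in L^1. *)
Lemma osc_summable f (r : nat -> R) : H2 f -> (forall j, 0 < r j) -> (forall j, r j < 1) ->
  (forall j, r j <= r j.+1) -> (forall j, nsq f - 16 ^- j <= msq f (r j)) ->
  {ae mu, forall t, `[0, 2 * pi]%classic t ->
    (\sum_(0 <= j <oo) (osc f (r j) (r j.+1) t)%:E)%E \is a fin_num}.
Proof.
move=> F r0 r1 rr Hr; have mD : measurable (`[0, 2 * pi]%classic : set R) by [].
have cw j x : {for x, continuous (osc f (r j) (r j.+1))}.
  by apply: osc_cts => //; [exact: F.1|exact: ltW|exact: ltW].
have w0 j x : (0 <= (osc f (r j) (r j.+1) x)%:E)%E by rewrite lee_fin cn_ge0.
have mw j : measurable_fun (`[0, 2 * pi]%classic : set R) (osc f (r j) (r j.+1)).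
  by apply: continuous_measurable => // x; exact: cw.
have mE j : measurable_fun (`[0, 2 * pi]%classic : set R) (fun x => (osc f (r j) (r j.+1) x)%:E).
  exact/measurable_EFinP.
apply: integrable_ae => //; apply/integrableP; split.
  apply: ge0_emeasurable_sum => [j x _ _|j _]; [exact: w0|exact: mE].
under eq_integral do rewrite gee0_abs ?nneseries_ge0 //.
rewrite integral_nneseries //.
have E j : (\int[mu]_(x in `[0%R, (2 * pi)%R]) (osc f (r j) (r j.+1) x)%:E)%E = (rint 0 (2 * pi) (osc f (r j) (r j.+1)))%:E.
  rewrite /rint /Rintegral fineK //; apply: integrable_fin_num => //.
  by apply: cts_integrable => x _ _; exact: cw.
under eq_eseriesr do rewrite E.
apply: (@nneseries_bounded _ _ (2 * pi * 2)).
  by move=> n; rewrite -lee_fin -E; apply: integral_ge0.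
move=> n; apply: (@le_trans _ _ (\sum_(0 <= j < n) (2 * pi) * (1 / 2) ^+ j)).
  apply: ler_sum => j _.
  apply: (@le_trans _ _ (2 * pi * 4 ^- j)); last first.
    rewrite ler_wpM2l ?(ltW (pi2_gt0 R)) // div1r -exprVn; apply: lerXn2r; rewrite ?nnegrE ?invr_ge0 //.
    by rewrite lef_pV2 ?posrE // ler_nat.
  have e0 : 0 < (4 ^- j : R) by rewrite invr_gt0 exprn_gt0.
  apply: osc_rint => //.
  have -> : (4 ^- j) ^+ 2 = 16 ^- j :> R by rewrite exprVn -exprM mulnC exprM -natrX.
  exact: Hr.
rewrite -mulr_sumr ler_pM2l ?pi2_gt0 //.
have h : (1 / 2 : R) != 1 by rewrite lt_eqF //; lra.
have : (\sum_(0 <= j < n) (1 / 2 : R) ^+ j) * (1 / 2) = 1 - (1 / 2) ^+ n.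
  elim: n => [|n IH]; first by rewrite big_nil mul0r expr0 subrr.
  by rewrite big_nat_recr //= mulrDl IH exprSr; lra.
have : 0 <= (1 / 2 : R) ^+ n by rewrite exprn_ge0.
lra.
Qed.

Lemma summable_cvg (u : nat -> R) : (\sum_(0 <= j <oo) (`|u j.+1 - u j|)%:E)%E \is a fin_num -> cvgn u.
Proof.
move=> H.
have h : cvgn [normed series (telescope u)].
  apply: nondecreasing_is_cvgn.
    by apply: nondecreasing_series => n _ _; exact: normr_ge0.
  exists (fine (\sum_(0 <= j <oo) (`|u j.+1 - u j|)%:E)%E) => _ [n _ <-].
  rewrite -lee_fin fineK //= -sumEFin.
  by apply: (nneseries_lim_ge (P := xpredT)) => j _ _; rewrite lee_fin.
have -> : u = (fun n => u 0%N + series (telescope u) n) by apply/funext => n; exact: eq_sum_telescope.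
by apply: is_cvgD; [exact: is_cvg_cst|exact: normed_cvg].
Qed.
End RadialSubsequence.

(** * The Poisson kernel and Poisson's formula *)

Section Poisson.
Variable R : realType.
Implicit Types (f g : R[i] -> R[i]) (z w : R[i]) (r s t : R).
Local Notation mu := (@lebesgue_measure R).

Lemma ae_imp (P Q : R -> Prop) : {ae mu, forall t, P t} -> (forall t, P t -> Q t) -> {ae mu, forall t, Q t}.
Proof.
by move=> [N [mN N0 sub]] PQ; exists N; split=> // t nQ; apply: sub => p; apply: nQ; exact: PQ.
Qed.

(** The usual kernel, as |1 - z conj(cis t)| = |cis t - z|; this form displays the two Cauchy
    kernels it is the sum of. *)
Definition poisson z t : R := (1 - normc z ^+ 2) / normc (1 - z * conjc (cis t)) ^+ 2.

Lemma poisson_den_neq0 z t : normc z < 1 -> 1 - z * conjc (cis t) != 0.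
Proof. by move=> z1; apply: disk_1B_neq0; rewrite cnM cnJ cn_cis mulr1. Qed.

Lemma poisson_ge0 z t : normc z < 1 -> 0 <= poisson z t.
Proof. by move=> z1; rewrite divr_ge0 ?sqr_ge0 // subr_ge0 expr_le1 ?cn_ge0 ?ltW. Qed.

Lemma poisson_continuous z t : normc z < 1 -> {for t, continuous (poisson z)}.
Proof.
move=> z1; apply: cvgM; first exact: cvg_cst.
have h : {for t, continuous (fun t => normc (1 - z * conjc (cis t)))}.
  apply: rcont_normc; apply: rcontB; first exact: rcont_cst.
  by apply: rcontM; [exact: rcont_cst|exact/rcontJ/rcont_cis].
apply: cvgV; first by rewrite expf_neq0 // cn_eq0 poisson_den_neq0.
exact: (cvgM h h).
Qed.

Lemma cis_mulJ t : conjc (cis t) * cis t = 1 :> R[i].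
Proof. by rewrite mulrC mulcJ cn_cis expr1n. Qed.

Lemma cauchy_kernel_sum z (e : R[i]) : conjc e * e = 1 -> e != 0 -> 1 - z * conjc e != 0 ->
  1 - conjc z * e != 0 ->
  e / (e - z) + conjc z * e / (1 - conjc z * e) = (1 - z * conjc z) / ((1 - z * conjc e) * (1 - conjc z * e)).
Proof.
move=> ee e0; have -> : e - z = e * (1 - z * conjc e).
  by rewrite mulrBr mulr1 mulrCA [e * _]mulrC ee mulr1.
move: (conjc e) (conjc z) ee => e' z' ee h1 h2.
have -> : e / (e * (1 - z * e')) = (1 - z * e')^-1 by rewrite invfM mulrA divff // mul1r.
have -> : 1 - z * z' = (1 - z' * e) + z' * e * (1 - z * e').
  by have -> : z * z' = z * z' * (e' * e) by [rewrite ee mulr1]; ring.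
by field; rewrite h1 h2.
Qed.

Lemma poisson_kernelE z t : normc z < 1 ->
  cis t / (cis t - z) + conjc z * cis t / (1 - conjc z * cis t) = (poisson z t)%:C.
Proof.
move=> z1; have h := poisson_den_neq0 t z1.
have hE : 1 - conjc z * cis t = conjc (1 - z * conjc (cis t)).
  by apply: cplx_ext; case: (z) => x y /=; ring.
have h' : 1 - conjc z * cis t != 0 by rewrite hE -cn_eq0 cnJ cn_eq0.
rewrite cauchy_kernel_sum ?cis_mulJ ?cis_neq0 //.
rewrite hE (mulcJ z) (mulcJ (1 - z * conjc (cis t))) /poisson.
by rewrite -[1 in LHS](rmorph1 (real_complex R)) -rmorphB -fmorphV -rmorphM.
Qed.

(* Twice the Cauchy formula: the conjugate kernel integrates [f] to [0]. *)
Lemma poisson_formula f r z : (forall z, normc z < 1 -> holo f z) -> 0 < r -> r < 1 -> normc z < 1 ->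
  f (r%:C * z) = ((2 * pi)^-1)%:C * cint 0 (2 * pi) (fun t => f (r%:C * cis t) * (poisson z t)%:C).
Proof.
move=> hf r0 r1 z1.
have rz : normc (r%:C * z) < r.
  by rewrite cnM cnR gtr0_norm // -[ltRHS]mulr1 ltr_pM2l.
pose G w := f w * (conjc z * w / (r%:C - conjc z * w)).
have Gh w : normc w < 1 -> normc z * normc w < r -> holo G w.
  move=> w1 hw; apply: holoM; first exact: hf.
  have cz : holo (fun w => conjc z * w) w by apply: holoM; [exact: holo_cst|exact: holo_id].
  apply: holo_div => //; last by apply: holoB => //; exact: holo_cst.
  rewrite subr_eq0; apply: contraTneq hw => /(congr1 (@normc R)).
  by rewrite cnM cnJ cnR gtr0_norm // => <-; rewrite ltxx.
have G0 : cmean G r = 0.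
  (* [G] is holomorphic only where |w| < 1 and |z| |w| < r, while [mean_value] asks for the whole
     disk: dilating by r / s with s larger than r and |z| provides it. *)
  pose s := (1 + Num.max r (normc z)) / 2.
  have m1 : r <= Num.max r (normc z) by rewrite le_max lexx.
  have m2 : normc z <= Num.max r (normc z) by rewrite le_max lexx orbT.
  have m3 : Num.max r (normc z) < 1 by rewrite gt_max r1.
  have [s0 s1 sr sz] : [/\ 0 < s, s < 1, r < s & normc z < s] by rewrite /s; split; lra.
  clearbody s.
  have -> : cmean G r = cmean (fun w => G ((r / s)%:C * w)) s.
    rewrite /cmean; congr (_ * _); apply: cint_eq => x _ _.
    by rewrite mulrA -rmorphM divfK // gt_eqF.
  rewrite mean_value // => [|w w1]; first by rewrite /G !mulr0 !mul0r mulr0.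
  have q0 : 0 < r / s by rewrite divr_gt0.
  have nE : normc ((r / s)%:C * w) = r / s * normc w by rewrite cnM cnR gtr0_norm.
  apply: holo_comp; first by apply: holoM; [exact: holo_cst|exact: holo_id].
  apply: Gh; rewrite nE.
    apply: (@le_lt_trans _ _ (normc w)) => //; rewrite ler_piMl ?cn_ge0 //.
    by rewrite ler_pdivrMr // mul1r ltW.
  have h : normc z * normc w < s * 1.
    apply: le_lt_trans (_ : normc z * 1 < _); last by rewrite !mulr1.
    by rewrite ler_wpM2l ?cn_ge0 // ltW.
  have -> : normc z * (r / s * normc w) = r / s * (normc z * normc w) by ring.
  apply: lt_le_trans (_ : r / s * (s * 1) <= _); first by rewrite ltr_pM2l.
  by rewrite mulr1 divfK // gt_eqF.
rewrite (cauchy hf rz r1) -[LHS]addr0 -G0 -cmeanD; first last.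
- apply: circ_holo; first exact: ltW.
  by move=> w wr; apply: Gh; rewrite wr // mulrC -[ltRHS]mulr1 ltr_pM2l.
- apply: circ_holo; first exact: ltW.
  move=> w wr; apply: holoM; first by apply: hf; rewrite wr.
  apply: holo_div; last by apply: holoB; [exact: holo_id|exact: holo_cst].
    by rewrite subr_eq0; apply: contraTneq rz => <-; rewrite wr ltxx.
  exact: holo_id.
rewrite /cmean; congr (_ * _); apply: cint_eq => t _ _.
rewrite /G -mulrDr; congr (_ * _); rewrite -poisson_kernelE //.
have rc : r%:C != 0 :> R[i] by rewrite -cn_gt0 cnR gtr0_norm.
congr (_ + _).
  by rewrite -mulrBr -mulf_div divff // mul1r.
have -> : conjc z * (r%:C * cis t) = r%:C * (conjc z * cis t) by ring.
by rewrite -{2}[r%:C]mulr1 -mulrBr -mulf_div divff // mul1r.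
Qed.

Lemma holo_rcont f r t : (forall z, normc z < 1 -> holo f z) -> 0 <= r -> r < 1 ->
  rcont (fun t => f (r%:C * cis t)) t.
Proof.
move=> hf r0 r1; have C : circ f r by apply: circ_disk => // z z1; exact/holo_ccont/hf.
by apply: (circ_rcts (a := t) (b := t) C).
Qed.

Lemma Re_mulR z r : complex.Re (z * r%:C) = complex.Re z * r.
Proof. by rewrite ReM /= mulr0 subr0. Qed.

Lemma poisson_Re f r z : (forall z, normc z < 1 -> holo f z) -> 0 < r -> r < 1 -> normc z < 1 ->
  complex.Re (f (r%:C * z)) =
    (2 * pi)^-1 * rint 0 (2 * pi) (fun t => complex.Re (f (r%:C * cis t)) * poisson z t).
Proof.
move=> hf r0 r1 z1; rewrite (poisson_formula hf r0 r1 z1) mulrC Re_mulR mulrC; congr (_ * _).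
by rewrite /cint /=; apply: rint_eq => t _ _; rewrite Re_mulR.
Qed.

Lemma poisson_normc f r z : (forall z, normc z < 1 -> holo f z) -> 0 < r -> r < 1 -> normc z < 1 ->
  normc (f (r%:C * z)) <=
    (2 * pi)^-1 * rint 0 (2 * pi) (fun t => normc (f (r%:C * cis t)) * poisson z t).
Proof.
move=> hf r0 r1 z1; rewrite (poisson_formula hf r0 r1 z1) cnM cnR ger0_norm; last first.
  by rewrite invr_ge0 ltW // pi2_gt0.
rewrite ler_wpM2l ?invr_ge0 ?(ltW (pi2_gt0 R)) //.
have -> : rint 0 (2 * pi) (fun t => normc (f (r%:C * cis t)) * poisson z t) =
    rint 0 (2 * pi) (fun t => normc (f (r%:C * cis t) * (poisson z t)%:C)).
  by apply: rint_eq => t _ _; rewrite cnM cnR ger0_norm // poisson_ge0.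
apply: cn_cint => t _ _; apply: rcontM; first by apply: holo_rcont => //; exact: ltW.
by apply: rcont_RtoC; exact: poisson_continuous.
Qed.

Lemma poisson_mass z : normc z < 1 -> (2 * pi)^-1 * rint 0 (2 * pi) (poisson z) = 1.
Proof.
move=> z1; have h : 0 < (1 / 2 : R) /\ (1 / 2 : R) < 1 by lra.
have := poisson_Re (fun w _ => holo_cst 1 w) h.1 h.2 z1.
by under [X in rint _ _ X]eq_fun do rewrite /= mul1r; move=> <-.
Qed.

Lemma radii_cvg (r : nat -> R) : (forall j, r j < 1) -> (forall j, 1 - j.+1%:R^-1 <= r j) ->
  forall e, 0 < e -> exists N, forall j, (N <= j)%N -> 1 - e < r j.
Proof.
move=> r1 Hr e e0; exists (Num.truncn e^-1) => j hj.
apply: lt_le_trans (Hr j); rewrite ltrD2l ltrN2 invf_plt ?posrE ?ltr0n //.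
by apply: lt_le_trans (truncnS_gt _) _; rewrite ler_nat.
Qed.

(** Dominated convergence in Poisson's formula on the circles of radius [r j], with dominating
    function [M * poisson z]. *)
Lemma poisson_limit f (M : R) (r : nat -> R) (U : R -> R) z :
  (forall z, normc z < 1 -> holo f z) -> (forall z, normc z < 1 -> normc (f z) <= M) ->
  (forall j, 0 < r j) -> (forall j, r j < 1) -> (forall j, 1 - j.+1%:R^-1 <= r j) ->
  measurable_fun setT U ->
  {ae mu, forall t, `[0, 2 * pi]%classic t -> complex.Re (f ((r j)%:C * cis t)) @[j --> \oo] --> U t} ->
  normc z < 1 ->
  complex.Re (f z) = (2 * pi)^-1 * rint 0 (2 * pi) (fun t => U t * poisson z t).
Proof.
move=> hf fM r0 r1 rl mU HU z1.
have mD : measurable (`[0, 2 * pi]%classic : set R) by [].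
have mP : measurable_fun (`[0, 2 * pi]%classic : set R) (poisson z).
  by apply: continuous_measurable => // t; exact: poisson_continuous.
have cu j t : {for t, continuous (fun t => complex.Re (f ((r j)%:C * cis t)))}.
  by apply: rcont_Re; apply: holo_rcont => //; exact: ltW.
have M0 : 0 <= M by apply: le_trans (cn_ge0 _) (fM 0 _); rewrite cn0.
pose F j t := (complex.Re (f ((r j)%:C * cis t)) * poisson z t)%:E.
have cF j t : {for t, continuous (fun t => complex.Re (f ((r j)%:C * cis t)) * poisson z t)}.
  by apply: cvgM; [exact: cu|exact: poisson_continuous].
have mF j : measurable_fun (`[0, 2 * pi]%classic : set R) (F j).
  by apply/measurable_EFinP; apply: continuous_measurable => // t; exact: cF.
have mU' : measurable_fun (`[0, 2 * pi]%classic : set R) (fun t => (U t * poisson z t)%:E).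
  by apply/measurable_EFinP; apply: measurable_funM => //; apply: measurable_funTS.
have cvF : {ae mu, forall t, `[0, 2 * pi]%classic t -> F ^~ t @ \oo --> (U t * poisson z t)%:E}.
  apply: (ae_imp HU) => t Ht /Ht h; apply: cvg_EFin; first by apply: nearW.
  by apply: cvgM => //; exact: cvg_cst.
have iM : mu.-integrable `[0, 2 * pi] (fun t => (M * poisson z t)%:E).
  by apply: cts_integrable => t _ _; apply: cvgM; [exact: cvg_cst|exact: poisson_continuous].
have bF : {ae mu, forall t n, `[0, 2 * pi]%classic t -> (`|F n t| <= (M * poisson z t)%:E)%E}.
  apply: aeW => t j _; rewrite lee_fin normrM [`|poisson _ _|]ger0_norm ?poisson_ge0 //.
  rewrite ler_wpM2r ?poisson_ge0 //; apply: le_trans (Re_le_cn _) (fM _ _).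
  by rewrite cn_circle // ltW.
have [_ _] := @dominated_convergence _ _ R mu _ mD F _ _ mF mU' cvF iM bF.
have -> : (fun n => \int[mu]_(x in `[0%R, (2 * pi)%R]) F n x)%E =
    (fun n => (2 * pi * complex.Re (f ((r n)%:C * z)))%:E).
  apply/funext => n; rewrite poisson_Re // mulrA divff ?gt_eqF ?pi2_gt0 // mul1r.
  rewrite /rint /Rintegral fineK //; apply: integrable_fin_num => //.
  by apply: cts_integrable => t _ _; exact: cF.
move=> H.
have H' : (2 * pi * complex.Re (f ((r n)%:C * z)))%:E @[n --> \oo] --> (2 * pi * complex.Re (f z))%:E.
  apply: cvg_EFin; first by apply: nearW.
  apply: cvgM; first exact: cvg_cst.
  apply/cvgrPdist_lt => e e0.
  have [d d0 Hd] := holo_ccont (hf _ z1) e0.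
  have [N HN] := radii_cvg r1 rl d0; exists N => // j /= /HN hj.
  rewrite distrC -ReN -ReD; apply: le_lt_trans (Re_le_cn _) _; apply: Hd.
  have -> : (r j)%:C * z - z = - ((1 - r j)%:C * z) by rewrite rmorphB rmorph1; ring.
  rewrite cnN cnM cnR ger0_norm ?subr_ge0 ?(ltW (r1 j)) //.
  have h1 : 0 <= 1 - r j by rewrite subr_ge0 ltW.
  have := ler_piMr h1 (ltW z1); lra.
have hR : hausdorff_space (\bar R) by exact: ereal_hausdorff.
have E := cvg_unique hR H H'.
by rewrite /rint /Rintegral E /= [RHS]mulrA mulVf ?mul1r // gt_eqF ?pi2_gt0.
Qed.
End Poisson.

(** * Lebesgue points and dyadic bounds for the Poisson kernel *)

Section LebesguePoint.
Variable R : realType.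
Implicit Types (f g : R[i] -> R[i]) (z w : R[i]) (r s t h e : R).
Local Notation mu := (@lebesgue_measure R).

Lemma bounded_integrable (D : set R) (u : R -> R) (M : R) : measurable D -> (mu D < +oo)%E ->
  measurable_fun D u -> (forall x, D x -> `|u x| <= M) -> mu.-integrable D (EFin \o u).
Proof.
move=> mD fD mU uM; apply: (@le_integrable _ _ _ mu D mD _ (EFin \o (cst M))).
- exact/measurable_EFinP.
- by move=> x Dx; rewrite /= lee_fin (le_trans (uM x Dx)) // ler_norm.
apply/integrableP; split; first exact/measurable_EFinP/measurable_cst.
by under eq_integral do rewrite /=; rewrite integral_cst // lte_mul_pinfty.
Qed.

Lemma lebesgue_pt_ball (U : R -> R) (M : R) t e : measurable_fun setT U -> (forall x, `|U x| <= M) ->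
  lebesgue_pt U t -> 0 < e ->
  exists2 d : R, 0 < d & forall p, 0 < p -> p < d ->
    \int[mu]_(s in ball t p) `|U s - U t| <= e * (2 * p).
Proof.
move=> mU UM /fine_cvgP[_ /cvgrPdist_le H] e0.
have := H e e0; rewrite near_withinE => /nbhs_ballP[d /= d0 Hd].
exists d => // p p0 pd; have := Hd p; rewrite /ball /= sub0r normrN gtr0_norm // => /(_ pd p0).
have p2 : p *+ 2 != 0 by rewrite mulrn_eq0 /= gt_eqF.
rewrite /davg /iavg lebesgue_measure_ball ?(ltW p0) // inver (negbTE p2).
have mB : measurable (ball t p : set R) by exact: measurable_ball.
have mW : measurable_fun (ball t p : set R) (fun s => `|U s - U t|).
  apply: measurableT_comp; first exact: normr_measurable.
  by apply: measurable_funB; [exact: measurable_funTS|exact: measurable_cst].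
have iW : mu.-integrable (ball t p) (EFin \o (fun s => `|U s - U t|)).
  apply: (@bounded_integrable _ _ (M + M)) => //; first by rewrite lebesgue_measure_ball ?(ltW p0) // ltry.
  by move=> x _; rewrite normr_id (le_trans (ler_normB _ _)) // lerD.
set I := (\int[mu]_(y in ball t p) _)%E.
have -> : I = (\int[mu]_(s in ball t p) `|U s - U t|)%:E.
  by rewrite /Rintegral fineK //; exact: integrable_fin_num.
rewrite /= sub0r normrN ger0_norm; last first.
  rewrite mulr_ge0 ?invr_ge0 ?mulrn_wge0 ?(ltW p0) //.
  by apply: Rintegral_ge0 => x _.
by rewrite mulrC ler_pdivrMr ?mulrn_wgt0 // mulr_natl.
Qed.

Lemma poisson_den r t s : normc (1 - r%:C * cis t * conjc (cis s)) ^+ 2 =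
  (1 - r) ^+ 2 + 2 * r * (1 - cos (t - s)).
Proof.
have -> : r%:C * cis t * conjc (cis s) = r%:C * cis (t - s) by rewrite -mulrA -cisN -cisD.
rewrite cn_sqr; have := cos2Dsin2 (t - s); rewrite /cis; move: (cos _) (sin _) => c d E.
rewrite !(ReD, ImD, ReN, ImN, ReM, ImM) /= !mul0r subr0 addr0 sub0r.
have -> : (- (r * d)) ^+ 2 = r ^+ 2 * d ^+ 2 by ring.
have -> : d ^+ 2 = 1 - c ^+ 2 by lra.
ring.
Qed.

Lemma sqr_1B r : 1 - r ^+ 2 = (1 - r) * (1 + r). Proof. by ring. Qed.

Lemma poisson_bound r t s (k : R) : 1 / 2 <= r -> r < 1 -> 0 < k ->
  k <= normc (1 - r%:C * cis t * conjc (cis s)) ^+ 2 ->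
  poisson (r%:C * cis t) s <= 2 * (1 - r) / k.
Proof.
move=> r2 r1 k0 hk; rewrite /poisson cn_circle; last by lra.
apply: ler_pM; rewrite ?invr_ge0 ?sqr_ge0 ?subr_ge0 //.
- by rewrite expr_le1 ?ltW //; lra.
- by rewrite sqr_1B mulrC ler_wpM2r //; lra.
- by rewrite lef_pV2 ?posrE // (lt_le_trans k0).
Qed.

Lemma poisson_le_height r t s : 1 / 2 <= r -> r < 1 -> poisson (r%:C * cis t) s <= 2 / (1 - r).
Proof.
move=> r2 r1; have h0 : 0 < 1 - r by lra.
have -> : 2 / (1 - r) = 2 * (1 - r) / (1 - r) ^+ 2 by field; rewrite gt_eqF.
apply: poisson_bound => //; first by rewrite exprn_gt0.
by rewrite poisson_den lerDl mulr_ge0 ?subr_ge0 ?cos_le1 //; lra.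
Qed.

Lemma poisson_le_cos r t s (c : R) : 1 / 2 <= r -> r < 1 -> 0 < c -> c <= 1 - cos (t - s) ->
  poisson (r%:C * cis t) s <= 2 * (1 - r) / c.
Proof.
move=> r2 r1 c0 hc; apply: poisson_bound => //; rewrite poisson_den.
have h1 := sqr_ge0 (1 - r); have h2 : 1 * (1 - cos (t - s)) <= 2 * r * (1 - cos (t - s)).
  by rewrite ler_wpM2r ?subr_ge0 ?cos_le1 //; lra.
lra.
Qed.

(** The derivative of the sine at 0 gives |sin x| >= |x| / 2 for small x, and 2 (1 - cos x) >= sin^2
    x. *)
Lemma cos_quadratic : exists2 d : R, 0 < d & forall x, `|x| < d -> x ^+ 2 / 8 <= 1 - cos x.
Proof.
have [du dv] := is_derive_sin (0 : R).
move: du => /cvg_ex[l Hl].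
have lE : l = 1 by rewrite -[RHS]cos0 -dv; apply/esym/cvg_lim.
have e0 : 0 < (1 / 2 : R) by lra.
move/cvgrPdist_le: Hl => /(_ _ e0); rewrite lE near_withinE => /nbhs_ballP[d /= d0 Hd].
exists d => // x xd; have [->|x0] := eqVneq x 0.
  by rewrite cos0 subrr expr0n mul0r.
have := Hd x; rewrite /ball /= sub0r normrN => /(_ xd x0).
rewrite /GRing.scale /= mulr1 addr0 sin0 subr0 => H.
have h1 : 1 / 2 <= `|x^-1 * sin x|.
  by have := ler_normD (1 - x^-1 * sin x) (x^-1 * sin x); rewrite subrK normr1; lra.
have h2 : (1 / 2) * `|x| <= `|sin x|.
  by rewrite -ler_pdivlMr ?normr_gt0 // [leRHS]mulrC -normfV -normrM.
have h3 : ((1 / 2) * `|x|) ^+ 2 <= `|sin x| ^+ 2.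
  by apply: lerXn2r; rewrite ?nnegrE ?mulr_ge0 //; lra.
rewrite exprMn !real_normK ?num_real // in h3.
have h4 := cos2Dsin2 x.
have h5 : 0 <= (1 - cos x) ^+ 2 by exact: sqr_ge0.
have E5 : (1 - cos x) ^+ 2 = 1 - 2 * cos x + cos x ^+ 2 by ring.
rewrite E5 in h5.
have E : (1 / 2) ^+ 2 = 1 / 4 :> R by field.
rewrite E in h3; lra.
Qed.

Lemma cos_far (d y : R) : 0 < d -> d <= pi -> d <= y -> y <= 2 * pi - d -> cos y <= cos d.
Proof.
move=> d0 dpi dy yd; have p0 := pi_gt0 R.
have H x : d <= x -> x <= pi -> cos x <= cos d.
  move=> h1 h2; have [->//|ne] := eqVneq x d.
  by rewrite ltW // ltr_cos ?in_itv /= ?lt_def ?ne //; lra.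
have [yp|yp] := leP y pi; first exact: H.
have -> : cos y = cos (2 * pi - y).
  by rewrite -cosN -(cosD2pi (- y)); congr cos; rewrite -mulr_natl; ring.
by apply: H; lra.
Qed.

Lemma dyadic_index (h x : R) n : 0 < h -> h <= x -> x < 2 ^+ n * h ->
  exists k, [/\ (k < n)%N, 2 ^+ k * h <= x & x < 2 ^+ k.+1 * h].
Proof.
move=> h0 hx; elim: n => [|n IH] H; first by move: H; rewrite expr0 mul1r ltNge hx.
have [xn|xn] := ltP x (2 ^+ n * h); last by exists n.
by have [k [k1 k2 k3]] := IH xn; exists k; split=> //; exact: ltnW.
Qed.

Lemma dyadic_scale (h d : R) : 0 < h -> h <= d -> exists n : nat, 2 ^+ n * h <= d /\ d < 2 ^+ n.+1 * h.
Proof.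
move=> h0 hd.
have [N HN] : exists N : nat, d < 2 ^+ N * h.
  exists (Num.truncn (d / h)).+1; rewrite -ltr_pdivrMr //.
  apply: lt_le_trans (truncnS_gt _) _; rewrite -natrX ler_nat ltnW //; exact: ltn_expl.
have [k [_ k1 k2]] := dyadic_index h0 hd HN; by exists k.
Qed.

(* On the k-th dyadic ring around [t] the Poisson kernel is at most [64 / (4^k h)]; the last term
   covers the arc where it is uniformly small. *)
Lemma poisson_dyadic t : 0 < t -> t < 2 * pi -> exists2 d0 : R, 0 < d0 &
  forall d, 0 < d -> d < d0 -> [/\ (forall s, ball t d s -> 0 <= s /\ s <= 2 * pi) &
  exists B : R, forall r, 1 / 2 <= r -> r < 1 -> 1 - r <= d -> exists n : nat,
    2 ^+ n * (1 - r) <= d /\ forall s, 0 <= s -> s <= 2 * pi ->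
    poisson (r%:C * cis t) s <=
      \sum_(k < n.+1) 64 / (4 ^+ k * (1 - r)) * \1_(ball t (2 ^+ k * (1 - r))) s + B * (1 - r)].
Proof.
move=> t0 t2; have [dq dq0 Hq] := cos_quadratic; have p0 := pi_gt0 R.
pose d0 := Num.min (Num.min dq pi) (Num.min t (2 * pi - t)).
have d01 : d0 <= dq by rewrite !ge_min lexx.
have d02 : d0 <= pi by rewrite !ge_min lexx orbT.
have d03 : d0 <= t by rewrite !ge_min lexx !orbT.
have d04 : d0 <= 2 * pi - t by rewrite !ge_min lexx !orbT.
exists d0; first by rewrite !lt_min dq0 p0 t0 subr_gt0.
clearbody d0 => d dp dd; split.
  by move=> s; rewrite /ball /= ltr_norml => /andP[? ?]; lra.
pose c := 1 - cos (d / 2).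
have c0 : 0 < c by rewrite subr_gt0 -[ltRHS]cos0 ltr_cos ?in_itv /=; lra.
exists (2 / c) => r r2 r1 hd; set h := 1 - r.
have h0 : 0 < h by rewrite subr_gt0.
have [n [n1 n2]] := dyadic_scale h0 hd; exists n; split=> // s s0 s2.
have T0 (k : nat) : 0 <= 64 / (4 ^+ k * h) * \1_(ball t (2 ^+ k * h)) s.
  by rewrite mulr_ge0 ?divr_ge0 ?mulr_ge0 ?exprn_ge0 ?(ltW h0) // indicE ler0n.
have S0 : 0 <= \sum_(k < n.+1) 64 / (4 ^+ k * h) * \1_(ball t (2 ^+ k * h)) s.
  by apply: sumr_ge0 => k _; exact: T0.
have B0 : 0 <= 2 / c * h by rewrite mulr_ge0 ?divr_ge0 ?ltW.
have bE k : `|t - s| < 2 ^+ k * h -> \1_(ball t (2 ^+ k * h)) s = 1 :> R.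
  by move=> H; rewrite indicE mem_set.
have single (k : nat) : (k < n.+1)%N -> `|t - s| < 2 ^+ k * h -> poisson (r%:C * cis t) s <= 64 / (4 ^+ k * h) ->
    poisson (r%:C * cis t) s <= \sum_(k < n.+1) 64 / (4 ^+ k * h) * \1_(ball t (2 ^+ k * h)) s.
  move=> kn H /le_trans; apply; rewrite (bigD1 (Ordinal kn)) //= bE // mulr1 lerDl.
  by apply: sumr_ge0 => j _; exact: T0.
have [far|near] := leP (d / 2) `|t - s|.
  apply: (@le_trans _ _ (2 / c * h)); last by rewrite lerDr.
  have -> : 2 / c * h = 2 * (1 - r) / c by rewrite /h; ring.
  apply: poisson_le_cos => //; rewrite lerB // -(cos_norm (t - s)).
  apply: cos_far; [lra|lra|by []|].
  by rewrite ler_norml; apply/andP; split; lra.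
apply: (@le_trans _ _ (\sum_(k < n.+1) 64 / (4 ^+ k * h) * \1_(ball t (2 ^+ k * h)) s)); last by rewrite lerDl.
have [hs|hs] := ltP `|t - s| h.
  apply: (single 0%N) => //; first by rewrite expr0 mul1r.
  apply: le_trans (poisson_le_height t s r2 r1) _.
  by rewrite expr0 mul1r ler_wpM2r ?invr_ge0 ?(ltW h0) // ler_nat.
have hn : `|t - s| < 2 ^+ n * h by move: n2; rewrite exprS; lra.
have [k [k1 k2 k3]] := dyadic_index h0 hs hn.
(* A point of the ring from 2^k h to 2^(k+1) h lies in the ball of index k + 1, where the bound 16 /
   (4^k h) equals 64 / (4^(k+1) h). *)
apply: (single k.+1) => //.
have ts0 : 0 < `|t - s| by apply: lt_le_trans hs.
have q0 : 0 < (t - s) ^+ 2 / 8 by rewrite -real_normK ?num_real // divr_gt0 ?exprn_gt0.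
have q1 : (t - s) ^+ 2 / 8 <= 1 - cos (t - s) by apply: Hq; lra.
apply: le_trans (poisson_le_cos r2 r1 q0 q1) _.
have x0 : 0 < (2 ^+ k * h) ^+ 2 by rewrite exprn_gt0 // mulr_gt0 ?exprn_gt0.
have x1 : (2 ^+ k * h) ^+ 2 <= (t - s) ^+ 2.
  rewrite -[(t - s) ^+ 2]real_normK ?num_real //; apply: lerXn2r; rewrite ?nnegrE //.
  by rewrite mulr_ge0 ?exprn_ge0 ?ltW.
apply: (@le_trans _ _ (2 * h / ((2 ^+ k * h) ^+ 2 / 8))).
  rewrite ler_wpM2l ?mulr_ge0 ?(ltW h0) // lef_pV2 ?posrE ?divr_gt0 ?(lt_le_trans x0 x1) //.
  by rewrite ler_pM2r // invr_gt0.
have E4 : (2 ^+ k * h) ^+ 2 = 4 ^+ k * h ^+ 2.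
  rewrite exprMn -[(2 ^+ k) ^+ 2]exprM mulnC exprM.
  by have -> : 2 ^+ 2 = 4 :> R by ring.
have y0 : (4 : R) ^+ k != 0 by rewrite expf_neq0.
rewrite E4 [4 ^+ k.+1]exprS le_eqVlt; apply/orP; left; apply/eqP.
have hn0 : h != 0 by rewrite gt_eqF.
clear -y0 hn0; move: (4 ^+ k) y0 => y y0; clearbody h.
by field; rewrite y0 hn0.
Qed.
End LebesguePoint.

(** * Radial limits of Poisson integrals at Lebesgue points *)

Section RadialLimit.
Variable R : realType.
Implicit Types (f g : R[i] -> R[i]) (z w : R[i]) (r s t h e : R).
Local Notation mu := (@lebesgue_measure R).
Local Notation D := (`[0, 2 * pi]%classic : set R).

Lemma circle_finite : (mu D < +oo)%E.
Proof. by rewrite /= lebesgue_measure_itv /= lte_fin pi2_gt0 -EFinD ltry. Qed.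

Lemma circle_integrableZ (c : R) (u : R -> R) : mu.-integrable D (EFin \o u) ->
  mu.-integrable D (EFin \o (fun s => c * u s)).
Proof. by move=> iu; have := @integrableZl _ _ R mu D (measurable_itv _) c (EFin \o u) iu. Qed.

Lemma circle_integrableD (u v : R -> R) : mu.-integrable D (EFin \o u) -> mu.-integrable D (EFin \o v) ->
  mu.-integrable D (EFin \o (fun s => u s + v s)).
Proof. by move=> iu iv; have := @integrableD _ _ R mu D (measurable_itv _) (EFin \o u) (EFin \o v) iu iv. Qed.

Lemma circle_integrableB (u v : R -> R) : mu.-integrable D (EFin \o u) -> mu.-integrable D (EFin \o v) ->
  mu.-integrable D (EFin \o (fun s => u s - v s)).
Proof. by move=> iu iv; have := @integrableB _ _ R mu D (measurable_itv _) (EFin \o u) (EFin \o v) iu iv. Qed.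

Lemma abs_rint_le (u : R -> R) : mu.-integrable D (EFin \o u) ->
  `|rint 0 (2 * pi) u| <= rint 0 (2 * pi) (fun s => `|u s|).
Proof. by move=> iu; exact: (@le_normr_Rintegral _ _ R mu D u (measurable_itv _) iu). Qed.

Lemma integrable_lincomb n (c : nat -> R) (V : nat -> R -> R) :
  (forall k, mu.-integrable D (EFin \o V k)) ->
  mu.-integrable D (EFin \o (fun s => \sum_(k < n) c k * V k s)) /\
  rint 0 (2 * pi) (fun s => \sum_(k < n) c k * V k s) = \sum_(k < n) c k * rint 0 (2 * pi) (V k).
Proof.
move=> iV; have mD : measurable D by [].
have iZ k : mu.-integrable D (EFin \o (fun s => c k * V k s)).
  exact: circle_integrableZ.
elim: n => [|n [IH1 IH2]].
  rewrite big_ord0; under [X in EFin \o X]eq_fun do rewrite big_ord0; split.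
    by apply: cts_integrable => s _ _; exact: cvg_cst.
  under [X in rint _ _ X]eq_fun do rewrite big_ord0.
  by rewrite rint_cst ?mul0r // ltW // pi2_gt0.
split.
  under [X in EFin \o X]eq_fun do rewrite big_ord_recr /=.
  exact: circle_integrableD IH1 (iZ n).
under [X in rint _ _ X]eq_fun do rewrite big_ord_recr /=.
rewrite big_ord_recr /= -IH2 -[X in _ = _ + X]RintegralZl //.
exact: RintegralD.
Qed.

Lemma geo_half_le n : \sum_(k < n) (2 ^- k : R) <= 2.
Proof.
have : \sum_(k < n) (2 ^- k : R) = 2 - 2 * 2 ^- n.
  elim: n => [|n IH]; first by rewrite big_ord0 expr0 invr1 mulr1 subrr.
  rewrite big_ord_recr /= IH exprS invfM.
  have x0 : (2 : R) ^+ n != 0 by rewrite expf_neq0.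
  by field.
have : 0 <= (2 ^- n : R) by rewrite invr_ge0 exprn_ge0.
lra.
Qed.

(** As the kernel has mass 1, the error is at most the Poisson mean of |U - U t|. The dyadic
    majorant reduces it to averages over balls centred at [t], weighted by 2^-k, which are small at
    a Lebesgue point. *)
Lemma radial_at_lebesgue_pt (u : R[i] -> R) (U : R -> R) (M t : R) :
  measurable_fun setT U -> (forall x, `|U x| <= M) -> 0 < t -> t < 2 * pi -> lebesgue_pt U t ->
  (forall z, normc z < 1 -> u z = (2 * pi)^-1 * rint 0 (2 * pi) (fun s => U s * poisson z s)) ->
  forall e, 0 < e -> exists2 d : R, 0 < d & forall r, 1 - d < r -> r < 1 -> `|u (r%:C * cis t) - U t| <= e.
Proof.
move=> mU UM t0 t2 Lt uE e e0; have p0 := pi2_gt0 R; have mD : measurable D by [].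
have M0 : 0 <= M by apply: le_trans (normr_ge0 _) (UM 0).
(* The ball of index k and radius p = 2^k h contributes 64 / (4^k h) times e (2 pi) / 512 times 2 p,
   which is e (2 pi) / 4 times 2^-k. *)
have e10 : 0 < e * (2 * pi) / 512 by apply: divr_gt0; [exact: mulr_gt0|rewrite ltr0n].
have [d1 d10 H1] := lebesgue_pt_ball mU UM Lt e10.
have [d0 d00 H0] := poisson_dyadic t0 t2.
pose d := Num.min d1 d0 / 2.
have [m1 m2 m3] : [/\ Num.min d1 d0 <= d1, Num.min d1 d0 <= d0 & 0 < Num.min d1 d0].
  by rewrite !ge_min !lexx !orbT lt_min d10 d00.
have [dp dd1 dd0] : [/\ 0 < d, d < d1 & d < d0] by rewrite /d; split; lra.
have [Hball [B HB]] := H0 d dp dd0.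
(* Makes the contribution of the far arc, [|B| (1 - r) (M + M)], at most [e / 2]. *)
pose eta := e / (4 * (`|B| * M + 1)).
have BM : 0 < `|B| * M + 1 by rewrite ltr_wpDl ?mulr_ge0.
have eta0 : 0 < eta by apply: divr_gt0 => //; exact: mulr_gt0.
exists (Num.min (1 / 2) (Num.min d eta)); first by rewrite !lt_min eta0 dp divr_gt0.
set m := Num.min (1 / 2) _; move=> r rm r1.
have [k1 k2 k3] : [/\ m <= 1 / 2, m <= d & m <= eta] by rewrite /m !ge_min !lexx !orbT.
have r2 : 1 / 2 <= r by lra.
have rd : 1 - r <= d by lra.
have re : 1 - r <= eta by lra.
have h0 : 0 < 1 - r by lra.
have [n [n1 Hn]] := HB r r2 r1 rd.
have z1 : normc (r%:C * cis t) < 1 by rewrite cn_circle //; lra.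
pose W : R -> R := fun s => `|U s - U t|.
have WM s : `|W s| <= M + M by rewrite normr_id (le_trans (ler_normB _ _)) // lerD.
have W0 s : 0 <= W s by exact: normr_ge0.
have mW : measurable_fun setT W.
  apply: measurableT_comp; first exact: normr_measurable.
  by apply: measurable_funB.
have cK s : {for s, continuous (poisson (r%:C * cis t))} by exact: poisson_continuous.
have K0 s : 0 <= poisson (r%:C * cis t) s by exact: poisson_ge0.
have mK : measurable_fun D (poisson (r%:C * cis t)) by apply: continuous_measurable.
have KB s : `|poisson (r%:C * cis t) s| <= 2 / (1 - r).
  by rewrite ger0_norm // poisson_le_height.
have iUK : mu.-integrable D (EFin \o (fun s => U s * poisson (r%:C * cis t) s)).
  apply: (@bounded_integrable _ _ _ (M * (2 / (1 - r))) mD circle_finite).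
    by apply: measurable_funM => //; exact: measurable_funTS.
  by move=> s _; rewrite normrM ler_pM.
have iK : mu.-integrable D (EFin \o (fun s => U t * poisson (r%:C * cis t) s)).
  apply: (@bounded_integrable _ _ _ (M * (2 / (1 - r))) mD circle_finite).
    by apply: measurable_funM.
  by move=> s _; rewrite normrM ler_pM.
have iWK : mu.-integrable D (EFin \o (fun s => W s * poisson (r%:C * cis t) s)).
  apply: (@bounded_integrable _ _ _ ((M + M) * (2 / (1 - r))) mD circle_finite).
    by apply: measurable_funM => //; exact: measurable_funTS.
  by move=> s _; rewrite normrM ler_pM.
have E : u (r%:C * cis t) - U t = (2 * pi)^-1 * rint 0 (2 * pi) (fun s => U s * poisson (r%:C * cis t) s - U t * poisson (r%:C * cis t) s).
  have E1 : rint 0 (2 * pi) (fun s => U s * poisson (r%:C * cis t) s - U t * poisson (r%:C * cis t) s) =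
      rint 0 (2 * pi) (fun s => U s * poisson (r%:C * cis t) s) - U t * rint 0 (2 * pi) (poisson (r%:C * cis t)).
    have iP : mu.-integrable D (EFin \o poisson (r%:C * cis t)).
      by apply: (@bounded_integrable _ _ _ (2 / (1 - r)) mD circle_finite).
    rewrite /rint RintegralB //; congr (_ - _); exact: RintegralZl.
  by rewrite E1 mulrBr [in X in _ = _ - X]mulrCA (poisson_mass z1) mulr1 uE.
have LE : `|u (r%:C * cis t) - U t| <= (2 * pi)^-1 * rint 0 (2 * pi) (fun s => W s * poisson (r%:C * cis t) s).
  rewrite E normrM ger0_norm ?invr_ge0 ?(ltW p0) // ler_wpM2l ?invr_ge0 ?(ltW p0) //.
  apply: le_trans (abs_rint_le (circle_integrableB iUK iK)) _.
  rewrite le_eqVlt; apply/orP; left; apply/eqP; apply: rint_eq => s _ _.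
  by rewrite /W -mulrBl normrM [`|poisson _ _|]ger0_norm.
apply: le_trans LE _.
pose c (k : nat) := 64 / (4 ^+ k * (1 - r)).
pose V (k : nat) s := W s * \1_(ball t (2 ^+ k * (1 - r))) s.
have iV k : mu.-integrable D (EFin \o V k).
  apply: (@bounded_integrable _ _ _ ((M + M) * 1) mD circle_finite).
    apply: measurable_funM; first exact: measurable_funTS.
    by apply: measurable_indic; exact: measurable_ball.
  by move=> s _; rewrite normrM; apply: ler_pM => //; rewrite indicE; case: (_ \in _); rewrite /= ?normr1 ?normr0.
have [iS ES] := integrable_lincomb n.+1 c iV.
have iC : mu.-integrable D (EFin \o (fun=> `|B| * (1 - r) * (M + M))).
  by apply: cts_integrable => s _ _; exact: cvg_cst.
have LE2 : rint 0 (2 * pi) (fun s => W s * poisson (r%:C * cis t) s) <=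
    rint 0 (2 * pi) (fun s => \sum_(k < n.+1) c k * V k s + `|B| * (1 - r) * (M + M)).
  apply: le_Rintegral => //; first exact: (circle_integrableD iS iC).
  move=> s; rewrite /= in_itv /= => /andP[s0 s2].
  apply: le_trans (ler_wpM2l (W0 s) (Hn s s0 s2)) _.
  rewrite mulrDr; apply: lerD.
    rewrite mulr_sumr; apply: ler_sum => k _; rewrite /c /V.
    by rewrite mulrCA.
  apply: (@le_trans _ _ (W s * (`|B| * (1 - r)))).
    by rewrite ler_wpM2l // ler_wpM2r ?(ltW h0) // ler_norm.
  rewrite mulrC ler_wpM2l ?mulr_ge0 ?(ltW h0) //.
  by apply: le_trans (ler_norm _) (WM s).
apply: (@le_trans _ _ ((2 * pi)^-1 * (\sum_(k < n.+1) c k * rint 0 (2 * pi) (V k) + `|B| * (1 - r) * (M + M) * (2 * pi)))).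
  rewrite ler_wpM2l ?invr_ge0 ?(ltW p0) //; apply: le_trans LE2 _.
  rewrite /rint RintegralD // -/(rint _ _ _) ES lerD2l.
  by rewrite -/(rint _ _ _) rint_cst ?subr0 // ltW.
have VE (k : nat) : (k < n.+1)%N -> c k * rint 0 (2 * pi) (V k) <= e * (2 * pi) / 4 * 2 ^- k.
  rewrite ltnS => kn; pose p := 2 ^+ k * (1 - r).
  have pp : 0 < p by rewrite mulr_gt0 ?exprn_gt0.
  have pd : p <= d.
    by apply: le_trans n1; rewrite ler_wpM2r ?(ltW h0) // ler_eXn2l // ltr1n.
  have EV : rint 0 (2 * pi) (V k) = \int[mu]_(s in ball t p) W s.
    have -> : ball t p = D `&` ball t p.
      rewrite setIC; apply/esym/setIidPl => s hs.
      have [h1 h2] := Hball s (le_ball pd hs); by rewrite /= in_itv /= h1.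
    rewrite Rintegral_mkcondr; apply: rint_eq => s _ _.
    by rewrite /V -/p patchE indicE; case: ifP => _; rewrite ?mulr1 ?mulr0.
  have := H1 p pp (le_lt_trans pd dd1); rewrite -/W -EV => h.
  have ck : 0 <= c k by rewrite divr_ge0 ?mulr_ge0 ?exprn_ge0 ?(ltW h0).
  apply: le_trans (ler_wpM2l ck h) _.
  have x0 : (2 : R) ^+ k != 0 by rewrite expf_neq0.
  have E4 : (4 : R) ^+ k = 2 ^+ k * 2 ^+ k by rewrite -exprMn; congr (_ ^+ _); ring.
  have hn0 : 1 - r != 0 by rewrite gt_eqF.
  rewrite /c /p E4; move: (2 ^+ k) x0 (1 - r) hn0 => x x0 h' hn0.
  rewrite le_eqVlt; apply/orP; left; apply/eqP; field; by rewrite x0 hn0.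
have SE : \sum_(k < n.+1) c k * rint 0 (2 * pi) (V k) <= e * (2 * pi) / 4 * 2.
  apply: (@le_trans _ _ (\sum_(k < n.+1) e * (2 * pi) / 4 * 2 ^- k)).
    by apply: ler_sum => k _; apply: VE.
  by rewrite -mulr_sumr ler_wpM2l ?geo_half_le // divr_ge0 // mulr_ge0 // ltW.
have LB : `|B| * (1 - r) * (M + M) <= e / 2.
  have : (`|B| * M + 1) * (1 - r) <= (`|B| * M + 1) * eta by rewrite ler_wpM2l // ltW.
  have -> : (`|B| * M + 1) * eta = e / 4 by rewrite /eta; field; rewrite gt_eqF.
  have -> : `|B| * (1 - r) * (M + M) = 2 * (`|B| * M * (1 - r)) by ring.
  rewrite mulrDl; lra.
rewrite mulrC ler_pdivrMr //.
have : `|B| * (1 - r) * (M + M) * (2 * pi) <= e / 2 * (2 * pi) by rewrite ler_wpM2r // ltW.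
lra.
Qed.
End RadialLimit.

(** * Fatou's theorem for bounded functions *)

Section FatouBounded.
Variable R : realType.
Implicit Types (f g : R[i] -> R[i]) (z w : R[i]) (r s t h e : R).
Local Notation mu := (@lebesgue_measure R).
Local Notation D := (`[0, 2 * pi]%classic : set R).

Lemma ae_and (P Q : R -> Prop) : {ae mu, forall t, P t} -> {ae mu, forall t, Q t} ->
  {ae mu, forall t, P t /\ Q t}.
Proof.
move=> [N [mN N0 sN]] [N' [mN' N'0 sN']]; exists (N `|` N'); split.
- exact: measurableU.
- exact: null_set_setU.
- move=> t /= nPQ; have [p|np] := pselect (P t); last by left; exact: sN.
  by right; apply: sN' => q; apply: nPQ.
Qed.

Lemma H2_bounded f (M : R) : (forall z, normc z < 1 -> holo f z) ->
  (forall z, normc z < 1 -> normc (f z) <= M) -> H2 f.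
Proof.
move=> hf fM; split=> //; exists (M * M) => r r0 r1.
have C : circ f r by apply: circ_disk => // z z1; exact/holo_ccont/hf.
apply: le_trans (ler_norm _) _; apply: le_trans (Re_le_cn _) _.
apply: cn_cmean_le; first by apply: circM => //; exact: circJ.
move=> t _ _; have h : normc (f (r%:C * cis t)) <= M by apply: fM; rewrite cn_circle.
by rewrite cnM cnJ ler_pM ?cn_ge0.
Qed.

Lemma Re_holo_bounded_radial f (M : R) : (forall z, normc z < 1 -> holo f z) ->
  (forall z, normc z < 1 -> normc (f z) <= M) ->
  {ae mu, forall t, 0 < t -> t < 2 * pi -> exists l : R, forall e, 0 < e -> exists2 d : R, 0 < d &
    forall r, 1 - d < r -> r < 1 -> `|complex.Re (f (r%:C * cis t)) - l| <= e}.
Proof.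
move=> hf fM; have F := H2_bounded hf fM.
have [r [r0 r1 rr rl rn]] := radii F.
pose u (j : nat) t : R^o := complex.Re (f ((r j)%:C * cis t)).
have uM j t : `|u j t| <= M.
  by apply: le_trans (Re_le_cn _) (fM _ _); rewrite cn_circle // ltW.
(* The upper limit is measurable and bounded by [M] at every angle, and agrees with the limit almost
   everywhere; both properties are required of the Poisson density. *)
pose U t : R := limn_sup (u ^~ t).
have cvU : {ae mu, forall t, D t -> u j t @[j --> \oo] --> U t}.
  apply: (ae_imp (osc_summable F r0 r1 rr rn)) => t Ht /Ht H.
  have : cvgn (u ^~ t : nat -> R).
    apply: summable_cvg; rewrite ge0_fin_numE; last by apply: nneseries_ge0 => j _ _; rewrite lee_fin.
    have H' : (\sum_(0 <= j <oo) (osc f (r j) (r j.+1) t)%:E < +oo)%E.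
      by rewrite -ge0_fin_numE //; apply: nneseries_ge0 => j _ _; rewrite lee_fin cn_ge0.
    apply: le_lt_trans H'; apply: lee_nneseries => [j _ _|j _]; rewrite lee_fin //.
    by rewrite /u -ReN -ReD Re_le_cn.
  by move=> /cvg_ex[l Hl]; rewrite /U (cvg_limn_inf_sup Hl).
have UE t : U t = inf (range (sups (u ^~ t))).
  apply: limn_supE; exists M; split; first exact: num_real.
  by move=> x Mx j _; apply: le_trans (uM j t) (ltW Mx).
have UM t : `|U t| <= M.
  have sb n : - M <= sups (u ^~ t) n /\ sups (u ^~ t) n <= M.
    have ub : has_ubound (sdrop (u ^~ t) n).
      by exists M => _ [j _ <-]; have := uM j t; rewrite ler_norml => /andP[].
    split; last first.
      by apply: ge_sup; [exists (u n t); exists n => /=|move=> _ [j _ <-]; have := uM j t; rewrite ler_norml => /andP[]].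
    apply: le_trans (_ : u n t <= _); first by have := uM n t; rewrite ler_norml => /andP[].
    by apply: ub_le_sup => //; exists n => /=.
  rewrite UE ler_norml; apply/andP; split.
    by apply: lb_le_inf; [exists (sups (u ^~ t) 0%N); exists 0%N|move=> _ [n _ <-]; exact: (sb n).1].
  apply: le_trans (sb 0%N).2; apply: ge_inf; last by exists 0%N.
  by exists (- M) => _ [n _ <-]; exact: (sb n).1.
have mU : measurable_fun setT U.
  apply: measurable_fun_limn_sup => [t _|t _|j].
  - by exists M => _ [j _ <-]; have := uM j t; rewrite ler_norml => /andP[].
  - by exists (- M) => _ [j _ <-]; have := uM j t; rewrite ler_norml => /andP[].
  - by apply: continuous_measurable => // t; apply: rcont_Re; apply: holo_rcont => //; exact: ltW.
have uE z : normc z < 1 -> complex.Re (f z) = (2 * pi)^-1 * rint 0 (2 * pi) (fun s => U s * poisson z s).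
  by apply: (poisson_limit hf fM r0 r1 rl mU cvU).
have LU : {ae mu, forall t, lebesgue_pt U t}.
  apply: lebesgue_differentiation; split=> //; first exact: openT.
  move=> K _ cK; have mK := compact_measurable cK.
  apply: (@le_lt_trans _ _ (\int[mu]_(x in K) (cst M%:E x))%E).
    apply: ge0_le_integral => //; last by move=> x _; rewrite lee_fin.
      by apply/measurable_EFinP; apply: measurableT_comp; [exact: normr_measurable|exact: measurable_funTS].
  have M0 : 0 <= M by apply: le_trans (normr_ge0 _) (UM 0).
  by rewrite integral_cst // lte_mul_pinfty // compact_finite_measure.
apply: (ae_imp LU) => t Lt t0 t2; exists (U t).
exact: (radial_at_lebesgue_pt (u := fun z => complex.Re (f z)) mU UM t0 t2 Lt uE).
Qed.

(** The imaginary part of [f] is minus the real part of ['i * f], to which the real case applies as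
    well. *)
Theorem bounded_fatou f (M : R) : (forall z, normc z < 1 -> holo f z) ->
  (forall z, normc z < 1 -> normc (f z) <= M) ->
  {ae mu, forall t, 0 < t -> t < 2 * pi -> exists l, lim1 (fun r => f (r%:C * cis t)) l}.
Proof.
move=> hf fM.
have hg z : normc z < 1 -> holo (fun z => 'i * f z) z.
  by move=> z1; apply: holoM; [exact: holo_cst|exact: hf].
have ni : normc ('i : R[i]) = 1 by rewrite /normc /= expr0n add0r expr1n sqrtr1.
have gM z : normc z < 1 -> normc ('i * f z) <= M by move=> z1; rewrite cnM ni mul1r fM.
apply: (ae_imp (ae_and (Re_holo_bounded_radial hf fM) (Re_holo_bounded_radial hg gM))).
move=> t [H1 H2] t0 t2; have [l1 L1] := H1 t0 t2; have [l2 L2] := H2 t0 t2.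
exists (l1 +i* - l2) => e e0; have e4 : 0 < e / 4 by rewrite divr_gt0.
have [d1 d10 K1] := L1 _ e4; have [d2 d20 K2] := L2 _ e4.
exists (Num.min d1 d2); first by rewrite lt_min d10.
set m := Num.min d1 d2; have [m1 m2] : m <= d1 /\ m <= d2 by rewrite /m !ge_min !lexx orbT.
move=> r rm r1.
have k1 : `|complex.Re (f (r%:C * cis t)) - l1| <= e / 4 by apply: K1 => //; lra.
have k2 : `|complex.Re ('i * f (r%:C * cis t)) - l2| <= e / 4 by apply: K2 => //; lra.
have Ei w : complex.Re ('i * w) = - complex.Im w by rewrite ReM /= mul0r mul1r sub0r.
rewrite Ei in k2; apply: le_lt_trans (cn_le_ReIm _) _.
rewrite ReD ImD ReN ImN /= opprK -[`|complex.Im _ + _|]normrN opprD; lra.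
Qed.
End FatouBounded.

(** * Radial limits in H^1 *)

Section HarmonicMajorant.
Variable R : realType.
Implicit Types (f g h : R[i] -> R[i]) (z w x : R[i]) (r s t e p : R).
Local Notation mu := (@lebesgue_measure R).

(** Taylor coefficients of (1 + x) / (1 - x). *)
Definition schwarz_coef (k : nat) : R[i] := if k is 0%N then 1 else 2%:R.

Lemma schwarz_kernel_rem x p n : normc x <= p -> p < 1 ->
  normc ((1 + x) / (1 - x) - \sum_(k < n) schwarz_coef k * x ^+ k) <= 2 / (1 - p) * p ^+ n.
Proof.
move=> xp p1; have x1 : normc x < 1 by apply: le_lt_trans p1.
have d0 := disk_1B_neq0 x1; have q0 : 0 < 1 - p by rewrite subr_gt0.
have hq : 1 - p <= normc (1 - x) by have := cnB_ge 1 x; rewrite cn1; lra.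
have hV : normc (1 - x)^-1 <= (1 - p)^-1.
  by rewrite cnV lef_pV2 ?posrE // (lt_le_trans q0).
case: n => [|n].
  rewrite big_ord0 subr0 expr0 mulr1 cnM ler_pM ?cn_ge0 //.
  by apply: le_trans (cnD _ _) _; rewrite cn1; lra.
have -> : (1 + x) / (1 - x) - \sum_(k < n.+1) schwarz_coef k * x ^+ k = 2%:R * x ^+ n.+1 / (1 - x).
  elim: n => [|n IH].
    by rewrite big_ord1 expr0 mulr1 expr1; field.
  rewrite big_ord_recr opprD addrA IH /= [x ^+ n.+2]exprSr.
  by move: (x ^+ n.+1) => y; field.
rewrite !cnM cnn cnX mulrAC; apply: ler_pM; rewrite ?mulr_ge0 ?exprn_ge0 ?cn_ge0 //.
  by rewrite ler_wpM2l.
by apply: lerXn2r; rewrite ?nnegrE ?cn_ge0 // (le_trans (cn_ge0 x)).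
Qed.

Lemma Re_cay x : normc x < 1 -> complex.Re ((1 + x) / (1 - x)) = (1 - normc x ^+ 2) / normc (1 - x) ^+ 2.
Proof.
move=> x1; rewrite Re_ratio ?disk_1B_neq0 //; congr (_ / _).
by rewrite cn_sqr; case: (x) => a b /=; ring.
Qed.

Lemma cn_cmean1 h : circ h 1 -> normc (cmean h 1) <= (2 * pi)^-1 * rint 0 (2 * pi) (fun t => normc (h (cis t))).
Proof.
move=> H; rewrite /cmean cnM cnR ger0_norm ?invr_ge0 ?(ltW (pi2_gt0 R)) //.
rewrite ler_wpM2l ?invr_ge0 ?(ltW (pi2_gt0 R)) //.
have -> : (fun t => normc (h (cis t))) = (fun t => normc (h (1%:C * cis t))).
  by apply/funext => t; rewrite mul1r.
exact/cn_cint/circ_rcts.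
Qed.

Lemma cn_cmean1_le h (g : R -> R) (k : R) : circ h 1 -> 0 <= k -> cts 0 (2 * pi) g ->
  (forall t, normc (h (cis t)) <= g t * k) ->
  normc (cmean h 1) <= (2 * pi)^-1 * rint 0 (2 * pi) g * k.
Proof.
move=> H k0 cg hg; apply: le_trans (cn_cmean1 H) _; rewrite -mulrA.
rewrite ler_wpM2l ?invr_ge0 ?(ltW (pi2_gt0 R)) // [leRHS]mulrC -(rintZ k cg); apply: rint_le.
- move=> t _ _; apply: rcont_normc; have := circ_rcts (a := t) (b := t) H.
  by under eq_fun do rewrite mul1r; apply.
- by move=> t t0 t1; apply: cvgM; [exact: cvg_cst|exact: cg].
- by move=> t _ _; rewrite mulrC.
Qed.

(** [G] is the Herglotz transform of the density [|f|] on the circle of radius [r]: as conj w = 1/w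
    on the unit circle, the kernel is (w + z) / (w - z), whose real part is the Poisson kernel. The
    bounds see [r] only through [B], which permits letting [r] tend to 1. *)
Lemma schwarz_integral f r (B : R) : (forall z, normc z < 1 -> holo f z) -> 0 < r -> r < 1 ->
  (2 * pi)^-1 * rint 0 (2 * pi) (fun t => normc (f (r%:C * cis t))) <= B ->
  exists (c : nat -> R[i]) (G : R[i] -> R[i]), [/\
    forall n w p, p < 1 -> normc w <= p -> normc (G w - pol c n w) <= B * (2 / (1 - p) * p ^+ n),
    forall k, normc (c k) <= B * 2 &
    forall z, normc z < 1 -> normc (f (r%:C * z)) <= complex.Re (G z)].
Proof.
move=> hf r0 r1 fB.
pose h w : R[i] := (normc (f (r%:C * w)))%:C.
have Ch : circ h 1.
  move=> t; rewrite mul1r; have hc : ccont (fun w => f (r%:C * w)) (cis t).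
    apply: (@ccont_comp _ (fun w => r%:C * w) f).
      by apply: ccontM; [exact: ccont_cst|exact: ccont_id].
    by apply/holo_ccont/hf; rewrite cn_circle // ltW.
  move=> e /hc[d d0 Hd]; exists d => // w /Hd; apply: le_lt_trans.
  rewrite /h -rmorphB cnR ler_norml; have := cnB_ge (f (r%:C * w)) (f (r%:C * cis t)).
  by have := cnB_ge (f (r%:C * cis t)) (f (r%:C * w)); rewrite cnBC; lra.
have CJ : circ (fun w => conjc w) 1 by apply: circJ; exact: circ_id.
have cg : cts 0 (2 * pi) (fun t => normc (f (r%:C * cis t))).
  by move=> t _ _; apply: rcont_normc; apply: holo_rcont => //; exact: ltW.
have nh t : normc (h (cis t)) = normc (f (r%:C * cis t)).
  by rewrite /h cnR ger0_norm // cn_ge0.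
have B0 : 0 <= B.
  apply: le_trans fB; rewrite mulr_ge0 ?invr_ge0 ?(ltW (pi2_gt0 R)) //.
  by apply: Rintegral_ge0 => t _; exact: cn_ge0.
have Cpow (k : nat) : circ (fun w => conjc w ^+ k) 1.
  elim: k => [|k IH]; first by under eq_fun do rewrite expr0; exact: circ_cst.
  by under eq_fun do rewrite exprS; exact: circM.
have fBk (x y : R) : 0 <= y -> x <= (2 * pi)^-1 * rint 0 (2 * pi) (fun t => normc (f (r%:C * cis t))) * y -> x <= B * y.
  by move=> y0 /le_trans; apply; rewrite ler_wpM2r.
exists (fun k => schwarz_coef k * cmean (fun w => h w * conjc w ^+ k) 1).
exists (fun z => cmean (fun w => h w * ((1 + z * conjc w) / (1 - z * conjc w))) 1).
have nsc k : normc (schwarz_coef k) <= 2 by case: k => [|k] /=; rewrite ?cn1 ?cnn; lra.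
have Ck z : normc z < 1 -> circ (fun w => (1 + z * conjc w) / (1 - z * conjc w)) 1.
  move=> z1 t; have := CJ t; rewrite mul1r => c; apply: ccontM.
    by apply: ccontD; [exact: ccont_cst|apply: ccontM => //; exact: ccont_cst].
  apply: ccontV; first exact: poisson_den_neq0.
  by apply: ccontD; [exact: ccont_cst|apply/ccontN/ccontM => //; exact: ccont_cst].
split.
- move=> n z p p1 zp; have z1 : normc z < 1 by apply: le_lt_trans p1.
  have p0 : 0 <= p by apply: le_trans zp; exact: cn_ge0.
  have CF k : circ (fun w => h w * (schwarz_coef k * (z * conjc w) ^+ k)) 1.
    apply: circM => //; apply: circM; first exact: circ_cst.
    under eq_fun do rewrite exprMn.
    by apply: circM => //; exact: circ_cst.
  have -> : pol (fun k => schwarz_coef k * cmean (fun w => h w * conjc w ^+ k) 1) n z =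
      cmean (fun w => \sum_(k < n) h w * (schwarz_coef k * (z * conjc w) ^+ k)) 1.
    rewrite (cmean_sum n CF); apply: eq_bigr => k _.
    rewrite -mulrA [cmean _ _ * _]mulrC mulrA -cmeanZ; last exact: circM.
    by apply: cmean_eq => t; rewrite exprMn; ring.
  rewrite -cmeanB; first last.
  - have CS m : circ (fun w => \sum_(k < m) h w * (schwarz_coef k * (z * conjc w) ^+ k)) 1.
      elim: m => [|m IH]; first by under eq_fun do rewrite big_ord0; exact: circ_cst.
      by under eq_fun do rewrite big_ord_recr /=; exact: circD.
    exact: CS.
  - by apply: circM => //; exact: Ck.
  have k0 : 0 <= 2 / (1 - p) * p ^+ n by rewrite mulr_ge0 ?exprn_ge0 ?divr_ge0 // subr_ge0 ltW.
  apply: fBk => //; apply: cn_cmean1_le => //.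
    apply: circD; first by apply: circM => //; exact: Ck.
    apply: circN; have CS m : circ (fun w => \sum_(k < m) h w * (schwarz_coef k * (z * conjc w) ^+ k)) 1.
      elim: m => [|m IH]; first by under eq_fun do rewrite big_ord0; exact: circ_cst.
      by under eq_fun do rewrite big_ord_recr /=; exact: circD.
    exact: CS.
  move=> t; rewrite -mulr_sumr -mulrBr cnM nh ler_wpM2l ?cn_ge0 //.
  by apply: schwarz_kernel_rem => //; rewrite cnM cnJ cn_cis mulr1.
- move=> k; rewrite cnM mulrC.
  apply: (@le_trans _ _ (B * 1 * 2)); last by rewrite mulr1.
  apply: ler_pM; rewrite ?cn_ge0 //; apply: fBk => //; apply: cn_cmean1_le => //; first exact: circM.
  by move=> t; rewrite cnM nh cnX cnJ cn_cis expr1n.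
- move=> z z1; apply: le_trans (poisson_normc hf r0 r1 z1) _.
  have ReZ (x : R) w : complex.Re (x%:C * w) = x * complex.Re w by rewrite [_%:C * w]mulrC Re_mulR [RHS]mulrC.
  rewrite /cmean ReZ.
  rewrite ler_wpM2l ?invr_ge0 ?(ltW (pi2_gt0 R)) //.
  have Re_cint F : complex.Re (cint 0 (2 * pi) F) = rint 0 (2 * pi) (fun t => complex.Re (F t)) by [].
  rewrite Re_cint le_eqVlt; apply/orP; left; apply/eqP; apply: rint_eq => t _ _.
  rewrite mul1r /h ReZ Re_cay; last by rewrite cnM cnJ cn_cis mulr1.
  by rewrite /poisson cnM cnJ cn_cis mulr1.
Qed.

(* A limit of the Schwarz integrals of [|f|] on circles of radius tending to 1. *)
Theorem harmonic_majorant f (B : R) : (forall z, normc z < 1 -> holo f z) ->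
  (forall r, 0 < r -> r < 1 -> (2 * pi)^-1 * rint 0 (2 * pi) (fun t => normc (f (r%:C * cis t))) <= B) ->
  exists G, (forall z, normc z < 1 -> holo G z) /\
    forall z, normc z < 1 -> normc (f z) <= complex.Re (G z).
Proof.
move=> hf fB.
pose r (j : nat) : R := 1 - j.+2%:R^-1.
have j0 (j : nat) : 0 < j.+2%:R^-1 :> R by rewrite invr_gt0 ltr0n.
have j1 (j : nat) : j.+2%:R^-1 < 1 :> R by rewrite invf_lt1 ?ltr0n // ltr1n.
have r0 j : 0 < r j by rewrite subr_gt0.
have r1 j : r j < 1 by rewrite /r gtrBl.
have rl j : 1 - j.+1%:R^-1 <= r j.
  by rewrite lerD2l lerN2 lef_pV2 ?posrE ?ltr0n // ler_nat.
clearbody r.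
have /choice[c Hc] : forall j, exists c : nat -> R[i], exists G : R[i] -> R[i], [/\
    forall n w p, p < 1 -> normc w <= p -> normc (G w - pol c n w) <= B * (2 / (1 - p) * p ^+ n),
    forall k, normc (c k) <= B * 2 &
    forall z, normc z < 1 -> normc (f ((r j)%:C * z)) <= complex.Re (G z)].
  by move=> j; apply: (schwarz_integral hf (r0 j) (r1 j)); exact: fB.
have [k [kinc [a Ha]]] : exists k : nat -> nat, (forall j, (k j < k j.+1)%N) /\
    exists a, forall n, ccvg (fun j => c (k j) n) (a n).
  by apply: (@diagonal _ c (B * 2)) => j n; have [G [_ H _]] := Hc j.
have ba n : normc (a n) <= B * 2.
  apply/ler_addgt0Pr => e e0; have [N /(_ N (leqnn N)) H] := Ha n e e0.
  have : normc (c (k N) n) <= B * 2 by have [G [_ H' _]] := Hc (k N).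
  by have := cnB_ge (a n) (c (k N) n); rewrite cnBC; lra.
have [G HG] := ps_exists_bounded ba.
exists G; split; first by move=> z z1; exact: (ps_holo HG).
move=> z z1; apply/ler_addgt0Pr => e e0; have z0 := cn_ge0 z.
have e4 : 0 < e / 4 by rewrite divr_gt0.
pose p := (1 + normc z) / 2; have [p0 p1 zp] : [/\ 0 < p, p < 1 & normc z <= p] by rewrite /p; split; lra.
have [M [q [M0 q0 q1 Hq]]] := HG p p0 p1.
have [N1 HN1] := geo_cvg M q0 q1 e4.
have [N2 HN2] := geo_cvg (B * (2 / (1 - p))) (ltW p0) p1 e4.
pose n := maxn N1 N2.
have d0 : 0 < e / 4 / n.+1%:R by rewrite divr_gt0.
have /choice[N HN] : forall i, exists N : nat, forall j, (N <= j)%N -> normc (c (k j) i - a i) < e / 4 / n.+1%:R.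
  by move=> i; exact: Ha.
have [d dp Hd] := holo_ccont (hf _ z1) e4.
have [N3 HN3] := radii_cvg r1 rl dp.
pose J := maxn N3 (\max_(i < n) N i)%N.
have [Gj [h1 _ h3]] := Hc (k J).
have A1 := h1 n z p p1 zp; have A2 := Hq n z zp; have A3 := h3 z z1.
have A4 : normc (f ((r (k J))%:C * z) - f z) < e / 4.
  apply: Hd; have -> : (r (k J))%:C * z - z = - ((1 - r (k J))%:C * z) by rewrite rmorphB rmorph1; ring.
  have hr := r1 (k J); rewrite cnN cnM cnR ger0_norm ?subr_ge0 ?(ltW hr) //.
  have hJ : 1 - d < r (k J).
    by apply: HN3; apply: leq_trans (incr_ge kinc J); exact: leq_maxl.
  have h5 : 0 <= 1 - r (k J) by rewrite subr_ge0 ltW.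
  have := ler_piMr h5 (ltW z1); lra.
have A5 : normc (pol (c (k J)) n z - pol a n z) <= e / 4.
  have -> : pol (c (k J)) n z - pol a n z = \sum_(i < n) (c (k J) i - a i) * z ^+ i.
    by rewrite /pol -sumrB; apply: eq_bigr => i _; rewrite mulrBl.
  apply: le_trans (cn_sum _ _ _) _.
  apply: (@le_trans _ _ (\sum_(i < n) e / 4 / n.+1%:R)).
    apply: ler_sum => i _; rewrite cnM cnX.
    apply: (@le_trans _ _ (e / 4 / n.+1%:R * 1)); last by rewrite mulr1.
    apply: ler_pM; rewrite ?exprn_ge0 ?cn_ge0 // ?exprn_ile1 ?cn_ge0 ?(ltW z1) //.
    apply/ltW/HN; apply: leq_trans (leq_maxr N3 _); exact: (leq_bigmax i).
  rewrite sumr_const card_ord -[leLHS]mulr_natr -mulrA ler_piMr ?(ltW e4) //.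
  by rewrite mulrC ler_pdivrMr ?ltr0n // mul1r ler_nat.
have A6 := HN1 n (leq_maxl _ _); have A7 := HN2 n (leq_maxr _ _).
rewrite -[B * _ * _]mulrA in A7.
have T : normc (Gj z - G z) <= e / 4 + e / 4 + e / 4.
  have -> : Gj z - G z = (Gj z - pol (c (k J)) n z) + (pol (c (k J)) n z - pol a n z) - (G z - pol a n z) by ring.
  apply: le_trans (cnB _ _) _; apply: lerD; last by apply: le_trans A2 (ltW A6).
  by apply: le_trans (cnD _ _) _; apply: lerD => //; apply: le_trans A1 (ltW A7).
have T1 := Re_le_cn (Gj z - G z); rewrite ReD ReN in T1.
have T2 := cnB_ge (f z) (f ((r (k J))%:C * z)); rewrite cnBC in T2.
have T3 := ler_norm (complex.Re (Gj z) - complex.Re (G z)).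
lra.
Qed.
End HarmonicMajorant.

(** * Fatou's theorem in H^1 *)

Section FatouHardy.
Variable R : realType.
Implicit Types (f g h : R[i] -> R[i]) (z w : R[i]) (r s t e p : R).
Local Notation mu := (@lebesgue_measure R).
Local Notation D := (`[0, 2 * pi]%classic : set R).

Lemma Re_scale (x : R) w : complex.Re (x%:C * w) = x * complex.Re w.
Proof. by rewrite ReM /= mul0r subr0. Qed.

Lemma Re_cint (a b : R) (F : R -> R[i]) : complex.Re (cint a b F) = rint a b (fun t => complex.Re (F t)).
Proof. by []. Qed.

Lemma hardy1_mean_le f : hardy 1 f -> (forall z, normc z < 1 -> holo f z) /\
  exists B : R, forall r, 0 < r -> r < 1 ->
    (2 * pi)^-1 * rint 0 (2 * pi) (fun t => normc (f (r%:C * cis t))) <= B.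
Proof.
move=> [/analyticP hf fo]; split=> //.
have E r : 0 < r -> r < 1 ->
    integral_mean 1 f r = ((2 * pi)^-1 * rint 0 (2 * pi) (fun t => normc (f (r%:C * cis t))))%:E.
  move=> r0 r1; rewrite /integral_mean /circle_integral EFinM; congr (_ * _)%E.
  have E : (fun t : R => (normc (f (r%:C * cis t)) `^ 1)%:E) = EFin \o (fun t => normc (f (r%:C * cis t))).
    by apply/funext => t /=; rewrite powRr1 ?cn_ge0.
  rewrite E /rint /Rintegral fineK // integrable_fin_num //; apply: cts_integrable => t _ _.
  by apply: rcont_normc; apply: holo_rcont => //; exact: ltW.
have le r : 0 < r -> r < 1 -> (integral_mean 1 f r <= hardy_sup 1 f)%E.
  by move=> r0 r1; apply: ereal_sup_ubound; exists r => //; rewrite /= in_itv /= (ltW r0).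
case S : (hardy_sup 1 f) fo => [x| |] // _.
  by exists x => r r0 r1; rewrite -lee_fin -E // -S; exact: le.
by exists 0 => r r0 r1; have := le r r0 r1; rewrite S E // leeNy_eq.
Qed.

Lemma limn_einf_ge (u : nat -> \bar R) (K : \bar R) : (exists N : nat, forall j, (N <= j)%N -> (K <= u j)%E) ->
  (K <= limn_einf u)%E.
Proof.
move=> [N HN]; rewrite limn_einf_lim; apply: lime_ge; first exact: is_cvg_einfs.
exists N => // n /= Nn; apply: le_ereal_inf_tmp => _ [m /= nm <-].
by apply: HN; exact: leq_trans nm.
Qed.

(* Fatou's lemma for the square root of [|g|], which is at most a multiple of [Re (g^(1/2))]. *)
Lemma norm_not_to_infinity g : (forall z, normc z < 1 -> holo g z) ->
  (forall z, normc z < 1 -> 0 < complex.Re (g z)) ->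
  {ae mu, forall t, D t -> ~ (forall K : R, exists2 d : R, 0 < d & forall r, 1 - d < r -> r < 1 ->
     K <= normc (g (r%:C * cis t)))}.
Proof.
move=> hg gp; pose s z := cpow (1 / 2) (g z).
have [h0 h1] : 0 < (1 / 2 : R) /\ (1 / 2 : R) < 1 by lra.
have hs z : normc z < 1 -> holo s z.
  by move=> z1; apply: holo_comp; [exact: hg|exact/holo_cpow/gp].
have sE z : normc z < 1 -> normc (s z) ^+ 2 = normc (g z).
  move=> z1; have g0 : 0 < normc (g z) by rewrite cn_gt0 Re_gt0_neq0 // gp.
  rewrite cn_cpow -expRM_natl mulrA.
  have -> : 2%:R * (1 / 2) = 1 :> R by field.
  by rewrite mul1r lnK.
pose c := cos (1 / 2 * (pi / 2) : R).
have c0 : 0 < c by exact: cos_cpow_gt0.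
have sc z : c * normc (s z) <= complex.Re (s z) by apply: Re_cpow_ge => //; exact: ltW.
clearbody s.
pose r (j : nat) : R := 1 - j.+2%:R^-1.
have j0 (j : nat) : 0 < j.+2%:R^-1 :> R by rewrite invr_gt0 ltr0n.
have j1 (j : nat) : j.+2%:R^-1 < 1 :> R by rewrite invf_lt1 ?ltr0n // ltr1n.
have r0 j : 0 < r j by rewrite subr_gt0.
have r1 j : r j < 1 by rewrite /r gtrBl.
have rl j : 1 - j.+1%:R^-1 <= r j.
  by rewrite lerD2l lerN2 lef_pV2 ?posrE ?ltr0n // ler_nat.
clearbody r.
have cs j t : {for t, continuous (fun t => normc (s ((r j)%:C * cis t)))}.
  by apply: rcont_normc; apply: holo_rcont => //; exact: ltW.
have mean_s j : rint 0 (2 * pi) (fun t => normc (s ((r j)%:C * cis t))) <= c^-1 * (2 * pi * complex.Re (s 0)).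
  have C : circ s (r j) by apply: circ_disk => // [z z1|]; [exact/holo_ccont/hs|exact: ltW].
  have := mean_value hs (r0 j) (r1 j) => /(congr1 (@complex.Re R)).
  rewrite /cmean Re_scale Re_cint => E.
  have ER : 2 * pi * complex.Re (s 0) = rint 0 (2 * pi) (fun t => complex.Re (s ((r j)%:C * cis t))).
    by rewrite -E mulrA divff ?mul1r // gt_eqF // pi2_gt0.
  rewrite ER ler_pdivlMl // -rintZ; last by move=> t _ _; exact: cs.
  apply: rint_le.
  - by move=> t _ _; apply: cvgM; [exact: cvg_cst|exact: cs].
  - by move=> t _ _; apply: rcont_Re; apply: holo_rcont => //; exact: ltW.
  - by move=> t _ _; exact: sc.
have mD : measurable D by [].
pose u (j : nat) t := (normc (s ((r j)%:C * cis t)))%:E.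
have mu_ j : measurable_fun D (u j).
  by apply/measurable_EFinP; apply: continuous_measurable => // t; exact: cs.
have u0 j t : D t -> (0 <= u j t)%E by move=> _; rewrite lee_fin cn_ge0.
have F : (\int[mu]_(t in D) limn_einf (u ^~ t) <= limn_einf (fun j => \int[mu]_(t in D) u j t))%E.
  exact: (@fatou _ _ R mu D mD u mu_ u0).
have L : (limn_einf (fun j => \int[mu]_(t in D) u j t) <= (c^-1 * (2 * pi * complex.Re (s 0)))%:E)%E.
  apply: le_trans (limn_einf_sup _) _; rewrite limn_esup_lim; apply: lime_le; first exact: is_cvg_esups.
  apply: nearW => n; apply: ge_ereal_sup => _ [m _ <-].
  have -> : (\int[mu]_(t in D) u m t)%E = (rint 0 (2 * pi) (fun t => normc (s ((r m)%:C * cis t))))%:E.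
    rewrite /rint /Rintegral fineK //; apply: integrable_fin_num => //.
    by apply: cts_integrable => t _ _; exact: cs.
  by rewrite lee_fin.
have e0 t : (0 <= limn_einf (u ^~ t))%E.
  by apply: limn_einf_ge; exists 0%N => j _; rewrite lee_fin cn_ge0.
have I : mu.-integrable D (fun t => limn_einf (u ^~ t)).
  apply/integrableP; split.
    have -> : (fun t => limn_einf (u ^~ t)) = (fun t => - limn_esup ((fun j t => - u j t) ^~ t))%E.
      by apply/funext => t; rewrite -[RHS]/(- limn_esup (-%E \o (u ^~ t)))%E limn_esupN oppeK.
    apply: measurableT_comp => //.
    by apply: (@measurable_fun_limn_esup _ _ R D (fun j t => - u j t)%E) => j; apply: measurableT_comp => //; exact: mu_.
  under eq_integral do rewrite gee0_abs //.
  by apply: le_lt_trans F _; apply: le_lt_trans L _; exact: ltry.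
have A : {ae mu, forall t, D t -> limn_einf (u ^~ t) \is a fin_num}.
  exact: (@integrable_ae _ _ R mu D mD _ I).
apply: (ae_imp A) => t H Dt K; have := H Dt.
rewrite ge0_fin_numE // => fi.
have fi' : limn_einf (u ^~ t) \is a fin_num by rewrite ge0_fin_numE.
(* Since |s|^2 = |g|, divergence of |g| would force the lower limit of |s| to be at least itself
   plus 1. *)
pose x := fine (limn_einf (u ^~ t)) + 1.
have x1 : 0 <= x by rewrite addr_ge0 // fine_ge0.
have [d d0 Hd] := K (x ^+ 2).
have [N HN] := radii_cvg r1 rl d0.
have : (x%:E <= limn_einf (u ^~ t))%E.
  apply: limn_einf_ge; exists N => j /HN hj; rewrite lee_fin.
  have := Hd (r j) hj (r1 j); rewrite -sE; last by rewrite cn_circle // ltW.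
  by rewrite ler_pXn2r // nnegrE ?cn_ge0.
by rewrite -(fineK fi') lee_fin /x; lra.
Qed.

Lemma lim1_cvgP (u : R -> R[i]) (l : R[i]) :
  lim1 u l <-> ((u r : R[i]^o) @[r --> (1 : R)^'-] --> (l : R[i]^o)).
Proof.
split=> [H|/(@cvgcP _ _ _ _ _ _) H e /H].
  apply/(@cvgcP _ _ _) => e e0; have [d d0 Hd] := H _ e0.
  rewrite near_withinE; apply/nbhs_ballP; exists d => // r.
  rewrite /ball /= => hr r1; apply: Hd => //.
  by move: hr; rewrite ltr_norml => /andP[_]; lra.
rewrite near_withinE => /nbhs_ballP[d /= d0 Hd]; exists d => // r hr r1.
by apply: Hd => //; rewrite /ball /= gtr0_norm; lra.
Qed.

Theorem fatou_H1 f : hardy 1 f ->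
  {ae mu, forall t, 0 < t -> t < 2 * pi -> exists l, lim1 (fun r => f (r%:C * cis t)) l}.
Proof.
move=> /hardy1_mean_le[hf [B fB]].
have [G [hG fG]] := harmonic_majorant hf fB.
pose g z := 1 + G z.
have hg z : normc z < 1 -> holo g z by move=> z1; apply: holoD; [exact: holo_cst|exact: hG].
have gR z : normc z < 1 -> 1 + normc (f z) <= complex.Re (g z).
  by move=> z1; rewrite ReD /= lerD2l fG.
have gp z : normc z < 1 -> 0 < complex.Re (g z).
  by move=> z1; apply: lt_le_trans (gR z z1); rewrite ltr_wpDr ?cn_ge0.
have g0 z : normc z < 1 -> g z != 0 by move=> z1; exact/Re_gt0_neq0/gp.
have gn z : normc z < 1 -> 1 + normc (f z) <= normc (g z).
  by move=> z1; apply: le_trans (gR z z1) _; apply: le_trans (ler_norm _) (Re_le_cn _).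
have hp z : normc z < 1 -> holo (fun z => (g z)^-1) z by move=> z1; apply: holoV; [exact: g0|exact: hg].
have hq z : normc z < 1 -> holo (fun z => f z / g z) z.
  by move=> z1; apply: holo_div; [exact: g0|exact: hf|exact: hg].
have pM z : normc z < 1 -> normc (g z)^-1 <= 1.
  move=> z1; have f0 := cn_ge0 (f z); have := gn z z1 => h.
  by rewrite cnV invf_le1; lra.
have qM z : normc z < 1 -> normc (f z / g z) <= 1.
  move=> z1; have f0 := cn_ge0 (f z); have := gn z z1 => h.
  by rewrite cnM cnV ler_pdivrMr; lra.
have A := ae_and (norm_not_to_infinity hg gp) (ae_and (bounded_fatou hp pM) (bounded_fatou hq qM)).
apply: (ae_imp A) => t [H0 [Hp Hq]] t0 t2.
have [p Lp] := Hp t0 t2; have [q Lq] := Hq t0 t2.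
have Dt : D t by rewrite /= in_itv /= !ltW.
(* A zero radial limit of 1/g would mean that |g| tends to infinity, which is excluded almost
   everywhere. *)
have p0 : p != 0.
  apply/eqP => p0; apply: (H0 Dt) => K.
  pose k := `|K| + 1; have k0 : 0 < k by rewrite ltr_wpDl.
  have kV : 0 < k^-1 by rewrite invr_gt0.
  have [d dp Hd] := Lp _ kV; exists (Num.min 1 d); first by rewrite lt_min ltr01.
  have [m1 m2] : Num.min 1 d <= 1 /\ Num.min 1 d <= d by rewrite !ge_min !lexx orbT.
  move=> r hr r1; have z1 : normc (r%:C * cis t) < 1 by rewrite cn_circle //; lra.
  have := Hd r _ r1; rewrite p0 subr0 cnV ltf_pV2 ?posrE // ?cn_gt0 ?g0 // => h.
  have : k < normc (g (r%:C * cis t)) by apply: h; lra.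
  by have := ler_norm K; rewrite /k; lra.
exists (q / p); apply/lim1_cvgP.
have C : (f (r%:C * cis t) / g (r%:C * cis t) / (g (r%:C * cis t))^-1 : R[i]^o) @[r --> (1 : R)^'-] --> (q / p : R[i]^o).
  apply: (@cvgM _ _ _ _ (fun r => f (r%:C * cis t) / g (r%:C * cis t) : R[i]^o) (fun r => ((g (r%:C * cis t))^-1)^-1 : R[i]^o)).
    exact/lim1_cvgP.
  by apply: cvgV => //; exact/lim1_cvgP.
apply/lim1_cvgP => e e0; move/lim1_cvgP: C => /(_ e e0)[d d0 Hd].
exists (Num.min 1 d); first by rewrite lt_min ltr01.
have [m1 m2] : Num.min 1 d <= 1 /\ Num.min 1 d <= d by rewrite !ge_min !lexx orbT.
move=> r hr r1; have z1 : normc (r%:C * cis t) < 1 by rewrite cn_circle //; lra.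
have := Hd r _ r1; rewrite invrK divfK ?g0 //; apply; lra.
Qed.
End FatouHardy.

(** * Orlicz functions and test functions *)

Section OrliczFunction.
Variables (R : realType) (Psi : \bar R -> \bar R).
Hypothesis HPsi : orlicz_function Psi.
Implicit Types (x y t h : R).

Definition orlicz_real x : R := fine (Psi x%:E).
Local Notation psi := orlicz_real.

(* Strict convexity at [x], between [x / 2] and [3 x / 2], bounds [Psi x] strictly. *)
Lemma orlicz_realE x : 0 <= x -> Psi x%:E = (psi x)%:E.
Proof.
rewrite le_eqVlt => /predU1P[<-|x0]; first by rewrite /psi (orlicz_0 HPsi).
rewrite /psi fineK // ge0_fin_numE; last by apply: (orlicz_ge0 HPsi); rewrite lee_fin ltW.
have := @orlicz_strictly_convex _ _ HPsi (x / 2) (3 * x / 2) (1 / 2).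
have -> : 1 / 2 * (x / 2) + (1 - 1 / 2) * (3 * x / 2) = x by field.
have ne : x / 2 != 3 * x / 2 by rewrite lt_eqF //; lra.
have [a b] : 0 <= x / 2 /\ 0 <= 3 * x / 2 by split; lra.
have [c d] : 0 < 1 / 2 :> R /\ 1 / 2 < 1 :> R by split; lra.
by move=> /(_ a b ne c d) /lt_le_trans; apply; exact: leey.
Qed.

Lemma orlicz_real_ge0 x : 0 <= x -> 0 <= psi x.
Proof. by move=> x0; rewrite -lee_fin -orlicz_realE //; apply: (orlicz_ge0 HPsi); rewrite lee_fin. Qed.

Lemma orlicz_real_mono x y : 0 <= x -> x <= y -> psi x <= psi y.
Proof.
move=> x0 xy; have y0 : 0 <= y by exact: le_trans xy.
by rewrite -lee_fin -!orlicz_realE //; apply: (orlicz_nondecreasing HPsi); rewrite lee_fin.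
Qed.

Lemma orlicz_real_scale t x : 0 <= t -> t <= 1 -> 0 <= x -> psi (t * x) <= t * psi x.
Proof.
move=> t0 t1 x0; have := @orlicz_convex _ _ HPsi x%:E 0%E t.
rewrite !lee_fin => /(_ x0 (lexx _) t0 t1).
rewrite mule0 adde0 (orlicz_0 HPsi) mule0 adde0 -EFinM !orlicz_realE ?mulr_ge0 //.
Qed.

Lemma orlicz_real_large (K : R) : exists x0 : R, forall x, x0 <= x -> K <= psi x.
Proof.
have /cvgeyPge/(_ `|K|)[M [_ HM]] := orlicz_superlinear HPsi.
exists (Num.max 1 (M + 1)) => x; rewrite ge_max => /andP[x1 xM].
have Mx : M < x by lra.
have x0 : 0 < x by lra.
have := HM x Mx; rewrite orlicz_realE ?(ltW x0) // -EFinM lee_fin ler_pdivlMr // => h.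
apply: le_trans h; apply: le_trans (ler_norm K) _.
by rewrite -[leLHS]mulr1 ler_wpM2l.
Qed.

(* No measurability is assumed: boundary functions of members of H^1 enter through
   [orlicz_modular] without being known to be measurable. *)
Lemma ge0_le_integral_pointwise (D : set R) (f g : R -> \bar R) :
  (forall x, D x -> (0 <= f x)%E) -> (forall x, D x -> (f x <= g x)%E) ->
  (\int[lebesgue_measure]_(x in D) f x <= \int[lebesgue_measure]_(x in D) g x)%E.
Proof.
move=> f0 fg; have g0 x : D x -> (0 <= g x)%E by move=> Dx; apply: le_trans (fg x Dx); exact: f0.
rewrite !ge0_integralE //; apply: ge_ereal_sup => _ [h hf <-].
apply: ereal_sup_ubound; exists h => // x; apply: le_trans (hf x) _.
by rewrite /patch; case: ifPn => //; rewrite inE; exact: fg.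
Qed.

Lemma orlicz_modular_ge (v : R[i] -> R[i]) (c K : R) (E : set R) : 0 < c -> 0 <= K -> measurable E ->
  E `<=` `[0, 2 * pi] -> (forall t, E t -> K * c <= normc (v (cis t))) ->
  (((2 * pi)^-1 * psi K)%:E * lebesgue_measure E <= orlicz_modular Psi v c)%E.
Proof.
move=> c0 K0 mE ED hv; rewrite /orlicz_modular /circle_integral EFinM -muleA.
apply: lee_wpmul2l; first by rewrite lee_fin invr_ge0 ltW // pi2_gt0.
have P0 t : (0 <= Psi (normc (v (cis t)) / c)%:E)%E.
  by apply: (orlicz_ge0 HPsi); rewrite lee_fin divr_ge0 ?cn_ge0 ?ltW.
have EE : E = `[0, 2 * pi]%classic `&` E by rewrite setIC; apply/esym/setIidPl.
have -> : ((psi K)%:E * lebesgue_measure E =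
    \int[lebesgue_measure]_(t in `[0%R, (2 * pi)%R]) ((cst (psi K)%:E) \_ E) t)%E.
  by rewrite -integral_mkcondr -EE integral_cst.
apply: ge0_le_integral_pointwise => t _; rewrite /patch; case: ifPn => //.
  by move=> _; rewrite lee_fin orlicz_real_ge0.
rewrite inE => /hv h; rewrite /= orlicz_realE; last by rewrite divr_ge0 ?cn_ge0 ?ltW.
by rewrite lee_fin orlicz_real_mono // ler_pdivlMr.
Qed.
End OrliczFunction.

(** * Test functions concentrated near 1 *)

Section TestFunctions.
Variable R : realType.
Implicit Types (f g : R[i] -> R[i]) (z w : R[i]) (r s t e x h : R).

Lemma hardy1_bounded f (M : R) : (forall z, normc z < 1 -> holo f z) ->
  (forall z, normc z < 1 -> normc (f z) <= M) -> hardy 1 f.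
Proof.
move=> hf fM; split; first exact/analyticP.
apply: (@le_lt_trans _ _ M%:E); last exact: ltry.
have p0 := pi2_gt0 R.
apply: ge_ereal_sup => _ [r /= + <-]; rewrite in_itv /= => /andP[r0 r1].
rewrite /integral_mean /circle_integral.
have E : (\int[lebesgue_measure]_(t in `[0%R, (2 * pi)%R]) (cst M%:E) t = (M * (2 * pi))%:E)%E.
  by rewrite integral_cst //= lebesgue_measure_itv /= lte_fin p0 -EFinD subr0 -EFinM.
apply: (@le_trans _ _ (((2 * pi)^-1)%:E * (M * (2 * pi))%:E)%E).
  apply: lee_wpmul2l; first by rewrite lee_fin invr_ge0 ltW.
  rewrite -E; apply: ge0_le_integral_pointwise => t _; rewrite lee_fin ?powR_ge0 //.
  by rewrite powRr1 ?cn_ge0 // fM // cn_circle.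
by rewrite -EFinM lee_fin mulrC mulfK // gt_eqF.
Qed.

(** The square makes its modulus on the unit circle x h / (2 - h) times the Poisson kernel at 1 - h:
    height [x] at the point 1, width of order [h], and mean at most [x h]. *)
Definition test_fun x h z : R[i] := x%:C * (h%:C / (1 - (1 - h)%:C * z)) ^+ 2.

Variables (x h : R).
Hypotheses (x0 : 0 < x) (h0 : 0 < h) (h1 : h < 1).

Let h1B : 0 <= 1 - h. Proof. by rewrite subr_ge0 ltW. Qed.
Let h2B : 0 < 2 - h. Proof. by rewrite subr_gt0 (lt_trans h1) // ltr1n. Qed.

Lemma test_den z : normc z <= 1 -> h <= normc (1 - (1 - h)%:C * z).
Proof.
move=> z1; have := cnB_ge 1 ((1 - h)%:C * z); rewrite cn1 cnM cnR ger0_norm //.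
have : (1 - h) * normc z <= 1 - h by rewrite ler_piMr.
lra.
Qed.

Lemma test_den_neq0 z : normc z <= 1 -> 1 - (1 - h)%:C * z != 0.
Proof. by move=> /test_den hz; rewrite -cn_gt0 (lt_le_trans h0). Qed.

Lemma test_holo z : normc z <= 1 -> holo (test_fun x h) z.
Proof.
move=> z1; apply: holoM; first exact: holo_cst.
apply: holoX; apply: holo_div; [exact: test_den_neq0|exact: holo_cst|].
apply: holoB; first exact: holo_cst.
by apply: holoM; [exact: holo_cst|exact: holo_id].
Qed.

Lemma cn_test z : normc (test_fun x h z) = x * (h / normc (1 - (1 - h)%:C * z)) ^+ 2.
Proof. by rewrite cnM cnX cnM cnV !cnR !gtr0_norm. Qed.

Lemma test_ratio z : normc z <= 1 -> 0 <= h / normc (1 - (1 - h)%:C * z) /\ h / normc (1 - (1 - h)%:C * z) <= 1.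
Proof.
move=> /test_den hz; split; first by rewrite divr_ge0 ?cn_ge0 // ltW.
by rewrite ler_pdivrMr ?mul1r // (lt_le_trans h0).
Qed.

Lemma test_le z : normc z <= 1 -> normc (test_fun x h z) <= x.
Proof.
move=> /test_ratio[a b]; rewrite cn_test -[leRHS]mulr1 ler_wpM2l ?(ltW x0) //.
exact: exprn_ile1.
Qed.

Lemma test_ge z : normc z <= 1 -> normc (1 - z) <= h -> x / 4 <= normc (test_fun x h z).
Proof.
move=> z1 zh; have hd := test_den z1; have hp := h0.
have d2 : normc (1 - (1 - h)%:C * z) <= 2 * h.
  have -> : 1 - (1 - h)%:C * z = (1 - z) + h%:C * z by rewrite rmorphB rmorph1; ring.
  apply: le_trans (cnD _ _) _; rewrite cnM cnR gtr0_norm //.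
  by have := ler_piMr (ltW h0) z1; lra.
rewrite cn_test ler_wpM2l ?(ltW x0) //.
have -> : 4^-1 = (1 / 2) ^+ 2 :> R by field.
apply: lerXn2r; rewrite ?nnegrE ?divr_ge0 ?cn_ge0 ?(ltW h0) //.
by rewrite ler_pdivlMr; lra.
Qed.

Lemma test_lim1 t : lim1 (fun r => test_fun x h (r%:C * cis t)) (test_fun x h (cis t)).
Proof.
have c1 : normc (cis t) <= 1 by rewrite cn_cis.
move=> e /(holo_ccont (test_holo c1))[d d0 Hd]; exists d => // r r1 r2; apply: Hd.
have -> : r%:C * cis t - cis t = - ((1 - r)%:C * cis t) by rewrite rmorphB rmorph1; ring.
by rewrite cnN cnM cn_cis cnR mulr1 ger0_norm; lra.
Qed.

Lemma test_boundary t : boundary (test_fun x h) (cis t) = test_fun x h (cis t).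
Proof. exact: lim1_lim (test_lim1 t). Qed.

Lemma test_circle_continuous t : rcont (fun t => test_fun x h (cis t)) t.
Proof.
apply: (@rcont_comp _ (@cis R) (test_fun x h)); first exact: rcont_cis.
by apply/holo_ccont/test_holo; rewrite cn_cis.
Qed.

Lemma test_mean : (2 * pi)^-1 * rint 0 (2 * pi) (fun t => (h / normc (1 - (1 - h)%:C * cis t)) ^+ 2) <= h.
Proof.
have a1 : normc ((1 - h)%:C : R[i]) < 1 by rewrite cnR ger0_norm // gtrBl.
have E t : (h / normc (1 - (1 - h)%:C * cis t)) ^+ 2 = h / (2 - h) * poisson (1 - h)%:C t.
  have nE : normc (1 - (1 - h)%:C * cis t) = normc (1 - (1 - h)%:C * conjc (cis t)).
    rewrite -[LHS]cnJ; congr normc; apply: cplx_ext; case: (cis t) => a b /=; ring.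
  have d0 : normc (1 - (1 - h)%:C * conjc (cis t)) != 0 by rewrite -nE cn_eq0 test_den_neq0 // cn_cis.
  rewrite /poisson nE cnR ger0_norm //.
  have h2 : 2 - h != 0 by rewrite gt_eqF.
  by move: (normc _) d0 => d d0; field; rewrite d0 h2.
under [X in rint _ _ X]eq_fun do rewrite E.
rewrite rintZ; last by move=> t _ _; exact: poisson_continuous.
rewrite mulrCA (poisson_mass a1) mulr1 ler_pdivrMr //.
have E2 : 2 - h = 1 + (1 - h) by ring.
by rewrite -[leLHS]mulr1 ler_wpM2l ?(ltW h0) // E2 lerDl.
Qed.

(** On the circle the modulus is [v x] with 0 <= v <= 1, so convexity and Psi(0) = 0 give Psi(v x)
    <= v Psi(x), and the mean of [v] is at most [h]. *)
Lemma test_modular (Psi : \bar R -> \bar R) : orlicz_function Psi -> orlicz_real Psi x * h <= 1 ->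
  (orlicz_modular Psi (boundary (test_fun x h)) 1 <= 1)%E.
Proof.
move=> HPsi hx; have px := orlicz_real_ge0 HPsi (ltW x0).
pose v t := (h / normc (1 - (1 - h)%:C * cis t)) ^+ 2.
have v01 t : 0 <= v t /\ v t <= 1.
  have c1 : normc (cis t) <= 1 by rewrite cn_cis.
  by have [a b] := test_ratio c1; rewrite /v sqr_ge0 exprn_ile1.
have cv t : {for t, continuous v}.
  have c : {for t, continuous (fun t => normc (1 - (1 - h)%:C * cis t))}.
    apply: rcont_normc; apply: rcontB; first exact: rcont_cst.
    by apply: rcontM; [exact: rcont_cst|exact: rcont_cis].
  have q : {for t, continuous (fun t => h / normc (1 - (1 - h)%:C * cis t))}.
    by apply: cvgM; [exact: cvg_cst|apply: cvgV => //; rewrite cn_eq0 test_den_neq0 // cn_cis].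
  exact: (cvgM q q).
rewrite /orlicz_modular /circle_integral.
apply: (@le_trans _ _ (((2 * pi)^-1)%:E * (orlicz_real Psi x * rint 0 (2 * pi) v)%:E)%E).
  apply: lee_wpmul2l; first by rewrite lee_fin invr_ge0 ltW // pi2_gt0.
  rewrite -rintZ; last by move=> t _ _; exact: cv.
  rewrite /rint /Rintegral fineK; last first.
    apply: integrable_fin_num => //; apply: cts_integrable => t _ _.
    by apply: cvgM; [exact: cvg_cst|exact: cv].
  apply: ge0_le_integral_pointwise => t _.
    by apply: (orlicz_ge0 HPsi); rewrite lee_fin divr1 cn_ge0.
  rewrite divr1 test_boundary cn_test -/(v t) (orlicz_realE HPsi); last first.
    by rewrite mulr_ge0 ?(ltW x0) //; case: (v01 t).
  rewrite lee_fin mulrC [leRHS]mulrC; have [a b] := v01 t.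
  exact: (orlicz_real_scale HPsi a b (ltW x0)).
rewrite -EFinM lee_fin mulrCA; apply: le_trans hx; rewrite ler_wpM2l //; exact: test_mean.
Qed.

Lemma test_hardy_orlicz (Psi : \bar R -> \bar R) : orlicz_function Psi -> orlicz_real Psi x * h <= 1 ->
  hardy_orlicz Psi (test_fun x h) /\ (hardy_orlicz_norm Psi (test_fun x h) <= 1)%E.
Proof.
move=> HPsi hx; have M := test_modular HPsi hx.
split; last by apply: ereal_inf_lbound; exists 1.
split.
  by apply: (hardy1_bounded (M := x)) => z z1; [apply: test_holo|apply: test_le]; exact: ltW.
split.
- have -> : (fun t => complex.Re (boundary (test_fun x h) (cis t))) = (fun t => complex.Re (test_fun x h (cis t))).
    by apply/funext => t; rewrite test_boundary.
  apply: continuous_measurable; first exact: measurable_itv.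
  by move=> t; exact/rcont_Re/test_circle_continuous.
- have -> : (fun t => complex.Im (boundary (test_fun x h) (cis t))) = (fun t => complex.Im (test_fun x h (cis t))).
    by apply/funext => t; rewrite test_boundary.
  apply: continuous_measurable; first exact: measurable_itv.
  by move=> t; exact/rcont_Im/test_circle_continuous.
by exists 1 => //; apply: le_lt_trans M _; exact: ltry.
Qed.
End TestFunctions.

(** * The lens map near the corner 1 *)

Section LensNearOne.
Variable R : realType.

Lemma cis_near0 : exists2 d : R, 0 < d & forall t, 0 < t -> t < d -> normc (1 - cis t) <= 2 * t.
Proof.
have [d d0 Hd] := cdiff_cexp0 (ltr01 : 0 < (1 : R)); exists d => // t t0 td.
have nE : normc ((0 +i* t) : R[i]) = t by rewrite /normc /= expr0n add0r sqrtr_sqr gtr0_norm.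
have := Hd (0 +i* t); rewrite subr0 nE => /(_ td).
have -> : cexp (0 +i* t) = cis t by rewrite /cexp /= expR0 mul1r.
rewrite cexp0 !mul1r => H.
have -> : 1 - cis t = - ((cis t - 1 - (0 +i* t)) + (0 +i* t)) by ring.
by rewrite cnN; apply: le_trans (cnD _ _) _; rewrite nE; lra.
Qed.

(** With W the square root of [cay z], 1 - lens = 2 / (W + 1) and |W + 1| >= |W|, whence |1 -
    lens|^2 <= 4 |1 - z| / |1 + z|; moreover |1 + z| >= 1. *)
Lemma lens_near1 (t : R) (z : R[i]) : normc z < 1 -> normc (1 - z) <= 3 * t -> 3 * t <= 1 ->
  normc (1 - lens (1 / 2) z) ^+ 2 <= 12 * t.
Proof.
move=> z1 zt t1; set W := cpow (1 / 2) (cay z).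
have [a b] : 0 < 1 / 2 :> R /\ 1 / 2 < 1 :> R by split; lra.
have Wp : 0 < complex.Re W by exact: Re_cpow_gt0.
have cz : 0 < normc (cay z) by rewrite cn_gt0 Re_gt0_neq0 // Re_cay_gt0.
have W2 : normc W ^+ 2 = normc (cay z).
  rewrite cn_cpow -expRM_natl mulrA.
  have -> : 2%:R * (1 / 2) = 1 :> R by field.
  by rewrite mul1r lnK.
have W1 : W + 1 != 0 by exact: Re_addV1 Wp erefl.
have E : 1 - lens (1 / 2) z = 2%:R / (W + 1) by rewrite /lens /cayV -/W; field.
have n2 : normc W ^+ 2 <= normc (W + 1) ^+ 2.
  by rewrite !cn_sqr; case: (W) Wp => u v /= Wp; lra.
have d0 : 0 < normc (1 - z) by rewrite cn_gt0 disk_1B_neq0.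
have zp : 1 <= normc (1 + z).
  have := cnB_ge 2%:R (1 - z); rewrite cnn.
  have -> : 2%:R - (1 - z) = 1 + z by ring.
  lra.
have nc : normc (cay z) = normc (1 + z) / normc (1 - z) by rewrite cnM cnV.
have W20 : 0 < normc W ^+ 2 by rewrite W2.
rewrite E cnM cnV cnn expr_div_n.
apply: (@le_trans _ _ (2 ^+ 2 / normc W ^+ 2)).
  by rewrite ler_wpM2l ?sqr_ge0 // lef_pV2 // posrE // (lt_le_trans W20).
rewrite W2 nc ler_pdivrMr ?divr_gt0 //; last by lra.
have h : normc (1 - z) <= 3 * t * normc (1 + z).
  by apply: (le_trans zt); rewrite ler_peMr // (le_trans (ltW d0) zt).
rewrite mulrA ler_pdivlMr //.
have -> : 12 * t * normc (1 + z) = 4 * (3 * t * normc (1 + z)) by ring.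
by rewrite expr2 -natrM ler_pM2l.
Qed.
End LensNearOne.

(** * Failure of compactness *)

Section NotCompact.
Variables (R : realType) (Psi : \bar R -> \bar R).
Hypothesis HPsi : orlicz_function Psi.
Implicit Types (f g : R[i] -> R[i]) (z w : R[i]) (r s t e x h : R).
Local Notation mu := (@lebesgue_measure R).
Local Notation D := (`[0, 2 * pi]%classic : set R).
Local Notation psi := (orlicz_real Psi).
Local Notation phi := (lens (1 / 2 : R)).

Lemma lim1_norm_ge (u : R -> R[i]) (L : R[i]) (K d : R) : lim1 u L -> 0 < d ->
  (forall r, 1 - d < r -> r < 1 -> K <= normc (u r)) -> K <= normc L.
Proof.
move=> H d0 uK; apply/ler_addgt0Pr => e e0; have [d' d'0 Hd] := H e e0.
pose m := Num.min d d'; have m0 : 0 < m by rewrite lt_min d0.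
have [m1 m2] : m <= d /\ m <= d' by rewrite /m !ge_min !lexx orbT.
have [a b] : 1 - d < 1 - m / 2 /\ 1 - m / 2 < 1 by split; lra.
have a' : 1 - d' < 1 - m / 2 by lra.
have := uK _ a b; have := Hd _ a' b; have := cnB_ge (u (1 - m / 2)) L; lra.
Qed.

Lemma lim1_norm_le (u : R -> R[i]) (L : R[i]) (K : R) : lim1 u L ->
  (forall r, 0 < r -> r < 1 -> normc (u r) <= K) -> normc L <= K.
Proof.
move=> H uK; apply/ler_addgt0Pr => e e0; have [d d0 Hd] := H e e0.
pose m := Num.min 1 d; have m0 : 0 < m by rewrite lt_min ltr01.
have [m1 m2] : m <= 1 /\ m <= d by rewrite /m !ge_min !lexx orbT.
have [a b] : 0 < 1 - m / 2 /\ 1 - m / 2 < 1 by split; lra.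
have a' : 1 - d < 1 - m / 2 by lra.
have := uK _ a b; have := Hd _ a' b; have := cnB_ge L (u (1 - m / 2)); rewrite cnBC; lra.
Qed.

Lemma half01 : 0 < 1 / 2 :> R /\ 1 / 2 < 1 :> R.
Proof. by split; lra. Qed.

Section Member.
Variables x h : R.
Hypotheses (x0 : 0 < x) (h0 : 0 < h) (h1 : h < 1).

Lemma test_lens_holo z : normc z < 1 -> holo (fun z => test_fun x h (phi z)) z.
Proof.
move=> z1; apply: holo_comp; first exact: (lens_holo half01.1 half01.2 z1).
by apply: test_holo => //; exact/ltW/(lens_disk half01.1 half01.2).
Qed.

Lemma test_lens_le z : normc (test_fun x h (phi z)) <= x.
Proof. by apply: test_le => //; exact/ltW/(lens_disk half01.1 half01.2). Qed.

Lemma test_lens_fatou :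
  {ae mu, forall t, 0 < t -> t < 2 * pi -> exists l, lim1 (fun r => test_fun x h (phi (r%:C * cis t))) l}.
Proof.
by apply: (bounded_fatou (f := fun z => test_fun x h (phi z)) (M := x) test_lens_holo) => z _; exact: test_lens_le.
Qed.

Lemma test_lens_limit_le t (l : R[i]) : lim1 (fun r => test_fun x h (phi (r%:C * cis t))) l -> normc l <= x.
Proof. by move=> H; apply: (lim1_norm_le H) => r _ _; exact: test_lens_le. Qed.

Lemma test_lens_limit_ge t (l : R[i]) : 0 < t -> normc (1 - cis t) <= 2 * t -> 3 * t <= 1 -> 12 * t <= h ^+ 2 ->
  lim1 (fun r => test_fun x h (phi (r%:C * cis t))) l -> x / 4 <= normc l.
Proof.
move=> t0 ct t3 th H; apply: (lim1_norm_ge H t0) => r r1 r2.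
have z1 : normc (r%:C * cis t) < 1 by rewrite cn_circle //; lra.
apply: test_ge => //; first exact/ltW/(lens_disk half01.1 half01.2).
have zt : normc (1 - r%:C * cis t) <= 3 * t.
  have -> : 1 - r%:C * cis t = (1 - cis t) + (1 - r)%:C * cis t by rewrite rmorphB rmorph1; ring.
  apply: le_trans (cnD _ _) _; rewrite cnM cn_cis cnR mulr1 ger0_norm; lra.
have := lens_near1 z1 zt t3 => /le_trans/(_ th).
by rewrite ler_pXn2r // nnegrE ?cn_ge0 ?(ltW h0).
Qed.
End Member.

(** One application of the condition gives the power 2, which merely balances an arc of length
    comparable to [psi x ^- 2]; the second leaves a surplus factor [psi x ^+ 2]. *)
Lemma Delta2_iter : Delta2_condition Psi -> exists A x0 : R, [/\ 1 < A, 0 <= x0 &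
  forall x, x0 <= x -> psi x ^+ 4 <= psi (A ^+ 2 * x)].
Proof.
move=> [A A1 [M [_ HM]]]; exists A, (Num.max 0 (M + 1)); split=> //; first by rewrite le_max lexx.
move=> x; rewrite ge_max => /andP[x0 xM].
have A0 : 0 < A by lra.
have sq y : 0 <= y -> M < y -> psi y ^+ 2 <= psi (A * y).
  move=> y0 My; have := HM y My.
  by rewrite !(orlicz_realE HPsi) ?mulr_ge0 ?(ltW A0) // -EFinM lee_fin expr2.
have xA : x <= A * x by rewrite ler_peMl // ltW.
have Mx : M < x by lra.
rewrite [A ^+ 2]expr2 -mulrA; apply: le_trans (sq (A * x) _ _); [|exact: le_trans xA|exact: lt_le_trans xA].
rewrite (exprM (psi x) 2 2); apply: lerXn2r; rewrite ?nnegrE ?sqr_ge0 //; last exact: sq.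
by apply: (orlicz_real_ge0 HPsi); rewrite mulr_ge0 // ltW.
Qed.

(** Values of size x / 16 divided by c <= 1 / (16 A^2) are at least A^2 x, where Psi is at least
    [psi x ^+ 4]. On a set of measure [psi x ^- 2 / 24] this contributes at least
    [psi x ^+ 2 / (48 pi)]. *)
Lemma modular_too_large (v : R[i] -> R[i]) (A x c : R) (E : set R) : 0 < A -> 0 < x -> 20 <= psi x ->
  psi x ^+ 4 <= psi (A ^+ 2 * x) -> 0 < c -> c <= (16 * A ^+ 2)^-1 ->
  measurable E -> E `<=` D -> (((psi x) ^- 2 / 24)%:E <= mu E)%E ->
  (forall t, E t -> x / 16 <= normc (v (cis t))) ->
  (1 < orlicz_modular Psi v c)%E.
Proof.
move=> A0 x0 p20 p4 c0 cA mE ED mE24 hv.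
have pp : 0 < psi x by apply: lt_le_trans p20.
pose K := x / 16 / c; have Kc : K * c = x / 16 by rewrite /K divfK // gt_eqF.
have K0 : 0 <= K by rewrite !divr_ge0 // ltW.
have KA : A ^+ 2 * x <= K.
  rewrite /K ler_pdivlMr // ler_pdivlMr //.
  have q0 : 0 < 16 * A ^+ 2 by rewrite mulr_gt0 ?exprn_gt0.
  have : c * (16 * A ^+ 2) <= 1 by rewrite -ler_pdivlMr // div1r.
  move=> /(ler_wpM2r (ltW x0)); rewrite mul1r; apply: le_trans.
  by rewrite le_eqVlt; apply/orP; left; apply/eqP; ring.
have pK : psi x ^+ 4 <= psi K.
  apply: le_trans p4 _; apply: (orlicz_real_mono HPsi) => //.
  by rewrite mulr_ge0 ?sqr_ge0 // ltW.
have p0 := pi2_gt0 R.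
have hE t : E t -> K * c <= normc (v (cis t)) by rewrite Kc; exact: hv.
apply: lt_le_trans (orlicz_modular_ge HPsi c0 K0 mE ED hE).
have k0 : 0 <= (2 * pi)^-1 * psi K.
  by rewrite mulr_ge0 ?invr_ge0 ?(ltW p0) // (orlicz_real_ge0 HPsi).
apply: lt_le_trans (lee_wpmul2l _ mE24); last by rewrite lee_fin.
rewrite -EFinM lte_fin.
have p8 : 2 * pi < 8 :> R by have := pihalf_lt2 R; lra.
apply: lt_le_trans (_ : (2 * pi)^-1 * psi x ^+ 4 * (psi x ^- 2 / 24) <= _); last first.
  rewrite ler_wpM2r //; first by rewrite divr_ge0 // invr_ge0 sqr_ge0.
  by rewrite ler_wpM2l // invr_ge0 ltW.
have -> : (2 * pi)^-1 * psi x ^+ 4 * (psi x ^- 2 / 24) = psi x ^+ 2 / ((2 * pi) * 24).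
  move: (2 * pi) p0 => q q0; field.
  by rewrite !gt_eqF.
rewrite ltr_pdivlMr ?mul1r; last by rewrite pmulr_lgt0.
(* The constant 20 is chosen so that 20^2 exceeds 24 * 8 > 24 * 2 pi. *)
apply: lt_le_trans (_ : 20 ^+ 2 <= _); first by rewrite expr2; lra.
by apply: lerXn2r; rewrite ?nnegrE // ltW.
Qed.

Theorem lens_not_compact : Delta2_condition Psi ->
  ~ compact_operator (hardy_orlicz Psi) (hardy_orlicz_norm Psi) (composition_operator phi).
Proof.
move=> /Delta2_iter[A [xA [A1 xA0 HA]]] comp; have A0 : 0 < A by lra.
have [d0 d00 Hcis] := cis_near0 R.
have [xL HL] := orlicz_real_large HPsi (20 + d0^-1).
have dV : 0 < d0^-1 by rewrite invr_gt0.
(* Heights beyond both thresholds, where [psi >= 20 + d0^-1] forces the width [1 / psi] below [d0];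
   adding [n] makes them unbounded along any subsequence. *)
pose X (n : nat) : R := Num.max 1 (Num.max xA xL) + n%:R.
have X1 n : 1 <= X n by rewrite /X -[leLHS]addr0 lerD // le_max lexx.
have X0 n : 0 < X n by apply: lt_le_trans (X1 n).
have XA n : xA <= X n by rewrite /X -[leLHS]addr0 lerD // !le_max lexx orbT.
have XL n : xL <= X n by rewrite /X -[leLHS]addr0 lerD // !le_max lexx !orbT.
have Xn n : n%:R <= X n by rewrite /X lerDr le_max ler01.
clearbody X.
have pX n : 20 + d0^-1 <= psi (X n) by exact: HL.
have pX20 n : 20 <= psi (X n) by have := pX n; lra.
have pX0 n : 0 < psi (X n) by apply: lt_le_trans (pX20 n).
pose h n := (psi (X n))^-1.
have h0 n : 0 < h n by rewrite invr_gt0.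
have h20 n : h n <= 1 / 20.
  by rewrite div1r lef_pV2 ?posrE.
have h1 n : h n < 1 by apply: le_lt_trans (h20 n) _; lra.
have hd n : h n < d0.
  rewrite /h invf_plt ?posrE //; apply: lt_le_trans (pX n); lra.
have ph n : psi (X n) * h n = 1 by rewrite /h divff // gt_eqF.
pose u n := test_fun (X n) (h n).
have Hu n : hardy_orlicz Psi (u n) /\ (hardy_orlicz_norm Psi (u n) <= 1)%E.
  by apply: test_hardy_orlicz => //; rewrite ph.
have [g [[g1 [mRe mIm _]] [k [kinc Nk]]]] := comp u Hu.
pose c := (16 * A ^+ 2)^-1; have c0 : 0 < c by rewrite invr_gt0 mulr_gt0 ?exprn_gt0.
(* A Luxemburg norm below [c] provides a scale [c' <= c] with modular at most 1, and [c] is the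
   threshold of [modular_too_large]. *)
have [M HM] : exists M : nat, forall n, (M <= n)%N ->
    exists c' : R, [/\ 0 < c', c' <= c &
      (orlicz_modular Psi (boundary (composition_operator phi (u (k n)) \- g)%R) c' <= 1)%E].
  have /fine_cvgP[fin /cvgrPdist_lt/(_ c c0) cv] := Nk.
  have [N _ HN] : \forall n \near \oo, hardy_orlicz_norm Psi (composition_operator phi (u (k n)) \- g) \is a fin_num /\
      `|0 - fine (hardy_orlicz_norm Psi (composition_operator phi (u (k n)) \- g))| < c.
    by near=> n; split; near: n.
  exists N => n /= /HN[fn cn]; move: cn; rewrite sub0r normrN => /(le_lt_trans (ler_norm _)).
  rewrite -lte_fin fineK // => /ereal_inf_lt[_ [c' [c'0 c'1] <-]]; rewrite lte_fin => c'c.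
  by exists c'; split=> //; exact: ltW.
pose Y := X (k M).
(* The index [M] is kept fixed and [j] is taken so late that the height at [k j] is at least 16
   times the height [Y] at [k M]. *)
pose j := maxn M (Num.truncn (16 * Y)).+1.
(* On the arc of length [tau], [12 t <= h^2], so the lens sends it within [h] of 1. *)
pose x := X (k j); pose tau := h (k j) ^+ 2 / 12.
have xY : 16 * Y <= x.
  apply: le_trans (Xn (k j)); apply: le_trans (ltW (truncnS_gt _)) _; rewrite ler_nat.
  by apply: leq_trans (leq_maxr M _) _; exact: incr_ge.
have tau0 : 0 < tau by rewrite divr_gt0 ?exprn_gt0.
have hh : h (k j) ^+ 2 <= h (k j) by rewrite expr2 ler_piMl ?ltW.
have tauh : tau <= h (k j) / 12 by rewrite /tau ler_wpM2r.
have hs := h20 (k j); have hds := hd (k j); have hp := h0 (k j).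
have taud : tau < d0 by lra.
have tau1 : 3 * tau <= 1 by lra.
have pi1 : 1 < 2 * pi :> R by have := pi_ge2 R; lra.
have := ae_and (test_lens_fatou (X0 (k M)) (h0 (k M)) (h1 (k M)))
  (ae_and (test_lens_fatou (X0 (k j)) (h0 (k j)) (h1 (k j))) (fatou_H1 g1)).
move=> [N [mN N0 sN]].
pose I : set R := `]0, tau]%classic.
have ID : I `<=` D by move=> t; rewrite /I /= !in_itv /= => /andP[a b]; lra.
have mI : measurable I by exact: measurable_itv.
have muI : mu I = tau%:E by rewrite /I lebesgue_measure_itv /= lte_fin tau0 -EFinD subr0.
(* Off the null set [N] all three radial limits exist, so [boundary] is a genuine limit there and
   splits over the difference. *)
have lims t : I t -> ~ N t -> exists a b l, [/\
    boundary (composition_operator phi (u (k M)) \- g) (cis t) = a - l,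
    boundary (composition_operator phi (u (k j)) \- g) (cis t) = b - l,
    boundary g (cis t) = l, normc a <= Y & x / 4 <= normc b].
  move=> It nN; have : ~ ~ _ := fun q => nN (sN t q).
  move=> /contrapT[Ha [Hb Hl]].
  move: It; rewrite /I /= in_itv /= => /andP[t0 tt].
  have t2 : t < 2 * pi by lra.
  have [a La] := Ha t0 t2; have [b Lb] := Hb t0 t2; have [l Ll] := Hl t0 t2.
  have LB (u1 u2 : R -> R[i]) (l1 l2 : R[i]) : lim1 u1 l1 -> lim1 u2 l2 -> lim1 (fun r => u1 r - u2 r) (l1 - l2).
    by move=> /lim1_cvgP c1 /lim1_cvgP c2; apply/lim1_cvgP; exact: (cvgB c1 c2).
  exists a, b, l; split.
  - exact: lim1_lim (LB _ _ _ _ La Ll).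
  - exact: lim1_lim (LB _ _ _ _ Lb Ll).
  - exact: lim1_lim.
  - exact: (test_lens_limit_le (X0 _) (h0 _) (h1 _) La).
  - apply: (test_lens_limit_ge (X0 _) (h0 _) (h1 _) t0 _ _ _ Lb).
    + by apply: Hcis => //; lra.
    + lra.
    + by move: tt; rewrite /tau ler_pdivlMr // mulrC.
pose q t := complex.Re (boundary g (cis t)) ^+ 2 + complex.Im (boundary g (cis t)) ^+ 2.
have mq : measurable_fun D q by apply: measurable_funD; exact: measurable_funX.
(* Either the boundary values of [g] are at most x / 8 on half of the arc, and differ from those at
   [k j] by at least x / 4 - x / 8, or they exceed x / 8 on half of it, and differ from those at
   [k M] by at least x / 8 - x / 16. *)
pose S1 := I `&` (D `&` q @^-1` `]-oo, (x / 8) ^+ 2]).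
have mS1 : measurable S1 by apply: measurableI => //; exact: mq.
pose S2 := I `\` S1.
have mS2 : measurable S2 by exact: measurableD.
have muS : mu I = (mu S1 + mu S2)%E.
  have -> : I = S1 `|` S2 by rewrite /S2 setDUK // => t [].
  rewrite measureU //; apply/seteqP; split=> t // [a [_ b]]; exact: b.
(* Both cases use the same level [x]; only the index of the function changes. Half of [tau] is
   [psi x ^- 2 / 24], and removing [N] costs no measure. *)
have big (i : nat) (E : set R) : measurable E -> E `<=` I -> (M <= i)%N ->
    ((tau / 2)%:E <= mu E)%E ->
    (forall t, E t -> ~ N t -> x / 16 <= normc (boundary (composition_operator phi (u (k i)) \- g) (cis t))) -> False.
  move=> mE EI Mi muE hE; have [c' [c'0 c'c]] := HM i Mi.
  apply/negP; rewrite -ltNge.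
  apply: (@modular_too_large _ A x c' (E `\` N)) => //.
  - exact: X0.
  - exact: pX20.
  - by apply: HA; exact: XA.
  - exact: measurableD.
  - by move=> t [Et _]; apply/ID/EI.
  - have -> : mu (E `\` N) = mu E.
      apply/eqP; rewrite eq_le; apply/andP; split.
        by apply: le_measure; [rewrite inE; exact: measurableD|rewrite inE|exact: subDsetl].
      have : (mu E <= mu ((E `\` N) `|` N))%E.
        apply: le_measure; [by rewrite inE|by rewrite inE; apply: measurableU => //; exact: measurableD|].
        by move=> t Et; have [n|n] := pselect (N t); [right|left].
      by rewrite measureU0 //; exact: measurableD.
    apply: le_trans muE; rewrite lee_fin /tau /h exprVn -mulrA ler_wpM2l ?invr_ge0 ?sqr_ge0 //.
    lra.
  - by move=> t [Et nN]; exact: hE.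
have [S1big|S1small] := leP (tau / 2)%:E (mu S1).
  apply: (big j S1 mS1 _ (leq_maxl _ _) S1big); first by move=> t [].
  move=> t [It [_ qt]] nN; have [a [b [l [_ Eb El _ bx]]]] := lims t It nN.
  have lx : normc l <= x / 8.
    rewrite -(@ler_pXn2r _ 2) ?nnegrE ?cn_ge0 ?divr_ge0 ?(ltW (X0 _)) // cn_sqr -El.
    by move: qt; rewrite /= in_itv.
  have xp := X0 (k j); rewrite -/x in xp.
  by rewrite Eb; have := cnB_ge b l; lra.
have S2big : ((tau / 2)%:E <= mu S2)%E.
  move: muS; rewrite muI; case: (mu S1) S1small => [s1| |] //; case: (mu S2) => [s2| |] //.
    by rewrite lte_fin lee_fin -EFinD => a [b]; lra.
apply: (big M S2 mS2 _ (leqnn _) S2big); first by move=> t [].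
move=> t [It nS] nN; have [a [b [l [Ea _ El aY _]]]] := lims t It nN.
have lx : x / 8 <= normc l.
  rewrite leNgt; apply/negP => lx; apply: nS; split=> //; split; first exact: ID.
  rewrite /= in_itv /= /q -cn_sqr El; apply: lerXn2r; rewrite ?nnegrE ?cn_ge0 ?divr_ge0 ?(ltW (X0 _)) //.
  exact: ltW.
by rewrite Ea cnBC; have := cnB_ge l a; lra.
Unshelve. all: by end_near. Qed.
End NotCompact.

Theorem proposition4p1 (R : realType) (Psi : \bar R -> \bar R)
    (HPsi : orlicz_function Psi) (HDelta2 : Delta2_condition Psi) :
  exists phi : R[i] -> R[i],
    [/\ self_map_of_disk phi,
        forall p : R, 0 < p -> schatten p (composition_operator phi)
      & ~ compact_operator (hardy_orlicz Psi) (hardy_orlicz_norm Psi)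
            (composition_operator phi)].
Proof.
have [h0 h1] := half01 R; exists (lens (1 / 2)); split.
- by split; [apply/analyticP => z; exact: lens_holo|move=> z _; exact: lens_disk].
- by move=> p; exact: lens_schatten.
- exact: lens_not_compact.
Qed.
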